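(* Let $\sigma,\mu>0$, $\kappa\ge0$. Let $r,k,Q>0$ be constants satisfying $$k^3Q<\frac{1+\sigma\pi^2}{\mu r\left(\left(1+\frac{\kappa}{\pi\mu\sqrt3}\right)^2+\frac{(r+1)^2(1+\sigma\pi^2)}{r\mu(\kappa+\mu\pi^2)}\right)}\qquad\text{(A)}$$ and let $\gamma>\frac{\gamma^*}{2}$, where $$\gamma^*:=\frac{2}{1-\frac{\mu rk^3Q}{1+\sigma\pi^2}\left(\left(1+\frac{\kappa}{\pi\mu\sqrt3}\right)^2+\frac{(r+1)^2(1+\sigma\pi^2)}{r\mu(\kappa+\mu\pi^2)}\right)}.$$ Then there exist constants $G,\omega>0$ such that for every $\varphi_0\in\bar S$, $\bar\varphi_0\in S$, $(\xi_0,w_0)\in\mathbb{R}^2$ the unique weak solution on $\mathbb{R}_+$ (in the sense defined in the context) of the initial-boundary value problem (P) with initial condition $\varphi[0]=\varphi_0$, $\varphi_t[0]=\bar\varphi_0$, $(\xi(0),w(0))=(\xi_0,w_0)$ which satisfies $$f(t)=P(\xi(t),w(t),\varphi[t],\varphi_t[t])\quad\text{for }t\ge0$$ also satisfies the following estimate for all $t\ge0$: $$|\xi(t)|^2+|w(t)|^2+\|\varphi_t[t]\|_2^2+\|\varphi[t]\|_{H^2(0,1)}^2\le G\exp(-\omega t)\left(|\xi_0|^2+|w_0|^2+\|\bar\varphi_0\|_2^2+\|\varphi_0\|_{H^2(0,1)}^2\right).$$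
   Context: Notation: $\mathbb{R}_+=[0,+\infty)$; $L^2_{loc}(\mathbb{R}_+)$ is the class of measurable $f:(0,+\infty)\to\mathbb{R}$ with $\int_0^T|f(t)|^2dt<+\infty$ for all $T>0$; $\varphi[t]$ denotes the profile $x\mapsto\varphi(t,x)$; $\|\cdot\|_2$ is the $L^2(0,1)$ norm; $H^k(0,1)=W^{k,2}(0,1)$; $H^1_0(0,1)$ is the closure of $C^1_c((0,1))$ in $H^1(0,1)$; $\chi_{[0,1]}$ is the characteristic function of $[0,1]$. Spaces: $\bar S=\{\varphi\in H^2(0,1):\varphi'(0)=\varphi'(1)=\int_0^1\varphi(x)dx=0\}$ and $S=\{\varphi\in L^2(0,1):\int_0^1\varphi(x)dx=0\}$. For $\varphi\in\bar S$, $\bar\varphi\in S$, $(\xi,w)\in\mathbb{R}^2$: $$P(\xi,w,\varphi,\bar\varphi)=\gamma k^3\left(k^{-2}w+k^{-1}\xi-rQ\int_0^1\Big(\kappa x\varphi(x)+\tfrac{r+1}{r}x\bar\varphi(x)+\mu\varphi'(x)\Big)dx\right).$$ Problem (P) is the PDE-ODE system, for $t\ge0$, $x\in(0,1)$, with input $f$: $\dot\xi=w$, $\dot w=-f$; $\varphi_{tt}=\varphi_{xx}-\sigma\varphi_{xxxx}+\mu\varphi_{txx}-\kappa\varphi_t$; $\varphi_x(t,0)=\varphi_x(t,1)=0$; $\varphi_{xxx}(t,0)=\varphi_{xxx}(t,1)=-\sigma^{-1}f(t)$; $\int_0^1\varphi(t,x)dx=\int_0^1\varphi_t(t,x)dx=0$.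 Weak solution on $[0,T]$: given $\varphi_0\in\bar S$, $\bar\varphi_0\in S$, $(\xi_0,w_0)\in\mathbb{R}^2$, $f\in L^2(0,T)$, absolutely continuous functions $\xi,w:[0,T]\to\mathbb{R}$ and a function $\varphi:[0,T]\to\bar S$ (absolutely continuous as a map into $L^2(0,1)$) constitute a weak solution on $[0,T]$ of (P) with initial condition $\varphi[0]=\varphi_0$, $\varphi_t[0]=\bar\varphi_0$, $(\xi(0),w(0))=(\xi_0,w_0)$, if: $\dot\xi=w$, $\dot w=-f$ hold for a.e. $t\in(0,T)$; $\varphi\in L^2((0,T);H^3(0,1)\cap\bar S)$; the initial condition holds; and there exists $u\in C^0([0,T];H_0^1(0,1))\cap L^2((0,T);H^2(0,1))$ with $u_t\in L^2((0,T);L^2(0,1))$ such that (i) $\varphi_t[t]=u_x[t]$ for $t\in[0,T]$; (ii) $u_t[t]=\varphi_x[t]-\sigma\varphi_{xxx}[t]+\mu u_{xx}[t]-\kappa u[t]-f(t)\chi_{[0,1]}$ for a.e. $t\in(0,T)$. For $f\in L^2_{loc}(\mathbb{R}_+)$, functions $\xi,w:\mathbb{R}_+\to\mathbb{R}$, $\varphi:\mathbb{R}_+\to\bar S$ constitute a weak solution on $\mathbb{R}_+$ if for every $T>0$ they constitute a weak solution on $[0,T]$ with the same initial condition. In the closed-loop problem the input $f$ is the function given by the feedback formula along the solution. *)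

(* Defs.v *)
From mathcomp Require Import all_boot all_order all_algebra.
From mathcomp Require Import all_classical all_reals all_analysis.

Set Implicit Arguments.
Unset Strict Implicit.
Unset Printing Implicit Defensive.
Import Order.TTheory GRing.Theory Num.Theory.
Import numFieldNormedType.Exports.
Local Open Scope classical_set_scope.
Local Open Scope ring_scope.

Notation leb := (@lebesgue_measure _).

(* Elements of L^2(0,1), and of its subspaces below, are represented by
   functions R -> R whose values outside ]0,1[ are irrelevant and which are
   identified when they agree a.e. on ]0,1[. A function of time with values in
   such a space has type R -> R -> R (time first). *)

Section Spaces.
Context {R : realType}.
Implicit Types (f g u phi psi : R -> R) (F v : R -> R -> R).

Definition eq01 f g : Prop := {ae leb, forall x, x \in `]0, 1[ -> f x = g x}.

Definition L2 (a b : R) f : Prop := f \_ `]a, b[ \in Lfun leb 2%:E.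

Definition L2norm f : R := fine 'N[leb]_2%:E[EFin \o (f \_ `]0%R, 1%R[)]%E.

Definition inner f g : R := \int[leb]_(x in `]0, 1[) (f x * g x).

Definition C1c (a b : R) psi : Prop :=
  [/\ forall x, derivable psi x 1, continuous psi^`()%classic &
      exists c d, [/\ a < c, d < b & forall x, x \notin `[c, d] -> psi x = 0]].

Definition weak_deriv (a b : R) f g : Prop := forall psi, C1c a b psi ->
  \int[leb]_(x in `]a, b[) (f x * psi^`()%classic x) =
  - \int[leb]_(x in `]a, b[) (g x * psi x).

(* H^k(0,1) = W^{k,2}(0,1) *)
Fixpoint Hk (k : nat) f : Prop :=
  if k is k'.+1 then L2 0 1 f /\ exists g, weak_deriv 0 1 f g /\ Hk k' g
  else L2 0 1 f.

(* The n-th weak derivative on ]0,1[ (junk when it is not in L^2). *)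
Definition wderiv f : R -> R :=
  xget (cst 0) [set g | L2 0 1 g /\ weak_deriv 0 1 f g].
Definition wD (n : nat) f : R -> R := iter n wderiv f.

(* Meaningful only for f in H^k(0,1). *)
Definition Hnorm (k : nat) f : R :=
  Num.sqrt (\sum_(j < k.+1) L2norm (wD j f) ^+ 2).

(* The closure of C^1_c((0,1)) in H^1(0,1). *)
Definition H10 u : Prop :=
  Hk 1 u /\
  forall e : R, 0 < e -> exists2 psi, C1c 0 1 psi & Hnorm 1 (u \- psi) < e.

(* The continuous representative of g on [0,1] takes the value y at a. *)
Definition boundary_value g (a y : R) : Prop :=
  exists h : R -> R, [/\ {within `[0 : R, 1 : R], continuous h}, eq01 h g & h a = y].

Definition inS phi : Prop :=
  L2 0 1 phi /\ \int[leb]_(x in `]0, 1[) phi x = 0.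

Definition inSbar phi : Prop :=
  [/\ Hk 2 phi, boundary_value (wD 1 phi) 0 0, boundary_value (wD 1 phi) 1 0 &
      \int[leb]_(x in `]0, 1[) phi x = 0].

(* Absolute continuity on [0,T] of a map into a metric space, d s t being the
   distance between its values at s and t. *)
Definition abs_cont (T : R) (d : R -> R -> R) : Prop :=
  forall e : R, 0 < e -> exists2 delta : R, 0 < delta &
    forall (n : nat) (a b : 'I_n -> R),
      (forall i, [/\ 0 <= a i, a i <= b i & b i <= T]) ->
      trivIset setT (fun i => [set` `]a i, b i[]) ->
      \sum_i (b i - a i) < delta -> \sum_i d (a i) (b i) < e.

(* C^0([0,T]; X) for the space X with norm N *)
Definition C0_into (T : R) (X : (R -> R) -> Prop) (N : (R -> R) -> R) F : Prop :=
  forall t, t \in `[0, T] ->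
    X (F t) /\ N (F s \- F t) @[s --> within `[0, T] (nbhs t)] --> 0.

Definition simple_into (X : (R -> R) -> Prop) F : Prop :=
  exists (m : nat) (A : 'I_m -> set R) (c : 'I_m -> R -> R),
    [/\ forall i, measurable (A i), forall i, X (c i) &
        forall t x, F t x = \sum_i \1_(A i) t * c i x].

(* The Bochner space L^2((0,T); X) for the space X with norm N: strong
   measurability (a.e. limit of simple functions) and square integrability of
   the norm. *)
Definition L2_into (T : R) (X : (R -> R) -> Prop) (N : (R -> R) -> R) F : Prop :=
  [/\ {ae leb, forall t, t \in `]0, T[ -> X (F t)},
      exists s : nat -> R -> R -> R,
        (forall n, simple_into X (s n)) /\
        {ae leb, forall t, t \in `]0, T[ ->
          N (F t \- s n t) @[n --> \oo] --> 0} &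
      (\int[leb]_(t in `]0%R, T[) ((N (F t) ^+ 2)%R)%:E < +oo)%E].

(* v is the derivative of F in the sense of L^2(0,1)-valued distributions on
   (0,T). The identity \int psi' F = - \int psi v between Bochner integrals in
   L^2(0,1) is expressed by pairing both sides with each eta in L^2(0,1). *)
Definition weak_tderiv (T : R) F v : Prop := forall eta, L2 0 1 eta ->
  weak_deriv 0 T (fun t => inner (F t) eta) (fun t => inner (v t) eta).

(* g is the derivative at t of F : I -> L^2(0,1), as the limit in L^2(0,1) of
   the difference quotients (one-sided at an endpoint of I). *)
Definition is_tderiv (I : set R) F (t : R) g : Prop :=
  L2 0 1 g /\
  L2norm (fun x => (F s x - F t x) / (s - t) - g x) @[s --> within I t^'] --> 0.

Definition tderiv (I : set R) F (t : R) : R -> R :=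
  xget (cst 0) [set g | is_tderiv I F t g].

End Spaces.

Section Problem.
Context {R : realType}.

(* P(xi, w, phi, phib) *)
Definition feedback (mu kappa r k Q gamma xi w : R) (phi phib : R -> R) : R :=
  gamma * k ^+ 3 *
  (k ^- 2 * w + k^-1 * xi -
   r * Q * \int[leb]_(x in `]0, 1[)
     (kappa * x * phi x + (r + 1) / r * x * phib x + mu * wD 1 phi x)).

Record weak_solution_on (sigma mu kappa : R) (f : R -> R)
    (phi0 phib0 : R -> R) (xi0 w0 T : R)
    (xi w : R -> R) (phi : R -> R -> R) : Prop := WeakSolutionOn {
  ws_input : L2 0 T f;
  ws_xi_ac : abs_cont T (fun s t => `|xi s - xi t|);
  ws_w_ac : abs_cont T (fun s t => `|w s - w t|);
  ws_phi_Sbar : forall t, t \in `[0, T] -> inSbar (phi t);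
  ws_phi_ac : abs_cont T (fun s t => L2norm (phi s \- phi t));
  ws_ode_xi : {ae leb, forall t, t \in `]0, T[ -> is_derive t 1 xi (w t)};
  ws_ode_w : {ae leb, forall t, t \in `]0, T[ -> is_derive t 1 w (- f t)};
  ws_phi_L2H3 : L2_into T (fun g => Hk 3 g /\ inSbar g) (Hnorm 3) phi;
  ws_init_phi : eq01 (phi 0) phi0;
  ws_init_phit : is_tderiv `[0, T] phi 0 phib0;
  ws_init_ode : xi 0 = xi0 /\ w 0 = w0;
  ws_pde : exists u ut : R -> R -> R,
    [/\ C0_into T H10 (Hnorm 1) u /\ L2_into T (Hk 2) (Hnorm 2) u,
        L2_into T (L2 0 1) L2norm ut /\ weak_tderiv T u ut,
        forall t, t \in `[0, T] -> is_tderiv `[0, T] phi t (wD 1 (u t)) &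
        {ae leb, forall t, t \in `]0, T[ ->
          eq01 (ut t) (fun x =>
            wD 1 (phi t) x - sigma * wD 3 (phi t) x + mu * wD 2 (u t) x
            - kappa * u t x - f t * \1_(`[0, 1]%classic) x)}]
}.

Definition weak_solution (sigma mu kappa : R) (f : R -> R)
    (phi0 phib0 : R -> R) (xi0 w0 : R)
    (xi w : R -> R) (phi : R -> R -> R) : Prop :=
  forall T : R, 0 < T ->
    weak_solution_on sigma mu kappa f phi0 phib0 xi0 w0 T xi w phi.

Definition phi_t (phi : R -> R -> R) (t : R) : R -> R :=
  tderiv `[0, +oo[ phi t.

(* The input is existentially quantified; that it is in L^2_loc is part of
   weak_solution. *)
Definition closed_loop_solution (sigma mu kappa r k Q gamma : R)
    (phi0 phib0 : R -> R) (xi0 w0 : R)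
    (xi w : R -> R) (phi : R -> R -> R) : Prop :=
  exists f : R -> R,
    weak_solution sigma mu kappa f phi0 phib0 xi0 w0 xi w phi /\
    forall t, 0 <= t ->
      f t = feedback mu kappa r k Q gamma (xi t) (w t) (phi t) (phi_t phi t).

End Problem.

(* Main.v *)
Require Import Defs.
From mathcomp Require Import all_boot all_order all_algebra.
From mathcomp Require Import all_classical all_reals all_analysis.
From mathcomp Require Import measurable_realfun ring lra.
Import Order.TTheory GRing.Theory Num.Theory.
Import numFieldNormedType.Exports.

(** With [phi_t = u_x], [phi] is expanded in the cosines [cosb n] and [u] in the sines
[sinb n], of frequency [nu = (n+1) pi].  The equation then splits into the modes
  [a' = nu b],  [b' = - (nu + sigma nu^3) a - (mu nu^2 + kappa) b - c_n f],
coupled only through [f]; here [c_n] is the sine coefficient of the constant 1.  Since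
the [c_n] are square summable, the force [f] acts with finite energy although it enters
through the boundary.

Each mode carries the functional
  [L = r/2 z^2 + b^2/2 + (r+1)/2 (1 + sigma nu^2) a^2],  [z = b + (mu nu + kappa/nu) a],
where [z] is the coefficient of [u - mu phi_x + kappa v], [v] the primitive of [phi]: it
obeys [z' = - (nu + sigma nu^3) a - c_n f], free of damping terms, so that the cross terms
of [L'] cancel and [L' = - D - c_n f (r z + b)] with [D] coercive ([Lmode_derive]).  With
[q = sum_n c_n (r z_n + b_n)] the sum [V] of all the [L] and of
[(k^2 xi^2 + (w + k xi)^2) / (2 k^2 Q)] has a derivative in which [f] is multiplied by
[-(q + (w + k xi)/(k^2 Q))], and the feedback is [gamma k] times
[w + k xi + k^2 Q q], so it makes that term negative.  What is left over is of the size of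
[q^2], and [q^2 <= C0 D] ([qsum_sqr_le]): the smallness condition says exactly that
[k^3 Q C0 < 1], and [gamma > gamma_star / 2] that [gamma (1 - k^3 Q C0) > 1].  Thus
[V' <= - om V + C h^2] when the input is the feedback plus a disturbance [h], with
constants independent of the number of modes ([Vdot_le], [Vtot_iss]).

This one estimate gives existence, decay and uniqueness.
Truncated to [N] modes, the closed loop is a linear system of ordinary differential
equations.  Seen from the first [N] modes, the truncation to [M >= N] modes is the same
system with a disturbance bounded by the tail [sum_(n >= N) c_n^2], so the truncations
converge uniformly in time and the limit inherits the decay of [V] ([modal_exists]).
The functional [V] is weaker than the norm of the statement by one derivative; but once [f]
decays, each mode is a scalar damped oscillator forced by [c_n f], and summing the
estimates of the single modes in the stronger norm costs only [sum_n c_n^2] ([mode_decay]).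
The resulting summable majorants turn the series into a weak solution
([synthesis_weak_solution], [closed_loop_stable]).
Conversely the coefficients of an arbitrary solution of the closed loop satisfy the modes
([closed_loop_modal]).  The point there is that [f] is continuous in time, because the
[L^2(0,T;H^2)] bound on [u] controls the increments of the integral of [phi_x]
([S_modulus]); then all the weak time derivatives are classical.  The difference of two
solutions starts at [V = 0] and satisfies the truncated loop up to a disturbance that
vanishes as [N] grows, so it is zero ([modal_unique]). *)

Set Implicit Arguments.
Unset Strict Implicit.
Unset Printing Implicit Defensive.
Local Open Scope classical_set_scope.
Local Open Scope ring_scope.

(** * Real calculus and differential equations *)
Section Calculus.
Context {R : realType}.
Implicit Types (f df : R -> R) (a b t : R).

Lemma is_derive_conv (f g : R -> R) (t d d' : R) :
  is_derive t 1 f d -> f =1 g -> d = d' -> is_derive t 1 g d'.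
Proof. by move=> h /funext <- <-. Qed.

Lemma derD f g t (d e : R) : is_derive t 1 f d -> is_derive t 1 g e ->
  is_derive t 1 (fun x => f x + g x) (d + e).
Proof. by move=> ? ?; exact: is_deriveD. Qed.

Lemma derN f t (d : R) : is_derive t 1 f d -> is_derive t 1 (fun x => - f x) (- d).
Proof. by move=> ?; exact: is_deriveN. Qed.

Lemma derB f g t (d e : R) : is_derive t 1 f d -> is_derive t 1 g e ->
  is_derive t 1 (fun x => f x - g x) (d - e).
Proof. by move=> ? ?; exact: is_deriveB. Qed.

Lemma derZ (c : R) f t (d : R) : is_derive t 1 f d ->
  is_derive t 1 (fun x => c * f x) (c * d).
Proof. by move=> h; exact: (is_deriveZ c h). Qed.

Lemma derId t : is_derive t 1 (fun x : R => x) 1.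
Proof. exact: is_derive_id. Qed.

Lemma derM f g t (d e : R) : is_derive t 1 f d -> is_derive t 1 g e ->
  is_derive t 1 (fun x => f x * g x) (d * g t + f t * e).
Proof.
move=> hf hg; apply: (is_derive_conv (is_deriveM hf hg)) => //.
by rewrite /GRing.scale /=; ring.
Qed.

Lemma derX2 f t (d : R) : is_derive t 1 f d ->
  is_derive t 1 (fun x => f x ^+ 2) (2 * f t * d).
Proof.
move=> hf; apply: (is_derive_conv (derM hf hf)); last by ring.
by move=> x; rewrite expr2.
Qed.

Lemma derive_le0_le f df a b : a <= b -> {within `[a, b], continuous f} ->
  (forall x : R, a < x < b -> is_derive x 1 f (df x)) ->
  (forall x : R, a < x < b -> df x <= 0) -> f b <= f a.
Proof.
rewrite le_eqVlt => /predU1P[->//|ab] cf fdf df0.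
have fdf' (x : R) : x \in `]a, b[ -> is_derive x 1 f (df x).
  by rewrite in_itv; exact: fdf.
have [c] := MVT ab fdf' cf.
rewrite in_itv => /= cab fE; rewrite -subr_le0 fE.
by rewrite mulr_le0_ge0 ?df0 // subr_ge0 ltW.
Qed.

Lemma cvg_bigsum (T : Type) (F : set_system T) {FF : Filter F} (I : Type)
    (s : seq I) (P : pred I) (f : I -> T -> R) (l : I -> R) :
  (forall i, P i -> f i x @[x --> F] --> l i) ->
  \sum_(i <- s | P i) f i x @[x --> F] --> \sum_(i <- s | P i) l i.
Proof.
move=> fl; elim: s => [|i s IH].
  by rewrite big_nil; under eq_fun do rewrite big_nil; exact: cvg_cst.
rewrite big_cons; under eq_fun do rewrite big_cons.
by case: ifPn => // Pi; apply: cvgD => //; exact: fl.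
Qed.

Lemma continuous_sum (I : Type) (s : seq I) (F : I -> R -> R) :
  (forall i, continuous (F i)) -> continuous (fun t => \sum_(i <- s) F i t).
Proof. by move=> cF t; apply: cvg_bigsum => i _; exact: cF. Qed.

Lemma is_derive_bigsum (I : Type) (s : seq I) (F dF : I -> R -> R) t :
  (forall i, is_derive t 1 (F i) (dF i t)) ->
  is_derive t 1 (fun t => \sum_(i <- s) F i t) (\sum_(i <- s) dF i t).
Proof.
move=> dFi; elim: s => [|i s IH].
  rewrite big_nil; under eq_fun do rewrite big_nil; exact: is_derive_cst.
rewrite big_cons; under eq_fun do rewrite big_cons.
exact: is_deriveD.
Qed.

Lemma is_derive_expRM (c t : R) :
  is_derive t 1 (fun s => expR (c * s)) (c * expR (c * t)).
Proof.
have h : is_derive t 1 (fun s : R => c * s) c.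
  have := @is_deriveZ _ _ _ (@id R) c t 1 1 (is_derive_id _ _).
  by rewrite /GRing.scale /= mulr1.
have := is_derive1_comp (f := expR) (g := fun s => c * s) (x := t).
move=> /(_ _ _ (is_derive_expR _) h); by rewrite mulrC.
Qed.

Lemma continuous_expRM (c : R) : continuous (fun s => expR (c * s)).
Proof.
move=> t; apply: (@continuous_comp _ _ _ ( *%R c) expR).
  exact: mulrl_continuous.
exact: continuous_expR.
Qed.

(** The differential inequality says that [exp(om t) (f - K / om)] decreases. *)
Lemma gronwall f df (om K T : R) : 0 < om -> 0 <= K -> 0 <= T ->
  {within `[0, T], continuous f} ->
  (forall x : R, 0 < x < T -> is_derive x 1 f (df x)) ->
  (forall x : R, 0 < x < T -> df x <= - om * f x + K) ->
  f T <= expR (- om * T) * f 0 + K / om.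
Proof.
move=> om0 K0 T0 cf fdf dfle.
pose g t := expR (om * t) * (f t - K / om).
pose dg t := om * expR (om * t) * (f t - K / om) + expR (om * t) * df t.
have gle : g T <= g 0.
  apply: (@derive_le0_le g dg) => //.
  - move=> x; apply: cvgM.
      by apply: continuous_subspaceT; exact: continuous_expRM.
    by apply: cvgB; [exact: cf | exact: cvg_cst].
  - move=> x x0T; have h1 := is_derive_expRM om x.
    have h2 := fdf _ x0T.
    have h3 := is_deriveB h2 (is_derive_cst (K / om) x 1).
    apply: (is_derive_conv (is_deriveM h1 h3)) => //.
    rewrite /dg /GRing.scale /= /cst !fctE subr0; ring.
  - move=> x /dfle h; rewrite /dg.
    rewrite [om * _]mulrC -mulrA -mulrDr pmulr_rle0 ?expR_gt0 //.
    rewrite mulrBr mulrCA divff ?gt_eqF // mulr1; lra.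
move: gle; rewrite /g mulr0 expR0 mul1r => gle.
have e0 : 0 < expR (om * T) by exact: expR_gt0.
rewrite mulNr expRN -lerBlDr -ler_pdivrMl ?invr_gt0 // invrK.
apply: le_trans gle _; rewrite lerBlDr lerDl; exact: divr_ge0 K0 (ltW om0).
Qed.

(** First-order expansion: a form of differentiability that survives uniform limits, without
    the quotient. *)
Lemma is_derive_nearP f t d : is_derive t 1 f d <->
  (forall e : R, 0 < e -> \forall s \near t, `|f s - f t - d * (s - t)| <= e * `|s - t|).
Proof.
split=> [[df fE] e e0|h].
  have := df; rewrite /derivable => /cvgrPdist_le /(_ e e0).
  rewrite -/('D_1 f t) fE => /nbhs_ballP [r /= r0 h].
  apply/nbhs_ballP; exists r => //= s st.
  have [->|nst] := eqVneq s t; first by rewrite !subrr mulr0 subrr normr0 mulr0.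
  have st' : `|s - t| < r by rewrite distrC.
  have := h (s - t); rewrite /ball /= sub0r normrN => /(_ st').
  rewrite subr_eq0 => /(_ nst); rewrite scaler1 subrK.
  rewrite -[in X in _ -> X](ler_pM2l (_ : 0 < `|s - t|^-1)); last first.
    by rewrite invr_gt0 normr_gt0 subr_eq0.
  rewrite [e * _]mulrC mulKf ?normr_eq0 ?subr_eq0 //.
  rewrite -normfV -normrM mulrBr [d * _]mulrC mulKf ?subr_eq0 //.
  by rewrite distrC.
have hc : h0^-1 *: (f (h0 *: 1 + t) - f t) @[h0 --> 0^'] --> d.
  apply/cvgrPdist_le => e e0; have /nbhs_ballP [r /= r0 hr] := h e e0.
  apply/nbhs_ballP; exists r => //= s; rewrite /ball /= sub0r normrN => st s0.
  have := hr (s + t); rewrite /ball /= opprD addrA [t - _ - t]addrAC subrr sub0r normrN => /(_ st).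
  rewrite addrK scaler1.
  have s1 : 0 < `|s|^-1 by rewrite invr_gt0 normr_gt0.
  rewrite -(ler_pM2l s1) [e * _]mulrC mulKf ?normr_eq0 //.
  rewrite -normfV -normrM mulrBr [d * _]mulrC mulKf //.
  by rewrite distrC /GRing.scale.
split; first by apply/cvg_ex; exists d.
exact: cvg_lim hc.
Qed.

Lemma derive_bound f df (a b K : R) : a <= b ->
  (forall x : R, a <= x <= b -> is_derive x 1 f (df x)) ->
  (forall x : R, a <= x <= b -> `|df x| <= K) -> `|f b - f a| <= K * (b - a).
Proof.
move=> ab fdf dfK.
have [|?|c] := @MVT_segment _ f df a b ab.
- by move=> x; rewrite in_itv /= => /andP[/ltW ? /ltW ?]; apply: fdf; apply/andP.
- apply: derivable_within_continuous => x; rewrite in_itv /= => xab.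
  by case: (fdf x xab).
- rewrite in_itv /= => cab ->.
  by rewrite normrM (ger0_norm (_ : 0 <= b - a)) ?subr_ge0 // ler_wpM2r ?subr_ge0 ?dfK.
Qed.

(** Uniform closeness of the derivatives makes the increments of [x N - x M] Lipschitz with a
    small constant, uniformly in [M]; this passes to the limit [M -> oo], and then [x N] for one
    fixed [N] has the expansion wanted for [y]. *)
Lemma is_derive_unif (x dx : nat -> R -> R) (y g : R -> R) :
  (forall N (t : R), 0 < t -> is_derive t 1 (x N) (dx N t)) ->
  (forall e : R, 0 < e -> exists N0, forall N, (N0 <= N)%N ->
     forall t : R, 0 < t -> `|dx N t - g t| <= e) ->
  (forall t : R, 0 < t -> x N t @[N --> \oo] --> y t) ->
  forall t : R, 0 < t -> is_derive t 1 y (g t).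
Proof.
move=> xdx dxg xy t t0; apply/is_derive_nearP => e e0.
have e4 : 0 < e / 4 by apply: divr_gt0.
have [N0 hN0] := dxg _ e4.
have main s : 0 < s -> `|(x N0 s - y s) - (x N0 t - y t)| <= e / 2 * `|s - t|.
  move=> s0.
  have hM M : (N0 <= M)%N ->
      `|(x N0 s - x M s) - (x N0 t - x M t)| <= e / 2 * `|s - t|.
    move=> hM.
    have dD (r : R) : 0 < r ->
        is_derive r 1 (fun r => x N0 r - x M r) (dx N0 r - dx M r).
      by move=> r0; apply: is_deriveB; apply: xdx.
    have bD (r : R) : 0 < r -> `|dx N0 r - dx M r| <= e / 2.
      move=> r0; have := hN0 _ (leqnn _) r r0; have := hN0 _ hM r r0.
      move=> h1 h2; rewrite (_ : _ - _ = (dx N0 r - g r) - (dx M r - g r)); last by ring.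
      apply: le_trans (ler_normB _ _) _.
      by rewrite (_ : e / 2 = e / 4 + e / 4); [exact: lerD | field].
    have [st|/ltW ts] := leP s t.
      have := @derive_bound (fun r => x N0 r - x M r) (fun r => dx N0 r - dx M r) s t (e / 2) st.
      rewrite distrC [`|s - t|]distrC [X in _ -> _ <= _ * X]ger0_norm ?subr_ge0 //.
      by apply=> r /andP[sr _]; [apply: dD | apply: bD]; exact: lt_le_trans sr.
    have := @derive_bound (fun r => x N0 r - x M r) (fun r => dx N0 r - dx M r) t s (e / 2) ts.
    rewrite [X in _ -> _ <= _ * X]ger0_norm ?subr_ge0 //.
    by apply=> r /andP[sr _]; [apply: dD | apply: bD]; exact: lt_le_trans sr.
  have cv : `|(x N0 s - x M s) - (x N0 t - x M t)| @[M --> \oo] -->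
      `|(x N0 s - y s) - (x N0 t - y t)|.
    apply: cvg_norm; apply: cvgB; apply: cvgB; try exact: cvg_cst; exact: xy.
  rewrite -(cvg_lim _ cv) //; apply: limr_le; first by apply/cvg_ex; eexists; exact: cv.
  near=> M; apply: hM; near: M; exact: nbhs_infty_ge.
have /is_derive_nearP /(_ _ e4) near1 := xdx N0 t t0.
have near2 : \forall s \near t, 0 < s by exact: lt_nbhsr.
near=> s.
have s0 : 0 < s by near: s.
have h1 := main s s0.
have h2 : `|x N0 s - x N0 t - dx N0 t * (s - t)| <= e / 4 * `|s - t| by near: s.
have h3 := hN0 _ (leqnn _) t t0.
rewrite (_ : _ - _ = (x N0 s - x N0 t - dx N0 t * (s - t)) -
   ((x N0 s - y s) - (x N0 t - y t)) + (dx N0 t - g t) * (s - t)); last by ring.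
apply: le_trans (ler_normD _ _) _.
rewrite (_ : e * _ = e / 4 * `|s - t| + e / 2 * `|s - t| + e / 4 * `|s - t|); last by field.
apply: lerD; last by rewrite normrM ler_wpM2r.
by apply: le_trans (ler_normB _ _) _; apply: lerD.
Unshelve. all: by end_near.
Qed.

(** Comparison with the exponential series of [M K]. *)
Lemma is_cvg_pseries_fact (v : nat -> R) (B M K : R) :
  (forall k, `|v k| <= B * M ^+ k) -> cvgn (pseries (fun k => v k / k`!%:R) K).
Proof.
move=> vB; apply: normed_cvg.
have M0 : 0 <= B by have := vB 0%N; rewrite mulr1; apply: le_trans.
apply: (@series_le_cvg _ _ (fun k => B * exp_coeff (M * `|K|) k)).
- by move=> k /=.
- move=> k; rewrite /exp_coeff /=; have := vB k => /(le_trans (normr_ge0 _)) h.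
  by rewrite exprMn !mulrA divr_ge0 // mulr_ge0 // exprn_ge0.
- move=> k; rewrite /exp_coeff /= !normrM normfV normrX.
  rewrite (ger0_norm (ler0n R k`!)) exprMn !mulrA mulrAC.
  by rewrite ler_wpM2r ?invr_ge0 // ler_wpM2r ?exprn_ge0.
- by apply: is_cvg_seriesZ; exact: is_cvg_series_exp_coeff.
Qed.

(** The solution is the exponential series [sum_k A^k x0 t^k / k!], differentiated term by
    term. *)
Lemma linear_ode (I : finType) (A : I -> I -> R) (x0 : I -> R) :
  exists x : R -> I -> R, x 0 = x0 /\
    forall (t : R) i, is_derive t 1 (x^~ i) (\sum_j A i j * x t j).
Proof.
pose v := fix v k := if k is k'.+1 then (fun i => \sum_j A i j * v k' j) else x0.
pose M : R := \sum_i \sum_j `|A i j|; pose B : R := \sum_i `|x0 i|.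
have vB k i : `|v k i| <= B * M ^+ k.
  elim: k i => [|k IH] i /=.
    by rewrite mulr1 /B (bigD1 i) //= lerDl sumr_ge0.
  have B0 : 0 <= B * M ^+ k by apply: le_trans (IH i).
  apply: le_trans (ler_norm_sum _ _ _) _.
  have h j : `|A i j * v k j| <= `|A i j| * (B * M ^+ k).
    by rewrite normrM ler_wpM2l.
  apply: le_trans (ler_sum _ (fun j _ => h j)) _.
  rewrite -mulr_suml exprSr mulrA mulrC ler_wpM2l //.
  by rewrite /M [X in _ <= X](bigD1 i) //= lerDl sumr_ge0 // => l _; rewrite sumr_ge0.
pose c (i : I) k := v k i / k`!%:R.
have cE i : pseries_diffs (c i) = fun k => v k.+1 i / k`!%:R.
  apply/funext => k; rewrite /pseries_diffs /c factS natrM invfM.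
  by rewrite mulrCA [k.+1%:R * _]mulrA divff ?mul1r // pnatr_eq0.
have cE2 i : pseries_diffs (pseries_diffs (c i)) = fun k => v k.+2 i / k`!%:R.
  rewrite cE; apply/funext => k; rewrite /pseries_diffs factS natrM invfM.
  by rewrite mulrCA [k.+1%:R * _]mulrA divff ?mul1r // pnatr_eq0.
have cv i p K : cvgn (pseries (fun k => v (p + k)%N i / k`!%:R) K).
  apply: (@is_cvg_pseries_fact _ (B * M ^+ p) M) => k.
  by rewrite -mulrA -exprD.
exists (fun t i => limn (pseries (c i) t)); split.
  apply/funext => i; apply: cvg_lim => //.
  apply: cvg_near_cst; exists 1%N => // -[//|n] _.
  rewrite /pseries /series /= big_nat_recl // expr0 mulr1 big1_seq ?addr0.
    by rewrite /c fact0 divr1.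
  by move=> j _; rewrite exprS mul0r mulr0.
move=> t i.
have -> : \sum_j A i j * limn (pseries (c j) t) = limn (pseries (pseries_diffs (c i)) t).
  rewrite cE; apply/esym/cvg_lim => //.
  have -> : pseries (fun k => v k.+1 i / k`!%:R) t =
      (fun n => \sum_j A i j * pseries (c j) t n).
    apply/funext => n; rewrite /pseries /series /=.
    under [RHS]eq_bigr do rewrite mulr_sumr.
    rewrite exchange_big /=; apply: eq_bigr => k _.
    rewrite !mulr_suml; apply: eq_bigr => j _.
    by rewrite /c !mulrA.
  apply: cvg_bigsum => j _; apply: cvgM; first exact: cvg_cst.
  exact: (cv j 0%N t).
have K1 : `|t| < `|(`|t| + 1)| by rewrite [X in _ < X]ger0_norm ?addr_ge0 // ltrDl.
apply: (@pseries_snd_diffs _ (c i) (`|t| + 1)) => //.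
- exact: (cv i 0%N).
- by rewrite cE; exact: (cv i 1%N).
- by rewrite cE2; exact: (cv i 2%N).
Qed.

(** The integral starts at [-1], so that the derivative at the end point [0] of the time
    interval is two-sided. *)
Lemma primitive_exists (g : R -> R) : continuous g -> exists P : R -> R,
  [/\ P 0 = 0, forall t : R, -1 < t -> is_derive t 1 P (g t) &
      forall a b : R, 0 <= a <= b -> \int[leb]_(x in `[a, b]) g x = P b - P a].
Proof.
move=> cg; pose P0 (t : R) : R := \int[leb]_(x in [set` `[-1, t]]) g x.
have ig (a b : R) : leb.-integrable `[a, b] (EFin \o g).
  apply: continuous_compact_integrable; first exact: segment_compact.
  exact: continuous_subspaceT.
have dP t : -1 < t -> is_derive t 1 P0 (g t).
  move=> t1; have t2 : t < t + 1 by rewrite ltrDl.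
  have [h1 h2] := continuous_FTC1_closed t2 (ig _ _) t1 (cg t).
  by split; [exact: h1 | rewrite -derive1E].
exists (fun t => P0 t - P0 0); split; first by rewrite subrr.
  move=> t /dP h; have := derB h (is_derive_cst (P0 0) t 1).
  by rewrite subr0.
move=> a b /andP[a0]; rewrite le_eqVlt => /predU1P[<-|ab].
  by rewrite set_itv1 Rintegral_set1 subrr.
have lo : -1 < a by apply: lt_le_trans a0; rewrite ltrN10.
rewrite /Rintegral (@continuous_FTC2 _ g (fun t => P0 t - P0 0)) //.
- exact: continuous_subspaceT.
- have dc (t : R) : -1 < t -> {for t, continuous (fun t => P0 t - P0 0)}.
    move=> /dP [h _]; apply: cvgB; last exact: cvg_cst.
    exact/differentiable_continuous/derivable1_diffP.
  have cP : {within `[a, b], continuous (fun t => P0 t - P0 0)}.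
    apply: continuous_in_subspaceT => x; rewrite inE /= in_itv /= => /andP[ax _].
    by apply: dc; apply: lt_le_trans ax.
  have [h1 h2 h3] := (continuous_within_itvP _ ab).1 cP.
  split => // x; rewrite in_itv /= => /andP[ax _].
  have /dP h := lt_trans lo ax.
  by have [h4 _] := derB h (is_derive_cst (P0 0) x 1); exact: h4.
- move=> x; rewrite in_itv /= => /andP[ax _].
  have /dP h := lt_trans lo ax; have [h1 h2] := derB h (is_derive_cst (P0 0) x 1).
  by rewrite derive1E h2 subr0.
Qed.

End Calculus.

(** * Positivity and finite sums *)
(** Sign conditions by structural recursion on the goal; [pos_hook] is redefined to supply the
    positivity of the frequencies. *)
Ltac pos_hook := fail.
Ltac pos := match goal with
  | |- _ => by []
  | |- _ => assumption
  | |- _ => pos_hook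
  | |- is_true (0 < _ + _) =>
      first [apply: addr_gt0; pos | apply: ltr_wpDr; pos | apply: ltr_wpDl; pos]
  | |- is_true (0 < _ * _) => apply: mulr_gt0; pos
  | |- is_true (0 < _ ^-1) => rewrite invr_gt0; pos
  | |- is_true (0 < _ ^+ _) => apply: exprn_gt0; pos
  | |- is_true (0 < pi) => exact: pi_gt0
  | |- is_true (0 < Num.sqrt _) => rewrite sqrtr_gt0; pos
  | |- is_true (0 <= _ + _) => apply: addr_ge0; pos
  | |- is_true (0 <= _ * _) => apply: mulr_ge0; pos
  | |- is_true (0 <= _ ^-1) => rewrite invr_ge0; pos
  | |- is_true (0 <= _ ^+ 2) => exact: sqr_ge0
  | |- is_true (0 <= _ ^+ _) => apply: exprn_ge0; pos
  | |- is_true (0 <= `|_|) => exact: normr_ge0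
  | |- is_true (0 <= Num.sqrt _) => exact: sqrtr_ge0
  | |- is_true (0 <= _) => apply: ltW; pos
  | |- is_true (_ != 0) => apply: lt0r_neq0; pos
  | |- is_true (_ && _) => apply/andP; split; pos
  | |- _ /\ _ => split; pos
  end.

Section FiniteSums.
Context {R : realType}.

(** The defect is [sum_i (Y x_i - Z y_i)^2 / Y]; when [Y = 0] all the [y_i] vanish. *)
Lemma sum_cauchy_schwarz (I : Type) (s : seq I) (x y : I -> R) :
  (\sum_(i <- s) x i * y i) ^+ 2 <=
  (\sum_(i <- s) x i ^+ 2) * (\sum_(i <- s) y i ^+ 2).
Proof.
set Z : R := \sum_(i <- s) x i * y i; set X : R := \sum_(i <- s) x i ^+ 2.
set Y : R := \sum_(i <- s) y i ^+ 2.
have Y0 : 0 <= Y by apply: sumr_ge0 => i _; exact: sqr_ge0.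
have h : 0 <= Y * (X * Y - Z ^+ 2).
  have -> : Y * (X * Y - Z ^+ 2) = \sum_(i <- s) (Y * x i - Z * y i) ^+ 2.
    rewrite (eq_bigr (fun i => Y ^+ 2 * (x i ^+ 2) +
      (- (2 * Y * Z)) * (x i * y i) + Z ^+ 2 * y i ^+ 2)); last by move=> i _; ring.
    by rewrite !big_split /= -!mulr_sumr -/X -/Y -/Z; ring.
  by apply: sumr_ge0 => i _; exact: sqr_ge0.
have [Yp|] := ltP 0 Y; first by rewrite -subr_ge0 -(pmulr_rge0 _ Yp).
move=> Yn; have Y00 : Y = 0 by apply/le_anti/andP.
suff -> : Z = 0 by rewrite expr0n mulr_ge0 // sumr_ge0 // => i _; exact: sqr_ge0.
rewrite /Z; elim: (s) (Y00 : \sum_(i <- s) y i ^+ 2 = 0) => [|i l IH].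
  by rewrite !big_nil.
rewrite !big_cons => /eqP; rewrite paddr_eq0 ?sqr_ge0 ?sumr_ge0 //; last first.
  by move=> j _; exact: sqr_ge0.
by case/andP; rewrite sqrf_eq0 => /eqP -> /eqP /IH ->; rewrite mulr0 addr0.
Qed.

End FiniteSums.

(** * Modes and their Lyapunov functional *)
Section Modes.
Context {R : realType}.
Variables (sigma mu kappa r k Q gamma : R) (c : nat -> R).
Hypotheses (sigma_gt0 : 0 < sigma) (mu_gt0 : 0 < mu) (kappa_ge0 : 0 <= kappa).
Hypotheses (r_gt0 : 0 < r) (k_gt0 : 0 < k) (Q_gt0 : 0 < Q).

Definition nu (n : nat) : R := n.+1%:R * pi.
Definition stiff n : R := nu n + sigma * nu n ^+ 3.
Definition damp n : R := mu * nu n ^+ 2 + kappa.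
(** The sine coefficient of [u - mu phi_x + kappa v], where [v] is the primitive of [phi] that
    vanishes at both ends.  The time derivative of this function is
    [phi_x - sigma phi_xxx - f]: the damping of [u] is absorbed. *)
Definition zcoef n (a b : R) : R := b + (mu * nu n + kappa / nu n) * a.
(** The weight [s] is a parameter because two values are used: [s = r] matches the feedback,
    [s = 1] serves for estimates of single modes. *)
Definition Lmode (s : R) n (a b : R) : R :=
  s / 2 * zcoef n a b ^+ 2 + b ^+ 2 / 2 + (s + 1) / 2 * (1 + sigma * nu n ^+ 2) * a ^+ 2.
Definition Dmode (s : R) n (a b : R) : R :=
  damp n * (s * (1 + sigma * nu n ^+ 2) * a ^+ 2 + b ^+ 2).

Lemma nu_gt0 n : 0 < nu n.
Proof. by rewrite mulr_gt0 ?pi_gt0. Qed.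
Ltac pos_hook ::= exact: nu_gt0.

Lemma nu_neq0 n : nu n != 0. Proof. by rewrite gt_eqF ?nu_gt0. Qed.
Lemma nu_ge_pi n : pi <= nu n.
Proof. by rewrite ler_peMl ?pi_ge0 // ler1n. Qed.
Lemma nu2_ge n : pi ^+ 2 <= nu n ^+ 2.
Proof. by rewrite ler_sqr ?nnegrE ?pi_ge0 ?nu_ge_pi // ltW ?nu_gt0. Qed.
Lemma damp_ge n : mu * pi ^+ 2 + kappa <= damp n.
Proof. by rewrite lerD2r ler_wpM2l ?nu2_ge // ltW. Qed.
Lemma damp_gt0 n : 0 < damp n.
Proof. by rewrite ltr_wpDr // mulr_gt0 // exprn_gt0 ?nu_gt0. Qed.
Lemma damp_le n : damp n <= (mu + kappa / pi ^+ 2) * nu n ^+ 2.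
Proof.
rewrite mulrDl lerD2l -mulrA ler_peMr // mulrC ler_pdivlMr ?exprn_gt0 ?pi_gt0 //.
by rewrite mul1r nu2_ge.
Qed.

(** The weight [(s + 1) / 2] of [a^2] is the one for which the products [a b] produced by [z]
    and by [b] cancel against the one produced by [a]. *)
Lemma Lmode_derive (s a b f : R) n (z := zcoef n a b) (da := nu n * b)
    (db := - stiff n * a - damp n * b - c n * f) :
  s * z * (db + (mu * nu n + kappa / nu n) * da) + b * db +
    (s + 1) * (1 + sigma * nu n ^+ 2) * a * da =
  - Dmode s n a b - c n * f * (s * z + b).
Proof.
rewrite /z /da /db /Dmode /zcoef /stiff /damp; field; exact: nu_neq0.
Qed.

Definition is_mode n (a b f : R -> R) (t : R) : Prop :=
  is_derive t 1 a (nu n * b t) /\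
  is_derive t 1 b (- stiff n * a t - damp n * b t - c n * f t).

Lemma is_derive_Lmode (s : R) n (a b f : R -> R) t : is_mode n a b f t ->
  is_derive t 1 (fun t => Lmode s n (a t) (b t))
    (- Dmode s n (a t) (b t) - c n * f t * (s * zcoef n (a t) (b t) + b t)).
Proof.
move=> [ha hb].
have h1 := derZ (s / 2) (derX2 (derD hb (derZ (mu * nu n + kappa / nu n) ha))).
have h3 := derZ ((s + 1) / 2 * (1 + sigma * nu n ^+ 2)) (derX2 ha).
apply: (is_derive_conv (derD (derD h1 (derZ (2^-1) (derX2 hb))) h3)).
  by move=> x; rewrite /Lmode /zcoef; ring.
by rewrite -Lmode_derive /zcoef; field; exact: nu_neq0.
Qed.

Hypothesis c_sum : forall N, \sum_(n < N) c n ^+ 2 <= 1.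
Hypothesis cnu_sum : forall N, \sum_(n < N) (c n / nu n) ^+ 2 <= 1 / 3.

Definition A0 : R := 1 + kappa / (pi * mu * Num.sqrt 3).
(** The best constant that the two halves of [D] give for [q^2 <= C0 D]; the smallness
    condition of the theorem reads [k^3 Q C0 < 1]. *)
Definition C0 : R := r * mu * A0 ^+ 2 / (1 + sigma * pi ^+ 2) +
  (r + 1) ^+ 2 / (kappa + mu * pi ^+ 2).

(** [qsum] is the integral over ]0,1[ of [r z + u], truncated to [N] modes: the quantity through
    which the force acts on the energy of the modes. *)
Definition qsum N (A B : nat -> R) : R :=
  \sum_(n < N) c n * (r * zcoef n (A n) (B n) + B n).
Definition Dsum (s : R) N (A B : nat -> R) : R := \sum_(n < N) Dmode s n (A n) (B n).
Definition Lsum (s : R) N (A B : nat -> R) : R := \sum_(n < N) Lmode s n (A n) (B n).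

(** [q] is [(r + 1)] times the component [Y] along [b] plus [r] times the component
    [X = mu P + kappa W] along [a].  By Cauchy-Schwarz [Y] and [P] cost [sum c_n^2 <= 1], whereas
    [W] costs [sum (c_n / nu)^2 <= 1/3], the origin of the square root of 3 in [A0].  The two
    components are then balanced by the weights [al] and [be], whose sum is [C0]. *)
Lemma qsum_sqr_le N A B : qsum N A B ^+ 2 <= C0 * Dsum r N A B.
Proof.
pose a2 : R := \sum_(n < N) (nu n * A n) ^+ 2; pose b2 : R := \sum_(n < N) B n ^+ 2.
pose P : R := \sum_(n < N) c n * (nu n * A n).
pose W : R := \sum_(n < N) (c n / nu n) * A n.
pose Y : R := \sum_(n < N) c n * B n.
have a20 : 0 <= a2 by apply: sumr_ge0 => i _; exact: sqr_ge0.
have b20 : 0 <= b2 by apply: sumr_ge0 => i _; exact: sqr_ge0.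
have pi0 : 0 < pi :> R by exact: pi_gt0.
have s30 : 0 < Num.sqrt 3 :> R by rewrite sqrtr_gt0.
have qE : qsum N A B = (r + 1) * Y + r * (mu * P + kappa * W).
  rewrite /qsum /Y /P /W !mulr_sumr -!big_split /= mulr_sumr -big_split /=.
  by apply: eq_bigr => n _; rewrite /zcoef; field; exact: nu_neq0.
have Y2 : Y ^+ 2 <= b2.
  by apply: le_trans (sum_cauchy_schwarz _ _ _) _; rewrite ler_piMl.
have P2 : `|P| <= Num.sqrt a2.
  rewrite -sqrtr_sqr ler_sqrt //.
  by apply: le_trans (sum_cauchy_schwarz _ _ _) _; rewrite ler_piMl.
have W2 : `|W| <= Num.sqrt a2 / (pi * Num.sqrt 3).
  rewrite -sqrtr_sqr ler_pdivlMr ?mulr_gt0 //.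
  rewrite -[X in _ * (X * _)](ger0_norm (ltW pi0)) -sqrtr_sqr -!sqrtrM ?sqr_ge0 //.
  rewrite ler_sqrt //.
  have h := sum_cauchy_schwarz (index_enum 'I_N) (fun n => c n / nu n) A.
  have h2 : \sum_(n < N) A n ^+ 2 <= a2 / pi ^+ 2.
    rewrite ler_pdivlMr ?exprn_gt0 // mulr_suml; apply: ler_sum => n _.
    by rewrite exprMn mulrC ler_wpM2r ?sqr_ge0 ?nu2_ge.
  have h3 : W ^+ 2 <= 1 / 3 * (a2 / pi ^+ 2).
    apply: le_trans h _; apply: ler_pM => //; last exact: cnu_sum.
    - by apply: sumr_ge0 => i _; exact: sqr_ge0.
    - by apply: sumr_ge0 => i _; exact: sqr_ge0.
  apply: le_trans (ler_wpM2r _ h3) _; first by rewrite mulr_ge0 ?sqr_ge0.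
  rewrite (_ : 1 / 3 * (a2 / pi ^+ 2) * (pi ^+ 2 * 3) = a2) //.
  by move: (pi : R) pi0 => p ?; field; pos.
have X2 : (mu * P + kappa * W) ^+ 2 <= mu ^+ 2 * A0 ^+ 2 * a2.
  rewrite -[X in _ <= _ * X](sqr_sqrtr a20) -!exprMn -[X in X <= _]real_normK ?num_real //.
  have A00 : 0 <= A0 by rewrite addr_ge0 // divr_ge0 // !mulr_ge0 // ltW.
  rewrite ler_sqr ?nnegrE //; last by rewrite !mulr_ge0 // ltW.
  apply: le_trans (ler_normD _ _) _; rewrite !normrM (gtr0_norm mu_gt0) (ger0_norm kappa_ge0).
  apply: le_trans (lerD (ler_wpM2l (ltW mu_gt0) P2) (ler_wpM2l kappa_ge0 W2)) _.
  rewrite /A0; move: (pi : R) pi0 (Num.sqrt 3 : R) s30 => p p0 s3 ?.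
  by rewrite le_eqVlt; apply/orP; left; apply/eqP; field; pos.
have D2 : r * mu * (1 + sigma * pi ^+ 2) * a2 + (kappa + mu * pi ^+ 2) * b2 <= Dsum r N A B.
  rewrite /a2 /b2 !mulr_sumr -big_split /=; apply: ler_sum => n _.
  rewrite /Dmode [X in _ <= X]mulrDr; apply: lerD; last first.
    by rewrite ler_wpM2r ?sqr_ge0 // addrC damp_ge.
  rewrite [X in X <= _](_ : _ = r * (mu * nu n ^+ 2 * (1 + sigma * pi ^+ 2)) * A n ^+ 2);
    last by ring.
  rewrite [X in _ <= X](_ : _ = r * (damp n * (1 + sigma * nu n ^+ 2)) * A n ^+ 2);
    last by ring.
  rewrite ler_wpM2r ?sqr_ge0 // ler_wpM2l ?(ltW r_gt0) //; apply: ler_pM.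
  - by rewrite mulr_ge0 ?sqr_ge0 // ltW.
  - by rewrite addr_ge0 // mulr_ge0 ?sqr_ge0 // ltW.
  - by rewrite lerDl.
  - by rewrite lerD2l ler_wpM2l ?nu2_ge // ltW.
set X := mu * P + kappa * W in qE X2.
have e1 : 0 < 1 + sigma * pi ^+ 2 by rewrite ltr_wpDr // mulr_ge0 ?sqr_ge0 // ltW.
have e2 : 0 < kappa + mu * pi ^+ 2 by rewrite ltr_wpDl // mulr_gt0 // exprn_gt0.
have A01 : 1 <= A0 by rewrite lerDl divr_ge0 // !mulr_ge0 // ltW.
have A0p : 0 < A0 by apply: lt_le_trans A01.
rewrite qE /C0; set al := r * mu * _ / _; set be := (r + 1) ^+ 2 / _.
have al0 : 0 < al by rewrite divr_gt0 // !mulr_gt0 // exprn_gt0.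
have be0 : 0 < be by rewrite divr_gt0 // exprn_gt0 // addr_gt0.
have wcs : ((r + 1) * Y + r * X) ^+ 2 <=
    (al + be) * (((r + 1) * Y) ^+ 2 / be + (r * X) ^+ 2 / al).
  set y := (r + 1) * Y; set x := r * X.
  have -> : (al + be) * (y ^+ 2 / be + x ^+ 2 / al) =
    (y + x) ^+ 2 + (al * y - be * x) ^+ 2 / (al * be).
    by field; pos.
  by rewrite lerDl divr_ge0 ?sqr_ge0 // ltW // mulr_gt0.
apply: le_trans wcs _; rewrite ler_wpM2l ?addr_ge0 ?(ltW al0) ?(ltW be0) //.
apply: le_trans D2; rewrite addrC; apply: lerD.
  rewrite ler_pdivrMr // exprMn.
  rewrite (_ : _ * al = r ^+ 2 * (mu ^+ 2 * A0 ^+ 2 * a2)).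
    by rewrite ler_wpM2l ?sqr_ge0.
  by rewrite /al; field; pos.
rewrite ler_pdivrMr // exprMn.
rewrite (_ : _ * be = (r + 1) ^+ 2 * b2).
  by rewrite ler_wpM2l ?sqr_ge0.
by rewrite /be; move: (kappa + _) e2 => e ?; field; pos.
Qed.

(** The second term is a quadratic Lyapunov function of the double integrator, scaled so that
    the derivative of [V] contains [f] only through [w + k xi + k^2 Q q]. *)
Definition Vtot N (A B : nat -> R) (xi w : R) : R :=
  Lsum r N A B + (k ^+ 2 * xi ^+ 2 + (w + k * xi) ^+ 2) / (2 * k ^+ 2 * Q).
(** The feedback computed from the first [N] modes; [Flaw_cvg_feedback] identifies its limit. *)
Definition Flaw N (A B : nat -> R) (xi w : R) : R :=
  gamma * k * (w + k * xi + k ^+ 2 * Q * qsum N A B).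
(** The value of the derivative of [Vtot] when the input takes the value [f]. *)
Definition Vdot N (A B : nat -> R) (xi w f : R) : R :=
  \sum_(n < N) (- Dmode r n (A n) (B n) -
     c n * f * (r * zcoef n (A n) (B n) + B n)) +
  (k ^+ 2 * xi * w + (w + k * xi) * (- f + k * w)) / (k ^+ 2 * Q).

Lemma Dmode_ge0 s n a b : 0 <= s -> 0 <= Dmode s n a b.
Proof.
move=> s0; have d0 := damp_gt0 n; rewrite /Dmode; pos.
Qed.

(** The only term of [L] that needs care is [(mu nu + kappa / nu)^2 a^2], of order [nu^2 a^2];
    it is absorbed because the factor [damp n] of [D] is itself of order [nu^2]. *)
Lemma Lmode_le_Dmode (s : R) : 0 < s -> exists2 C : R, 0 < C &
  forall n a b, Lmode s n a b <= C * Dmode s n a b.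
Proof.
move=> s0.
pose m1 : R := mu + kappa / pi ^+ 2; pose d0 : R := mu * pi ^+ 2 + kappa.
have pi2 : 0 < pi ^+ 2 :> R by rewrite exprn_gt0 ?pi_gt0.
have m10 : 0 < m1 by rewrite ltr_wpDr // divr_ge0 // ltW.
have d00 : 0 < d0 by rewrite ltr_wpDr // mulr_gt0.
exists (m1 + (s + 1) / d0 + (s + 1) / (2 * s * d0)) => [|n a b].
  pos.
have dn := damp_gt0 n; have dge := damp_ge n; have dle := damp_le n.
have n0 := nu_gt0 n; have n20 : 0 < nu n ^+ 2 by rewrite exprn_gt0.
pose g := mu * nu n + kappa / nu n.
have gE : g = damp n / nu n by rewrite /g /damp; field; exact: nu_neq0.
have g2 : g ^+ 2 <= m1 * damp n.
  rewrite gE expr_div_n ler_pdivrMr // expr2 mulrAC ler_wpM2r ?(ltW dn) //.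
pose S1 := 1 + sigma * nu n ^+ 2.
have S11 : 1 <= S1 by rewrite lerDl mulr_ge0 // ltW.
have S10 : 0 < S1 by apply: lt_le_trans S11.
have D1 : damp n * b ^+ 2 <= Dmode s n a b.
  by rewrite /Dmode -/S1 ler_wpM2l ?(ltW dn) // lerDr; pos.
have D2 : damp n * (s * S1 * a ^+ 2) <= Dmode s n a b.
  by rewrite /Dmode ler_wpM2l ?(ltW dn) // lerDl sqr_ge0.
have Dd : (s + 1) / 2 * S1 * a ^+ 2 <= (s + 1) / (2 * s * d0) * Dmode s n a b.
  apply: le_trans (_ : (s + 1) / (2 * s * d0) * (damp n * (s * S1 * a ^+ 2)) <= _); last first.
    by rewrite ler_wpM2l //; pos.
  rewrite [X in _ <= X](_ : _ = (s + 1) / 2 * S1 * a ^+ 2 * (damp n / d0)); last first.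
    by field; pos.
  by rewrite ler_peMr // ?ler_pdivlMr ?mul1r //; pos.
have Db : (s + 1) * b ^+ 2 <= (s + 1) / d0 * Dmode s n a b.
  apply: le_trans (_ : (s + 1) / d0 * (damp n * b ^+ 2) <= _); last first.
    by rewrite ler_wpM2l //; pos.
  rewrite [X in _ <= X](_ : _ = (s + 1) * b ^+ 2 * (damp n / d0)); last first.
    by field; pos.
  by rewrite ler_peMr // ?ler_pdivlMr ?mul1r //; pos.
have Da : s * g ^+ 2 * a ^+ 2 <= m1 * Dmode s n a b.
  apply: le_trans (_ : m1 * (damp n * (s * S1 * a ^+ 2)) <= _); last first.
    by rewrite ler_wpM2l // ltW.
  rewrite [X in _ <= X](_ : _ = s * (m1 * damp n) * S1 * a ^+ 2); last by ring.
  rewrite ler_wpM2r ?sqr_ge0 // -mulrA ler_wpM2l ?(ltW s0) //.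
  by apply: le_trans g2 _; rewrite ler_peMr //; pos.
rewrite /Lmode [X in _ <= X]mulrDl; apply: lerD => //.
rewrite [X in _ <= X]mulrDl; apply: le_trans (lerD Da Db).
rewrite /zcoef -/g.
have : 0 <= s / 2 * (b - g * a) ^+ 2 by rewrite mulr_ge0 ?sqr_ge0 // divr_ge0 // ltW.
have := sqr_ge0 b; nra.
Qed.

Hypothesis small : k ^+ 3 * Q * C0 < 1.
Hypothesis gain : 1 < gamma * (1 - k ^+ 3 * Q * C0).

Lemma C0_gt0 : 0 < C0.
Proof.
have pi0 : 0 < pi :> R by exact: pi_gt0.
have A01 : 1 <= A0 by rewrite lerDl divr_ge0 // !mulr_ge0 // ltW.
have A0p : 0 < A0 by apply: lt_le_trans A01.
have e1 : 0 < 1 + sigma * pi ^+ 2 by rewrite ltr_wpDr // mulr_ge0 ?sqr_ge0 // ltW.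
have e2 : 0 < kappa + mu * pi ^+ 2 by rewrite ltr_wpDl // mulr_gt0 // exprn_gt0.
by rewrite /C0; pos.
Qed.

(** Put [p = w + k xi + k^2 Q q] and [x = k^2 Q q].  The derivative is
    [- D - (k / Q) xi^2 + ((p - x)^2 - gamma p^2 - h p / k) / (k Q)].  For [g1 > 1],
    [(p - x)^2 <= g1 p^2 + g1 / (g1 - 1) x^2], and [x^2 / (k Q) = k^3 Q q^2 <= th D] with
    [th = k^3 Q C0].  So one needs [g1 < gamma], to dominate [p^2], and [g1 (1 - th) > 1], to keep
    a part of [D]: such a [g1] exists because [gamma (1 - th) > 1].  The slack [gamma - g1]
    absorbs [h p] as well. *)
Lemma Vdot_le : exists om C : R, [/\ 0 < om, 0 < C &
  forall N A B xi w h,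
    Vdot N A B xi w (Flaw N A B xi w + h) <= - om * Vtot N A B xi w + C * h ^+ 2].
Proof.
have [C2 C20 hC2] := Lmode_le_Dmode r_gt0.
pose th := k ^+ 3 * Q * C0.
have th0 : 0 < th by rewrite !mulr_gt0 ?C0_gt0 // exprn_gt0.
have th1 : 0 < 1 - th by rewrite subr_gt0.
(* halfway between the two bounds that [g1] has to satisfy *)
pose g1 := (gamma + (1 - th)^-1) / 2.
have ginv : (1 - th)^-1 < gamma by rewrite -(ltr_pM2r th1) mulVf ?gt_eqF.
have inv1 : 1 < (1 - th)^-1 by rewrite -(ltr_pM2r th1) mulVf ?gt_eqF // mul1r; lra.
have g1a : (1 - th)^-1 < g1 by rewrite /g1; lra.
have g11 : 0 < g1 - 1 by lra.
pose eta := (gamma - g1) / 2.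
have eta0 : 0 < eta by rewrite /eta /g1; lra.
pose d1 := 1 - th * g1 / (g1 - 1).
have d10 : 0 < d1.
  rewrite /d1 subr_gt0 ltr_pdivrMr // mul1r.
  have : 1 < g1 * (1 - th) by rewrite -(ltr_pM2r th1) mulVf ?gt_eqF // in g1a.
  lra.
pose d := Num.min d1 (Num.min (k / Q) (eta / (k * Q))).
have d0 : 0 < d by rewrite /d !lt_min d10 /=; pos.
pose C3 := C2 + k ^+ 2 * Q * C0 + 1 / (2 * Q) + 1 / (k ^+ 2 * Q).
have C30 : 0 < C3.
  by rewrite !addr_gt0 ?divr_gt0 ?mulr_gt0 ?exprn_gt0 ?C0_gt0 //.
exists (d / C3), (1 / (4 * eta * k ^+ 3 * Q)).
split=> [||N A B xi w h]; [by pos | by pos |].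
set f := Flaw _ _ _ _ _ + h.
pose S := Dsum r N A B; pose q := qsum N A B; pose y := w + k * xi.
pose p := y + k ^+ 2 * Q * q; pose x := k ^+ 2 * Q * q.
have S0 : 0 <= S by apply: sumr_ge0 => n _; rewrite Dmode_ge0 // ltW.
have q2 : q ^+ 2 <= C0 * S by exact: qsum_sqr_le.
have VdE : Vdot N A B xi w f = - S - f * q +
    (k ^+ 2 * xi * w + y * (- f + k * w)) / (k ^+ 2 * Q).
  rewrite /Vdot; congr (_ + _); rewrite big_split /= sumrN; congr (_ + _).
  by rewrite sumrN /q /qsum mulr_sumr; congr (- _); apply: eq_bigr => n _; ring.
have fE : f = gamma * k * p + h by [].
have V1 : Vdot N A B xi w f = - S - k / Q * xi ^+ 2 +
    ((p - x) ^+ 2 - gamma * p ^+ 2 - h * p / k) / (k * Q).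
  rewrite VdE fE (_ : y = p - x); last by rewrite /p /x addrK.
  rewrite (_ : w = p - x - k * xi); last by rewrite /p /x addrK /y addrK.
  by rewrite /x; field; pos.
have key : (p - x) ^+ 2 - gamma * p ^+ 2 - h * p / k <=
    x ^+ 2 * g1 / (g1 - 1) - eta * p ^+ 2 + h ^+ 2 / (4 * eta * k ^+ 2).
  have e1 : x ^+ 2 * g1 / (g1 - 1) - (p - x) ^+ 2 + g1 * p ^+ 2 =
      ((g1 - 1) * p + x) ^+ 2 / (g1 - 1) by field; pos.
  have e2 : h ^+ 2 / (4 * eta * k ^+ 2) + eta * p ^+ 2 + h * p / k =
      eta * (p + h / (2 * eta * k)) ^+ 2 by field; pos.
  have p1 : 0 <= ((g1 - 1) * p + x) ^+ 2 / (g1 - 1) by rewrite divr_ge0 ?sqr_ge0 // ltW.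
  have p2 : 0 <= eta * (p + h / (2 * eta * k)) ^+ 2 by rewrite mulr_ge0 ?sqr_ge0 // ltW.
  have e3 : gamma = g1 + 2 * eta by rewrite /eta; field.
  rewrite e3; move: p1 p2; rewrite -e1 -e2; set u := x ^+ 2 * g1 / _; set v := h ^+ 2 / _; set ww := h * p / k.
  by move=> p1 p2; lra.
have x2 : x ^+ 2 / (k * Q) <= th * S.
  rewrite (_ : x ^+ 2 / (k * Q) = k ^+ 3 * Q * q ^+ 2); last first.
    by rewrite /x; field; pos.
  by rewrite /th -[X in _ <= X]mulrA ler_wpM2l //; pos.
have Vd2 : Vdot N A B xi w f <= - d1 * S - k / Q * xi ^+ 2 - eta / (k * Q) * p ^+ 2 +
    1 / (4 * eta * k ^+ 3 * Q) * h ^+ 2.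
  rewrite V1; have kQ : 0 < k * Q by rewrite mulr_gt0.
  have h1 := ler_wpM2r (ltW (_ : 0 < (k * Q)^-1)) key; rewrite invr_gt0 in h1.
  have h2 : x ^+ 2 * g1 / (g1 - 1) / (k * Q) <= th * S * (g1 / (g1 - 1)).
    rewrite [X in X <= _](_ : _ = x ^+ 2 / (k * Q) * (g1 / (g1 - 1))); last first.
      by field; pos.
    by rewrite ler_wpM2r // divr_ge0 // ltW //; lra.
  have h3 := h1 kQ; rewrite /d1.
  have e : (x ^+ 2 * g1 / (g1 - 1) - eta * p ^+ 2 + h ^+ 2 / (4 * eta * k ^+ 2)) / (k * Q) =
     x ^+ 2 * g1 / (g1 - 1) / (k * Q) - eta / (k * Q) * p ^+ 2 + 1 / (4 * eta * k ^+ 3 * Q) * h ^+ 2.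
    by field; pos.
  rewrite e in h3.
  have e' : - (1 - th * g1 / (g1 - 1)) * S = - S + th * S * (g1 / (g1 - 1)) by field; pos.
  rewrite e'; lra.
have V3 : Vtot N A B xi w <= C3 * (S + xi ^+ 2 + p ^+ 2).
  have hL : Lsum r N A B <= C2 * S.
    by rewrite /Lsum /S /Dsum mulr_sumr; apply: ler_sum => n _.
  have hy : y ^+ 2 <= 2 * p ^+ 2 + 2 * (k ^+ 4 * Q ^+ 2 * (C0 * S)).
    have : k ^+ 4 * Q ^+ 2 * q ^+ 2 <= k ^+ 4 * Q ^+ 2 * (C0 * S).
      by rewrite ler_wpM2l // mulr_ge0 ?sqr_ge0 // exprn_ge0 // ltW.
    rewrite (_ : k ^+ 4 * Q ^+ 2 * q ^+ 2 = x ^+ 2); last by rewrite /x; ring.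
    rewrite (_ : y = p - x); last by rewrite /p /x addrK.
    have := sqr_ge0 (p + x); move: (k ^+ 4 * _ * _) => K; nra.
  have kQ2 : 0 < 2 * k ^+ 2 * Q by rewrite !mulr_gt0 // exprn_gt0.
  have hy2 : (k ^+ 2 * xi ^+ 2 + y ^+ 2) / (2 * k ^+ 2 * Q) <=
     1 / (2 * Q) * xi ^+ 2 + 1 / (k ^+ 2 * Q) * p ^+ 2 + k ^+ 2 * Q * C0 * S.
    rewrite ler_pdivrMr //.
    rewrite [X in _ <= X](_ : _ = k ^+ 2 * xi ^+ 2 + (2 * p ^+ 2 + 2 * (k ^+ 4 * Q ^+ 2 * (C0 * S)))); last first.
      by field; pos.
    by rewrite lerD2l.
  have := C0_gt0 => C00.
  have i1 : 0 < 1 / (2 * Q) by rewrite divr_gt0 // mulr_gt0.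
  have i2 : 0 < 1 / (k ^+ 2 * Q) by rewrite divr_gt0 // mulr_gt0 // exprn_gt0.
  have i3 : 0 < k ^+ 2 * Q * C0 by rewrite !mulr_gt0 // exprn_gt0.
  have x20 := sqr_ge0 xi; have p20 := sqr_ge0 p.
  rewrite /Vtot -/y /C3; apply: le_trans (lerD hL hy2) _.
  move: i1 i2 i3; move: (1 / (2 * Q)) (1 / (k ^+ 2 * Q)) (k ^+ 2 * Q * C0) => I1 I2 I3 *.
  nra.
have dS : d * (S + xi ^+ 2 + p ^+ 2) <= d1 * S + k / Q * xi ^+ 2 + eta / (k * Q) * p ^+ 2.
  rewrite !mulrDr; apply: lerD; [apply: lerD|]; rewrite ler_wpM2r ?sqr_ge0 // /d.
  - by rewrite ge_min lexx.
  - by rewrite !ge_min lexx orbT.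
  - by rewrite !ge_min lexx !orbT.
apply: le_trans Vd2 _; rewrite lerD2r.
have hh : d / C3 * Vtot N A B xi w <= d * (S + xi ^+ 2 + p ^+ 2).
  by rewrite -mulrA ler_wpM2l ?(ltW d0) // mulrC ler_pdivrMr // mulrC.
lra.
Qed.

(** The input [f] is left free: it is the feedback of the modes present, up to a
    disturbance. *)
Definition is_sys N T (a b : nat -> R -> R) (xi w f : R -> R) : Prop :=
  forall t : R, 0 < t < T ->
    [/\ forall n, (n < N)%N -> is_mode n (a n) (b n) f t,
        is_derive t 1 xi (w t) & is_derive t 1 w (- f t)].

Lemma is_derive_Vtot N T a b xi w f t : 0 < t < T -> is_sys N T a b xi w f ->
  is_derive t 1 (fun t => Vtot N (a^~ t) (b^~ t) (xi t) (w t))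
    (Vdot N (a^~ t) (b^~ t) (xi t) (w t) (f t)).
Proof.
move=> tT /(_ t tT) [hab hxi hw].
have hL : is_derive t 1 (fun t => Lsum r N (a^~ t) (b^~ t))
   (\sum_(n < N) (- Dmode r n (a n t) (b n t) -
     c n * f t * (r * zcoef n (a n t) (b n t) + b n t))).
  apply: (@is_derive_bigsum R 'I_N (index_enum 'I_N) (fun n t => Lmode r n (a n t) (b n t))
     (fun n t => - Dmode r n (a n t) (b n t) - c n * f t * (r * zcoef n (a n t) (b n t) + b n t))).
  by move=> n; apply: is_derive_Lmode; exact: hab.
have h2 := derX2 (derD hw (derZ k hxi)).
have h3 := derZ (k ^+ 2) (derX2 hxi).
apply: (is_derive_conv (derD hL (derZ ((2 * k ^+ 2 * Q)^-1) (derD h3 h2)))).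
  by move=> x; rewrite /Vtot [_^-1 * _]mulrC.
by rewrite /Vdot; congr (_ + _); field; pos.
Qed.

Lemma continuous_Lmode s n (a b : R -> R) : continuous a -> continuous b ->
  continuous (fun t => Lmode s n (a t) (b t)).
Proof.
move=> ca cb; have cz : continuous (fun t => zcoef n (a t) (b t)).
  by move=> t; apply: cvgD; [exact: cb | apply: cvgM; [exact: cvg_cst | exact: ca]].
have X2 (g : R -> R) : continuous g -> continuous (fun t => g t ^+ 2).
  by move=> cg t; apply: cvgM; exact: cg.
move=> t; apply: cvgD; first apply: cvgD.
- by apply: cvgM; [exact: cvg_cst | exact: (X2 _ cz)].
- by apply: cvgM; [exact: (X2 _ cb) | exact: cvg_cst].
- by apply: cvgM; [exact: cvg_cst | exact: (X2 _ ca)].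
Qed.

Lemma continuous_Vtot N (a b : nat -> R -> R) (xi w : R -> R) :
  (forall n, continuous (a n)) -> (forall n, continuous (b n)) ->
  continuous xi -> continuous w ->
  continuous (fun t => Vtot N (a^~ t) (b^~ t) (xi t) (w t)).
Proof.
move=> ca cb cx cw t; apply: cvgD.
  apply: (@continuous_sum R 'I_N (index_enum 'I_N) (fun n t => Lmode r n (a n t) (b n t))).
  by move=> n; exact: continuous_Lmode.
have X2 (g : R -> R) : continuous g -> continuous (fun t => g t ^+ 2).
  by move=> cg x; apply: cvgM; exact: cg.
apply: cvgM; last exact: cvg_cst.
apply: cvgD; first by apply: cvgM; [exact: cvg_cst | exact: (X2 _ cx)].
apply: (X2 (fun t => w t + k * xi t)) => x.
by apply: cvgD; [exact: cw | apply: cvgM; [exact: cvg_cst | exact: cx]].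
Qed.

(** Input-to-state stability with respect to a disturbance of the feedback.  That [om] and [C]
    do not depend on [N] is what makes the limit [N -> oo] possible. *)
Definition iss_bound (om C : R) : Prop :=
  forall N (T : R) (a b : nat -> R -> R) (xi w f h : R -> R) (H : R), 0 <= T -> 0 <= H ->
    (forall n, continuous (a n)) -> (forall n, continuous (b n)) ->
    continuous xi -> continuous w -> is_sys N T a b xi w f ->
    (forall t : R, 0 < t < T ->
      f t = Flaw N (a^~ t) (b^~ t) (xi t) (w t) + h t /\ h t ^+ 2 <= H) ->
    Vtot N (a^~ T) (b^~ T) (xi T) (w T) <=
      expR (- om * T) * Vtot N (a^~ 0) (b^~ 0) (xi 0) (w 0) + C * H.

Lemma Vtot_iss : exists om C : R, [/\ 0 < om, 0 < C & iss_bound om C].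
Proof.
have [om [C [om0 C0 hV]]] := Vdot_le.
exists om, (C / om); split => //; first by pos.
move=> N T a b xi w f h H T0 H0 ca cb cx cw hs hf.
have := @gronwall R (fun t => Vtot N (a^~ t) (b^~ t) (xi t) (w t))
  (fun t => Vdot N (a^~ t) (b^~ t) (xi t) (w t) (f t)) om (C * H) T om0 _ T0.
rewrite -mulrAC; apply.
- by pos.
- by apply: continuous_subspaceT; exact: continuous_Vtot.
- by move=> t tT; apply: is_derive_Vtot hs.
- move=> t tT; have [-> hH] := hf t tT; apply: le_trans (hV _ _ _ _ _ _) _.
  by rewrite lerD2l ler_wpM2l // ltW.
Qed.

Lemma zfactor_le n : mu * nu n + kappa / nu n <= (mu + kappa / pi ^+ 2) * nu n.
Proof.
have n0 := nu_gt0 n; rewrite -(ler_pM2r n0) -mulrA -expr2.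
apply: le_trans (damp_le n); rewrite /damp mulrDl -mulrA -expr2 mulfVK ?nu_neq0 //.
Qed.

Lemma Lmode_ge s n a b : 0 <= s ->
  Num.min (1 / 2) (sigma / 2) * (nu n ^+ 2 * a ^+ 2 + b ^+ 2) <= Lmode s n a b.
Proof.
move=> s0; rewrite mulrDr addrC; apply: lerD.
  apply: le_trans (_ : 1 / 2 * b ^+ 2 <= _).
    by rewrite ler_wpM2r ?sqr_ge0 // ge_min lexx.
  rewrite mulrC mul1r lerDr; pos.
apply: le_trans (_ : sigma / 2 * (nu n ^+ 2 * a ^+ 2) <= _).
  by rewrite ler_wpM2r ?ge_min ?lexx ?orbT //; pos.
rewrite mulrA ler_wpM2r ?sqr_ge0 //.
have : 0 <= sigma * nu n ^+ 2 * s by pos.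
have : 0 <= s + 1 by pos.
nra.
Qed.

Lemma Lmode_ge0 s n a b : 0 <= s -> 0 <= Lmode s n a b.
Proof.
move=> s0; apply: le_trans (Lmode_ge n a b s0); apply: mulr_ge0; last by pos.
by rewrite le_min; apply/andP; split; pos.
Qed.

Lemma Lmode_le s : 0 <= s -> exists2 M : R, 0 < M &
  forall n a b, Lmode s n a b <= M * (nu n ^+ 2 * a ^+ 2 + b ^+ 2).
Proof.
move=> s0; pose m1 : R := mu + kappa / pi ^+ 2.
have pi2 : 0 < pi ^+ 2 :> R by pos.
have m10 : 0 < m1 by rewrite /m1; pos.
exists (s * m1 ^+ 2 + (s + 1) + (s + 1) / 2 * ((pi ^+ 2)^-1 + sigma)); first by pos.
move=> n a b; have n0 := nu_gt0 n.
set g := (mu * nu n + kappa / nu n).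
have g0 : 0 <= g by rewrite /g; pos.
have g2 : g ^+ 2 <= m1 ^+ 2 * nu n ^+ 2.
  by rewrite -exprMn ler_sqr ?nnegrE ?zfactor_le //; pos.
have hz : s / 2 * zcoef n a b ^+ 2 <= s * b ^+ 2 + s * m1 ^+ 2 * (nu n ^+ 2 * a ^+ 2).
  have h1 : zcoef n a b ^+ 2 <= 2 * b ^+ 2 + 2 * (m1 ^+ 2 * nu n ^+ 2 * a ^+ 2).
    have h2 : (g * a) ^+ 2 <= m1 ^+ 2 * nu n ^+ 2 * a ^+ 2.
      by rewrite exprMn ler_wpM2r ?sqr_ge0.
    by have := sqr_ge0 (b - g * a); rewrite /zcoef -/g; nra.
  have := ler_wpM2l (_ : 0 <= s / 2) h1; rewrite divr_ge0 // => /(_ isT) h3.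
  by apply: le_trans h3 _; rewrite le_eqVlt; apply/orP; left; apply/eqP; field.
have hn : 1 <= nu n ^+ 2 / pi ^+ 2 by rewrite ler_pdivlMr // mul1r nu2_ge.
have h1 : (s + 1) / 2 * (1 + sigma * nu n ^+ 2) * a ^+ 2 <=
   (s + 1) / 2 * ((pi ^+ 2)^-1 + sigma) * (nu n ^+ 2 * a ^+ 2).
  rewrite [X in _ <= X]mulrA ler_wpM2r ?sqr_ge0 // -[X in _ <= X]mulrA ler_wpM2l //; first by pos.
  by rewrite mulrDl lerD2r mulrC.
have sb : 0 <= s * m1 ^+ 2 * b ^+ 2 by pos.
have sb2 : 0 <= (s + 1) * (nu n ^+ 2 * a ^+ 2) by pos.
have sb3 : 0 <= (s + 1) / 2 * ((pi ^+ 2)^-1 + sigma) * b ^+ 2 by pos.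
have sb4 : 0 <= b ^+ 2 by pos.
rewrite /Lmode.
move: hz h1 sb sb2 sb3 sb4; set u := (s + 1) / 2 * _; set v := nu n ^+ 2 * a ^+ 2.
move: (b ^+ 2) (s * m1 ^+ 2) => B S.
move=> hz h1 *; rewrite !mulrDl !mulrDr; lra.
Qed.

(** With the multiplier [nu^2] the dissipation is of order [nu^4 b^2 + nu^6 a^2]; half of it
    absorbs the forcing, by completion of squares in [b] and in [a].  Only [c_n^2 f^2] remains,
    without a power of [nu], so the sum over [n] converges. *)
Lemma mode_level1 : exists d C : R, [/\ 0 < d, 0 < C & forall n a b f,
  nu n ^+ 2 * (- Dmode 1 n a b - c n * f * (1 * zcoef n a b + b)) <=
  - d * (nu n ^+ 4 * b ^+ 2 + nu n ^+ 6 * a ^+ 2) + C * (c n ^+ 2 * f ^+ 2)].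
Proof.
pose m1 : R := mu + kappa / pi ^+ 2.
have pi2 : 0 < pi ^+ 2 :> R by pos.
have m10 : 0 < m1 by rewrite /m1; pos.
pose d := Num.min (mu / 2) (mu * sigma / 2).
have d0 : 0 < d by rewrite /d lt_min; pos.
exists d, (2 / mu + m1 ^+ 2 / (2 * mu * sigma)); split=> // [|n a b f]; first by pos.
set e := c n * f; have -> : c n ^+ 2 * f ^+ 2 = e ^+ 2 by rewrite exprMn.
have n0 := nu_gt0 n; set v := nu n in n0 *.
set g := mu * v + kappa / v.
have g0 : 0 <= g by rewrite /g; pos.
have gle : g <= m1 * v by exact: zfactor_le.
have D1 : mu * v ^+ 2 * (sigma * v ^+ 2 * a ^+ 2 + b ^+ 2) <= Dmode 1 n a b.
  apply: ler_pM; [pos | pos | by rewrite /damp -/v lerDl | ].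
  by rewrite mul1r lerD2r -/v mulrDl mul1r lerDr; pos.
have e1 : - (v ^+ 2 * (e * (2 * b))) <= mu / 2 * (v ^+ 4 * b ^+ 2) + 2 / mu * e ^+ 2.
  have : 0 <= mu / 2 * (v ^+ 2 * b + 2 / mu * e) ^+ 2 by pos.
  rewrite (_ : _ * _ ^+ 2 = mu / 2 * (v ^+ 4 * b ^+ 2) + 2 / mu * e ^+ 2 + v ^+ 2 * (e * (2 * b))).
    by lra.
  by field; pos.
have e2 : - (v ^+ 2 * (e * (g * a))) <= mu * sigma / 2 * (v ^+ 6 * a ^+ 2) +
    m1 ^+ 2 / (2 * mu * sigma) * e ^+ 2.
  apply: le_trans (_ : mu * sigma / 2 * (v ^+ 6 * a ^+ 2) + (g / v) ^+ 2 / (2 * mu * sigma) * e ^+ 2 <= _).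
    have : 0 <= mu * sigma / 2 * (v ^+ 3 * a + g / v * e / (mu * sigma)) ^+ 2 by pos.
    rewrite (_ : _ * _ ^+ 2 = mu * sigma / 2 * (v ^+ 6 * a ^+ 2) + (g / v) ^+ 2 / (2 * mu * sigma) * e ^+ 2 +
       v ^+ 2 * (e * (g * a))); last by field; pos.
    by lra.
  rewrite lerD2l ler_wpM2r ?sqr_ge0 // ler_wpM2r //; first by pos.
  by rewrite ler_sqr ?nnegrE ?ler_pdivrMr //; pos.
have dm1 : d * (v ^+ 4 * b ^+ 2) <= mu / 2 * (v ^+ 4 * b ^+ 2).
  by rewrite ler_wpM2r ?ge_min ?lexx //; pos.
have dm2 : d * (v ^+ 6 * a ^+ 2) <= mu * sigma / 2 * (v ^+ 6 * a ^+ 2).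
  by rewrite ler_wpM2r ?ge_min ?lexx ?orbT //; pos.
have D2 := ler_wpM2l (sqr_ge0 v) D1.
rewrite (_ : v ^+ 2 * (- _ - _) = - (v ^+ 2 * Dmode 1 n a b) - v ^+ 2 * (e * (2 * b)) -
   v ^+ 2 * (e * (g * a))); last by rewrite /zcoef -/v -/g; ring.
have E : v ^+ 2 * (mu * v ^+ 2 * (sigma * v ^+ 2 * a ^+ 2 + b ^+ 2)) =
  mu * sigma * (v ^+ 6 * a ^+ 2) + mu * (v ^+ 4 * b ^+ 2) by ring.
rewrite E in D2; move: D2 e1 e2 dm1 dm2.
move: (v ^+ 2 * Dmode 1 n a b) (v ^+ 2 * (e * (2 * b))) (v ^+ 2 * (e * (g * a))).
move: (v ^+ 6 * a ^+ 2) (v ^+ 4 * b ^+ 2) => A B X1 X2 X3.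
rewrite (_ : mu * sigma * A = 2 * (mu * sigma / 2 * A)); last by field.
rewrite (_ : mu * B = 2 * (mu / 2 * B)); last by field.
rewrite [X in _ -> _ -> _ -> _ -> _ -> _ <= _ + X]mulrDl mulrDr !mulNr.
move: (mu * sigma / 2 * A) (mu / 2 * B) (d * A) (d * B) (2 / mu * e ^+ 2) (m1 ^+ 2 / _ * e ^+ 2).
by move=> *; lra.
Qed.

End Modes.

(** * The closed loop in terms of modes *)
Section Galerkin.
Context {R : realType}.
Variables (sigma mu kappa r k Q gamma : R) (c : nat -> R).
Hypotheses (sigma_gt0 : 0 < sigma) (mu_gt0 : 0 < mu) (kappa_ge0 : 0 <= kappa).
Hypotheses (r_gt0 : 0 < r) (k_gt0 : 0 < k) (Q_gt0 : 0 < Q).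
Local Notation is_mode := (is_mode sigma mu kappa c).
Local Notation is_sys := (is_sys sigma mu kappa c).
Local Notation Flaw := (Flaw mu kappa r k Q gamma c).
Local Notation qsum := (qsum mu kappa r c).
Local Notation Vtot := (Vtot sigma mu kappa r k Q).
Local Notation Lsum := (Lsum sigma mu kappa).
Local Notation Lmode := (Lmode sigma mu kappa).
Local Notation zcoef := (zcoef mu kappa).

Lemma sum_delta N (n : 'I_N) (F : 'I_N -> R) : \sum_(m < N) (m == n)%:R * F m = F n.
Proof.
rewrite (bigD1 n) //= eqxx mul1r big1 ?addr0 // => m /negPf ->.
by rewrite mul0r.
Qed.

(** The feedback is linear in the finitely many unknowns, so this is a linear system; its
    unknowns are indexed by ['I_N + 'I_N + bool], for the [a n], the [b n] and the pair
    [(xi, w)]. *)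
Lemma galerkin N (a0 b0 : nat -> R) (xi0 w0 : R) :
  exists (a b : nat -> R -> R) (xi w : R -> R),
    [/\ forall n, (n < N)%N -> a n 0 = a0 n /\ b n 0 = b0 n,
        xi 0 = xi0 /\ w 0 = w0,
        [/\ forall n, continuous (a n), forall n, continuous (b n),
            continuous xi & continuous w] &
        forall T, is_sys N T a b xi w (fun t => Flaw N (a^~ t) (b^~ t) (xi t) (w t))].
Proof.
pose zc n : R := mu * nu n + kappa / nu n.
pose I : finType := ('I_N + 'I_N + bool)%type.
pose G := gamma * k.
pose rowF (j : I) : R := match j with
  | inl (inl m) => G * (k ^+ 2 * Q * (c m * (r * zc m)))
  | inl (inr m) => G * (k ^+ 2 * Q * (c m * (r + 1)))
  | inr true => G * k | inr false => G end.
pose A (i j : I) : R := match i with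
  | inl (inl n) => if j is inl (inr m) then (m == n)%:R * nu n else 0
  | inl (inr n) => match j with
     | inl (inl m) => (m == n)%:R * (- stiff sigma n)
     | inl (inr m) => (m == n)%:R * (- damp mu kappa n) | _ => 0 end - c n * rowF j
  | inr true => if j is inr false then 1 else 0
  | inr false => - rowF j end.
pose x0 (i : I) : R := match i with inl (inl n) => a0 n | inl (inr n) => b0 n
  | inr true => xi0 | inr false => w0 end.
have [x [x00 dx]] := linear_ode A x0.
have cx i : continuous (x^~ i).
  move=> t; have [h _] := dx t i.
  exact/differentiable_continuous/derivable1_diffP.
pose a n t : R := oapp (fun i : 'I_N => x t (inl (inl i))) 0 (insub n).
pose b n t : R := oapp (fun i : 'I_N => x t (inl (inr i))) 0 (insub n).
exists a, b, (x^~ (inr true)), (x^~ (inr false)).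
have aE t (i : 'I_N) : a i t = x t (inl (inl i)) by rewrite /a valK.
have bE t (i : 'I_N) : b i t = x t (inl (inr i)) by rewrite /b valK.
have rowFE t : \sum_j rowF j * x t j =
    Flaw N (a^~ t) (b^~ t) (x t (inr true)) (x t (inr false)).
  rewrite big_sumType big_sumType big_bool /= /Flaw /qsum.
  rewrite -big_split /=.
  rewrite (eq_bigr (fun i : 'I_N => G * (k ^+ 2 * Q * (c i * (r * zcoef i (a i t) (b i t) + b i t))))).
    by rewrite -!mulr_sumr /G; ring.
  by move=> i _; rewrite aE bE /zcoef -/(zc i); ring.
split.
- move=> n nN; pose i := Ordinal nN.
  by rewrite (aE 0 i) (bE 0 i) x00.
- by rewrite x00.
- split=> [n|n||]; [| |exact: cx|exact: cx].
    by rewrite /a; case: insubP => [i _ _|_]; [exact: cx | exact: cst_continuous].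
  by rewrite /b; case: insubP => [i _ _|_]; [exact: cx | exact: cst_continuous].
- move=> T t _; split.
  + move=> n nN; pose i := Ordinal nN; split.
      have -> : a n = x^~ (inl (inl i)) by apply/funext => s; rewrite -aE.
      apply: (is_derive_conv (dx t _)) => //.
      rewrite big_sumType big_sumType big_bool /= !mul0r !addr0 big1; last first.
        by move=> m _; rewrite mul0r.
      under eq_bigr do rewrite -mulrA.
      by rewrite add0r sum_delta -bE.
    have -> : b n = x^~ (inl (inr i)) by apply/funext => s; rewrite -bE.
    apply: (is_derive_conv (dx t _)) => //.
    rewrite -rowFE !big_sumType !big_bool /= -(bE t i).
    rewrite (eq_bigr (fun m : 'I_N => (m == i)%:R * (- stiff sigma n * a m t) +
       (- c n) * (rowF (inl (inl m)) * x t (inl (inl m))))); last first.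
      by move=> m _; rewrite aE /rowF /=; ring.
    rewrite [X in _ + X + _ = _](eq_bigr (fun m : 'I_N => (m == i)%:R * (- damp mu kappa n * b m t) +
       (- c n) * (rowF (inl (inr m)) * x t (inl (inr m))))); last first.
      by move=> m _; rewrite bE /rowF /=; ring.
    by rewrite !big_split /= -!mulr_sumr !sum_delta /=; ring.
  + apply: (is_derive_conv (dx t _)) => //.
    rewrite big_sumType big_sumType big_bool /= mul0r mul1r add0r !big1 ?addr0 ?add0r //.
      by move=> m _; rewrite mul0r.
    by move=> m _; rewrite mul0r.
  + apply: (is_derive_conv (dx t _)) => //.
    rewrite -rowFE -sumrN; apply: eq_bigr => j _; by rewrite mulNr.
Qed.

Lemma is_sys_le N M T a b xi w f : (N <= M)%N -> is_sys M T a b xi w f ->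
  is_sys N T a b xi w f.
Proof.
move=> NM h t tT; have [h1 h2 h3] := h t tT; split=> // n nN.
by apply: h1; exact: leq_trans NM.
Qed.

Lemma is_sysB N T a b xi w f a' b' xi' w' f' :
  is_sys N T a b xi w f -> is_sys N T a' b' xi' w' f' ->
  is_sys N T (fun n t => a n t - a' n t) (fun n t => b n t - b' n t)
    (fun t => xi t - xi' t) (fun t => w t - w' t) (fun t => f t - f' t).
Proof.
move=> h h' t tT; have [h1 h2 h3] := h t tT; have [h1' h2' h3'] := h' t tT; split.
- move=> n nN; have [d1 d2] := h1 n nN; have [d1' d2'] := h1' n nN; split.
    by apply: (is_derive_conv (derB d1 d1')) => //; ring.
  by apply: (is_derive_conv (derB d2 d2')) => //; ring.
- exact: derB.
- by apply: (is_derive_conv (derB h3 h3')) => //; ring.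
Qed.

Lemma qsumB N A B A' B' : qsum N (fun n => A n - A' n) (fun n => B n - B' n) =
  qsum N A B - qsum N A' B'.
Proof.
rewrite /qsum -sumrB; apply: eq_bigr => n _; rewrite /zcoef; ring.
Qed.

Lemma FlawB N A B xi w A' B' xi' w' :
  Flaw N (fun n => A n - A' n) (fun n => B n - B' n) (xi - xi') (w - w') =
  Flaw N A B xi w - Flaw N A' B' xi' w'.
Proof. by rewrite /Flaw qsumB; ring. Qed.

Hypothesis c_sum : forall N, \sum_(n < N) c n ^+ 2 <= 1.
Hypothesis cnu_sum : forall N, \sum_(n < N) (c n / nu n) ^+ 2 <= 1 / 3.
Hypothesis small : k ^+ 3 * Q * C0 sigma mu kappa r < 1.
Hypothesis gain : 1 < gamma * (1 - k ^+ 3 * Q * C0 sigma mu kappa r).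

(** The system and the feedback are linear, hence the difference of two trajectories is a
    trajectory whose disturbance is the difference of the disturbances. *)
Lemma Vtot_compare om C : iss_bound sigma mu kappa r k Q gamma c om C ->
  forall N (T : R) (a b a' b' : nat -> R -> R) (xi w f h xi' w' f' h' : R -> R) (H : R),
    0 <= T -> 0 <= H ->
    (forall n, continuous (a n)) -> (forall n, continuous (b n)) ->
    continuous xi -> continuous w ->
    (forall n, continuous (a' n)) -> (forall n, continuous (b' n)) ->
    continuous xi' -> continuous w' ->
    is_sys N T a b xi w f -> is_sys N T a' b' xi' w' f' ->
    (forall t : R, 0 < t < T -> f t = Flaw N (a^~ t) (b^~ t) (xi t) (w t) + h t) ->
    (forall t : R, 0 < t < T -> f' t = Flaw N (a'^~ t) (b'^~ t) (xi' t) (w' t) + h' t) ->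
    (forall t : R, 0 < t < T -> (h t - h' t) ^+ 2 <= H) ->
    Vtot N (fun n => a n T - a' n T) (fun n => b n T - b' n T) (xi T - xi' T) (w T - w' T) <=
      expR (- om * T) * Vtot N (fun n => a n 0 - a' n 0) (fun n => b n 0 - b' n 0)
        (xi 0 - xi' 0) (w 0 - w' 0) + C * H.
Proof.
move=> h N T a b a' b' xi w f h1 xi' w' f' h1' H T0 H0 ca cb cx cw ca' cb' cx' cw' s s' fE fE' hH.
apply: (h N T (fun n t => a n t - a' n t) (fun n t => b n t - b' n t)
    (fun t => xi t - xi' t) (fun t => w t - w' t) (fun t => f t - f' t) (fun t => h1 t - h1' t) H T0 H0).
- by move=> n t; apply: cvgB; [exact: ca | exact: ca'].
- by move=> n t; apply: cvgB; [exact: cb | exact: cb'].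
- by move=> t; apply: cvgB; [exact: cx | exact: cx'].
- by move=> t; apply: cvgB; [exact: cw | exact: cw'].
- exact: is_sysB.
- move=> t tT; split; last exact: hH.
  by rewrite FlawB (fE t tT) (fE' t tT); ring.
Qed.

Lemma forcing_sqr_le n a b :
  (r * zcoef n a b + b) ^+ 2 <= 4 * (r + 1) * Lmode r n a b.
Proof.
have h : 4 * (r + 1) * (r / 2 * zcoef n a b ^+ 2 + b ^+ 2 / 2) <= 4 * (r + 1) * Lmode r n a b.
  rewrite ler_wpM2l //; first by pos.
  by rewrite /Lmode lerDl; pos.
apply: le_trans h; set z := zcoef n a b.
have : 0 <= (r * z - b) ^+ 2 by pos.
have : 0 <= r * z ^+ 2 by pos.
have : 0 <= r * b ^+ 2 by pos.
nra.
Qed.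

Lemma Lmode_r_ge0 n a b : 0 <= Lmode r n a b.
Proof. by apply: Lmode_ge0 => //; exact: ltW. Qed.

Lemma Lsum_ge0 N A B : 0 <= Lsum r N A B.
Proof. by apply: sumr_ge0 => n _; exact: Lmode_r_ge0. Qed.

Lemma Lsum_Vtot N A B xi w : Lsum r N A B <= Vtot N A B xi w.
Proof. by rewrite lerDl; pos. Qed.

Lemma xi_Vtot N A B xi w :
  (k ^+ 2 * xi ^+ 2 + (w + k * xi) ^+ 2) <= 2 * k ^+ 2 * Q * Vtot N A B xi w.
Proof.
rewrite [X in _ <= X]mulrC -ler_pdivrMr; last by pos.
by rewrite lerDr Lsum_ge0.
Qed.

Lemma Vtot_ge0 N A B xi w : 0 <= Vtot N A B xi w.
Proof. exact: le_trans (Lsum_ge0 _ _ _) (Lsum_Vtot _ _ _ _ _). Qed.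

(** Modes of high rank enter the feedback with small weight: this is where the square
    summability of [c] controls the truncation. *)
Lemma qtail_sqr_le N M A B : (N <= M)%N ->
  (qsum M A B - qsum N A B) ^+ 2 <=
  4 * (r + 1) * (\sum_(N <= n < M) c n ^+ 2) * Lsum r M A B.
Proof.
move=> NM; rewrite /qsum /Lsum -!(big_mkord xpredT (fun n => c n * (r * zcoef n (A n) (B n) + B n))).
rewrite -(big_mkord xpredT (fun n => Lmode r n (A n) (B n))).
rewrite (@big_cat_nat _ _ _ N 0 M) //= addrAC subrr add0r.
rewrite [X in _ <= _ * X](@big_cat_nat _ _ _ N 0 M) //=.
apply: le_trans (sum_cauchy_schwarz _ _ _) _.
rewrite mulrAC mulrC ler_wpM2r ?sumr_ge0 // => [n _|]; first exact: sqr_ge0.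
apply: le_trans (_ : 4 * (r + 1) * \sum_(N <= n < M) Lmode r n (A n) (B n) <= _).
  by rewrite mulr_sumr; apply: ler_sum => n _; exact: forcing_sqr_le.
rewrite ler_wpM2l //; first by pos.
by rewrite lerDr sumr_ge0 // => n _; exact: Lmode_r_ge0.
Qed.

Lemma Flaw_sqr_le : exists2 C : R, 0 < C & forall N A B xi w,
  Flaw N A B xi w ^+ 2 <= C * Vtot N A B xi w.
Proof.
exists ((gamma * k) ^+ 2 * (2 * (2 * k ^+ 2 * Q) + 2 * (k ^+ 2 * Q) ^+ 2 * (4 * (r + 1))) + 1).
  by pos.
move=> N A B xi w; rewrite mulrDl mul1r.
have V0 := Vtot_ge0 N A B xi w.
apply: le_trans (_ : _ <= (gamma * k) ^+ 2 * (2 * (2 * k ^+ 2 * Q) + 2 * (k ^+ 2 * Q) ^+ 2 * (4 * (r + 1))) * Vtot N A B xi w) _; last by rewrite lerDl.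
rewrite /Flaw exprMn -[X in _ <= X]mulrA ler_wpM2l ?sqr_ge0 //.
set q := qsum N A B; set y := w + k * xi.
have hq : q ^+ 2 <= 4 * (r + 1) * Vtot N A B xi w.
  have := qtail_sqr_le A B (leq0n N); rewrite /qsum big_ord0 subr0 -/(qsum N A B) -/q.
  move=> h; apply: le_trans h _; rewrite -mulrA ler_wpM2l //; first by pos.
  apply: le_trans (_ : 1 * Lsum r N A B <= _); last by rewrite mul1r Lsum_Vtot.
  by rewrite ler_wpM2r ?Lsum_ge0 // big_mkord.
have hy : y ^+ 2 <= 2 * k ^+ 2 * Q * Vtot N A B xi w.
  apply: le_trans (xi_Vtot N A B xi w); rewrite lerDr; pos.
apply: le_trans (_ : 2 * y ^+ 2 + 2 * (k ^+ 2 * Q) ^+ 2 * q ^+ 2 <= _).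
  have : 0 <= (y - k ^+ 2 * Q * q) ^+ 2 by pos.
  move: (k ^+ 2 * Q) => K; nra.
rewrite [X in _ <= X]mulrDl; apply: lerD.
  by rewrite -[X in _ <= X]mulrA ler_wpM2l.
by rewrite -[X in _ <= X]mulrA ler_wpM2l //; pos.
Qed.

(** The hypothesis concerns nonnegative times only; the limit is taken at [max t 0], which
    makes it continuous on the whole line. *)
Lemma uniform_limit (x : nat -> R -> R) (K : R) (rho : nat -> R) (N0 : nat) :
  rho @ \oo --> (0 : R) -> (forall N, continuous (x N)) ->
  (forall N M (t : R), (N0 <= N)%N -> (N <= M)%N -> 0 <= t ->
     (x M t - x N t) ^+ 2 <= K * rho N) ->
  exists y : R -> R, [/\ continuous y,
    forall N (t : R), (N0 <= N)%N -> 0 <= t -> (y t - x N t) ^+ 2 <= K * rho N &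
    forall t : R, 0 <= t -> x N t @[N --> \oo] --> y t].
Proof.
move=> rho0 cx xB.
have Krho0 : (fun N => K * rho N) @ \oo --> (0 : R).
  by rewrite -(mulr0 K); apply: cvgM; [exact: cvg_cst | exact: rho0].
have unif (e : R) : 0 < e -> exists N1, (N0 <= N1)%N /\
    forall N M (t : R), (N1 <= N)%N -> (N1 <= M)%N -> 0 <= t -> `|x M t - x N t| <= e.
  move=> e0; have e20 : 0 < e ^+ 2 by pos.
  have /cvgrPdist_le /(_ _ e20) [N1 _ hN1] := Krho0.
  exists (maxn N0 N1); split; first exact: leq_maxl.
  have main N M t : (maxn N0 N1 <= N)%N -> (N <= M)%N -> 0 <= t -> `|x M t - x N t| <= e.
    rewrite geq_max => /andP[h0 h1] NM t0.
    rewrite -(ler_sqr (normr_ge0 _)) ?nnegrE ?(ltW e0) // real_normK ?num_real //.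
    apply: le_trans (xB _ _ _ h0 NM t0) _; apply: le_trans (ler_norm _) _.
    by have := hN1 N h1; rewrite /= sub0r normrN.
  move=> N M t hN hM t0; have [NM|/ltnW MN] := leqP N M; first exact: main.
  by rewrite distrC; exact: main.
have cv t : 0 <= t -> cvgn (x^~ t).
  move=> t0; apply/cauchy_cvgP; apply: cauchy_exP => e e0.
  have [|N1 [_ hN1]] := unif (e / 2); first by pos.
  exists (x N1 t); exists N1 => // N /= hN.
  by rewrite /ball /= (le_lt_trans (hN1 N N1 t hN (leqnn _) t0)) //; lra.
pose y (t : R) := limn (x^~ (Num.max t 0)).
have m0 (t : R) : 0 <= Num.max t 0 by rewrite le_max lexx orbT.
have yE t : 0 <= t -> y t = limn (x^~ t) by move=> t0; rewrite /y (max_idPl t0).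
have xy t : 0 <= t -> x N t @[N --> \oo] --> y t.
  by move=> t0; rewrite yE //; exact: cv.
have uy (e : R) : 0 < e -> exists N1, forall N (t : R), (N1 <= N)%N -> 0 <= t -> `|y t - x N t| <= e.
  move=> /unif [N1 [_ hN1]]; exists N1 => N t hN t0.
  have h : `|x M t - x N t| @[M --> \oo] --> `|y t - x N t|.
    by apply: cvg_norm; apply: cvgB; [exact: xy | exact: cvg_cst].
  rewrite -(cvg_lim _ h) //; apply: limr_le; first by apply/cvg_ex; eexists; exact: h.
  near=> M; apply: hN1 => //; near: M; exact: nbhs_infty_ge.
exists y; split=> //.
- move=> t; apply/cvgrPdist_le => e e0.
  have [|N1 hN1] := uy (e / 3); first by pos.
  have cm : {for t, continuous (fun s : R => x N1 (Num.max s 0))}.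
    apply: (@continuous_comp _ _ _ (fun s : R => Num.max s 0) (x N1)); last exact: cx.
    by apply: continuous_max; [exact: cvg_id | exact: cvg_cst].
  have e30 : 0 < e / 3 by pos.
  have /cvgrPdist_le /(_ _ e30) := cm; apply: filterS => s hs.
  have yM s' : y s' = y (Num.max s' 0) by rewrite /y (max_idPl (m0 s')).
  have h1 := hN1 _ _ (leqnn _) (m0 t); have h2 := hN1 _ _ (leqnn _) (m0 s).
  rewrite (yM t) (yM s).
  rewrite (_ : _ - _ = (y (Num.max t 0) - x N1 (Num.max t 0)) +
    (x N1 (Num.max t 0) - x N1 (Num.max s 0)) - (y (Num.max s 0) - x N1 (Num.max s 0))); last by ring.
  apply: le_trans (ler_normB _ _) _; apply: le_trans (lerD (ler_normD _ _) (lexx _)) _.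
  rewrite (_ : e = e / 3 + e / 3 + e / 3); last by field.
  by apply: lerD => //; apply: lerD.
- move=> N t hN t0.
  have h : (x M t - x N t) ^+ 2 @[M --> \oo] --> (y t - x N t) ^+ 2.
    rewrite expr2; under eq_fun do rewrite expr2.
    by apply: cvgM; apply: cvgB; try exact: cvg_cst; exact: xy.
  rewrite -(cvg_lim _ h) //; apply: limr_le; first by apply/cvg_ex; eexists; exact: h.
  near=> M; apply: xB => //; near: M; exact: nbhs_infty_ge.
Unshelve. all: by end_near. Qed.

Definition ucvg (y : nat -> R -> R) (l : R -> R) : Prop :=
  forall e : R, 0 < e -> exists N1, forall N, (N1 <= N)%N ->
    forall t : R, 0 <= t -> `|y N t - l t| <= e.

Lemma ucvg_of_sqr (y : nat -> R -> R) (l : R -> R) (K : R) (tau : nat -> R) n :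
  tau @ \oo --> (0 : R) ->
  (forall N (t : R), (n <= N)%N -> 0 <= t -> (l t - y N t) ^+ 2 <= K * tau N) ->
  ucvg y l.
Proof.
move=> tau0 hy e e0; have e20 : 0 < e ^+ 2 by pos.
have Kt : (fun N => K * tau N) @ \oo --> (0 : R).
  by rewrite -(mulr0 K); apply: cvgM; [exact: cvg_cst | exact: tau0].
have /cvgrPdist_le /(_ _ e20) [N1 _ hN1] := Kt.
exists (maxn n N1) => N; rewrite geq_max => /andP[nN N1N] t t0.
rewrite -(ler_sqr (normr_ge0 _)) ?nnegrE ?(ltW e0) // real_normK ?num_real //.
rewrite -sqrrN opprB; apply: le_trans (hy _ _ nN t0) _; apply: le_trans (ler_norm _) _.
by have := hN1 N N1N; rewrite /= sub0r normrN.
Qed.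

Lemma ucvg_lin (y1 y2 y3 : nat -> R -> R) (l1 l2 l3 : R -> R) (c1 c2 c3 : R) :
  ucvg y1 l1 -> ucvg y2 l2 -> ucvg y3 l3 ->
  ucvg (fun N t => c1 * y1 N t + c2 * y2 N t + c3 * y3 N t)
       (fun t => c1 * l1 t + c2 * l2 t + c3 * l3 t).
Proof.
move=> h1 h2 h3 e e0; pose S : R := `|c1| + `|c2| + `|c3| + 1.
have S0 : 0 < S by rewrite /S; pos.
have eS : 0 < e / S by pos.
have [M1 H1] := h1 _ eS; have [M2 H2] := h2 _ eS; have [M3 H3] := h3 _ eS.
exists (maxn M1 (maxn M2 M3)) => N; rewrite !geq_max => /and3P[n1 n2 n3] t t0.
rewrite (_ : _ - _ = c1 * (y1 N t - l1 t) + c2 * (y2 N t - l2 t) + c3 * (y3 N t - l3 t)); last by ring.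
apply: le_trans (ler_normD _ _) _; apply: le_trans (lerD (ler_normD _ _) (lexx _)) _.
rewrite !normrM; apply: le_trans (_ : (`|c1| + `|c2| + `|c3|) * (e / S) <= _).
  rewrite !mulrDl; apply: lerD; [apply: lerD|]; apply: ler_wpM2l => //.
  - exact: H1.
  - exact: H2.
  - exact: H3.
by rewrite mulrC -mulrA ler_piMr ?(ltW e0) // mulrC ler_pdivrMr // mul1r lerDl.
Qed.

Lemma is_derive_ucvg (n0 : nat) (y dy : nat -> R -> R) (l g : R -> R) :
  (forall N (t : R), (n0 <= N)%N -> 0 < t -> is_derive t 1 (y N) (dy N t)) ->
  ucvg dy g -> (forall t : R, 0 <= t -> y N t @[N --> \oo] --> l t) ->
  forall t : R, 0 < t -> is_derive t 1 l (g t).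
Proof.
move=> h1 h2 h3; apply: (@is_derive_unif R (fun N => y (N + n0)%N) (fun N => dy (N + n0)%N)).
- by move=> N t; apply: h1; rewrite leq_addl.
- move=> e /h2 [N1 hN1]; exists N1 => N hN t /ltW; apply: hN1.
  exact: leq_trans hN (leq_addr _ _).
- by move=> t /ltW t0; rewrite (cvg_shiftn n0 (fun N => y N t)); exact: h3.
Qed.

Lemma csum_tail : exists tau : nat -> R, [/\ tau @ \oo --> (0 : R),
  forall N, 0 <= tau N &
  forall N M, (N <= M)%N -> \sum_(N <= n < M) c n ^+ 2 <= tau N].
Proof.
pose s N : R := \sum_(0 <= n < N) c n ^+ 2.
have sE N M : (N <= M)%N -> s M = s N + \sum_(N <= n < M) c n ^+ 2.
  by move=> NM; rewrite /s (@big_cat_nat _ _ _ N 0 M).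
have s_nd : nondecreasing_seq s.
  move=> N M NM; rewrite (sE _ _ NM) lerDl sumr_ge0 // => n _; exact: sqr_ge0.
have s_b : has_ubound (range s) by exists 1 => _ [N _ <-]; rewrite /s big_mkord.
have s_cv : cvgn s by exact: nondecreasing_is_cvgn.
exists (fun N => limn s - s N); split.
- rewrite -(subrr (limn s)); apply: cvgB; [exact: cvg_cst | exact: s_cv].
- by move=> N; rewrite subr_ge0; exact: nondecreasing_cvgn_le.
- move=> N M NM; rewrite lerBrDl -sE //; exact: nondecreasing_cvgn_le.
Qed.

Lemma ab_Vtot : exists2 K : R, 0 < K & forall N A B xi w,
  (forall n, (n < N)%N -> A n ^+ 2 <= K * Vtot N A B xi w /\ B n ^+ 2 <= K * Vtot N A B xi w) /\
  xi ^+ 2 <= K * Vtot N A B xi w /\ w ^+ 2 <= K * Vtot N A B xi w.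
Proof.
pose m := Num.min (1 / 2) (sigma / 2).
have m0 : 0 < m by rewrite /m lt_min; apply/andP; split; pos.
have pi2 : 0 < pi ^+ 2 :> R by pos.
exists (m^-1 + (m * pi ^+ 2)^-1 + 2 * Q + 8 * k ^+ 2 * Q); first by pos.
move=> N A B xi w; set V := Vtot N A B xi w.
have V0 : 0 <= V by exact: Vtot_ge0.
have i1 : 0 < m^-1 by pos.
have i2 : 0 < (m * pi ^+ 2)^-1 by pos.
have i3 : 0 <= 2 * Q by pos.
have i4 : 0 <= 8 * k ^+ 2 * Q by pos.
split.
  move=> n nN.
  have hL : m * (nu n ^+ 2 * A n ^+ 2 + B n ^+ 2) <= V.
    apply: le_trans (Lmode_ge mu kappa sigma_gt0 n (A n) (B n) (ltW r_gt0)) _.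
    apply: le_trans (Lsum_Vtot _ _ _ _ _).
    rewrite /Lsum (bigD1 (Ordinal nN)) //= lerDl sumr_ge0 // => i _; exact: Lmode_r_ge0.
  have hb : B n ^+ 2 <= m^-1 * V.
    rewrite [X in _ <= X]mulrC ler_pdivlMr // mulrC.
    by apply: le_trans hL; rewrite ler_wpM2l ?(ltW m0) // lerDr; pos.
  have ha : A n ^+ 2 <= (m * pi ^+ 2)^-1 * V.
    have mp : 0 < m * pi ^+ 2 by pos.
    rewrite [X in _ <= X]mulrC ler_pdivlMr // mulrC.
    apply: le_trans hL; rewrite -mulrA ler_wpM2l ?(ltW m0) //.
    by apply: le_trans (_ : nu n ^+ 2 * A n ^+ 2 <= _);
      rewrite ?ler_wpM2r ?sqr_ge0 ?nu2_ge // lerDl sqr_ge0.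
  split.
    by apply: le_trans ha _; rewrite ler_wpM2r //; lra.
  by apply: le_trans hb _; rewrite ler_wpM2r //; lra.
have h := xi_Vtot N A B xi w; rewrite -/V in h.
have hx : xi ^+ 2 <= 2 * Q * V.
  have k2 : 0 < k ^+ 2 by pos.
  rewrite -(ler_pM2l k2); apply: le_trans (_ : k ^+ 2 * xi ^+ 2 + (w + k * xi) ^+ 2 <= _).
    by rewrite lerDl; pos.
  by apply: le_trans h _; rewrite le_eqVlt; apply/orP; left; apply/eqP; ring.
have hw : w ^+ 2 <= 8 * k ^+ 2 * Q * V.
  have : 0 <= (w + k * xi + k * xi) ^+ 2 by pos.
  have : 0 <= k ^+ 2 * xi ^+ 2 by pos.
  have : 0 <= (w + k * xi) ^+ 2 by pos.
  move: h; rewrite (_ : 8 * k ^+ 2 * Q * V = 4 * (2 * k ^+ 2 * Q * V)); last by ring.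
  move: (2 * k ^+ 2 * Q * V) => W; nra.
split.
  by apply: le_trans hx _; rewrite ler_wpM2r //; lra.
by apply: le_trans hw _; rewrite ler_wpM2r //; lra.
Qed.

Lemma cvg_Vtot N (F : set_system nat) {FF : Filter F} (x y : nat -> nat -> R) (u v : nat -> R) A B xi w :
  (forall n, (n < N)%N -> x M n @[M --> F] --> A n) ->
  (forall n, (n < N)%N -> y M n @[M --> F] --> B n) ->
  u @ F --> xi -> v @ F --> w ->
  Vtot N (x M) (y M) (u M) (v M) @[M --> F] --> Vtot N A B xi w.
Proof.
move=> hx hy hu hv.
have X2 (f : nat -> R) (l : R) : f @ F --> l -> f M ^+ 2 @[M --> F] --> l ^+ 2.
  by move=> fl; rewrite expr2; under eq_fun do rewrite expr2; exact: cvgM.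
apply: cvgD.
  apply: cvg_bigsum => n _; apply: cvgD; first apply: cvgD.
  - apply: cvgM; first exact: cvg_cst.
    apply: (X2 (fun M => zcoef n (x M n) (y M n))).
    by apply: cvgD; [exact: hy | apply: cvgM; [exact: cvg_cst | exact: hx]].
  - by apply: cvgM; [apply: (X2 (fun M => y M n)); exact: hy | exact: cvg_cst].
  - by apply: cvgM; [exact: cvg_cst | apply: (X2 (fun M => x M n)); exact: hx].
apply: cvgM; last exact: cvg_cst.
apply: cvgD; first by apply: cvgM; [exact: cvg_cst | exact: X2].
apply: (X2 (fun M => v M + k * u M)).
by apply: cvgD => //; apply: cvgM; [exact: cvg_cst | exact: hu].
Qed.

(** The [M]-th truncation, restricted to its first [N] modes, is the [N]-th one with the
    disturbance [h N M], whose square is at most a multiple of [tau N].  By [Vtot_compare] the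
    truncations are uniformly Cauchy, so the limit satisfies the modes, and the bounds on [V],
    uniform in the truncation, pass to the limit. *)
Lemma modal_exists : exists om C : R, [/\ 0 < om, 0 < C &
  forall (a0 b0 : nat -> R) (xi0 w0 E : R), (forall N, Vtot N a0 b0 xi0 w0 <= E) ->
  exists (a b : nat -> R -> R) (xi w f : R -> R),
    [/\ [/\ forall n, continuous (a n), forall n, continuous (b n),
            continuous xi, continuous w & continuous f],
        [/\ forall n, a n 0 = a0 n, forall n, b n 0 = b0 n, xi 0 = xi0 & w 0 = w0],
        forall N T, is_sys N T a b xi w f,
        forall t : R, 0 <= t -> Flaw N (a^~ t) (b^~ t) (xi t) (w t) @[N --> \oo] --> f t &
        forall t : R, 0 <= t -> (forall N, Vtot N (a^~ t) (b^~ t) (xi t) (w t) <= expR (- om * t) * E) /\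
          f t ^+ 2 <= C * (expR (- om * t) * E)]].
Proof.
have [om [C1 [om0 C10 hiss]]] :=
  Vtot_iss sigma_gt0 mu_gt0 kappa_ge0 r_gt0 k_gt0 Q_gt0 c_sum cnu_sum small gain.
have hcmp := Vtot_compare hiss.
have [C2 C20 hF] := Flaw_sqr_le.
have [K K0 hK] := ab_Vtot.
have [tau [tau0 tau_ge0 htau]] := csum_tail.
exists om, C2; split=> // a0 b0 xi0 w0 E hE.
have E0 : 0 <= E by apply: le_trans (hE 0%N); exact: Vtot_ge0.
pose G (N : nat) (p : (nat -> R -> R) * (nat -> R -> R) * (R -> R) * (R -> R)) :=
  let: (a, b, xi, w) := p in
  [/\ forall n, (n < N)%N -> a n 0 = a0 n /\ b n 0 = b0 n,
      xi 0 = xi0 /\ w 0 = w0,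
      [/\ forall n, continuous (a n), forall n, continuous (b n),
            continuous xi & continuous w] &
      forall T, is_sys N T a b xi w (fun t => Flaw N (a^~ t) (b^~ t) (xi t) (w t))].
have /choice [X hX] : forall N, exists p, G N p.
  move=> N; have [a [b [xi [w h]]]] := galerkin N a0 b0 xi0 w0.
  by exists (a, b, xi, w).
pose a N := (X N).1.1.1; pose b N := (X N).1.1.2; pose xi N := (X N).1.2; pose w N := (X N).2.
have hG N : G N (a N, b N, xi N, w N).
  by have := hX N; rewrite /a /b /xi /w; case: (X N) => [[[]]].
move: a b xi w hG => {X hX} a b xi w hG.
pose f N t := Flaw N ((a N)^~ t) ((b N)^~ t) (xi N t) (w N t).
have VN N t : 0 <= t -> Vtot N ((a N)^~ t) ((b N)^~ t) (xi N t) (w N t) <= expR (- om * t) * E.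
  move=> t0; have [h1 [h2 h3] [ca cb cx cw] hs] := hG N.
  apply: le_trans (hiss N t (a N) (b N) (xi N) (w N) (f N) (cst 0) 0 t0 (lexx _) ca cb cx cw (hs t) _) _.
    by move=> s _; rewrite addr0 expr0n.
  rewrite mulr0 addr0 ler_wpM2l ?expR_ge0 // h2 h3; apply: le_trans (hE N).
  rewrite le_eqVlt; apply/orP; left; apply/eqP; rewrite /Vtot; congr (_ + _).
  by apply: eq_bigr => n _; have [-> ->] := h1 n (ltn_ord n).
have VN1 N t : 0 <= t -> Vtot N ((a N)^~ t) ((b N)^~ t) (xi N t) (w N t) <= E.
  move=> t0; apply: le_trans (VN N t t0) _; rewrite ler_piMl //.
  by rewrite -expR0 ler_expR mulNr oppr_le0; pos.
pose C3 := (gamma * k * (k ^+ 2 * Q)) ^+ 2 * (4 * (r + 1)).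
have C30 : 0 <= C3 by rewrite /C3; pos.
(* the modes above N of the M-th approximation, seen by the first N modes *)
pose h N M t : R := gamma * k * (k ^+ 2 * Q) *
  (qsum M ((a M)^~ t) ((b M)^~ t) - qsum N ((a M)^~ t) ((b M)^~ t)).
have hB N M t : (N <= M)%N -> 0 <= t -> h N M t ^+ 2 <= C3 * E * tau N.
  move=> NM t0; rewrite exprMn /C3.
  rewrite [X in _ <= X](_ : _ = (gamma * k * (k ^+ 2 * Q)) ^+ 2 * (4 * (r + 1) * (E * tau N))); last by ring.
  rewrite ler_wpM2l ?sqr_ge0 //.
  apply: le_trans (qtail_sqr_le _ _ NM) _.
  rewrite -[X in X <= _]mulrA ler_wpM2l //; first by pos.
  rewrite mulrC; apply: ler_pM.
  - exact: Lsum_ge0.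
  - by apply: sumr_ge0 => n _; exact: sqr_ge0.
  - by apply: le_trans (VN1 M t t0); exact: Lsum_Vtot.
  - exact: htau.
have fE N M t : f M t = Flaw N ((a M)^~ t) ((b M)^~ t) (xi M t) (w M t) + h N M t.
  by rewrite /f /h /Flaw; ring.
pose D N M t := Vtot N (fun n => a M n t - a N n t) (fun n => b M n t - b N n t)
  (xi M t - xi N t) (w M t - w N t).
have DB N M t : (N <= M)%N -> 0 <= t -> D N M t <= C1 * C3 * E * tau N.
  move=> NM t0; have [i1 [i2 i3] [ca cb cx cw] hs] := hG N.
  have [j1 [j2 j3] [ca' cb' cx' cw'] hs'] := hG M.
  have Ht : 0 <= C3 * E * tau N by apply: mulr_ge0 (tau_ge0 N); exact: mulr_ge0 C30 E0.
  have := hcmp N t (a M) (b M) (a N) (b N) (xi M) (w M) (f M) (h N M) (xi N) (w N) (f N) (cst 0)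
    (C3 * E * tau N) t0 Ht ca' cb' cx' cw' ca cb cx cw (is_sys_le NM (hs' t)) (hs t).
  move=> hh; apply: le_trans (hh _ _ _) _.
  - by move=> s _; exact: fE.
  - by move=> s _; rewrite addr0.
  - by move=> s /andP[s0 _]; rewrite /cst subr0; apply: hB => //; exact: ltW.
  rewrite [X in _ * X + _](_ : _ = 0); first by rewrite mulr0 add0r !mulrA.
  rewrite /Vtot /Lsum big1 => [|n _].
    by rewrite i2 j2 i3 j3 !subrr mulr0 addr0 expr0n /= mulr0 addr0 mul0r addr0.
  have [-> ->] := i1 n (ltn_ord n); have [-> ->] := j1 n (leq_trans (ltn_ord n) NM).
  by rewrite !subrr /Lmode /zcoef !mulr0 addr0 expr0n /= !mulr0 mul0r !addr0.
pose K1 := K * (C1 * C3 * E).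
have aB n N M t : (n < N)%N -> (N <= M)%N -> 0 <= t ->
    (a M n t - a N n t) ^+ 2 <= K1 * tau N /\ (b M n t - b N n t) ^+ 2 <= K1 * tau N.
  move=> nN NM t0; have [/(_ n nN) [h1 h2] _] := hK N (fun n => a M n t - a N n t)
    (fun n => b M n t - b N n t) (xi M t - xi N t) (w M t - w N t).
  by split; [apply: le_trans h1 _ | apply: le_trans h2 _];
    rewrite /K1 -mulrA ler_wpM2l ?(ltW K0) //; exact: DB.
have xB N M t : (0 <= N)%N -> (N <= M)%N -> 0 <= t ->
    (xi M t - xi N t) ^+ 2 <= K1 * tau N /\ (w M t - w N t) ^+ 2 <= K1 * tau N.
  move=> _ NM t0; have [_ [h1 h2]] := hK N (fun n => a M n t - a N n t)
    (fun n => b M n t - b N n t) (xi M t - xi N t) (w M t - w N t).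
  by split; [apply: le_trans h1 _ | apply: le_trans h2 _];
    rewrite /K1 -mulrA ler_wpM2l ?(ltW K0) //; exact: DB.
pose K2 := 2 * (C2 * (C1 * C3 * E)) + 2 * (C3 * E).
have fB N M t : (0 <= N)%N -> (N <= M)%N -> 0 <= t -> (f M t - f N t) ^+ 2 <= K2 * tau N.
  move=> _ NM t0; rewrite (fE N M).
  have -> : f N t = Flaw N ((a N)^~ t) ((b N)^~ t) (xi N t) (w N t) by [].
  rewrite addrAC -FlawB; set F := Flaw N _ _ _ _.
  have F2 : F ^+ 2 <= C2 * (C1 * C3 * E) * tau N.
    by apply: le_trans (hF _ _ _ _ _) _; rewrite -mulrA ler_wpM2l ?(ltW C20) //; exact: DB.
  have := hB N M t NM t0; have : 0 <= (F - h N M t) ^+ 2 by pos.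
  rewrite /K2 mulrDl -!(mulrA 2); nra.
have [cf ca cb cx cw] : [/\ forall N, continuous (f N), forall N n, continuous (a N n),
   forall N n, continuous (b N n), forall N, continuous (xi N) & forall N, continuous (w N)].
  split=> N; have [_ _ [ca cb cx cw] _] := hG N => //.
  have cq : continuous (fun t => qsum N ((a N)^~ t) ((b N)^~ t)).
    apply: (@continuous_sum R 'I_N (index_enum 'I_N)
      (fun n t => c n * (r * zcoef n (a N n t) (b N n t) + b N n t))) => n t.
    apply: cvgM; first exact: cvg_cst.
    apply: cvgD; last exact: cb.
    apply: cvgM; first exact: cvg_cst.
    by apply: cvgD; [exact: cb | apply: cvgM; [exact: cvg_cst | exact: ca]].
  move=> t; apply: cvgM; first exact: cvg_cst.
  apply: cvgD; last by apply: cvgM; [exact: cvg_cst | exact: cq].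
  by apply: cvgD; [exact: cw | apply: cvgM; [exact: cvg_cst | exact: cx]].
have [ff [cff uff lff]] := uniform_limit tau0 cf fB.
have [xx [cxx uxx lxx']] := uniform_limit tau0 cx (fun N M t h1 h2 h3 => (xB N M t h1 h2 h3).1).
have [ww [cww uww lww]] := uniform_limit tau0 cw (fun N M t h1 h2 h3 => (xB N M t h1 h2 h3).2).
have /choice [aa haa] : forall n, exists y : R -> R, [/\ continuous y,
    forall N (t : R), (n < N)%N -> 0 <= t -> (y t - a N n t) ^+ 2 <= K1 * tau N &
    forall t : R, 0 <= t -> a N n t @[N --> \oo] --> y t].
  move=> n; apply: (uniform_limit tau0 (fun N => ca N n)) => N M t h1 h2 h3.
  exact: (aB n N M t h1 h2 h3).1.
have /choice [bb hbb] : forall n, exists y : R -> R, [/\ continuous y,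
    forall N (t : R), (n < N)%N -> 0 <= t -> (y t - b N n t) ^+ 2 <= K1 * tau N &
    forall t : R, 0 <= t -> b N n t @[N --> \oo] --> y t].
  move=> n; apply: (uniform_limit tau0 (fun N => cb N n)) => N M t h1 h2 h3.
  exact: (aB n N M t h1 h2 h3).2.
have Vcv N t : 0 <= t -> Vtot N (fun n => a M n t) (fun n => b M n t) (xi M t) (w M t) @[M --> \oo] -->
    Vtot N (aa^~ t) (bb^~ t) (xx t) (ww t).
  move=> t0; apply: cvg_Vtot; [| |exact: lxx' | exact: lww].
    by move=> n _; have [_ _] := haa n; exact.
  by move=> n _; have [_ _] := hbb n; exact.
have sysN N t : 0 < t -> [/\ forall n, (n < N)%N -> is_mode n (a N n) (b N n) (f N) t,
      is_derive t 1 (xi N) (w N t) & is_derive t 1 (w N) (- f N t)].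
  move=> t0; have [_ _ _ hs] := hG N.
  by apply: (hs (t + 1) t); rewrite t0 ltrDl ltr01.
have fdef N t : f N t = Flaw N ((a N)^~ t) ((b N)^~ t) (xi N t) (w N t) by [].
clearbody f.
exists aa, bb, xx, ww, ff; split.
- by split=> // n; [have [] := haa n | have [] := hbb n].
- have lim0 (y : nat -> R) (l v : R) (n : nat) : y @ \oo --> l ->
      (forall N, (n < N)%N -> y N = v) -> l = v.
    move=> yl yv; rewrite -(cvg_lim _ yl) //; apply: lim_near_cst => //.
    by exists n.+1 => // N /= nN; exact: yv.
  split=> [n|n||].
  + have [_ _ /(_ 0 (lexx _)) hl] := haa n; apply: (lim0 _ _ _ n hl) => N nN.
    by have [/(_ n nN) [-> _] _ _ _] := hG N.
  + have [_ _ /(_ 0 (lexx _)) hl] := hbb n; apply: (lim0 _ _ _ n hl) => N nN.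
    by have [/(_ n nN) [_ ->] _ _ _] := hG N.
  + by apply: (lim0 _ _ _ 0%N (lxx' 0 (lexx _))) => N _; have [_ [-> _] _ _] := hG N.
  + by apply: (lim0 _ _ _ 0%N (lww 0 (lexx _))) => N _; have [_ [_ ->] _ _] := hG N.
- have uf := ucvg_of_sqr tau0 uff; have uw := ucvg_of_sqr tau0 uww.
  have ua n := ucvg_of_sqr tau0 (let: And3 _ h _ := haa n in h).
  have ub n := ucvg_of_sqr tau0 (let: And3 _ h _ := hbb n in h).
  move=> N T t /andP[t0 _]; split.
  + move=> n _; split.
      apply: (is_derive_ucvg (n0 := n.+1) (y := fun N => a N n)
        (dy := fun N t => nu n * b N n t + 0 * b N n t + 0 * b N n t) (g := fun t => nu n * bb n t)) t0.
      * move=> M s nM s0; have [/(_ n nM) [h1 _] _ _] := sysN M s s0.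
        by apply: (is_derive_conv h1) => //; rewrite !mul0r !addr0.
      * move=> e e0; have [N1 hN1] := ucvg_lin (nu n) 0 0 (ub n) (ub n) (ub n) e0.
        by exists N1 => M hM s s0; have := hN1 M hM s s0; rewrite !mul0r !addr0.
      * by have [_ _ hl] := haa n; exact: hl.
    apply: (is_derive_ucvg (n0 := n.+1) (y := fun N => b N n)
      (dy := fun N t => - stiff sigma n * a N n t + (- damp mu kappa n) * b N n t + (- c n) * f N t)
      (g := fun t => - stiff sigma n * aa n t - damp mu kappa n * bb n t - c n * ff t)) t0.
    * move=> M s nM s0; have [/(_ n nM) [_ h1] _ _] := sysN M s s0.
      by apply: (is_derive_conv h1) => //; rewrite !mulNr.
    * move=> e e0.
      have [N1 hN1] := ucvg_lin (- stiff sigma n) (- damp mu kappa n) (- c n) (ua n) (ub n) uf e0.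
      by exists N1 => M hM s s0; have := hN1 M hM s s0; rewrite !mulNr.
    * by have [_ _ hl] := hbb n; exact: hl.
  + apply: (is_derive_ucvg (n0 := 0%N) (y := xi) (dy := w)) t0 => //.
    by move=> M s _ s0; have [_ h1 _] := sysN M s s0.
  + apply: (is_derive_ucvg (n0 := 0%N) (y := w) (dy := fun N t => - f N t) (g := fun t => - ff t)) t0 => //.
      by move=> M s _ s0; have [_ _ h1] := sysN M s s0.
    move=> e e0; have [N1 hN1] := uf e e0.
    by exists N1 => M hM s s0; rewrite -opprD normrN; exact: hN1.
- move=> t t0; pose K3 := 2 * (C2 * (C1 * C3 * E)) + 2 * K2.
  have Ktau : (fun N => K3 * tau N) @ \oo --> (0 : R).
    by rewrite -(mulr0 K3); apply: cvgM; [exact: cvg_cst | exact: tau0].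
  have D' N : Vtot N (fun n => aa n t - a N n t) (fun n => bb n t - b N n t) (xx t - xi N t) (ww t - w N t) <= C1 * C3 * E * tau N.
    have hD : D N M t @[M --> \oo] --> Vtot N (fun n => aa n t - a N n t) (fun n => bb n t - b N n t) (xx t - xi N t) (ww t - w N t).
      apply: (cvg_Vtot (x := fun M n => a M n t - a N n t) (y := fun M n => b M n t - b N n t)
         (u := fun M => xi M t - xi N t) (v := fun M => w M t - w N t)).
      - by move=> n _; apply: cvgB; [have [_ _] := haa n; exact | exact: cvg_cst].
      - by move=> n _; apply: cvgB; [have [_ _] := hbb n; exact | exact: cvg_cst].
      - by apply: cvgB; [exact: lxx' | exact: cvg_cst].
      - by apply: cvgB; [exact: lww | exact: cvg_cst].
    rewrite -(cvg_lim _ hD) //; apply: limr_le; first by apply/cvg_ex; eexists; exact: hD.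
    near=> M; apply: DB => //; near: M; exact: nbhs_infty_ge.
  apply/cvgrPdist_le => e e0; have e20 : 0 < e ^+ 2 by pos.
  have /cvgrPdist_le /(_ _ e20) := Ktau; apply: filterS => N hN.
  rewrite -(ler_sqr (normr_ge0 _)) ?nnegrE ?(ltW e0) // real_normK ?num_real //.
  move: hN; rewrite sub0r normrN => hN; apply: le_trans hN; apply: le_trans (ler_norm _).
  have -> : ff t - Flaw N (aa^~ t) (bb^~ t) (xx t) (ww t) = (ff t - f N t) -
     Flaw N (fun n => aa n t - a N n t) (fun n => bb n t - b N n t) (xx t - xi N t) (ww t - w N t).
    by rewrite (FlawB N (aa^~ t) (bb^~ t) (xx t) (ww t) ((a N)^~ t)) fdef; ring.
  have h1 := uff N t (leq0n _) t0; set F := Flaw N _ _ _ _.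
  have h2 : F ^+ 2 <= C2 * (C1 * C3 * E) * tau N.
    by apply: le_trans (hF _ _ _ _ _) _; rewrite -mulrA ler_wpM2l ?(ltW C20).
  have : 0 <= (ff t - f N t + F) ^+ 2 by pos.
  rewrite /K3 mulrDl -!(mulrA 2); nra.
- move=> t t0; split.
    move=> N; rewrite -(cvg_lim _ (Vcv N t t0)) //; apply: limr_le; first by apply/cvg_ex; eexists; exact: Vcv.
    near=> M; apply: le_trans (VN M t t0).
    have NM : (N <= M)%N by near: M; exact: nbhs_infty_ge.
    rewrite lerD2r /Lsum -!(big_mkord xpredT (fun n => Lmode r n (a M n t) (b M n t))).
    by rewrite (@big_cat_nat _ _ _ N 0 M) //= lerDl sumr_ge0 // => n _; exact: Lmode_r_ge0.
  have hl : f N t ^+ 2 @[N --> \oo] --> ff t ^+ 2.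
    by rewrite expr2; under eq_fun do rewrite expr2; apply: cvgM; exact: lff.
  rewrite -(cvg_lim _ hl) //; apply: limr_le; first by apply/cvg_ex; eexists; exact: hl.
  near=> N; rewrite fdef; apply: le_trans (hF _ _ _ _ _) _; rewrite ler_wpM2l ?(ltW C20) //; exact: VN.
Unshelve. all: by end_near. Qed.

(** Let [Y] be [nu^2] times the functional of the mode with weight 1; [mode_level1] bounds its
    derivative by the dissipation plus [C c_n^2 f^2].  For a rate [om] below [om0] and below
    that of the dissipation, [G], the sum of [exp(om s) Y] and of a term whose derivative cancels
    the weighted forcing, decreases.  The integral bound is the same inequality without
    the exponential weight. *)
Lemma mode_decay (om0 : R) : 0 < om0 -> exists om C : R, [/\ 0 < om, 0 < C &
  forall n (a b f : R -> R) (F : R),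
    continuous a -> continuous b -> continuous f -> 0 <= F ->
    (forall t : R, 0 < t -> is_mode n a b f t) ->
    (forall t : R, 0 <= t -> f t ^+ 2 <= expR (- om0 * t) * F) ->
    forall t : R, 0 <= t ->
      let E := nu n ^+ 2 * b 0 ^+ 2 + nu n ^+ 4 * a 0 ^+ 2 + c n ^+ 2 * F in
      nu n ^+ 2 * b t ^+ 2 + nu n ^+ 4 * a t ^+ 2 <= C * expR (- om * t) * E /\
      \int[leb]_(s in `[0, t]) (nu n ^+ 4 * b s ^+ 2 + nu n ^+ 6 * a s ^+ 2) <=
        C * (1 + t) * E].
Proof.
move=> om00; have [d [C [d0 C0 h1]]] := mode_level1 c sigma_gt0 mu_gt0 kappa_ge0.
have [M M0 hM] := Lmode_le sigma_gt0 mu_gt0 kappa_ge0 ler01.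
pose m := Num.min (1 / 2) (sigma / 2).
have m0 : 0 < m by rewrite /m lt_min; apply/andP; split; pos.
have pi2 : 0 < pi ^+ 2 :> R by pos.
(* strictly below the rate [om0] of the forcing, so that [dl] is positive *)
pose om := Num.min om0 (d * pi ^+ 2 / M) / 2.
have om_gt0 : 0 < om by rewrite divr_gt0 // lt_min om00 /=; pos.
have om_le : om <= om0 / 2 by rewrite ler_wpM2r // ge_min lexx.
have om_le2 : om <= d * pi ^+ 2 / M.
  apply: le_trans (_ : d * pi ^+ 2 / M / 2 <= _); first by rewrite ler_wpM2r // ge_min lexx orbT.
  have : 0 < d * pi ^+ 2 / M by pos.
  by move: (d * pi ^+ 2 / M) => x; lra.
pose dl := om0 - om; have dl0 : 0 < dl by rewrite /dl; lra.
exists om, ((M + C / dl) / m + (M + C) / d); split=> [//||n a b f F ca cb cf F0 hmode hf t t0 /=].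
  by pos.
have n0 := nu_gt0 (R := R) n; set v := nu n in n0 *.
pose Y s := v ^+ 2 * Lmode 1 n (a s) (b s).
pose D s := v ^+ 4 * b s ^+ 2 + v ^+ 6 * a s ^+ 2.
pose W s := v ^+ 2 * b s ^+ 2 + v ^+ 4 * a s ^+ 2.
have YW s : Y s <= M * W s.
  apply: le_trans (ler_wpM2l (sqr_ge0 v) (hM n _ _)) _; rewrite -/v /W.
  by rewrite le_eqVlt; apply/orP; left; apply/eqP; ring.
have WY s : m * W s <= Y s.
  have := ler_wpM2l (sqr_ge0 v) (Lmode_ge mu kappa sigma_gt0 n (a s) (b s) ler01).
  apply: le_trans; rewrite -/m -/v /W.
  by rewrite le_eqVlt; apply/orP; left; apply/eqP; ring.
have WD s : pi ^+ 2 * W s <= D s.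
  rewrite (_ : D s = v ^+ 2 * W s); last by rewrite /D /W; ring.
  by rewrite ler_wpM2r ?nu2_ge // /W; pos.
have DY s : om * Y s <= d * D s.
  apply: le_trans (ler_wpM2l (ltW om_gt0) (YW s)) _.
  apply: le_trans (ler_wpM2r _ om_le2) _; first by rewrite /W; pos.
  rewrite [X in X <= _](_ : _ = d * (pi ^+ 2 * W s)); first by rewrite ler_wpM2l // ltW.
  by move: (pi ^+ 2) => p; field; pos.
pose dY s := v ^+ 2 * (- Dmode sigma mu kappa 1 n (a s) (b s) -
  c n * f s * (1 * zcoef n (a s) (b s) + b s)).
have dYle s : dY s <= - d * D s + C * (c n ^+ 2 * f s ^+ 2) by exact: h1.
have Yder (s : R) : 0 < s -> is_derive s 1 Y (dY s).
  by move=> /hmode h; apply: derZ; exact: is_derive_Lmode.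
have cY : continuous Y.
  by move=> s; apply: cvgM; [exact: cvg_cst | exact: (@continuous_Lmode R sigma mu kappa 1 n a b ca cb)].
have E1 : 0 <= C * (c n ^+ 2 * F) by pos.
set E := _ + c n ^+ 2 * F.
have E0 : 0 <= E by rewrite /E; pos.
have WE : W 0 <= E by rewrite lerDl; pos.
have FE : c n ^+ 2 * F <= E by rewrite lerDr; pos.
have Y0E : Y 0 <= M * E by apply: le_trans (YW 0) _; rewrite ler_wpM2l // ltW.
split.
- pose B := C * (c n ^+ 2 * F) / dl.
  pose G (s : R) : R := expR (om * s) * Y s + B * expR (- dl * s).
  pose dG (s : R) : R := om * expR (om * s) * Y s + expR (om * s) * dY s + B * (- dl * expR (- dl * s)).
  have cG : continuous G.
    move=> s; apply: cvgD; apply: cvgM; [exact: continuous_expRM | exact: cY | exact: cvg_cst|].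
    exact: continuous_expRM.
  have Gle : G t <= G 0.
    have cG' : {within `[0, t], continuous G} by exact: continuous_subspaceT.
    apply: (@derive_le0_le R G dG 0 t t0 cG').
      move=> s /andP[s0 _]; apply: derD; last by apply: derZ; exact: is_derive_expRM.
      by apply: derM; [exact: is_derive_expRM | exact: Yder].
    move=> s /andP[s0 _]; rewrite /dG.
    have e1 : B * (- dl * expR (- dl * s)) = - (expR (om * s) * (C * (c n ^+ 2 * (expR (- om0 * s) * F)))).
      rewrite (_ : - dl * s = om * s + - om0 * s); last by rewrite /dl; ring.
      by rewrite expRD /B; field; pos.
    rewrite e1 [om * _]mulrC -mulrA -mulrDr -mulrBr pmulr_rle0 ?expR_gt0 //.
    have f1 : C * (c n ^+ 2 * f s ^+ 2) <= C * (c n ^+ 2 * (expR (- om0 * s) * F)).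
      by rewrite ler_wpM2l ?(ltW C0) // ler_wpM2l ?sqr_ge0 // hf // ltW.
    have := dYle s; have := DY s; rewrite mulNr; lra.
  have G0 : G 0 <= (M + C / dl) * E.
    rewrite /G !mulr0 expR0 mul1r mulr1 mulrDl; apply: lerD => //.
    rewrite (_ : B = C / dl * (c n ^+ 2 * F)); last by rewrite /B; ring.
    by rewrite ler_wpM2l //; pos.
  have Yt : expR (om * t) * Y t <= (M + C / dl) * E.
    apply: le_trans G0; apply: le_trans Gle; rewrite lerDl.
    by rewrite mulr_ge0 ?expR_ge0 // /B; pos.
  have Wt : W t <= (M + C / dl) / m * expR (- om * t) * E.
    have e0 : 0 < expR (om * t) by exact: expR_gt0.
    rewrite -(ler_pM2l m0) -(ler_pM2l e0).
    apply: le_trans (ler_wpM2l (ltW e0) (WY t)) _; apply: le_trans Yt _.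
    rewrite mulNr expRN le_eqVlt; apply/orP; left; apply/eqP.
    by field; pos.
  apply: le_trans Wt _; rewrite ler_wpM2r // ler_wpM2r ?expR_ge0 // lerDl; pos.
- have cD : continuous D.
    have X2 (g : R -> R) : continuous g -> continuous (fun t => g t ^+ 2).
      by move=> cg x; apply: cvgM; exact: cg.
    by move=> s; apply: cvgD; apply: cvgM; try exact: cvg_cst; [exact: (X2 b) | exact: (X2 a)].
  have [P [P0 dP intP]] := primitive_exists cD.
  rewrite [X in X <= _](intP 0 t); last by rewrite lexx.
  rewrite P0 subr0.
  pose Z (s : R) : R := Y s + d * P s - C * (c n ^+ 2 * F) * s.
  pose dZ (s : R) : R := dY s + d * D s - C * (c n ^+ 2 * F) * 1.
  have Zle : Z t <= Z 0.
    have cZ : {within `[0, t], continuous Z}.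
      apply: continuous_in_subspaceT => s; rewrite inE /= in_itv /= => /andP[s0 _].
      apply: cvgB; last by apply: cvgM; [exact: cvg_cst | exact: cvg_id].
      apply: cvgD; first exact: cY.
      apply: cvgM; first exact: cvg_cst.
      have [|dPs _] := dP s; first by apply: lt_le_trans s0; rewrite ltrN10.
      exact/differentiable_continuous/derivable1_diffP.
    apply: (@derive_le0_le R Z dZ 0 t t0 cZ).
    + move=> s /andP[s0 _]; have s1 : -1 < s by apply: lt_trans s0; rewrite ltrN10.
      exact: (derB (derD (Yder s s0) (derZ d (dP s s1))) (derZ (C * (c n ^+ 2 * F)) (derId s))).
    + move=> s /andP[s0 _]; have := dYle s; rewrite /dZ mulr1.
      have f1 : C * (c n ^+ 2 * f s ^+ 2) <= C * (c n ^+ 2 * F).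
        rewrite ler_wpM2l ?(ltW C0) // ler_wpM2l ?sqr_ge0 //.
        apply: le_trans (hf s (ltW s0)) _; rewrite ler_piMl // -expR0 ler_expR mulNr oppr_le0.
        by pos.
      by rewrite mulNr; lra.
  have Pt : d * P t <= (M + C) * (1 + t) * E.
    move: Zle; rewrite /Z P0 !mulr0 subr0 addr0.
    have Yt : 0 <= Y t by apply: le_trans (WY t); rewrite /W; pos.
    have q1 : C * (c n ^+ 2 * F) * t <= C * E * t.
      by rewrite ler_wpM2r // ler_wpM2l // ltW.
    have q2 : 0 <= M * t * E by pos.
    have q3 : 0 <= C * E by pos.
    rewrite (_ : (M + C) * (1 + t) * E = M * E + M * t * E + C * E + C * E * t); last by ring.
    lra.
  rewrite -(ler_pM2l d0); apply: le_trans Pt _.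
  rewrite [X in _ <= X](_ : _ = (M + C) * (1 + t) * E + d * ((M + C / dl) / m) * (1 + t) * E).
    by rewrite lerDl; pos.
  by field; pos.
Qed.

End Galerkin.

(** * The space L^2(0,1) *)
Section L2.
Context {R : realType}.
Implicit Types (f g h : R -> R).

Lemma aeS (P P' : R -> Prop) : (forall x, P x -> P' x) ->
  {ae leb, forall x : R, P x} -> {ae leb, forall x : R, P' x}.
Proof.
by move=> h [N [mN N0 sN]]; exists N; split=> // x nx; apply: sN => px; apply: nx; exact: h.
Qed.

Lemma aeS2 (P P' P'' : R -> Prop) : (forall x, P x -> P' x -> P'' x) ->
  {ae leb, forall x : R, P x} -> {ae leb, forall x : R, P' x} -> {ae leb, forall x : R, P'' x}.
Proof.
move=> h h1 h2; apply: (negligibleS _ (negligibleU h1 h2)) => x /= nP.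
by apply: contrapT => /not_orP[] /contrapT p /contrapT p'; apply: nP; exact: h.
Qed.

Lemma measurable_oo (a b : R) : measurable (`]a, b[%classic : set (measurableTypeR R)).
Proof. exact: measurable_itv. Qed.
Hint Resolve measurable_oo : core.

Lemma integrable_EFinD (D : set (measurableTypeR R)) f g : measurable D ->
  leb.-integrable D (EFin \o f) -> leb.-integrable D (EFin \o g) ->
  leb.-integrable D (EFin \o (fun x => f x + g x)).
Proof. by move=> mD hf hg; exact: (integrableD mD hf hg). Qed.

Lemma integrable_EFinZ (D : set (measurableTypeR R)) (c : R) f : measurable D ->
  leb.-integrable D (EFin \o f) -> leb.-integrable D (EFin \o (fun x => c * f x)).
Proof. by move=> mD hf; exact: (integrableZl mD c hf). Qed.

Lemma integrable_dom (D : set (measurableTypeR R)) f g : measurable D ->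
  measurable_fun D f -> (forall x, D x -> `|f x| <= g x) ->
  leb.-integrable D (EFin \o g) -> leb.-integrable D (EFin \o f).
Proof.
move=> mD mf fg; apply: le_integrable => //; first exact/measurable_EFinP.
by move=> x Dx /=; rewrite lee_fin (le_trans (fg x Dx)) // ler_norm.
Qed.

(** The definition goes through the restriction of [f] to the interval and a power [2] with
    real exponent; this is the usual description. *)
Lemma L2P (a b : R) f : L2 a b f <-> measurable_fun `]a, b[ f /\
  (\int[leb]_(x in `]a, b[) (f x ^+ 2)%:E < +oo)%E.
Proof.
have e : (\int[leb]_x (`|(f \_ `]a, b[) x| `^ 2)%:E)%E = (\int[leb]_(x in `]a, b[) (f x ^+ 2)%:E)%E.
  rewrite [RHS]integral_mkcond; apply: eq_integral => x _.
  rewrite restrict_EFin /= !patchE; case: ifP => _.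
    by rewrite powR_mulrn // real_normK ?num_real.
  by rewrite normr0 powR0.
rewrite /L2 inE; split.
- move=> /andP[]; rewrite !inE /= => mf; rewrite /finite_norm unlock /= => h.
  split; first by apply/(measurable_restrictT _ _).2.
  rewrite -e; have := poweR_lty 2 h; rewrite -poweRrM mulVf // poweRe1 //.
  by apply: integral_ge0.
- move=> [mf h]; apply/andP; rewrite !inE /=; split.
    by apply/(measurable_restrictT _ _).1.
  by rewrite /finite_norm unlock /=; apply: poweR_lty; rewrite e.
Qed.

Lemma L2_measurable (a b : R) f : L2 a b f -> measurable_fun `]a, b[ f.
Proof. by case/L2P. Qed.

Lemma integral_sqr_lty (a b : R) f : L2 a b f -> leb.-integrable `]a, b[ (EFin \o (fun x => f x ^+ 2)).
Proof.
move=> /L2P [mf h]; apply/integrableP; split.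
  by apply/measurable_EFinP; apply: measurable_funX.
by under eq_integral do rewrite /= ger0_norm ?sqr_ge0 //.
Qed.

Lemma L2_mul_integrable (a b : R) f g : L2 a b f -> L2 a b g ->
  leb.-integrable `]a, b[ (EFin \o (fun x => f x * g x)).
Proof.
move=> hf hg; have sf := integral_sqr_lty hf; have sg := integral_sqr_lty hg.
have mf := L2_measurable hf; have mg := L2_measurable hg.
apply: (integrable_dom (g := fun x => f x ^+ 2 + g x ^+ 2)) => //.
- exact: measurable_funM.
- move=> x _; rewrite normrM.
  rewrite -(real_normK (num_real (f x))) -(real_normK (num_real (g x))).
  have := sqr_ge0 (`|f x| - `|g x|); have := sqr_ge0 (`|f x| + `|g x|); nra.
- exact: integrable_EFinD.
Qed.

Lemma L2D (a b : R) f g : L2 a b f -> L2 a b g -> L2 a b (fun x => f x + g x).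
Proof.
move=> hf hg; have sf := integral_sqr_lty hf; have sg := integral_sqr_lty hg.
have sfg := L2_mul_integrable hf hg.
have mf := L2_measurable hf; have mg := L2_measurable hg.
have m : measurable_fun `]a, b[ (fun x => f x + g x) by apply: measurable_funD.
apply/L2P; split=> //.
have : leb.-integrable `]a, b[ (EFin \o (fun x => f x ^+ 2 + g x ^+ 2 + 2 * (f x * g x))).
  apply: integrable_EFinD => //; first exact: integrable_EFinD.
  exact: integrable_EFinZ.
move=> /integrableP [_]; apply: le_lt_trans; apply: ge0_le_integral => //.
- by move=> x _; rewrite lee_fin sqr_ge0.
- by apply/measurable_EFinP; apply: measurable_funX.
- apply/measurable_EFinP; apply: measurableT_comp => //.
  apply: measurable_funD; last by apply: measurable_funM => //; apply: measurable_funM.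
  by apply: measurable_funD; apply: measurable_funX.
- move=> x _ /=; rewrite lee_fin; apply: le_trans (ler_norm _).
  by rewrite le_eqVlt; apply/orP; left; apply/eqP; ring.
Qed.

Lemma L2Z (a b c : R) f : L2 a b f -> L2 a b (fun x => c * f x).
Proof.
move=> hf; have sf := integral_sqr_lty hf; have mf := L2_measurable hf.
apply/L2P; split; first by apply: measurable_funM.
have /integrableP[_] := integrable_EFinZ (c ^+ 2) (measurable_oo a b) sf.
apply: le_lt_trans; apply: ge0_le_integral => //.
- by move=> x _; rewrite lee_fin sqr_ge0.
- by apply/measurable_EFinP; apply: measurable_funX; apply: measurable_funM.
- apply/measurable_EFinP; apply: measurableT_comp => //.
  by apply: measurable_funM => //; exact: measurable_funX.
- by move=> x _ /=; rewrite lee_fin exprMn ler_norm.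
Qed.

Lemma L2N (a b : R) f : L2 a b f -> L2 a b (fun x => - f x).
Proof. by move=> /(L2Z (-1)); under eq_fun do rewrite mulN1r. Qed.

Lemma L2B (a b : R) f g : L2 a b f -> L2 a b g -> L2 a b (fun x => f x - g x).
Proof. by move=> hf /L2N; exact: L2D. Qed.

Lemma bounded_L2 (a b M : R) f : measurable_fun `]a, b[ f ->
  (forall x, a < x < b -> `|f x| <= M) -> L2 a b f.
Proof.
move=> mf fM; apply/L2P; split=> //.
have [ab|ba] := ltP a b; last first.
  by rewrite set_itv_ge ?bnd_simp -?leNgt // integral_set0.
apply: (@le_lt_trans _ _ (\int[leb]_(x in `]a, b[) (cst (M ^+ 2)%:E) x)%E).
  apply: ge0_le_integral => //.
  - by move=> x _; rewrite lee_fin sqr_ge0.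
  - by apply/measurable_EFinP; apply: measurable_funX.
  - move=> x; rewrite /= in_itv /= => xab; rewrite lee_fin -(real_normK (num_real (f x))).
    have := fM _ xab => h; rewrite ler_sqr ?nnegrE //; exact: le_trans h.
rewrite integral_cst // /= lebesgue_measure_itv /= lte_fin ab -EFinB -EFinM ltry //.
Qed.

Lemma continuous_L2 (a b : R) f : continuous f -> L2 a b f.
Proof.
move=> cf; have mf : measurable_fun `]a, b[ f.
  by apply: measurable_funS (measurableT) _ (continuous_measurable_fun cf).
have /compact_bounded [M [_ hM]] : compact (f @` `[a, b]).
  by apply: continuous_compact; [exact: continuous_subspaceT | exact: segment_compact].
apply: (@bounded_L2 _ _ (`|M| + 1)) => // x /andP[ax xb].
apply: (hM (`|M| + 1)); first by apply: (le_lt_trans (ler_norm _)); rewrite ltrDl.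
by exists x => //=; rewrite in_itv /= !ltW.
Qed.

Lemma L2_cst (a b c : R) : L2 a b (fun _ => c).
Proof. by apply: continuous_L2; exact: cst_continuous. Qed.

Lemma L2_sum (a b : R) (I : Type) (s : seq I) (F : I -> R -> R) :
  (forall i, L2 a b (F i)) -> L2 a b (fun x => \sum_(i <- s) F i x).
Proof.
move=> hF; elim: s => [|i s IH].
  by under eq_fun do rewrite big_nil; exact: L2_cst.
by under eq_fun do rewrite big_cons; exact: L2D.
Qed.

Lemma L2_integrable (a b : R) f : L2 a b f -> leb.-integrable `]a, b[ (EFin \o f).
Proof.
move=> hf; have := L2_mul_integrable hf (L2_cst a b 1).
by rewrite (_ : (fun x => f x * 1) = f) //; apply/funext => x; rewrite mulr1.
Qed.

Lemma innerC f g : inner f g = inner g f.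
Proof. by apply: eq_Rintegral => x _; rewrite mulrC. Qed.

Lemma innerDl f g h : L2 0 1 f -> L2 0 1 g -> L2 0 1 h ->
  inner (fun x => f x + g x) h = inner f h + inner g h.
Proof.
move=> hf hg hh; rewrite /inner -RintegralD //; try exact: L2_mul_integrable.
by apply: eq_Rintegral => x _; rewrite mulrDl.
Qed.

Lemma innerZl (c : R) f h : L2 0 1 f -> L2 0 1 h -> inner (fun x => c * f x) h = c * inner f h.
Proof.
move=> hf hh; rewrite /inner -RintegralZl //; last exact: L2_mul_integrable.
by apply: eq_Rintegral => x _; rewrite mulrA.
Qed.

Lemma innerBl f g h : L2 0 1 f -> L2 0 1 g -> L2 0 1 h ->
  inner (fun x => f x - g x) h = inner f h - inner g h.
Proof.
move=> hf hg hh; rewrite /inner -RintegralB //; try exact: L2_mul_integrable.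
by apply: eq_Rintegral => x _; rewrite mulrBl.
Qed.

Lemma innerDr f g h : L2 0 1 f -> L2 0 1 g -> L2 0 1 h ->
  inner h (fun x => f x + g x) = inner h f + inner h g.
Proof. by move=> *; rewrite innerC innerDl // 2!(innerC h). Qed.

Lemma innerBr f g h : L2 0 1 f -> L2 0 1 g -> L2 0 1 h ->
  inner h (fun x => f x - g x) = inner h f - inner h g.
Proof. by move=> *; rewrite innerC innerBl // 2!(innerC h). Qed.

Lemma innerZr (c : R) f h : L2 0 1 f -> L2 0 1 h -> inner h (fun x => c * f x) = c * inner h f.
Proof. by move=> *; rewrite innerC innerZl // (innerC h). Qed.

Lemma inner0l h : inner (fun _ => 0) h = 0.
Proof.
rewrite /inner; under eq_Rintegral do rewrite mul0r.
by rewrite Rintegral_cst // mul0r.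
Qed.

Lemma inner_suml (I : Type) (s : seq I) (F : I -> R -> R) h :
  (forall i, L2 0 1 (F i)) -> L2 0 1 h ->
  inner (fun x => \sum_(i <- s) F i x) h = \sum_(i <- s) inner (F i) h.
Proof.
move=> hF hh; elim: s => [|i s IH].
  by under eq_fun do rewrite big_nil; rewrite big_nil inner0l.
by under eq_fun do rewrite big_cons; rewrite big_cons innerDl ?IH //; exact: L2_sum.
Qed.

Lemma inner_ge0 f : 0 <= inner f f.
Proof. by apply: Rintegral_ge0 => x _; rewrite -expr2 sqr_ge0. Qed.

Lemma L2norm_sqr f : L2 0 1 f -> L2norm f ^+ 2 = inner f f.
Proof.
move=> hf; have /integrableP[_ fin] := integral_sqr_lty hf.
have e : (\int[leb]_x (`|(f \_ `]0%R, 1%R[) x| `^ 2)%:E)%E = (inner f f)%:E.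
  rewrite /inner /Rintegral fineK; last first.
    by apply: integrable_fin_num => //; exact: L2_mul_integrable.
  rewrite [RHS]integral_mkcond; apply: eq_integral => x _.
  rewrite restrict_EFin /= !patchE; case: ifP => _.
    by rewrite powR_mulrn // real_normK ?num_real // expr2.
  by rewrite normr0 powR0.
rewrite /L2norm unlock /= e poweR_EFin /= powR12_sqrt ?sqr_sqrtr ?inner_ge0 //.
Qed.

Lemma L2norm_ge0 f : 0 <= L2norm f.
Proof. by rewrite fine_ge0 // Lnorm_ge0. Qed.

Lemma L2normE f : L2 0 1 f -> L2norm f = Num.sqrt (inner f f).
Proof. by move=> hf; rewrite -L2norm_sqr // sqrtr_sqr ger0_norm // L2norm_ge0. Qed.

Lemma inner_sqr_le f g : L2 0 1 f -> L2 0 1 g -> inner f g ^+ 2 <= inner f f * inner g g.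
Proof.
move=> hf hg; have quad (s : R) : 0 <= inner f f - 2 * s * inner f g + s ^+ 2 * inner g g.
  have := inner_ge0 (fun x => f x - s * g x).
  have hs := L2Z s hg.
  rewrite innerBl //; last exact: L2B.
  have hfs := L2B hf hs.
  rewrite (innerBr hf hs hf) (innerZl s hg hfs) (innerBr hf hs hg) !innerZr // (innerC g f).
  by rewrite (_ : _ - _ = inner f f - 2 * s * inner f g + s ^+ 2 * inner g g) //; ring.
have [G0|] := ltP 0 (inner g g).
  have := quad (inner f g / inner g g).
  rewrite (_ : _ + _ = inner f f - inner f g ^+ 2 / inner g g); last by field; rewrite gt_eqF.
  by rewrite subr_ge0 ler_pdivrMr.
move=> G0; have G00 : inner g g = 0 by apply/le_anti; rewrite G0 inner_ge0.
rewrite G00 mulr0; have [Z0|Z0] := eqVneq (inner f g) 0; first by rewrite Z0 expr0n.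
have := quad ((inner f f + 1) / (2 * inner f g)); rewrite G00 mulr0 addr0.
by rewrite (_ : _ - _ = -1); [rewrite oppr_ge0 ler10 | field].
Qed.

Lemma inner_le f g : L2 0 1 f -> L2 0 1 g -> `|inner f g| <= L2norm f * L2norm g.
Proof.
move=> hf hg; rewrite -sqrtr_sqr !L2normE // -sqrtrM ?inner_ge0 //.
by rewrite ler_wsqrtr // inner_sqr_le.
Qed.

Lemma L2norm_triangle f g : L2 0 1 f -> L2 0 1 g ->
  L2norm (fun x => f x + g x) <= L2norm f + L2norm g.
Proof.
move=> hf hg; rewrite -(ler_sqr (L2norm_ge0 _)) ?nnegrE ?addr_ge0 ?L2norm_ge0 //.
rewrite sqrrD !L2norm_sqr //; last exact: L2D.
rewrite innerDl ?innerDr //; last exact: L2D.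
have := inner_le hf hg; have := ler_norm (inner f g); rewrite (innerC g f).
rewrite -(L2norm_sqr hf) -(L2norm_sqr hg) mulr2n; lra.
Qed.

Lemma L2normN f : L2norm (fun x => - f x) = L2norm f.
Proof.
rewrite /L2norm; congr fine.
rewrite (_ : EFin \o _ = (\- (EFin \o f \_ `]0%R, 1%R[))%E) ?oppe_Lnorm //.
by apply/funext => x /=; rewrite !patchE; case: ifP => // _; rewrite oppr0.
Qed.

Lemma L2normZ (c : R) f : L2 0 1 f -> L2norm (fun x => c * f x) = `|c| * L2norm f.
Proof.
move=> hf; have hc := L2Z c hf.
rewrite !L2normE // innerZl ?innerZr // mulrA -expr2 sqrtrM ?sqr_ge0 // sqrtr_sqr //.
Qed.

Lemma eq01_refl f : eq01 f f.
Proof. by apply: aeW. Qed.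

Lemma eq01_sym f g : eq01 f g -> eq01 g f.
Proof. by apply: aeS => x h /h. Qed.

Lemma eq01_trans f g h : eq01 f g -> eq01 g h -> eq01 f h.
Proof. by apply: aeS2 => x h1 h2 xI; rewrite h1 // h2. Qed.

Lemma inner_eq01l f f' g : L2 0 1 f -> L2 0 1 f' -> L2 0 1 g -> eq01 f f' ->
  inner f g = inner f' g.
Proof.
move=> hf hf' hg e; congr fine; apply: ae_eq_integral => //.
- exact: measurable_int (L2_mul_integrable hf hg).
- exact: measurable_int (L2_mul_integrable hf' hg).
- by apply: aeS e => x ex xI; rewrite ex // inE.
Qed.

Lemma inner_eq01r f g g' : L2 0 1 f -> L2 0 1 g -> L2 0 1 g' -> eq01 g g' ->
  inner f g = inner f g'.
Proof. by move=> *; rewrite innerC (@inner_eq01l g g') // innerC. Qed.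

Lemma L2norm_eq01 f g : L2 0 1 f -> L2 0 1 g -> eq01 f g -> L2norm f = L2norm g.
Proof.
move=> hf hg e; rewrite !L2normE //.
by rewrite (@inner_eq01l f g) // (@inner_eq01r _ f g).
Qed.

Lemma L2norm0_eq01 f : L2 0 1 f -> L2norm f = 0 -> eq01 f (fun _ => 0).
Proof.
move=> hf f0; have sf := integral_sqr_lty hf.
have i0 : inner f f = 0 by rewrite -L2norm_sqr // f0 expr0n.
have : (\int[leb]_(x in `]0%R, 1%R[) `|(f x ^+ 2)%:E|)%E = 0%E.
  under eq_integral do rewrite /= ger0_norm ?sqr_ge0 //.
  rewrite -[LHS]fineK; last exact: integrable_fin_num sf.
  by under eq_integral do rewrite expr2; rewrite -/(Rintegral _ _ _) -/(inner f f) i0.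
move=> /(ae_eq_integral_abs _ (measurable_oo _ _)) h.
have {}h := h (measurable_int _ sf); apply: aeS h => x h xI.
by have := h xI; rewrite /= => -[] /eqP; rewrite sqrf_eq0 => /eqP.
Qed.

End L2.

(** * Completeness of L^2(0,1) *)
Section RieszFischer.
Context {R : realType}.
Implicit Types (f g h : R -> R).

(** Fatou's lemma; the limit is allowed to be outside the space in advance. *)
Lemma inner_fatou (S : nat -> R -> R) (s f : R -> R) (K : R) :
  (forall n, L2 0 1 (S n)) -> L2 0 1 f -> measurable_fun `](0 : R), (1 : R)[ s ->
  (forall n, L2norm (fun x => S n x - f x) ^+ 2 <= K) ->
  {ae leb, forall x, x \in `]0, 1[ -> S n x @[n --> \oo] --> s x} ->
  L2 0 1 (fun x => s x - f x) /\ L2norm (fun x => s x - f x) ^+ 2 <= K.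
Proof.
move=> hS hf ms hK hcv.
have mD := measurable_oo (0 : R) 1.
have mf := L2_measurable hf.
have mSf (n : nat) : measurable_fun `](0:R), (1:R)[ (fun x => (((S n x - f x) ^+ 2)%R)%:E).
  apply/measurable_EFinP; apply: measurable_funX.
  by apply: measurable_funB => //; exact: L2_measurable.
have msf : measurable_fun `](0:R), (1:R)[ (fun x => (((s x - f x) ^+ 2)%R)%:E).
  by apply/measurable_EFinP; apply: measurable_funX; exact: measurable_funB.
have key : (\int[leb]_(x in `]0%R, 1%R[) (((s x - f x) ^+ 2)%R)%:E <= K%:E)%E.
  have intS n : (\int[leb]_(x in `]0%R, 1%R[) (((S n x - f x) ^+ 2)%R)%:E <= K%:E)%E.
    have hn := L2B (hS n) hf; have := hK n; rewrite L2norm_sqr // -lee_fin.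
    rewrite /inner /Rintegral fineK.
      by under eq_integral do rewrite -expr2.
    by apply: integrable_fin_num => //; exact: L2_mul_integrable.
  apply: (@le_trans _ _ (\int[leb]_(x in `]0%R, 1%R[) limn_einf (fun n => ((S n x - f x) ^+ 2)%:E))%E).
    apply: ae_ge0_le_integral => //.
    - by move=> x _; rewrite lee_fin sqr_ge0.
    - move=> x _; rewrite limn_einf_lim; apply: lime_ge; first exact: is_cvg_einfs.
      apply: nearW => n; apply: le_ereal_inf_tmp => _ [m /= nm <-].
      by rewrite lee_fin sqr_ge0.
    - rewrite (_ : (fun x => _) = (fun x => limn (einfs (fun n => ((S n x - f x) ^+ 2)%:E)))); last first.
        by apply/funext => x; rewrite limn_einf_lim.
      apply: (emeasurable_fun_cvg (fun n x => einfs (fun n => ((S n x - f x) ^+ 2)%:E) n)).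
        by move=> n; apply: measurable_fun_einfs.
      by move=> x _; exact: is_cvg_einfs.
    - apply: aeS hcv => x hx xI; have {}hx := hx xI.
      suff : ((S n x - f x) ^+ 2)%:E @[n --> \oo] --> ((s x - f x) ^+ 2)%:E.
        by move=> /cvg_limn_einf_sup [-> _].
      apply: cvg_EFin; first by apply: nearW.
      rewrite /comp /= expr2; under eq_fun do rewrite expr2.
      by apply: cvgM; apply: cvgB => //; exact: cvg_cst.
  apply: le_trans (fatou _ mD mSf _) _ => [n x _|]; first by rewrite lee_fin sqr_ge0.
  apply: le_trans (limn_einf_sup _) _.
  rewrite limn_esup_lim; apply: lime_le; first exact: is_cvg_esups.
  apply: nearW => n; apply: ge_ereal_sup => _ [m _ <-]; exact: intS.
have h : L2 0 1 (fun x => s x - f x).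
  by apply/L2P; split; [exact: measurable_funB | apply: le_lt_trans key _; rewrite ltry].
split=> //; rewrite L2norm_sqr // -lee_fin /inner /Rintegral fineK.
  by under eq_integral do rewrite -expr2.
by apply: integrable_fin_num => //; exact: L2_mul_integrable.
Qed.

(** A subsequence with increments at most [2^-k] has an almost everywhere absolutely convergent
    telescoping series, whose sum is the limit; the distance to it is estimated by Fatou. *)
Lemma L2_complete (S : nat -> R -> R) : (forall n, L2 0 1 (S n)) ->
  (forall e : R, 0 < e -> exists N, forall n m, (N <= n)%N -> (N <= m)%N ->
     L2norm (fun x => S n x - S m x) <= e) ->
  exists f, L2 0 1 f /\ L2norm (fun x => f x - S n x) @[n --> \oo] --> (0 : R).
Proof.
move=> hS hC; have mD := measurable_oo (0 : R) 1.
have /choice [M hM] : forall k : nat, exists N, forall n m, (N <= n)%N -> (N <= m)%N ->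
    L2norm (fun x => S n x - S m x) <= 2^-1 ^+ k.
  by move=> k; apply: hC; rewrite exprn_gt0.
(* an increasing sequence of ranks beyond the M k *)
pose N k := \sum_(i < k.+1) M i.
have MN k : (M k <= N k)%N by rewrite /N big_ord_recr leq_addl.
have Nnd k : (N k <= N k.+1)%N by rewrite /N [X in (_ <= X)%N]big_ord_recr leq_addr.
pose d k x : R := `|S (N k.+1) x - S (N k) x|.
have hd k : L2 0 1 (fun x => S (N k.+1) x - S (N k) x) by exact: L2B.
have md (k : nat) : measurable_fun `](0:R), (1:R)[ (fun x => (d k x)%:E).
  by apply/measurable_EFinP; apply: measurableT_comp => //; exact: L2_measurable (hd k).
have dabs k : L2 0 1 (d k).
  apply/L2P; split; first by apply/measurable_EFinP; exact: md.
  have /L2P[_] := hd k; congr (_ < _)%E; apply: eq_integral => x _.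
  by rewrite /d real_normK ?num_real.
have intd k : (\int[leb]_(x in `]0%R, 1%R[) (d k x)%:E <= (2^-1 ^+ k)%:E)%E.
  have one : L2 0 1 (fun _ : R => 1) by exact: L2_cst.
  have n1 : L2norm (fun _ : R => 1) = 1.
    rewrite L2normE // /inner /Rintegral integral_cst // -[X in (_ * X)%E]/(leb _).
    by rewrite lebesgue_measure_itv /= lte_fin ltr01 -EFinB -EFinM subr0 !mulr1 sqrtr1.
  have := inner_le (dabs k) one; rewrite n1 mulr1 => h.
  have e : L2norm (d k) = L2norm (fun x => S (N k.+1) x - S (N k) x).
    rewrite !L2normE //; congr Num.sqrt; apply: eq_Rintegral => x _.
    by rewrite -!expr2 /d real_normK ?num_real.
  have h2 : `|inner (d k) (fun _ => 1)| <= 2^-1 ^+ k.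
    apply: le_trans h _; rewrite e; apply: hM; last exact: MN.
    exact: leq_trans (MN k) (Nnd k).
  have h3 := le_trans (ler_norm _) h2; rewrite -lee_fin /inner /Rintegral fineK in h3.
    by under eq_integral do rewrite -[d k _]mulr1.
  by apply: integrable_fin_num => //; exact: L2_mul_integrable.
have aefin : {ae leb, forall x, x \in `]0, 1[ -> (\sum_(k <oo) (d k x)%:E < +oo)%E}.
  have ig : leb.-integrable `]0%R, 1%R[ (fun x => (\sum_(k <oo) (d k x)%:E)%E).
    apply/integrableP; split.
      have d0 (k : nat) (x : measurableTypeR R) : `]0%R, 1%R[%classic x -> xpredT k -> (0 <= (d k x)%:E)%E.
        by move=> _ _; rewrite lee_fin normr_ge0.
      exact: (ge0_emeasurable_sum d0 (fun k _ => md k)).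
    have d0 (k : nat) (x : R) : (0 <= (d k x)%:E)%E by rewrite lee_fin normr_ge0.
    rewrite (_ : (\int[leb]_(x in _) _)%E = (\int[leb]_(x in `]0%R, 1%R[) (\sum_(k <oo) (d k x)%:E))%E); last first.
      by apply: eq_integral => x _; rewrite gee0_abs // nneseries_ge0.
    rewrite (@integral_nneseries _ _ _ leb _ mD _ md (fun k x _ => d0 k x)).
    apply: (@le_lt_trans _ _ (\sum_(k <oo) (2^-1 ^+ k)%:E)%E).
      by apply: lee_nneseries => [k _ _|k _]; [apply: integral_ge0 => x _; rewrite lee_fin normr_ge0 | exact: intd].
    have := @is_cvg_geometric_series R 1 2^-1.
    rewrite ger0_norm ?invr_ge0 // invf_lt1 ?ltr1n // => /(_ isT) cg.
    rewrite (_ : (fun n : nat => _) = EFin \o series (geometric 1 2^-1)); last first.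
      by apply/funext => n; rewrite /series /= -sumEFin; apply: eq_bigr => k _; rewrite mul1r.
    by rewrite EFin_lim ?ltry.
  have := integrable_ae mD ig; apply: aeS => x h xI.
  by have /(_ xI) := h; rewrite fin_numElt => /andP[].
(* the upper limit is measurable even where the subsequence diverges *)
pose s x : R := fine (limn_esup (fun k => (S (N k) x)%:E)).
have ms : measurable_fun `](0 : R), (1 : R)[ s.
  apply: measurableT_comp => //; apply: measurable_fun_limn_esup => k.
  by apply/measurable_EFinP; exact: L2_measurable.
have cv : {ae leb, forall x, x \in `]0, 1[ -> S (N k) x @[k --> \oo] --> s x}.
  apply: aeS aefin => x h xI; have {}h := h xI.
  have cs : cvgn (series (fun k => S (N k.+1) x - S (N k) x)).
    apply: normed_cvg; apply: nondecreasing_is_cvgn.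
      by apply: nondecreasing_series => k _ /=; rewrite normr_ge0.
    exists (fine (\sum_(k <oo) (d k x)%:E)%E) => _ [n _ <-].
    rewrite -lee_fin fineK; last first.
      by rewrite ge0_fin_numE // nneseries_ge0 // => k _ _; rewrite lee_fin normr_ge0.
    rewrite /series /= -sumEFin; apply: nneseries_lim_ge => k _ _.
    by rewrite lee_fin normr_ge0.
  have {}cs : cvgn (fun k => S (N k) x).
    have -> : (fun k => S (N k) x) = (fun k => series (fun k => S (N k.+1) x - S (N k) x) k + S (N 0%N) x).
      by apply/funext => k; rewrite /series /= telescope_sumr // subrK.
    by apply: is_cvgD => //; exact: is_cvg_cst.
  have : (S (N k) x)%:E @[k --> \oo] --> (limn (fun k => S (N k) x))%:E.
    by apply: cvg_EFin; [exact: nearW | exact: cs].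
  by move=> /cvg_limn_einf_sup [_ es]; rewrite /s es.
exists s.
have main k n : (M k <= n)%N -> L2 0 1 (fun x => s x - S n x) /\
    L2norm (fun x => s x - S n x) ^+ 2 <= (2^-1 ^+ k) ^+ 2.
  move=> kn; apply: (@inner_fatou (fun j => S (N (j + k)%N))) => //.
    move=> j; rewrite ler_sqr ?nnegrE ?L2norm_ge0 ?exprn_ge0 //; apply: hM => //.
    apply: leq_trans (MN k) _; elim: j => // j IH; exact: leq_trans IH (Nnd _).
  apply: aeS cv => x h xI; have {}h := h xI.
  by rewrite (cvg_shiftn k (fun j => S (N j) x)).
split.
  have [h _] := main 0%N _ (leqnn _); have := L2D h (hS (M 0%N)).
  by rewrite (_ : (fun x => s x - S (M 0%N) x + S (M 0%N) x) = s) //; apply/funext => x; rewrite subrK.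
apply/cvgrPdist_le => e e0.
have : (fun k => 2^-1 ^+ k : R) @ \oo --> (0 : R).
  by apply: cvg_expr; rewrite ger0_norm ?invr_ge0 // invf_lt1 ?ltr1n.
move=> /cvgrPdist_le /(_ _ e0) [k _ hk].
exists (M k) => // n /= kn; rewrite sub0r normrN ger0_norm ?L2norm_ge0 //.
have [_ h] := main k n kn.
rewrite ler_sqr ?nnegrE ?L2norm_ge0 ?exprn_ge0 // in h.
apply: le_trans h _; apply: le_trans (ler_norm _) _.
by have := hk k (leqnn _); rewrite sub0r normrN.
Qed.

End RieszFischer.

(** * Orthonormal systems of L^2(0,1) *)
Section Orthonormal.
Context {R : realType}.
Variable e : nat -> R -> R.
Implicit Types (f g : R -> R) (a b : nat -> R).
Hypothesis e_L2 : forall n, L2 0 1 (e n).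
Hypothesis e_on : forall n m, inner (e n) (e m) = (n == m)%:R.

Definition fsum a (N : nat) (x : R) : R := \sum_(n < N) a n * e n x.

(** A function together with its coefficients: everything below is a computation on
    coefficients, and [expands] is the dictionary. *)
Definition expands f a : Prop :=
  L2 0 1 f /\ L2norm (fun x => f x - fsum a N x) @[N --> \oo] --> (0 : R).

Lemma fsum_L2 a N : L2 0 1 (fsum a N).
Proof. by apply: (@L2_sum _ 0 1 _ (index_enum 'I_N) (fun n x => a n * e n x)) => n; exact: L2Z. Qed.

Lemma inner_fsum a N f : L2 0 1 f -> inner (fsum a N) f = \sum_(n < N) a n * inner (e n) f.
Proof.
move=> hf; rewrite /fsum (@inner_suml _ _ (index_enum 'I_N) (fun n x => a n * e n x)) //.
  by apply: eq_bigr => n _; rewrite innerZl.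
by move=> n; exact: L2Z.
Qed.

Lemma inner_fsum_e a N m : inner (fsum a N) (e m) = if (m < N)%N then a m else 0.
Proof.
rewrite inner_fsum //; under eq_bigr do rewrite e_on.
case: ifP => mN.
  rewrite (bigD1 (Ordinal mN)) //= eqxx mulr1 big1 ?addr0 // => i ne.
  by rewrite (_ : (val i == m) = false) ?mulr0 //; apply/negbTE; apply: contraNneq ne => h; apply/eqP/val_inj.
rewrite big1 // => i _; rewrite (_ : (val i == m) = false) ?mulr0 //.
by apply: contraFF mN => /eqP <-; exact: ltn_ord.
Qed.

Lemma inner_fsum2 a b N : inner (fsum a N) (fsum b N) = \sum_(n < N) a n * b n.
Proof.
rewrite inner_fsum; last exact: fsum_L2.
by apply: eq_bigr => n _; rewrite innerC inner_fsum_e ltn_ord.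
Qed.

Lemma fsum_tail a (N M : nat) : (N <= M)%N ->
  L2norm (fun x => fsum a M x - fsum a N x) ^+ 2 = \sum_(N <= n < M) a n ^+ 2.
Proof.
move=> NM; pose d n := if (n < N)%N then 0 else a n.
have -> : (fun x => fsum a M x - fsum a N x) = fsum d M.
  apply/funext => x; rewrite /fsum -!(big_mkord xpredT (fun n => _ n * e n x)).
  rewrite (big_cat_nat (n := N)) // [in RHS](big_cat_nat (n := N)) //= addrAC subrr add0r.
  rewrite [X in _ = X + _]big_nat_cond [X in _ = X + _]big1 ?add0r; last first.
    by move=> n /andP[/andP[_ nN] _]; rewrite /d nN mul0r.
  rewrite big_nat_cond [RHS]big_nat_cond; apply: eq_bigr => n /andP[/andP[Nn _] _].
  by rewrite /d ltnNge Nn.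
rewrite L2norm_sqr; last exact: fsum_L2.
rewrite inner_fsum2 -(big_mkord xpredT (fun n => d n * d n)) (big_cat_nat (n := N)) //=.
rewrite big_nat_cond big1 ?add0r; last first.
  by move=> n /andP[/andP[_ nN] _]; rewrite /d nN mul0r.
rewrite big_nat_cond [RHS]big_nat_cond; apply: eq_bigr => n /andP[/andP[Nn _] _].
by rewrite /d ltnNge Nn -expr2.
Qed.

(** The squared norm of [f] minus its partial sum is nonnegative. *)
Lemma bessel f N : L2 0 1 f -> \sum_(n < N) inner f (e n) ^+ 2 <= L2norm f ^+ 2.
Proof.
move=> hf; pose a n := inner f (e n).
have hs := fsum_L2 a N.
have := inner_ge0 (fun x => f x - fsum a N x); have hd := L2B hf hs.
rewrite innerBl // (innerBr hf hs hf) (innerBr hf hs hs) (innerC f) inner_fsum //.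
rewrite inner_fsum2 L2norm_sqr //; under eq_bigr do rewrite innerC -expr2.
by under [X in _ - (_ - X)]eq_bigr do rewrite -expr2; rewrite subrr subr0 subr_ge0.
Qed.

Lemma expands_L2 f a : expands f a -> L2 0 1 f. Proof. by case. Qed.

Lemma cvg0_sandwich (u v : nat -> R) (l : R) : (forall n, `|u n - l| <= v n) ->
  v @ \oo --> (0 : R) -> u @ \oo --> l.
Proof.
move=> h hv; apply/cvgrPdist_le => eps e0; move/cvgrPdist_le: hv => /(_ _ e0); apply: filterS => n.
rewrite sub0r normrN => hn; rewrite distrC; apply: le_trans (h n) _.
exact: le_trans (ler_norm _) hn.
Qed.

Lemma expands_inner f a g : expands f a -> L2 0 1 g ->
  \sum_(n < N) a n * inner (e n) g @[N --> \oo] --> inner f g.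
Proof.
move=> [hf cf] hg.
apply: (@cvg0_sandwich _ (fun N => L2norm (fun x => f x - fsum a N x) * L2norm g)).
  move=> N; have hs := fsum_L2 a N; rewrite -inner_fsum // distrC -innerBl //.
  by apply: inner_le => //; exact: L2B.
rewrite -[X in _ --> X](mul0r (L2norm g)); apply: cvgM => //; exact: cvg_cst.
Qed.

Lemma expands_coef f a n : expands f a -> inner f (e n) = a n.
Proof.
move=> h; have := expands_inner h (e_L2 n) => c1.
have c2 : \sum_(m < N) a m * inner (e m) (e n) @[N --> \oo] --> a n.
  apply: cvg_near_cst; exists n.+1 => // N /= nN; apply/eqP.
  by rewrite -inner_fsum // inner_fsum_e nN.
exact: (cvg_unique _ c1 c2).
Qed.

Lemma expands_norm f a : expands f a -> \sum_(n < N) a n ^+ 2 @[N --> \oo] --> L2norm f ^+ 2.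
Proof.
move=> h; have hf := expands_L2 h; have := expands_inner h hf; rewrite -L2norm_sqr //.
apply: cvg_trans; apply: near_eq_cvg; near=> N.
by apply: eq_bigr => n _; rewrite innerC (expands_coef n h) expr2.
Unshelve. all: by end_near. Qed.

Lemma expands_norm_ge f a N : expands f a -> \sum_(n < N) a n ^+ 2 <= L2norm f ^+ 2.
Proof.
move=> h; have hf := expands_L2 h; apply: le_trans (bessel N hf).
by apply: ler_sum => n _; rewrite (expands_coef n h).
Qed.

Lemma cvg_le_cst (u : nat -> R) (l K : R) : u @ \oo --> l -> (forall n, u n <= K) -> l <= K.
Proof.
move=> cu hu; rewrite -(cvg_lim (@Rhausdorff R) cu).
by apply: limr_le; [apply/cvg_ex; exists l | exact: nearW].
Qed.

Lemma expands_norm_le f a K : expands f a -> (forall N, \sum_(n < N) a n ^+ 2 <= K) ->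
  L2norm f ^+ 2 <= K.
Proof. by move=> h; apply: cvg_le_cst (expands_norm h). Qed.

Lemma expandsD f g a b : expands f a -> expands g b ->
  expands (fun x => f x + g x) (fun n => a n + b n).
Proof.
move=> [hf cf] [hg cg]; split; first exact: L2D.
apply: (@cvg0_sandwich _ (fun N => L2norm (fun x => f x - fsum a N x) + L2norm (fun x => g x - fsum b N x))).
  move=> N; rewrite subr0 ger0_norm ?L2norm_ge0 //.
  have := L2norm_triangle (L2B hf (fsum_L2 a N)) (L2B hg (fsum_L2 b N)).
  rewrite (_ : (fun x => f x - fsum a N x + _) = (fun x => f x + g x - fsum (fun n => a n + b n) N x)) //.
  apply/funext => x; rewrite /fsum addrACA -opprD -big_split /=; congr (_ - _).
  by apply: eq_bigr => n _; rewrite mulrDl.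
by rewrite -[X in _ --> X](addr0 0); apply: cvgD.
Qed.

Lemma expandsZ (c : R) f a : expands f a -> expands (fun x => c * f x) (fun n => c * a n).
Proof.
move=> [hf cf]; split; first exact: L2Z.
apply: (@cvg0_sandwich _ (fun N => `|c| * L2norm (fun x => f x - fsum a N x))).
  move=> N; rewrite subr0 ger0_norm ?L2norm_ge0 // -L2normZ; last exact: L2B (fsum_L2 a N).
  rewrite le_eqVlt; apply/orP; left; apply/eqP; congr L2norm; apply/funext => x.
  by rewrite mulrBr /fsum mulr_sumr; congr (_ - _); apply: eq_bigr => n _; rewrite mulrA.
by rewrite -[X in _ --> X](mulr0 `|c|); apply: cvgM => //; exact: cvg_cst.
Qed.

Lemma expands_ext f a b : (forall n, a n = b n) -> expands f a -> expands f b.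
Proof. by move=> /funext ->. Qed.

Lemma expandsB f g a b : expands f a -> expands g b ->
  expands (fun x => f x - g x) (fun n => a n - b n).
Proof.
move=> hf hg; have := expandsD hf (expandsZ (-1) hg).
rewrite (_ : (fun x => f x + -1 * g x) = (fun x => f x - g x)); last by apply/funext => x; rewrite mulN1r.
by apply: expands_ext => n; rewrite mulN1r.
Qed.

Lemma expands_eq01 f g a : expands f a -> L2 0 1 g -> eq01 f g -> expands g a.
Proof.
move=> [hf cf] hg fg; split=> //; apply: cvg_trans cf; apply: near_eq_cvg; near=> N.
have hs := fsum_L2 a N.
by apply: L2norm_eq01; [exact: L2B | exact: L2B |]; apply: aeS fg => x h /h ->.
Unshelve. all: by end_near. Qed.

Lemma expands_unique f g a : expands f a -> expands g a -> eq01 f g.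
Proof.
move=> hf hg; have h := expandsB hf hg.
have l0 : L2norm (fun x => f x - g x) = 0.
  apply/eqP; rewrite -(@sqrf_eq0 R) eq_le sqr_ge0 andbT; apply: (expands_norm_le h) => N.
  by rewrite big1 // => n _; rewrite subrr expr0n.
by apply: aeS (L2norm0_eq01 (expands_L2 h) l0) => x hx /hx /eqP; rewrite subr_eq0 => /eqP.
Qed.

(** The Riesz-Fischer theorem: square summability makes the partial sums Cauchy. *)
Lemma expands_synthesis a K : (forall N, \sum_(n < N) a n ^+ 2 <= K) -> exists f, expands f a.
Proof.
move=> hK; have [] := @L2_complete R (fsum a); first exact: fsum_L2.
  move=> eps e0; have cs : cvgn (series (fun n => a n ^+ 2)).
    apply: nondecreasing_is_cvgn; first by apply: nondecreasing_series => n _ _; exact: sqr_ge0.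
    by exists K => _ [N _ <-]; rewrite /series /= big_mkord.
  move/cauchy_cvgP/cauchy_seriesP: cs => /(_ _ (exprn_gt0 2 e0)) [[/= D1 D2] [[N1 _ h1] [N2 _ h2]] hN].
  have key n m : (maxn N1 N2 <= n)%N -> (n <= m)%N -> L2norm (fun x => fsum a m x - fsum a n x) <= eps.
    move=> hn nm; rewrite -ler_sqr ?nnegrE ?L2norm_ge0 ?(ltW e0) // fsum_tail //.
    have := hN (n, m); rewrite /= => h; apply: le_trans (ler_norm _) (ltW _); apply: h; split.
      by apply: h1; exact: leq_trans (leq_maxl _ _) hn.
    by apply: h2; apply: leq_trans nm; exact: leq_trans (leq_maxr _ _) hn.
  exists (maxn N1 N2) => n m hn hm; have [mn|nm] := leqP m n; first exact: key.
  rewrite -L2normN (_ : (fun x => _) = (fun x => fsum a m x - fsum a n x)) ?key ?(ltnW nm) //.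
  by apply/funext => x; rewrite opprB.
by move=> f [hf cf]; exists f.
Qed.

(** The series of the coefficients of [f] converges by Bessel; completeness of the system is
    only needed to know that its sum is [f]. *)
Lemma expands_complete f : L2 0 1 f ->
  (forall g, expands g (fun n => inner f (e n)) -> eq01 g f) ->
  expands f (fun n => inner f (e n)).
Proof.
move=> hf h; have [g hg] := @expands_synthesis (fun n => inner f (e n)) _ (fun N => bessel N hf).
exact: expands_eq01 hg hf (h g hg).
Qed.

End Orthonormal.

(** * Trigonometric systems *)
Section Trigonometric.
Context {R : realType}.
Implicit Types (f g h : R -> R).

Lemma Rintegral_oo_cc (a b : R) f : measurable_fun `]a, b[ f ->
  \int[leb]_(x in `]a, b[) f x = \int[leb]_(x in `[a, b]) f x.
Proof.
move=> mf; rewrite /Rintegral; congr fine; apply/esym.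
by apply: integral_itv_bndoo; apply/measurable_EFinP.
Qed.

Lemma integral_derive (F f : R -> R) (a b : R) : a < b ->
  (forall x : R, is_derive x 1 F (f x)) -> continuous f ->
  \int[leb]_(x in `]a, b[) f x = F b - F a.
Proof.
move=> ab dF cf; rewrite Rintegral_oo_cc; last first.
  by apply: measurable_funS (measurableT) _ (continuous_measurable_fun cf).
have cF : continuous F.
  by move=> x; apply: differentiable_continuous; apply/derivable1_diffP; exact: (@ex_derive _ _ _ _ _ _ _ (dF x)).
rewrite /Rintegral (@continuous_FTC2 _ f F) //.
- exact: continuous_subspaceT.
- split=> [x _||].
  + exact: (@ex_derive _ _ _ _ _ _ _ (dF x)).
  + by apply: cvg_at_right_filter; exact: cF.
  + by apply: cvg_at_left_filter; exact: cF.
- by move=> x _; rewrite derive1E; exact: (@derive_val _ _ _ _ _ _ _ (dF x)).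
Qed.

Lemma integral_derive_eq (F f : R -> R) (a b V : R) : a < b ->
  (forall x : R, is_derive x 1 F (f x)) -> continuous f -> F b - F a = V ->
  \int[leb]_(x in `]a, b[) f x = V.
Proof. by move=> ab dF cf <-; exact: integral_derive. Qed.

Lemma sin_natpi (n : nat) : sin (n%:R * pi : R) = 0.
Proof.
elim: n => [|n IH]; first by rewrite mul0r sin0.
by rewrite -natr1 mulrDl mul1r sinDpi IH oppr0.
Qed.

Lemma der_cosM (c x : R) : is_derive x 1 (fun x => cos (c * x)) (- c * sin (c * x)).
Proof.
have h := @is_derive1_comp R cos (fun x => c * x) x _ _ (is_derive_cos _) (derZ c (derId x)).
by apply: is_derive_conv h (fun _ => erefl) _; rewrite /= /GRing.scale /=; ring.
Qed.

Lemma der_sinM (c x : R) : is_derive x 1 (fun x => sin (c * x)) (c * cos (c * x)).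
Proof.
have h := @is_derive1_comp R sin (fun x => c * x) x _ _ (is_derive_sin _) (derZ c (derId x)).
by apply: is_derive_conv h (fun _ => erefl) _; rewrite /= /GRing.scale /=; ring.
Qed.

Lemma continuous_cosM (c : R) : continuous (fun x : R => cos (c * x)).
Proof.
by move=> x; apply: differentiable_continuous; apply/derivable1_diffP; exact: (@ex_derive _ _ _ _ _ _ _ (der_cosM c x)).
Qed.

Lemma continuous_sinM (c : R) : continuous (fun x : R => sin (c * x)).
Proof.
by move=> x; apply: differentiable_continuous; apply/derivable1_diffP; exact: (@ex_derive _ _ _ _ _ _ _ (der_sinM c x)).
Qed.

Definition cosk (n : nat) (x : R) : R := cos (n%:R * pi * x).

Lemma continuous_cosk n : continuous (cosk n). Proof. exact: continuous_cosM. Qed.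
Lemma cosk_L2 n : L2 0 1 (cosk n). Proof. by apply: continuous_L2; exact: continuous_cosk. Qed.

Lemma integral_cosk n : \int[leb]_(x in `](0:R), 1[) cosk n x = (n == 0%N)%:R.
Proof.
case: n => [|n] /=.
  have := @integral_derive (fun x => x) (fun=> 1) 0 1 ltr01 (fun x => derId x) (@cst_continuous _ _ _).
  by rewrite subr0 => h; rewrite -[RHS]h; apply: eq_Rintegral => x _; rewrite /cosk !mul0r cos0.
have c0 : n.+1%:R * pi != 0 :> R by rewrite mulf_neq0 // gt_eqF // ?pi_gt0.
apply: (@integral_derive_eq (fun x => (n.+1%:R * pi)^-1 * sin (n.+1%:R * pi * x))) ltr01 _ _ _.
- by move=> x; apply: is_derive_conv (derZ _ (der_sinM _ x)) (fun _ => erefl) _; rewrite mulrA mulVf // mul1r.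
- exact: continuous_cosk.
- by rewrite mulr1 sin_natpi !mulr0 sin0 mulr0 subr0.
Qed.

Lemma inner_cosk_cosk n m : (m <= n)%N ->
  2 * inner (cosk n) (cosk m) = ((n + m)%N == 0%N)%:R + ((n - m)%N == 0%N)%:R.
Proof.
move=> mn; rewrite -!integral_cosk -RintegralD //; try exact: L2_integrable (cosk_L2 _).
rewrite /inner -RintegralZl //; last exact: L2_mul_integrable (cosk_L2 _) (cosk_L2 _).
apply: eq_Rintegral => x _; rewrite /cosk natrD natrB //.
rewrite (_ : (n%:R + m%:R) * pi * x = n%:R * pi * x + m%:R * pi * x); last by ring.
rewrite (_ : (n%:R - m%:R) * pi * x = n%:R * pi * x - m%:R * pi * x); last by ring.
rewrite cosD cosB; ring.
Qed.

Definition sink (n : nat) (x : R) : R := sin (n%:R * pi * x).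
Lemma continuous_sink n : continuous (sink n). Proof. exact: continuous_sinM. Qed.
Lemma sink_L2 n : L2 0 1 (sink n). Proof. by apply: continuous_L2; exact: continuous_sink. Qed.

Lemma inner_sink_sink n m : (m <= n)%N ->
  2 * inner (sink n) (sink m) = ((n - m)%N == 0%N)%:R - ((n + m)%N == 0%N)%:R.
Proof.
move=> mn; rewrite -!integral_cosk -RintegralB //; try exact: L2_integrable (cosk_L2 _).
rewrite /inner -RintegralZl //; last exact: L2_mul_integrable (sink_L2 _) (sink_L2 _).
apply: eq_Rintegral => x _; rewrite /cosk /sink natrD natrB //.
rewrite (_ : (n%:R + m%:R) * pi * x = n%:R * pi * x + m%:R * pi * x); last by ring.
rewrite (_ : (n%:R - m%:R) * pi * x = n%:R * pi * x - m%:R * pi * x); last by ring.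
rewrite cosB cosD; ring.
Qed.

Definition cosb (n : nat) (x : R) : R := Num.sqrt 2 * cos (nu n * x).
Definition sinb (n : nat) (x : R) : R := Num.sqrt 2 * sin (nu n * x).

Lemma continuous_cosb n : continuous (cosb n).
Proof. by move=> x; apply: cvgM; [exact: cvg_cst | exact: continuous_cosM]. Qed.
Lemma continuous_sinb n : continuous (sinb n).
Proof. by move=> x; apply: cvgM; [exact: cvg_cst | exact: continuous_sinM]. Qed.
Lemma cosb_L2 n : L2 0 1 (cosb n). Proof. by apply: continuous_L2; exact: continuous_cosb. Qed.
Lemma sinb_L2 n : L2 0 1 (sinb n). Proof. by apply: continuous_L2; exact: continuous_sinb. Qed.

Lemma sqrt2_sqr : Num.sqrt 2 * Num.sqrt 2 = 2 :> R.
Proof. by rewrite -expr2 sqr_sqrtr. Qed.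

Lemma cosb_on n m : inner (cosb n) (cosb m) = (n == m)%:R.
Proof.
wlog mn : n m / (m <= n)%N => [h|].
  by have [|/ltnW] := leqP m n => mn; [exact: h | rewrite innerC h // eq_sym].
have -> : inner (cosb n) (cosb m) = 2 * inner (cosk n.+1) (cosk m.+1).
  have := cosk_L2 n.+1; have := cosk_L2 m.+1 => h1 h2.
  rewrite (_ : cosb n = fun x => Num.sqrt 2 * cosk n.+1 x) // (_ : cosb m = fun x => Num.sqrt 2 * cosk m.+1 x) //.
  by rewrite innerZl ?innerZr // ?mulrA ?sqrt2_sqr //; exact: L2Z.
by rewrite inner_cosk_cosk // addSn /= add0r subSS subn_eq0 eqn_leq mn andbT.
Qed.

Lemma sinb_on n m : inner (sinb n) (sinb m) = (n == m)%:R.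
Proof.
wlog mn : n m / (m <= n)%N => [h|].
  by have [|/ltnW] := leqP m n => mn; [exact: h | rewrite innerC h // eq_sym].
have -> : inner (sinb n) (sinb m) = 2 * inner (sink n.+1) (sink m.+1).
  have := sink_L2 n.+1; have := sink_L2 m.+1 => h1 h2.
  rewrite (_ : sinb n = fun x => Num.sqrt 2 * sink n.+1 x) // (_ : sinb m = fun x => Num.sqrt 2 * sink m.+1 x) //.
  by rewrite innerZl ?innerZr // ?mulrA ?sqrt2_sqr //; exact: L2Z.
by rewrite inner_sink_sink // addSn /= subr0 subSS subn_eq0 eqn_leq mn andbT.
Qed.

Lemma der_cosb n (x : R) : is_derive x 1 (cosb n) (- nu n * sinb n x).
Proof.
apply: is_derive_conv (derZ (Num.sqrt 2) (der_cosM (nu n) x)) (fun _ => erefl) _.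
by rewrite /sinb; ring.
Qed.

Lemma der_sinb n (x : R) : is_derive x 1 (sinb n) (nu n * cosb n x).
Proof.
apply: is_derive_conv (derZ (Num.sqrt 2) (der_sinM (nu n) x)) (fun _ => erefl) _.
by rewrite /cosb; ring.
Qed.

Lemma sinb0 n : sinb n 0 = 0. Proof. by rewrite /sinb mulr0 sin0 mulr0. Qed.
Lemma sinb1 n : sinb n 1 = 0. Proof. by rewrite /sinb mulr1 sin_natpi mulr0. Qed.

Lemma integral_cosb n : inner (cosb n) (fun _ => 1) = 0.
Proof.
rewrite /inner; under eq_Rintegral do rewrite mulr1.
apply: (@integral_derive_eq (fun x => (nu n)^-1 * sinb n x)) ltr01 _ _ _.
- move=> x; apply: is_derive_conv (derZ _ (der_sinb n x)) (fun _ => erefl) _.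
  by rewrite mulrA mulVf ?mul1r // nu_neq0.
- exact: continuous_cosb.
- by rewrite sinb1 sinb0 subrr.
Qed.

Definition one_coef n : R := inner (sinb n) (fun _ => 1).

Lemma L2norm1 : L2norm (fun _ : R => 1) ^+ 2 = 1.
Proof.
rewrite L2norm_sqr /inner; last exact: L2_cst.
apply: (@integral_derive_eq (fun x => x)) ltr01 _ _ _; last by rewrite subr0.
  by move=> x; rewrite mulr1; exact: derId.
by rewrite mulr1; exact: cst_continuous.
Qed.

(** Bessel's inequality for the constant 1. *)
Lemma one_coef_sum N : \sum_(n < N) one_coef n ^+ 2 <= 1.
Proof.
rewrite -L2norm1; under eq_bigr do rewrite /one_coef innerC.
by apply: bessel; [exact: sinb_L2 | exact: sinb_on | exact: L2_cst].
Qed.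

(** Integration by parts: [x sinb n x] vanishes at both ends.  It turns the moments against
    [x] of the feedback into the coefficients [one_coef]. *)
Lemma inner_id_cosb n : inner (fun x => x) (cosb n) = - (one_coef n / nu n).
Proof.
have c1 : continuous (fun x : R => x * cosb n x).
  by move=> x; apply: cvgM; [exact: cvg_id | exact: continuous_cosb].
have c2 : continuous (fun x : R => sinb n x + nu n * (x * cosb n x)).
  move=> x; apply: cvgD; first exact: continuous_sinb.
  by apply: cvgM; [exact: cvg_cst | exact: c1].
have h : \int[leb]_(x in `](0:R), 1[) (sinb n x + nu n * (x * cosb n x)) = 0.
  apply: (@integral_derive_eq (fun x => x * sinb n x)) ltr01 _ c2 _; last by rewrite sinb1 sinb0 !mulr0 subrr.
  move=> x; apply: is_derive_conv (derM (derId x) (der_sinb n x)) (fun _ => erefl) _; ring.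
have i1 : leb.-integrable `](0:R), 1[ (EFin \o (fun x => x * cosb n x)).
  exact: L2_integrable (continuous_L2 0 1 c1).
have i2 : leb.-integrable `](0:R), 1[ (EFin \o (fun x => nu n * (x * cosb n x))).
  exact: integrable_EFinZ.
rewrite RintegralD // in h; last exact: L2_integrable (sinb_L2 n).
rewrite RintegralZl // in h; rewrite /one_coef /inner.
rewrite (_ : \int[leb]_(x in `]0, 1[) (sinb n x * 1) = \int[leb]_(x in `]0, 1[) sinb n x); last first.
  by apply: eq_Rintegral => x _; rewrite mulr1.
apply: (mulfI (nu_neq0 n)); move/eqP: h; rewrite addrC addr_eq0 => /eqP ->.
by rewrite mulrN mulrCA divff ?nu_neq0 // mulr1.
Qed.

(** By [inner_id_cosb] these are the cosine coefficients of [x], and the squared norm of [x] is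
    [1/3]. *)
Lemma one_coef_nu_sum N : \sum_(n < N) (one_coef n / nu n) ^+ 2 <= 3^-1.
Proof.
have cI : continuous (fun x : R => x) by move=> x; exact: cvg_id.
have -> : 3^-1 = L2norm (fun x : R => x) ^+ 2.
  rewrite L2norm_sqr /inner; last exact: continuous_L2.
  apply/esym; apply: (@integral_derive_eq (fun x => 3^-1 * (x * (x * x)))) ltr01 _ _ _; last by field.
    move=> x; apply: is_derive_conv (derZ _ (derM (derId x) (derM (derId x) (derId x)))) (fun _ => erefl) _; by field.
  by move=> x; apply: cvgM; exact: cvg_id.
under eq_bigr do rewrite -sqrrN -inner_id_cosb.
by apply: bessel; [exact: cosb_L2 | exact: cosb_on | exact: continuous_L2].
Qed.

End Trigonometric.

(** * Completeness of the trigonometric systems *)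
Section Completeness.
Context {R : realType}.
Implicit Types (f g h : R -> R).

Lemma continuous_mul (f g : R -> R) : continuous f -> continuous g -> continuous (fun x => f x * g x).
Proof. by move=> cf cg x; apply: cvgM; [exact: cf | exact: cg]. Qed.

Lemma continuousX (f : R -> R) n : continuous f -> continuous (fun x => f x ^+ n).
Proof.
move=> cf; elim: n => [|n IH]; first by under eq_fun do rewrite expr0; exact: cst_continuous.
by under eq_fun do rewrite exprS; exact: continuous_mul.
Qed.

(** By the product formula for cosines the system [cosk] spans the powers of [cos (pi x)]. *)
Lemma orthogonal_cos_powers g : L2 0 1 g -> (forall n, inner g (cosk n) = 0) ->
  forall (q : {poly R}), inner g (fun x => q.[cos (pi * x)]) = 0.
Proof.
move=> hg g0; pose C (x : R) := cos (pi * x).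
have cC : continuous C by exact: continuous_cosM.
have L j k : L2 0 1 (fun x => cosk k x * C x ^+ j).
  by apply: continuous_L2; apply: continuous_mul; [exact: continuous_cosk | exact: continuousX].
have key j : forall k, inner g (fun x => cosk k x * C x ^+ j) = 0.
  elim: j => [|j IH] k.
    by under [X in inner _ X]eq_fun do rewrite expr0 mulr1.
  case: k => [|k].
    rewrite -(IH 1%N); congr inner; apply/funext => x.
    by rewrite /cosk !mul0r cos0 !mul1r exprS.
  have e x : cosk k.+1 x * C x ^+ j.+1 = 2^-1 * (cosk k.+2 x * C x ^+ j) + 2^-1 * (cosk k x * C x ^+ j).
    have -> : cosk k.+2 x = cosk k.+1 x * C x - sin (k.+1%:R * pi * x) * sin (pi * x).
      by rewrite /cosk -cosD; congr cos; rewrite -[in LHS]natr1; ring.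
    have -> : cosk k x = cosk k.+1 x * C x + sin (k.+1%:R * pi * x) * sin (pi * x).
      by rewrite /cosk -cosB; congr cos; rewrite -natr1; ring.
    by rewrite exprS; field.
  under [X in inner _ X]eq_fun do rewrite e.
  by rewrite innerDr ?innerZr ?IH ?mulr0 ?addr0 //; exact: L2Z.
move=> q; have -> : (fun x => q.[cos (pi * x)]) = (fun x => \sum_(i < size q) q`_i * (cosk 0 x * C x ^+ i)).
  by apply/funext => x; rewrite horner_coef; apply: eq_bigr => i _; rewrite /cosk !mul0r cos0 mul1r.
rewrite innerC (@inner_suml _ _ (index_enum _) (fun (i : 'I_(size q)) x => q`_i * (cosk 0 x * C x ^+ i))) //.
  by rewrite big1 // => i _; rewrite innerZl // innerC key mulr0.
by move=> i; exact: L2Z.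
Qed.

(** By Bernoulli's inequality the polynomials [(1 - t^n)^(2^n)] approach the indicator of
    [t < 1/2] on ]0,1[, boundedly: [2^n t^n] tends to 0 below 1/2 and to infinity above. *)
Lemma threshold_lt (t : R) : 0 < t -> t < 2^-1 -> (1 - t ^+ n) ^+ (2 ^ n) @[n --> \oo] --> (1 : R).
Proof.
move=> t0 t1; have t1' : t <= 1 by lra.
have c : (2 * t) ^+ n @[n --> \oo] --> (0 : R) by apply: cvg_expr; rewrite ger0_norm; lra.
apply: (cvg0_sandwich _ c) => n.
have tn : 0 <= t ^+ n <= 1 by rewrite exprn_ge0 ?(ltW t0) // exprn_ile1 // ltW.
have bern N : 1 - N%:R * t ^+ n <= (1 - t ^+ n) ^+ N.
  elim: N => [|N IH]; first by rewrite mul0r subr0 expr0.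
  rewrite exprS; have := ler_wpM2l (_ : 0 <= 1 - t ^+ n) IH; rewrite -natr1 => h.
  apply: le_trans (h _); last by lra.
  have N0 : 0 <= N%:R :> R by [].
  move/andP: tn => [tn0 tn1]; nra.
have := bern (2 ^ n)%N; rewrite natrX -exprMn => h.
have h1 : (1 - t ^+ n) ^+ (2 ^ n) <= 1 by apply: exprn_ile1; lra.
by rewrite ler0_norm; lra.
Qed.

Lemma threshold_gt (t : R) : 2^-1 < t -> t < 1 -> (1 - t ^+ n) ^+ (2 ^ n) @[n --> \oo] --> (0 : R).
Proof.
move=> t0 t1; have tp : 0 < t by lra.
have c : ((2 * t)^-1) ^+ n @[n --> \oo] --> (0 : R).
  by apply: cvg_expr; rewrite ger0_norm ?invr_ge0; [rewrite invf_lt1; lra | lra].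
apply: (cvg0_sandwich _ c) => n.
have tn0 : 0 < t ^+ n by rewrite exprn_gt0.
have tn1 : t ^+ n <= 1 by apply: exprn_ile1; lra.
have bern N : (1 - t ^+ n) ^+ N * (1 + N%:R * t ^+ n) <= 1.
  elim: N => [|N IH]; first by rewrite mul0r addr0 expr0 mul1r.
  rewrite exprS -natr1.
  have p0 : 0 <= (1 - t ^+ n) ^+ N by apply: exprn_ge0; lra.
  have N0 : 0 <= N%:R :> R by [].
  apply: le_trans IH; rewrite mulrAC -mulrA [X in _ <= X]mulrC -subr_ge0.
  rewrite (_ : _ - _ = (1 - t ^+ n) ^+ N * ((N%:R + 1) * t ^+ n * t ^+ n)); last by ring.
  by pos.
have := bern (2 ^ n)%N; rewrite natrX -exprMn => h.
have p0 : 0 <= (1 - t ^+ n) ^+ (2 ^ n) by apply: exprn_ge0; lra.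
have q0 : 0 < (2 * t) ^+ n by rewrite exprn_gt0; lra.
rewrite subr0 ger0_norm // exprVn -[leRHS]mul1r ler_pdivlMr //.
by lra.
Qed.

(** The indicator of [x0 < x] is a bounded pointwise limit of polynomials in [cos (pi x)],
    since [cos (pi x)] decreases on ]0,1[; the affine map [tau] sends the threshold
    [cos (pi x0)] to 1/2 and keeps the values inside ]0,1[. *)
Lemma integral_tail_eq0 g (x0 : R) : 0 < x0 -> x0 < 1 -> L2 0 1 g ->
  (forall n, inner g (cosk n) = 0) -> \int[leb]_(x in `](0:R), 1[) (g x * (x0 < x)%R%:R) = 0.
Proof.
move=> x00 x01 hg g0; have mD := measurable_oo (0 : R) 1.
pose tau : R -> R := fun x => 2^-1 + 8^-1 * (cos (pi * x) - cos (pi * x0)).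
pose q n : {poly R} := (1 - (2^-1%:P + 8^-1%:P * ('X - (cos (pi * x0))%:P)) ^+ n) ^+ (2 ^ n).
have qE n x : (q n).[cos (pi * x)] = (1 - tau x ^+ n) ^+ (2 ^ n).
  by rewrite /q !(hornerE, horner_exp).
have cosx (x : R) : 0 < x < 1 -> -1 <= cos (pi * x) <= 1 by move=> _; rewrite cos_geN1 cos_le1.
have ctau : continuous tau.
  move=> x; apply: cvgD; first exact: cvg_cst.
  by apply: cvgM; [exact: cvg_cst | apply: cvgB; [exact: continuous_cosM | exact: cvg_cst]].
have cq n : continuous (fun x => (1 - tau x ^+ n) ^+ (2 ^ n)).
  by apply: continuousX => x; apply: cvgB; [exact: cvg_cst | exact: continuousX].
have mg := L2_measurable hg.
have tau_bd x : 0 < tau x < 1.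
  rewrite /tau; have := cos_geN1 (pi * x); have := cos_le1 (pi * x).
  have := cos_geN1 (pi * x0); have := cos_le1 (pi * x0); lra.
have pt : (0 : R) < pi := pi_gt0 R.
have cv x : 0 < x < 1 -> x != x0 -> (1 - tau x ^+ n) ^+ (2 ^ n) @[n --> \oo] --> ((x0 < x)%R%:R : R).
  move=> /andP[x_0 x_1] xx0; have := tau_bd x => tb.
  have i1 : pi * x \in `[0, pi].
    by rewrite in_itv /= mulr_ge0 ?(ltW pt) ?(ltW x_0) //= ger_pMr // ltW.
  have i0 : pi * x0 \in `[0, pi].
    by rewrite in_itv /= mulr_ge0 ?(ltW pt) ?(ltW x00) //= ger_pMr // ltW.
  case: ltgtP xx0 => // lt _.
    have : cos (pi * x) < cos (pi * x0) by rewrite ltr_cos // ltr_pM2l.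
    by move=> h; apply: threshold_lt; rewrite /tau in tb *; lra.
  have : cos (pi * x0) < cos (pi * x) by rewrite ltr_cos // ltr_pM2l.
  by move=> h; apply: threshold_gt; rewrite /tau in tb *; lra.
have mind : measurable_fun `](0:R), 1[ (fun x : R => g x * (x0 < x)%R%:R).
  apply: measurable_funM => //.
  rewrite (_ : (fun x : R => (x0 < x)%R%:R) = \1_(`]x0, +oo[ : set R)).
    exact: measurable_indic.
  by apply/funext => x; rewrite indicE mem_setE in_itv /= andbT.
have [] := @dominated_convergence _ _ R leb `]0%R, 1%R[%classic mD
  (fun n x => (g x * (1 - tau x ^+ n) ^+ (2 ^ n))%:E) (fun x => (g x * (x0 < x)%R%:R)%:E) (fun x => `|g x|%:E).
- move=> n; apply/measurable_EFinP; apply: measurable_funM => //.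
  by apply: measurable_funS (measurableT) _ (continuous_measurable_fun (cq n)).
- exact/measurable_EFinP.
- have n0 : {ae leb, forall x : R, x != x0}.
    exists [set x0]; split; [exact: measurable_set1 | exact: lebesgue_measure_set1 |].
    by move=> x /= /negP; rewrite negbK => /eqP.
  apply: aeS n0 => x xx0; rewrite /= in_itv /= => x01'.
  apply: cvg_EFin; first exact: nearW.
  by apply: cvgM; [exact: cvg_cst | exact: cv].
- by have := integrable_norm (L2_integrable hg).
- apply: aeW => x n _; rewrite abse_EFin lee_fin normrM ler_piMr //.
  have /andP[t0 t1] := tau_bd x.
  have tn1 : tau x ^+ n <= 1 by apply: exprn_ile1; lra.
  have tn0 : 0 <= tau x ^+ n by apply: exprn_ge0; lra.
  by rewrite ger0_norm; [apply: exprn_ile1 | apply: exprn_ge0]; lra.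
move=> ig _; rewrite /=.
rewrite (_ : (fun n => _) = fun _ => 0%E); last first.
  apply/funext => n; have ii := L2_mul_integrable hg (continuous_L2 0 1 (cq n)).
  rewrite -[LHS]fineK; last exact: integrable_fin_num.
  rewrite -[fine _]/(inner g (fun x => (1 - tau x ^+ n) ^+ (2 ^ n))).
  under [X in inner _ X]eq_fun do rewrite -qE.
  by rewrite orthogonal_cos_powers.
move=> h; have h0 := @cvg_unique _ (@ereal_hausdorff R) _ _ _ _ h (cvg_cst _).
by rewrite /Rintegral h0.
Qed.

(** All the integrals of [g] over [0,x] vanish, so [g = 0] at its Lebesgue points. *)
Lemma cos_complete g : L2 0 1 g -> (forall n, inner g (cosk n) = 0) -> eq01 g (fun _ => 0).
Proof.
move=> hg g0; have mD := measurable_oo (0 : R) 1.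
pose G := g \_ `](0:R), 1[.
have iG : leb.-integrable setT (EFin \o G).
  have := L2_integrable hg; move/(integrable_mkcond _ mD).
  by rewrite restrict_EFin.
have iGD (D : set (measurableTypeR R)) : measurable D -> leb.-integrable D (EFin \o G).
  by move=> mE; apply: integrableS iG.
have F0 (x : R) : 0 < x < 1 -> \int[leb]_(t in `]-oo, x]) G t = 0.
  move=> /andP[x0 x1].
  have tot : \int[leb]_(t in `](0:R), 1[) g t = 0.
    rewrite -[RHS](g0 0%N); apply: eq_Rintegral => t _.
    by rewrite /cosk !mul0r cos0 mulr1.
  have tl := integral_tail_eq0 x0 x1 hg g0.
  have : \int[leb]_(t in `](0:R), 1[) (g t - g t * (x < t)%R%:R) = 0.
    rewrite RintegralB ?tot ?tl ?subrr //; first exact: L2_integrable.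
    apply: (integrable_dom (g := fun t => `|g t|)) => //.
    - apply: measurable_funM; first exact: L2_measurable.
      rewrite (_ : (fun t : R => (x < t)%R%:R) = \1_(`]x, +oo[ : set R)).
        exact: measurable_indic.
      by apply/funext => t; rewrite indicE mem_setE in_itv /= andbT.
    - by move=> t _; rewrite normrM ler_piMr //; case: (x < t); rewrite ?normr1 ?normr0.
    - by have := integrable_norm (L2_integrable hg).
  move=> <-; rewrite /Rintegral; congr fine; rewrite integral_mkcond [RHS]integral_mkcond.
  apply: eq_integral => t _; rewrite !patchE /G !patchE !mem_setE !in_itv /=.
  by case: (leP t x) => h; case: ifP => // _; rewrite ?mulr0 ?subr0 ?mulr1 ?subrr //.
have loc : locally_integrable [set: R] G.
  by apply: integrable_locally => //; exact: L2_integrable.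
have := FTC1Ny (fun y => iGD _ (measurable_itv _)) loc.
apply: aeS => x [dF vF]; rewrite in_itv /= => x01.
have : (fun x => \int[leb]_(t in `]-oo, x]) G t)^`()%classic x = 0.
  rewrite derive1E (@near_eq_derive _ _ _ _ (fun _ : R => 0)) ?derive_cst //.
  near=> y; apply: F0; near: y; by apply: near_in_itvoo; rewrite in_itv /= x01.
by rewrite vF /G patchE mem_setE in_itv /= x01.
Unshelve. all: by end_near. Qed.

(** The function [g sin (pi x)] is orthogonal to all cosines, again by product formulas, and
    [sin (pi x)] does not vanish on ]0,1[. *)
Lemma sin_complete g : L2 0 1 g -> (forall n, inner g (sinb n) = 0) -> eq01 g (fun _ => 0).
Proof.
move=> hg g0.
have gs n : inner g (sink n) = 0.
  case: n => [|n].
    by rewrite innerC -(inner0l g); congr inner; apply/funext => x; rewrite /sink !mul0r sin0.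
  have := g0 n; rewrite (_ : sinb n = fun x => Num.sqrt 2 * sink n.+1 x) // innerZr //; last exact: sink_L2.
  by move/eqP; rewrite mulf_eq0 sqrtr_eq0 leNgt ltr0n /= => /eqP.
have cs : continuous (fun x : R => sin (pi * x)) by exact: continuous_sinM.
have hgs : L2 0 1 (fun x => g x * sin (pi * x)).
  apply/L2P; split; first by apply: measurable_funM; [exact: L2_measurable | apply: measurable_funS (measurableT) _ (continuous_measurable_fun cs)].
  have /L2P[mg] := hg; apply: le_lt_trans; apply: ge0_le_integral => //.
  - by move=> x _; rewrite lee_fin sqr_ge0.
  - by apply/measurable_EFinP; apply: measurable_funX; apply: measurable_funM => //; apply: measurable_funS (measurableT) _ (continuous_measurable_fun cs).
  - by apply/measurable_EFinP; apply: measurable_funX.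
  - move=> x _; rewrite lee_fin exprMn ler_piMr ?sqr_ge0 //.
have h : eq01 (fun x => g x * sin (pi * x)) (fun _ => 0).
  apply: cos_complete => // n.
  have -> : inner (fun x => g x * sin (pi * x)) (cosk n) = inner g (fun x => sin (pi * x) * cosk n x).
    by apply: eq_Rintegral => x _; rewrite mulrA.
  case: n => [|n].
    rewrite -(gs 1%N); congr inner; apply/funext => x.
    by rewrite /cosk /sink !mul0r cos0 mulr1 mul1r.
  have e x : sin (pi * x) * cosk n.+1 x = 2^-1 * sink n.+2 x - 2^-1 * sink n x.
    have -> : sink n.+2 x = sin (n.+1%:R * pi * x) * cos (pi * x) + cosk n.+1 x * sin (pi * x).
      by rewrite /cosk /sink -sinD; congr sin; rewrite -[in LHS]natr1; ring.
    have -> : sink n x = sin (n.+1%:R * pi * x) * cos (pi * x) - cosk n.+1 x * sin (pi * x).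
      by rewrite /cosk /sink -sinB; congr sin; rewrite -natr1; ring.
    by field.
  under [X in inner _ X]eq_fun do rewrite e.
  have s1 := sink_L2 n.+2; have s2 := sink_L2 n.
  by rewrite innerBr ?innerZr ?gs ?mulr0 ?subr0 //; exact: L2Z.
apply: aeS h => x h xI; have := h xI; move/eqP; rewrite mulf_eq0 => /orP[/eqP //|].
rewrite in_itv /= in xI; rewrite gt_eqF // sin_gt0_pi // mulr_gt0 ?pi_gt0 //; last by case/andP: xI.
case/andP: xI => _ x1; by rewrite -[ltRHS]mulr1 ltr_pM2l ?pi_gt0.
Qed.

Lemma expands_sinb f : L2 0 1 f -> expands sinb f (fun n => inner f (sinb n)).
Proof.
move=> hf; apply: expands_complete => //; [exact: sinb_L2 | exact: sinb_on |].
move=> g hg; have h2 := expands_L2 hg.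
have : eq01 (fun x => g x - f x) (fun _ => 0).
  apply: sin_complete; first exact: L2B.
  by move=> n; have sn := sinb_L2 n; rewrite innerBl // (expands_coef (@sinb_L2 R) (@sinb_on R) n hg) subrr.
by apply: aeS => x h /h /eqP; rewrite subr_eq0 => /eqP.
Qed.

(** The constant cosine is missing from [cosb]; the zero mean of [f] replaces it. *)
Lemma expands_cosb f : inS f -> expands cosb f (fun n => inner f (cosb n)).
Proof.
move=> [hf f0]; apply: expands_complete => //; [exact: cosb_L2 | exact: cosb_on |].
move=> g hg; have h2 := expands_L2 hg.
have : eq01 (fun x => g x - f x) (fun _ => 0).
  apply: cos_complete; first exact: L2B.
  case=> [|n]; have sn := cosk_L2 (R := R).
    rewrite innerBl //.
    have -> : cosk 0 = (fun _ : R => 1) by apply/funext => x; rewrite /cosk !mul0r cos0.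
    have -> : inner f (fun _ => 1) = 0.
      by rewrite -[RHS]f0; apply: eq_Rintegral => x _; rewrite mulr1.
    have c1 := expands_inner (@cosb_L2 R) hg (L2_cst 0 1 1).
    have c2 : \sum_(n < N) inner f (cosb n) * inner (cosb n) (fun _ => 1) @[N --> \oo] --> (0 : R).
      by under eq_fun do under eq_bigr do rewrite integral_cosb mulr0; under eq_fun do rewrite big1 //; exact: cvg_cst.
    by rewrite (cvg_unique _ c1 c2) ?subrr //; exact: Rhausdorff.
  have -> : cosk n.+1 = fun x : R => (Num.sqrt 2)^-1 * cosb n x.
    by apply/funext => x; rewrite /cosb mulrA mulVf ?mul1r // sqrtr_eq0 -ltNge.
  have cn := cosb_L2 (R := R) n.
  rewrite innerZr //; last exact: L2B.
  by rewrite innerBl // (expands_coef (@cosb_L2 R) (@cosb_on R) n hg) subrr mulr0.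
by apply: aeS => x h /h /eqP; rewrite subr_eq0 => /eqP.
Qed.

End Completeness.

(** * Weak derivatives on ]0,1[ *)
Section Cutoff.
Context {R : realType}.
Implicit Types (f g h : R -> R).

Lemma measurable_continuous (D : set (measurableTypeR R)) f : continuous f -> measurable_fun D f.
Proof. by move=> cf; apply: measurable_funS (measurableT) _ (continuous_measurable_fun cf). Qed.

Lemma is_derive_continuous f df : (forall x : R, is_derive x 1 f (df x)) -> continuous f.
Proof.
by move=> h x; apply: differentiable_continuous; apply/derivable1_diffP; exact: (@ex_derive _ _ _ _ _ _ _ (h x)).
Qed.

(** Dominated convergence with majorant [M |f|]. *)
Lemma bounded_cvg_integral (a b M : R) f (h : nat -> R -> R) (l : R -> R) :
  leb.-integrable `]a, b[ (EFin \o f) ->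
  (forall n, measurable_fun `]a, b[ (h n)) -> measurable_fun `]a, b[ l ->
  (forall n x, a < x < b -> `|h n x| <= M) ->
  (forall x, a < x < b -> h n x @[n --> \oo] --> l x) ->
  \int[leb]_(x in `]a, b[) (f x * h n x) @[n --> \oo] --> \int[leb]_(x in `]a, b[) (f x * l x).
Proof.
move=> hf mh ml hM hl; have mD := measurable_oo a b.
have mf : measurable_fun `]a, b[ f by apply/measurable_EFinP; exact: measurable_int hf.
have mfh n : measurable_fun `]a, b[ (fun x => (f x * h n x)%:E).
  by apply/measurable_EFinP; apply: measurable_funM.
have mfl : measurable_fun `]a, b[ (fun x => (f x * l x)%:E).
  by apply/measurable_EFinP; apply: measurable_funM.
have dom : leb.-integrable `]a, b[ (fun x => (M * `|f x|)%:E).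
  by apply: integrable_EFinZ => //; have := integrable_norm hf.
have c : {ae leb, forall x, `]a, b[%classic x -> (f x * h n x)%:E @[n --> \oo] --> (f x * l x)%:E}.
  apply: aeW => x; rewrite /= in_itv /= => xab.
  apply: cvg_EFin; first exact: nearW.
  by apply: cvgM; [exact: cvg_cst | exact: hl].
have le n x : a < x < b -> (`|(f x * h n x)%:E| <= (M * `|f x|)%:E)%E.
  by move=> xab; rewrite abse_EFin lee_fin normrM mulrC ler_wpM2r // hM.
have [|ii _] := @dominated_convergence _ _ R leb `]a, b[%classic mD _ _ _ mfh mfl c dom.
  by apply: aeW => x n; rewrite /= in_itv /=; exact: le.
move=> h1; have fin := integrable_fin_num mD ii.
by rewrite -(fineK fin) in h1; exact: (fine_cvg h1).
Qed.

Lemma inner_bounded_cvg (M : R) f (h : nat -> R -> R) (l : R -> R) : L2 0 1 f ->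
  (forall n, continuous (h n)) -> continuous l ->
  (forall n x, 0 < x < 1 -> `|h n x| <= M) ->
  (forall x, 0 < x < 1 -> h n x @[n --> \oo] --> l x) ->
  inner f (h n) @[n --> \oo] --> inner f l.
Proof.
move=> hf ch cl hM hl; apply: (@bounded_cvg_integral 0 1 M) => //.
- exact: L2_integrable.
- by move=> n; exact: measurable_continuous.
- exact: measurable_continuous.
Qed.

Let p (y : R) : R := Num.max 0 y.

Let p_le0 y : y <= 0 -> p y = 0. Proof. by move=> h; rewrite /p max_l. Qed.
Let p_id y : 0 <= y -> p y = y. Proof. by move=> h; rewrite /p max_r. Qed.

Let p_prop y : [/\ 0 <= p y, y <= p y & p y * p y = p y * y].
Proof. by have [h|h] := leP y 0; [rewrite p_le0 // !mul0r | rewrite p_id ?(ltW h)]; split. Qed.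

Let continuous_p : continuous p.
Proof. by move=> y; apply: (@continuous_max _ _ (fun=> 0) id); [exact: cvg_cst | exact: cvg_id]. Qed.

Let der_p2 (y : R) : is_derive y 1 (fun y => p y ^+ 2) (2 * p y).
Proof.
apply/is_derive_nearP => e e0.
have key s : `|p s ^+ 2 - p y ^+ 2 - 2 * p y * (s - y)| <= `|s - y| * `|s - y|.
  rewrite -normrM -expr2 [leRHS]ger0_norm ?sqr_ge0 // ler_norml.
  have [P0 Ps Pe] := p_prop s; have [Y0 Yy Ye] := p_prop y.
  have -> : p s ^+ 2 - p y ^+ 2 - 2 * p y * (s - y) = (p s - p y) ^+ 2 + 2 * p y * (p s - s) by ring: Ye.
  apply/andP; split.
    apply: (@le_trans _ _ 0); first by rewrite oppr_le0 sqr_ge0.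
    by rewrite addr_ge0 ?sqr_ge0 // mulr_ge0 ?subr_ge0 // mulr_ge0.
  rewrite -subr_ge0 (_ : _ - _ = ((p s - s) - (p y - y)) ^+ 2 + 2 * (p s * (p y - y))).
    by rewrite addr_ge0 ?sqr_ge0 // mulr_ge0 // mulr_ge0 // subr_ge0.
  by ring: Pe Ye.
apply/nbhs_ballP; exists e => // s; rewrite /ball /= distrC => /ltW hs.
by apply: le_trans (key s) _; exact: ler_wpM2r.
Qed.

(** A step of class C^1 from 0 (for [y <= 1]) to 1 (for [y >= 2]), made of squares of positive
    parts; its derivative is piecewise linear. *)
Definition step (y : R) : R :=
  2 * p (y - 1) ^+ 2 - 4 * p (y - 3 / 2) ^+ 2 + 2 * p (y - 2) ^+ 2.
Definition dstep (y : R) : R := 4 * p (y - 1) - 8 * p (y - 3 / 2) + 4 * p (y - 2).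

Ltac pcase := match goal with
  | |- context [p ?y] => let H := fresh in have [H|H] := leP y 0; [rewrite (p_le0 H) | rewrite (p_id (ltW H))] end.

Lemma step_le1 y : y <= 1 -> step y = 0.
Proof. by move=> h; rewrite /step !p_le0; try lra. Qed.
Lemma step_ge2 y : 2 <= y -> step y = 1.
Proof. by move=> h; rewrite /step !p_id; try lra. Qed.
Lemma dstep_le1 y : y <= 1 -> dstep y = 0.
Proof. by move=> h; rewrite /dstep !p_le0; try lra. Qed.
Lemma dstep_ge2 y : 2 <= y -> dstep y = 0.
Proof. by move=> h; rewrite /dstep !p_id; try lra. Qed.
Lemma step_in01 y : 0 <= step y <= 1.
Proof. by rewrite /step; do 3 pcase; nra. Qed.
Lemma dstep_bound y : 0 <= dstep y <= 2.
Proof. by rewrite /dstep; do 3 pcase; lra. Qed.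

Lemma der_shift f df (c m x : R) : (forall x : R, is_derive x 1 f (df x)) ->
  is_derive x 1 (fun x => f (m * x + c)) (m * df (m * x + c)).
Proof.
move=> h; have hx := derD (derZ m (derId x)) (is_derive_cst c x 1).
have := @is_derive1_comp R f (fun x => m * x + c) x _ _ (h _) hx.
by move=> h1; apply: is_derive_conv h1 (fun _ => erefl) _; rewrite mulr1 addr0 mulrC.
Qed.

Let der_p2s (c y : R) : is_derive y 1 (fun y => p (y - c) ^+ 2) (2 * p (y - c)).
Proof.
have := @der_shift (fun y => p y ^+ 2) (fun y => 2 * p y) (- c) 1 y der_p2.
by move=> h; apply: is_derive_conv h _ _ => [z|]; rewrite !mul1r.
Qed.

Lemma der_step (y : R) : is_derive y 1 step (dstep y).
Proof.
apply: is_derive_conv (derD (derB (derZ 2 (der_p2s 1 y)) (derZ 4 (der_p2s (3 / 2) y))) (derZ 2 (der_p2s 2 y))) _ _ => //.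
by rewrite /dstep; ring.
Qed.

Lemma continuous_dstep : continuous dstep.
Proof.
have c (a : R) : continuous (fun y => p (y - a)).
  move=> y; apply: (@continuous_comp _ _ _ (fun y => y - a) p); last exact: continuous_p.
  by apply: cvgB; [exact: cvg_id | exact: cvg_cst].
move=> y; apply: cvgD; [apply: cvgB |]; (apply: cvgM; [exact: cvg_cst | exact: c]).
Qed.

(** Equal to 1 except at distance less than [2 / m] from the ends, where it falls to 0. *)
Definition cutoff (m x : R) : R := step (m * x) + step (m * (1 - x)) - 1.
Definition dcutoff (m x : R) : R := m * dstep (m * x) - m * dstep (m * (1 - x)).

Let mE (m x : R) : m * (1 - x) = - m * x + m. Proof. ring. Qed.

Lemma der_stepl (m x : R) : is_derive x 1 (fun x => step (m * x)) (m * dstep (m * x)).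
Proof.
have h := @der_shift step dstep 0 m x der_step.
by apply: is_derive_conv h _ _ => [z|]; rewrite !addr0.
Qed.

Lemma der_stepr (m x : R) : is_derive x 1 (fun x => step (m * (1 - x))) (- (m * dstep (m * (1 - x)))).
Proof.
have h := @der_shift step dstep m (- m) x der_step.
by apply: is_derive_conv h _ _ => [z|]; rewrite !mE // mulNr.
Qed.

Lemma der_cut (m x : R) : is_derive x 1 (cutoff m) (dcutoff m x).
Proof.
apply: is_derive_conv (derB (derD (der_stepl m x) (der_stepr m x)) (is_derive_cst (1:R) x 1)) _ _ => //.
by rewrite subr0.
Qed.

Lemma continuous_cut m : continuous (cutoff m).
Proof. exact: is_derive_continuous (der_cut m). Qed.

Lemma continuous_dstepl (m : R) : continuous (fun x => m * dstep (m * x)).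
Proof.
move=> x; apply: cvgM; first exact: cvg_cst.
apply: (@continuous_comp _ _ _ (fun x => m * x) dstep); last exact: continuous_dstep.
by apply: cvgM; [exact: cvg_cst | exact: cvg_id].
Qed.

Lemma continuous_dstepr (m : R) : continuous (fun x : R => m * dstep (m * (1 - x))).
Proof.
move=> x; apply: cvgM; first exact: cvg_cst.
apply: (@continuous_comp _ _ _ (fun x : R => m * (1 - x)) dstep); last exact: continuous_dstep.
by apply: cvgM; [exact: cvg_cst | apply: cvgB; [exact: cvg_cst | exact: cvg_id]].
Qed.

Lemma continuous_dcut m : continuous (dcutoff m).
Proof. by move=> x; apply: cvgB; [exact: continuous_dstepl | exact: continuous_dstepr]. Qed.

Lemma cut_norm_le1 m x : `|cutoff m x| <= 1.
Proof.
rewrite /cutoff; have := step_in01 (m * x); have := step_in01 (m * (1 - x)).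
by move=> /andP[? ?] /andP[? ?]; rewrite ler_norml; apply/andP; split; lra.
Qed.

Lemma cut_out (m x : R) : 4 <= m -> x \notin `[m^-1, 1 - m^-1] -> cutoff m x = 0.
Proof.
move=> m4; have m0 : 0 < m by lra.
have mm : m * m^-1 = 1 by rewrite divff // gt_eqF.
rewrite in_itv /= negb_and -!ltNge /cutoff => /orP[h|h].
  have h2 : m * x < 1 by rewrite -mm ltr_pM2l.
  by rewrite step_le1 ?step_ge2; lra.
have h2 : m * (1 - x) < 1 by rewrite -mm ltr_pM2l //; lra.
by rewrite addrC addrA step_ge2 ?step_le1; lra.
Qed.

Lemma cut_in (m x : R) : 0 < x < 1 -> 2 <= m * x -> 2 <= m * (1 - x) -> cutoff m x = 1 /\ dcutoff m x = 0.
Proof.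
move=> x01 h1 h2; rewrite /cutoff /dcutoff !step_ge2 // !dstep_ge2 // !mulr0 subrr; split=> //.
by rewrite addrK.
Qed.

(** For [m >= 4] the two layers of [cutoff m] are disjoint, hence the shift by 4. *)
Definition rank (j : nat) : R := j.+4%:R.

Lemma rank_ge4 j : 4 <= rank j. Proof. by rewrite ler_nat. Qed.

Lemma near_rank (x K : R) : 0 < x -> \forall j \near \oo, K <= rank j * x.
Proof.
move=> x0; have [N hN] : exists N : nat, K / x <= N%:R.
  by exists (Num.trunc `|K / x|).+1; apply: le_trans (ler_norm _) (ltW (truncnS_gt _)).
exists N => // j /= Nj; rewrite -ler_pdivrMr //; apply: le_trans hN _.
by rewrite ler_nat (leq_trans Nj) // -[j.+4]/(4 + j)%N leq_addl.
Qed.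

Lemma near_cut (x : R) : 0 < x < 1 -> \forall j \near \oo, cutoff (rank j) x = 1 /\ dcutoff (rank j) x = 0.
Proof.
move=> x01; have x1 : 0 < 1 - x by lra.
have x0 : 0 < x by lra.
near=> j; apply: cut_in => //; first by near: j; exact: near_rank.
by near: j; exact: near_rank.
Unshelve. all: by end_near. Qed.

Lemma cvg_cut (x : R) : 0 < x < 1 -> cutoff (rank j) x @[j --> \oo] --> (1 : R).
Proof.
move=> x01; apply: cvg_near_cst; near=> j.
by have [->] : cutoff (rank j) x = 1 /\ dcutoff (rank j) x = 0 by near: j; exact: near_cut.
Unshelve. all: by end_near. Qed.

Lemma C1c_of_derive (a b : R) f df : (forall x : R, is_derive x 1 f (df x)) -> continuous df ->
  (exists c d, [/\ a < c, d < b & forall x, x \notin `[c, d] -> f x = 0]) -> C1c a b f.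
Proof.
move=> h cdf hs; have e : f^`()%classic = df.
  by apply/funext => x; rewrite derive1E; exact: (@derive_val _ _ _ _ _ _ _ (h x)).
by split; [move=> x; exact: (@ex_derive _ _ _ _ _ _ _ (h x)) | rewrite e | exact: hs].
Qed.

Lemma C1c_derive (a b : R) f : C1c a b f -> forall x : R, is_derive x 1 f (f^`()%classic x).
Proof. by move=> [h _ _] x; rewrite derive1E; apply: DeriveDef => //; exact: h. Qed.

(** A C^1 function times a cut-off is a test function; every boundary condition below is
    obtained by letting the layer shrink. *)
Lemma C1c_cut j f df : (forall x : R, is_derive x 1 f (df x)) -> continuous df ->
  C1c 0 1 (fun x => cutoff (rank j) x * f x).
Proof.
move=> h cdf; apply: (@C1c_of_derive _ _ _ (fun x => dcutoff (rank j) x * f x + cutoff (rank j) x * df x)).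
- by move=> x; apply: is_derive_conv (derM (der_cut (rank j) x) (h x)) (fun _ => erefl) _.
- move=> x; apply: cvgD; apply: cvgM.
  + exact: continuous_dcut.
  + exact: (is_derive_continuous h).
  + exact: continuous_cut.
  + exact: cdf.
- have r4 := rank_ge4 j; have r0 : 0 < (rank j)^-1 by rewrite invr_gt0; lra.
  exists (rank j)^-1, (1 - (rank j)^-1); split=> //; first by rewrite ltrBlDr ltrDl.
  by move=> x hx; rewrite cut_out // mul0r.
Qed.

Lemma C1c_bd (a b : R) f : C1c a b f -> f a = 0 /\ f b = 0.
Proof.
move=> [_ _ [c [d [ac db h]]]]; split; apply: h; rewrite in_itv /= negb_and -!ltNge ?ac ?db //.
by rewrite orbT.
Qed.

Lemma C1c_continuous (a b : R) f : C1c a b f -> continuous f.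
Proof. by move=> h; exact: is_derive_continuous (C1c_derive h). Qed.

Lemma C1c_L2 f : C1c 0 1 f -> L2 0 1 f /\ L2 0 1 f^`()%classic.
Proof.
move=> h; split; apply: continuous_L2; first exact: C1c_continuous h.
by case: h.
Qed.

Lemma inner_parts F f S dS : (forall x : R, is_derive x 1 F (f x)) -> continuous f ->
  (forall x : R, is_derive x 1 S (dS x)) -> continuous dS -> S 0 = 0 -> S 1 = 0 ->
  inner F dS = - inner f S.
Proof.
move=> hF cf hS cS S0 S1; have cF := is_derive_continuous hF; have cS' := is_derive_continuous hS.
have LF := continuous_L2 0 1 cF; have Lf := continuous_L2 0 1 cf.
have LS := continuous_L2 0 1 cS'; have LdS := continuous_L2 0 1 cS.
apply/eqP; rewrite -addr_eq0 /inner -RintegralD //; try exact: L2_mul_integrable.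
apply/eqP; apply: (@integral_derive_eq _ (fun x => F x * S x)) ltr01 _ _ _.
- by move=> x; apply: is_derive_conv (derM (hF x) (hS x)) (fun _ => erefl) _; rewrite addrC.
- by move=> x; apply: cvgD; apply: cvgM; [exact: cF | exact: cS | exact: cf | exact: cS'].
- by rewrite S0 S1 !mulr0 subrr.
Qed.

Lemma weak_deriv_classical F f : (forall x : R, is_derive x 1 F (f x)) -> continuous f ->
  weak_deriv 0 1 F f.
Proof.
move=> hF cf psi hpsi; have [p0 p1] := C1c_bd hpsi.
by apply: inner_parts => //; [exact: C1c_derive hpsi | case: hpsi].
Qed.

(** Testing the weak derivative against [cutoff S] and letting the layer shrink: the limit on
    the right is the boundary term of the integration by parts. *)
Lemma cvg_boundary_layer f g S dS : L2 0 1 f -> L2 0 1 g -> weak_deriv 0 1 f g ->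
  (forall x : R, is_derive x 1 S (dS x)) -> continuous dS ->
  inner f (fun x => dcutoff (rank j) x * S x) @[j --> \oo] --> - inner g S - inner f dS.
Proof.
move=> hf hg hfg hS cdS; have cS := is_derive_continuous hS.
have bnd h : continuous h -> exists M, forall j x, 0 < x < 1 -> `|cutoff (rank j) x * h x| <= M.
  move=> ch; have /compact_bounded [M [_ hM]] : compact (h @` `[0, 1]).
    by apply: continuous_compact; [exact: continuous_subspaceT | exact: segment_compact].
  exists (`|M| + 1) => j x /andP[x0 x1]; rewrite normrM -[leRHS]mul1r.
  apply: ler_pM => //; first exact: cut_norm_le1.
  apply: (hM (`|M| + 1)); first by apply: (le_lt_trans (ler_norm _)); rewrite ltrDl.
  by exists x => //=; rewrite in_itv /= !ltW.
have lim h f' : L2 0 1 f' -> continuous h -> inner f' (fun x => cutoff (rank j) x * h x) @[j --> \oo] --> inner f' h.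
  move=> hf' ch; have [M hM] := bnd h ch.
  apply: (inner_bounded_cvg hf' _ ch hM) => [j|x x01].
    by move=> x; apply: cvgM; [exact: continuous_cut | exact: ch].
  by rewrite -[X in _ --> X]mul1r; apply: cvgM; [exact: cvg_cut | exact: cvg_cst].
rewrite (_ : (fun j => _) = fun j => - inner g (fun x => cutoff (rank j) x * S x) - inner f (fun x => cutoff (rank j) x * dS x)).
  by apply: cvgB; [apply: cvgN; exact: lim | exact: lim].
apply/funext => j; have hc := C1c_cut j hS cdS; rewrite /= -[X in X - _](hfg _ hc).
have e x : (fun x => cutoff (rank j) x * S x)^`()%classic x = dcutoff (rank j) x * S x + cutoff (rank j) x * dS x.
  rewrite derive1E; apply: (@derive_val _ _ _ _ _ _ _ _).
  by apply: is_derive_conv (derM (der_cut (rank j) x) (hS x)) (fun _ => erefl) _.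
under eq_Rintegral do rewrite e.
rewrite -/(inner f (fun x => dcutoff (rank j) x * S x + cutoff (rank j) x * dS x)) innerDr ?addrK //.
- by apply: continuous_L2 => x; apply: cvgM; [exact: continuous_dcut | exact: cS].
- by apply: continuous_L2 => x; apply: cvgM; [exact: continuous_cut | exact: cdS].
Qed.

End Cutoff.

Section WeakDerivatives.
Context {R : realType}.
Implicit Types (f g h S u : R -> R).

Lemma continuous_bounded (a b : R) h : continuous h ->
  exists2 M : R, 0 < M & forall x : R, a <= x <= b -> `|h x| <= M.
Proof.
move=> ch; have /compact_bounded [M [_ hM]] : compact (h @` `[a, b]).
  by apply: continuous_compact; [exact: continuous_subspaceT | exact: segment_compact].
exists (`|M| + 1) => [|x xab]; first by rewrite ltr_wpDl.
by apply: (hM (`|M| + 1)); [apply: (le_lt_trans (ler_norm _)); rewrite ltrDl | exists x].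
Qed.

Lemma inner0r f : inner f (fun _ => 0) = 0.
Proof. by rewrite innerC inner0l. Qed.

(** The derivative of the cut-off is of order [m], on a layer of width of order [1/m]: against
    a function that vanishes at the end it stays bounded. *)
Lemma mul_dstep_le (m x y K : R) : 4 <= m -> 0 <= x -> 0 <= K -> `|y| <= K * x ->
  `|m * dstep (m * x) * y| <= 4 * K.
Proof.
move=> m4 x0 K0 hy; have m0 : 0 < m by lra.
have [h|h] := leP 2 (m * x); first by rewrite dstep_ge2 // mulr0 mul0r normr0 mulr_ge0.
rewrite !normrM (ger0_norm (ltW m0)); have /andP[d0 d2] := dstep_bound (m * x).
rewrite (ger0_norm d0); apply: (@le_trans _ _ (m * 2 * (K * x))).
  by apply: ler_pM => //; [exact: mulr_ge0 (ltW m0) d0 | rewrite ler_pM2l].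
rewrite (_ : m * 2 * (K * x) = 2 * K * (m * x)); last by ring.
rewrite (_ : 4 * K = 2 * K * 2); last by ring.
by apply: ler_wpM2l (ltW h); rewrite mulr_ge0.
Qed.

(** The test functions need not have compact support, only vanish at the ends, because the
    boundary layer term tends to 0 by dominated convergence. *)
Lemma weak_deriv_test0 f g S dS : L2 0 1 f -> L2 0 1 g -> weak_deriv 0 1 f g ->
  (forall x : R, is_derive x 1 S (dS x)) -> continuous dS -> S 0 = 0 -> S 1 = 0 ->
  inner g S = - inner f dS.
Proof.
move=> hf hg hfg hS cdS S0 S1; have cS := is_derive_continuous hS.
have c1 := cvg_boundary_layer hf hg hfg hS cdS.
have [K K0 hK] := continuous_bounded 0 1 cdS.
have Sx (x : R) : 0 < x < 1 -> `|S x| <= K * x.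
  move=> /andP[/ltW x0 /ltW x1]; rewrite -[S x]subr0 -[X in _ - X]S0 -[X in K * X]subr0.
  apply: (derive_bound x0 (fun y _ => hS y)) => y /andP[y0 yx]; apply: hK.
  by rewrite y0 (le_trans yx).
have Sx1 (x : R) : 0 < x < 1 -> `|S x| <= K * (1 - x).
  move=> /andP[/ltW x0 /ltW x1]; rewrite -normrN -[- S x]add0r -[X in X - _]S1.
  apply: (derive_bound x1 (fun y _ => hS y)) => y /andP[y0 yx]; apply: hK.
  by rewrite yx (le_trans x0).
have c2 : inner f (fun x => dcutoff (rank j) x * S x) @[j --> \oo] --> inner f (fun _ => 0).
  apply: (@inner_bounded_cvg _ (4 * K + 4 * K)) => //.
  - by move=> j x; apply: cvgM; [exact: continuous_dcut | exact: cS].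
  - exact: cst_continuous.
  - move=> j x x01; have r4 := @rank_ge4 R j; rewrite /dcutoff mulrBl.
    apply: le_trans (ler_normB _ _) _; apply: lerD; apply: mul_dstep_le => //; try exact: ltW.
    + by case/andP: x01 => /ltW.
    + exact: Sx.
    + by case/andP: x01 => _ /ltW; rewrite subr_ge0.
    + exact: Sx1.
  - move=> x x01; apply: cvg_near_cst; near=> j.
    have [_ ->] : cutoff (rank j) x = 1 /\ dcutoff (rank j) x = 0 by near: j; exact: near_cut.
    by rewrite mul0r.
rewrite inner0r in c2.
have /eqP : - inner g S - inner f dS = 0 by exact: (cvg_unique (@Rhausdorff R) c1 c2).
by rewrite subr_eq0 => /eqP <-; rewrite opprK.
Unshelve. all: by end_near. Qed.

(** A mean with weight [W] of a function that is small on the support of [W] is small. *)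
Lemma inner_layer_le f (W S : R -> R) (e K : R) : L2 0 1 f -> continuous W -> continuous S ->
  0 <= e -> 0 <= K -> (forall x, 0 <= W x) -> \int[leb]_(x in `](0:R), 1[) W x <= 1 ->
  (forall x, 0 < x < 1 -> `|S x| <= K) ->
  {ae leb, forall x, x \in `](0:R), 1[ -> W x != 0 -> `|f x| <= e} ->
  `|inner f (fun x => W x * S x)| <= e * K.
Proof.
move=> hf cW cS e0 K0 W0 iW SK hae; have mD := measurable_oo (0:R) 1.
have LW := continuous_L2 0 1 cW.
have LWS : L2 0 1 (fun x => W x * S x).
  by apply: continuous_L2 => x; apply: cvgM; [exact: cW | exact: cS].
have ii := L2_mul_integrable hf LWS.
apply: (@le_trans _ _ (e * K * \int[leb]_(x in `](0:R), 1[) W x)); last first.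
  by rewrite -[leRHS]mulr1 ler_wpM2l // mulr_ge0.
have iZ := integrable_EFinZ (e * K) mD (L2_integrable LW).
rewrite -RintegralZl //; last exact: L2_integrable.
rewrite -lee_fin EFin_normr_Rintegral //; apply: le_trans (le_abse_integral _ mD (measurable_int _ ii)) _.
rewrite /Rintegral fineK; last exact: integrable_fin_num.
apply: ae_ge0_le_integral => //.
- by apply: measurableT_comp => //; exact: measurable_int ii.
- by move=> x _; rewrite lee_fin mulr_ge0 // mulr_ge0.
- exact: measurable_int iZ.
- apply: aeS hae => x h xI; have {}h := h xI; rewrite /= lee_fin.
  have x01 : 0 < x < 1 by move: xI; rewrite /= in_itv.
  have [->|w0] := eqVneq (W x) 0; first by rewrite mul0r !mulr0 normr0.
  rewrite !normrM (ger0_norm (W0 x)) mulrCA [leRHS]mulrC.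
  by apply: ler_wpM2l => //; apply: ler_pM => //; [exact: h | exact: SK].
Qed.

Lemma cvg0_eps (u : nat -> R) (K : R) : 0 <= K ->
  (forall e : R, 0 < e -> \forall j \near \oo, `|u j| <= e * K) -> u @ \oo --> (0 : R).
Proof.
move=> K0 h; apply/cvgrPdist_le => e e0; have K1 : 0 < K + 1 by lra.
have := h (e / (K + 1)) (divr_gt0 e0 K1); apply: filterS => j hj.
rewrite sub0r normrN; apply: le_trans hj _; rewrite -mulrA -[leRHS]mulr1.
by apply: ler_wpM2l; [exact: ltW | rewrite mulrC ler_pdivrMr // mul1r; lra].
Qed.

(** Here [f] vanishes at the ends and [S] is free.  The layer term is a mean of [f S] over the
    layer, hence small by continuity; the two ends are treated separately, since the two
    boundary values come with two representatives of [f]. *)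
Lemma weak_deriv_test f g S dS : L2 0 1 f -> L2 0 1 g -> weak_deriv 0 1 f g ->
  boundary_value f 0 0 -> boundary_value f 1 0 ->
  (forall x : R, is_derive x 1 S (dS x)) -> continuous dS ->
  inner g S = - inner f dS.
Proof.
move=> hf hg hfg [h [ch hhf h0]] [h' [ch' hhf' h1]] hS cdS; have cS := is_derive_continuous hS.
have c1 := cvg_boundary_layer hf hg hfg hS cdS.
have [K K0 hK] := continuous_bounded 0 1 cS.
have SK (x : R) : 0 < x < 1 -> `|S x| <= K by move=> /andP[/ltW x0 /ltW x1]; apply: hK; rewrite x0.
have small (h2 : R -> R) (y : R) : {within `[0, 1], continuous h2} -> y \in `[0, 1] -> h2 y = 0 ->
    forall e, 0 < e -> exists2 d, 0 < d & forall x, x \in `[0, 1] -> `|y - x| < d -> `|h2 x| <= e.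
  move=> /subspace_continuousP chh yI hy0 e e0.
  have /cvgrPdist_le /(_ _ e0) := chh y yI.
  rewrite near_withinE => /nbhs_ballP [d d0 hd].
  by exists d => // x xI yx; have : `|h2 y - h2 x| <= e := hd x yx xI; rewrite hy0 sub0r normrN.
have cl : inner f (fun x => rank j * dstep (rank j * x) * S x) @[j --> \oo] --> (0 : R).
  apply: (cvg0_eps (ltW K0)) => e e0.
  have [d d0 hd] := small h 0 ch ltac:(by rewrite in_itv /= lexx ler01) h0 e e0.
  have := @near_rank R d 2 d0; apply: filterS => j jd.
  have r0 : 0 < rank j :> R by apply: lt_le_trans (rank_ge4 j); lra.
  apply: inner_layer_le => //; [exact: continuous_dstepl | exact: ltW | exact: ltW | | |].
  - by move=> x; apply: mulr_ge0; [exact: ltW | case/andP: (dstep_bound (rank j * x))].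
  - rewrite (@integral_derive _ (fun x => step (rank j * x)) _ 0 1 ltr01 (der_stepl (rank j))).
      by have /andP[? ?] := @step_in01 R (rank j * 1); have /andP[? ?] := @step_in01 R (rank j * 0); lra.
    exact: continuous_dstepl.
  - apply: aeS hhf => x hx xI Wx; rewrite -hx //; move: (xI); rewrite in_itv /= => /andP[x0 x1].
    apply: hd; first by rewrite in_itv /= !ltW.
    rewrite sub0r normrN gtr0_norm // ltNge; apply/negP => dx; move/eqP: Wx; apply.
    by rewrite dstep_ge2 ?mulr0 //; apply: le_trans jd _; rewrite ler_pM2l.
have cr : inner f (fun x => rank j * dstep (rank j * (1 - x)) * S x) @[j --> \oo] --> (0 : R).
  apply: (cvg0_eps (ltW K0)) => e e0.
  have [d d0 hd] := small h' 1 ch' ltac:(by rewrite in_itv /= lexx ler01) h1 e e0.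
  have := @near_rank R d 2 d0; apply: filterS => j jd.
  have r0 : 0 < rank j :> R by apply: lt_le_trans (rank_ge4 j); lra.
  apply: inner_layer_le => //; [exact: continuous_dstepr | exact: ltW | exact: ltW | | |].
  - by move=> x; apply: mulr_ge0; [exact: ltW | case/andP: (dstep_bound (rank j * (1 - x)))].
  - have dr (x : R) : is_derive x 1 (fun x => - step (rank j * (1 - x))) (rank j * dstep (rank j * (1 - x))).
      by apply: is_derive_conv (derN (der_stepr (rank j) x)) (fun _ => erefl) _; rewrite opprK.
    rewrite (@integral_derive _ _ _ 0 1 ltr01 dr).
      by have /andP[? ?] := @step_in01 R (rank j * (1 - 1)); have /andP[? ?] := @step_in01 R (rank j * (1 - 0)); lra.
    exact: continuous_dstepr.
  - apply: aeS hhf' => x hx xI Wx; rewrite -hx //; move: (xI); rewrite in_itv /= => /andP[x0 x1].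
    apply: hd; first by rewrite in_itv /= !ltW.
    rewrite gtr0_norm ?subr_gt0 // ltNge; apply/negP => dx; move/eqP: Wx; apply.
    by rewrite dstep_ge2 ?mulr0 //; apply: le_trans jd _; rewrite ler_pM2l.
have c2 : inner f (fun x => dcutoff (rank j) x * S x) @[j --> \oo] --> (0 - 0 : R).
  rewrite (_ : (fun j => _) = (fun j => inner f (fun x => rank j * dstep (rank j * x) * S x) -
     inner f (fun x => rank j * dstep (rank j * (1 - x)) * S x))); first exact: cvgB cl cr.
  apply/funext => j; rewrite -innerBr //.
  - by congr inner; apply/funext => x; rewrite /dcutoff mulrBl.
  - by apply: continuous_L2 => x; apply: cvgM; [exact: continuous_dstepl | exact: cS].
  - by apply: continuous_L2 => x; apply: cvgM; [exact: continuous_dstepr | exact: cS].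
have /eqP : - inner g S - inner f dS = 0 - 0 by exact: (cvg_unique (@Rhausdorff R) c1 c2).
by rewrite subrr subr_eq0 => /eqP <-; rewrite opprK.
Qed.

Lemma weak_deriv_sin f g n : L2 0 1 f -> L2 0 1 g -> weak_deriv 0 1 f g ->
  inner g (sinb n) = - (nu n * inner f (cosb n)).
Proof.
move=> hf hg hfg; rewrite (weak_deriv_test0 hf hg hfg (der_sinb n)) ?sinb0 ?sinb1 //.
  by rewrite innerZr //; exact: cosb_L2.
by move=> x; apply: cvgM; [exact: cvg_cst | exact: continuous_cosb].
Qed.

(** Completeness of the sines: weak derivatives can be identified by their coefficients. *)
Lemma eq01_of_sin f g : L2 0 1 f -> L2 0 1 g ->
  (forall n, inner f (sinb n) = inner g (sinb n)) -> eq01 f g.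
Proof.
move=> hf hg h; have e := expands_sinb hf; have e' := expands_sinb hg.
by apply: (expands_unique (@sinb_L2 R) (@sinb_on R) e); apply: expands_ext e' => n; rewrite h.
Qed.

Lemma weak_deriv_unique f g g' : L2 0 1 f -> L2 0 1 g -> L2 0 1 g' ->
  weak_deriv 0 1 f g -> weak_deriv 0 1 f g' -> eq01 g g'.
Proof. by move=> hf hg hg' h h'; apply: eq01_of_sin => // n; rewrite !(@weak_deriv_sin f). Qed.

Lemma weak_deriv_eq01 f f' g g' : L2 0 1 f -> L2 0 1 f' -> L2 0 1 g -> L2 0 1 g' ->
  eq01 f f' -> eq01 g g' -> weak_deriv 0 1 f g -> weak_deriv 0 1 f' g'.
Proof.
move=> hf hf' hg hg' ef eg h psi hpsi; have [L L'] := C1c_L2 hpsi.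
have := h psi hpsi; rewrite -/(inner f psi^`()%classic) -/(inner g psi).
by rewrite (inner_eq01l hf hf' L' ef) (inner_eq01l hg hg' L eg).
Qed.

Lemma weak_derivB f f' g g' : L2 0 1 f -> L2 0 1 f' -> L2 0 1 g -> L2 0 1 g' ->
  weak_deriv 0 1 f g -> weak_deriv 0 1 f' g' ->
  weak_deriv 0 1 (fun x => f x - f' x) (fun x => g x - g' x).
Proof.
move=> hf hf' hg hg' h h' psi hpsi; have [L L'] := C1c_L2 hpsi.
rewrite -/(inner (fun x => f x - f' x) psi^`()%classic) -/(inner (fun x => g x - g' x) psi).
by rewrite !innerBl // [inner f _]h // [inner f' _]h' // opprB opprK addrC.
Qed.

(** The canonical weak derivative is one of the weak derivatives, which are unique. *)
Lemma wderivP f g : L2 0 1 f -> L2 0 1 g -> weak_deriv 0 1 f g ->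
  [/\ L2 0 1 (wderiv f), weak_deriv 0 1 f (wderiv f) & eq01 (wderiv f) g].
Proof.
move=> hf hg h; have [] : [set g | L2 0 1 g /\ weak_deriv 0 1 f g] (wderiv f).
  by apply: xgetPex; exists g.
by move=> h1 h2; split=> //; exact: (weak_deriv_unique hf).
Qed.

Lemma Hk_L2 k f : Hk k f -> L2 0 1 f.
Proof. by case: k => [|k] //= []. Qed.

Lemma Hk_eq01 k f f' : eq01 f f' -> L2 0 1 f' -> Hk k f -> Hk k f'.
Proof.
case: k => [|k] //= e hf' [hf [g [h hg]]]; split=> //; exists g; split=> //.
have Lg := Hk_L2 hg; exact: (weak_deriv_eq01 hf hf' Lg Lg e (eq01_refl g)).
Qed.

Lemma Hk_wderiv k f : Hk k.+1 f -> weak_deriv 0 1 f (wderiv f) /\ Hk k (wderiv f).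
Proof.
move=> /= [hf [g [h hg]]]; have Lg := Hk_L2 hg; have [h1 h2 e] := wderivP hf Lg h.
by split=> //; apply: Hk_eq01 hg => //; exact: eq01_sym.
Qed.

(** The identity holds for each term, and both series converge in L^2.  No boundary term appears:
    a test function vanishes at the ends. *)
Lemma weak_deriv_cosb f g a : expands cosb f a -> expands sinb g (fun n => - (nu n * a n)) ->
  weak_deriv 0 1 f g.
Proof.
move=> hf hg psi hpsi; have [L L'] := C1c_L2 hpsi; have [p0 p1] := C1c_bd hpsi.
have c1 := expands_inner (@cosb_L2 R) hf L';
have c2 : - (\sum_(n < N) - (nu n * a n) * inner (sinb n) psi) @[N --> \oo] --> - inner g psi.
  exact: cvgN (expands_inner (@sinb_L2 R) hg L).
apply: (cvg_unique (@Rhausdorff R) c1); apply: cvg_trans c2; apply: near_eq_cvg; near=> N.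
rewrite /= -sumrN; apply: eq_bigr => n _.
have Lp := @sinb_L2 R n.
have cd : continuous (fun x : R => - nu n * sinb n x).
  by move=> x; apply: cvgM; [exact: cvg_cst | exact: continuous_sinb].
have cp : continuous psi^`()%classic by case: hpsi.
have := inner_parts (der_cosb n) cd (C1c_derive hpsi) cp p0 p1.
by rewrite (innerZl (- nu n) Lp L) => ->; ring.
Unshelve. all: by end_near. Qed.

Lemma weak_deriv_sinb f g a : expands sinb f a -> expands cosb g (fun n => nu n * a n) ->
  weak_deriv 0 1 f g.
Proof.
move=> hf hg psi hpsi; have [L L'] := C1c_L2 hpsi; have [p0 p1] := C1c_bd hpsi.
have c1 := expands_inner (@sinb_L2 R) hf L';
have c2 : - (\sum_(n < N) (nu n * a n) * inner (cosb n) psi) @[N --> \oo] --> - inner g psi.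
  exact: cvgN (expands_inner (@cosb_L2 R) hg L).
apply: (cvg_unique (@Rhausdorff R) c1); apply: cvg_trans c2; apply: near_eq_cvg; near=> N.
rewrite /= -sumrN; apply: eq_bigr => n _.
have Lp := @cosb_L2 R n.
have cd : continuous (fun x : R => nu n * cosb n x).
  by move=> x; apply: cvgM; [exact: cvg_cst | exact: continuous_cosb].
have cp : continuous psi^`()%classic by case: hpsi.
have := inner_parts (der_sinb n) cd (C1c_derive hpsi) cp p0 p1.
by rewrite (innerZl (nu n) Lp L) => ->; ring.
Unshelve. all: by end_near. Qed.

Lemma Hnorm1 f : Hnorm 1 f ^+ 2 = L2norm f ^+ 2 + L2norm (wderiv f) ^+ 2.
Proof.
by rewrite /Hnorm sqr_sqrtr ?sumr_ge0 // => [|i _]; rewrite ?sqr_ge0 // !big_ord_recl big_ord0 addr0.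
Qed.

Lemma Hnorm_ge k j f : (j <= k)%N -> L2norm (wD j f) <= Hnorm k f.
Proof.
move=> jk; rewrite -(ger0_norm (L2norm_ge0 (wD j f))) -sqrtr_sqr; apply: ler_wsqrtr.
rewrite (bigD1 (Ordinal (jk : (j < k.+1)%N))) //= lerDl sumr_ge0 // => i _; exact: sqr_ge0.
Qed.

(** The identity holds for test functions and both sides are continuous in the H^1 norm. *)
Lemma H10_test u S dS : H10 u -> (forall x : R, is_derive x 1 S (dS x)) -> continuous dS ->
  inner (wderiv u) S = - inner u dS.
Proof.
move=> [hu happ] hS cdS; have cS := is_derive_continuous hS.
have LS := continuous_L2 0 1 cS; have LdS := continuous_L2 0 1 cdS.
have Lu := Hk_L2 hu; have [wu Lwu] := Hk_wderiv hu.
apply/eqP; rewrite -addr_eq0 -normr_eq0 eq_le normr_ge0 andbT.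
apply/ler_addgt0Pr => e e0; rewrite add0r.
pose K := L2norm S + L2norm dS + 1.
have K0 : 0 < K by rewrite /K; have := L2norm_ge0 S; have := L2norm_ge0 dS; lra.
have [psi hpsi hn] := happ (e / K) (divr_gt0 e0 K0).
have [Lp Lp'] := C1c_L2 hpsi; have [p0 p1] := C1c_bd hpsi.
have cp' : continuous psi^`()%classic by case: hpsi.
have wp := weak_deriv_classical (C1c_derive hpsi) cp'.
have wd := weak_derivB Lu Lp Lwu Lp' wu wp.
have Ld := L2B Lu Lp; have Ldd := L2B Lwu Lp'.
have [Lw _ ew] := wderivP Ld Ldd wd.
have n0 : L2norm (fun x => u x - psi x) <= e / K.
  by apply: le_trans (ltW hn); exact: (@Hnorm_ge 1 0).
have n1 : L2norm (fun x => wderiv u x - psi^`()%classic x) <= e / K.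
  by rewrite -(L2norm_eq01 Lw Ldd ew); apply: le_trans (ltW hn); exact: (@Hnorm_ge 1 1).
have ip : inner psi^`()%classic S = - inner psi dS.
  rewrite innerC [inner psi dS]innerC.
  by rewrite (inner_parts hS cdS (C1c_derive hpsi) cp' p0 p1).
have -> : inner (wderiv u) S + inner u dS =
    inner (fun x => wderiv u x - psi^`()%classic x) S + inner (fun x => u x - psi x) dS.
  by rewrite !innerBl // ip opprK; ring.
apply: le_trans (ler_normD _ _) _.
apply: (@le_trans _ _ (e / K * L2norm S + e / K * L2norm dS)).
  by apply: lerD; apply: le_trans (inner_le _ _) _ => //; apply: ler_wpM2r => //; exact: L2norm_ge0.
rewrite -mulrDr -[leRHS]mulr1 -mulrA ler_pM2l // ler_pdivrMl // mulr1 /K; lra.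
Qed.

Lemma H10_cos u n : H10 u -> inner (wderiv u) (cosb n) = nu n * inner u (sinb n).
Proof.
move=> hu; have Lu := Hk_L2 hu.1; rewrite (H10_test hu (der_cosb n)); last first.
  by move=> x; apply: cvgM; [exact: cvg_cst | exact: continuous_sinb].
by rewrite innerZr //; [ring | exact: sinb_L2].
Qed.

Lemma H10_mean u : H10 u -> inner (wderiv u) (fun _ => 1) = 0.
Proof.
by move=> hu; rewrite (H10_test hu (fun x : R => is_derive_cst (1 : R) x 1) (@cst_continuous _ _ _)) inner0r oppr0.
Qed.

Lemma L2norm_bounded_cvg (M : R) (h : nat -> R -> R) : (forall n, continuous (h n)) ->
  (forall n x, 0 < x < 1 -> `|h n x| <= M) ->
  (forall x, 0 < x < 1 -> h n x @[n --> \oo] --> (0 : R)) -> L2norm (h n) @[n --> \oo] --> (0 : R).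
Proof.
move=> ch hM h0; have L n : L2 0 1 (h n) by exact: continuous_L2.
have c : inner (fun _ => 1) (fun x => h n x * h n x) @[n --> \oo] --> inner (fun _ : R => 1) (fun _ => 0).
  apply: (@inner_bounded_cvg _ (M * M)); first exact: L2_cst.
  - by move=> n; exact: (continuous_mul (ch n) (ch n)).
  - exact: cst_continuous.
  - by move=> n x x01; rewrite normrM; apply: ler_pM => //; exact: hM.
  - by move=> x x01; rewrite -[X in _ --> X](mulr0 0); apply: cvgM; exact: h0.
rewrite inner0r in c.
have : Num.sqrt (inner (fun _ => 1) (fun x => h n x * h n x)) @[n --> \oo] --> Num.sqrt (0 : R).
  by apply: continuous_cvg => //; exact: sqrt_continuous.
rewrite sqrtr0; apply: cvg_trans; apply: near_eq_cvg; near=> n; rewrite L2normE //=; congr Num.sqrt.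
by apply: eq_Rintegral => x _; rewrite mul1r.
Unshelve. all: by end_near. Qed.

(** The function is multiplied by a cut-off; the layer term of the derivative stays bounded by
    [mul_dstep_le] and tends to 0 pointwise. *)
Lemma C1_H1_dense F dF : (forall x : R, is_derive x 1 F (dF x)) -> continuous dF ->
  F 0 = 0 -> F 1 = 0 -> forall e : R, 0 < e -> exists2 psi, C1c 0 1 psi &
  L2norm (fun x => F x - psi x) < e /\ L2norm (fun x => dF x - psi^`()%classic x) < e.
Proof.
move=> hF cdF F0 F1 e e0; have cF := is_derive_continuous hF.
pose psi j x := cutoff (rank j) x * F x.
have hpsi j : C1c 0 1 (psi j) by exact: C1c_cut hF cdF.
have dpsi j : (psi j)^`()%classic = fun x => dcutoff (rank j) x * F x + cutoff (rank j) x * dF x.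
  apply/funext => x; rewrite derive1E; apply: (@derive_val _ _ _ _ _ _ _ _).
  by apply: is_derive_conv (derM (der_cut (rank j) x) (hF x)) (fun _ => erefl) _.
have [M M0 hM] := continuous_bounded 0 1 cF; have [K K0 hK] := continuous_bounded 0 1 cdF.
have Sx (x : R) : 0 < x < 1 -> `|F x| <= K * x.
  move=> /andP[/ltW x0 /ltW x1]; rewrite -[F x]subr0 -[X in _ - X]F0 -[X in K * X]subr0.
  apply: (derive_bound x0 (fun y _ => hF y)) => y /andP[y0 yx]; apply: hK.
  by rewrite y0 (le_trans yx).
have Sx1 (x : R) : 0 < x < 1 -> `|F x| <= K * (1 - x).
  move=> /andP[/ltW x0 /ltW x1]; rewrite -normrN -[- F x]add0r -[X in X - _]F1.
  apply: (derive_bound x1 (fun y _ => hF y)) => y /andP[y0 yx]; apply: hK.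
  by rewrite yx (le_trans x0).
have c1 : L2norm (fun x => F x - psi j x) @[j --> \oo] --> (0 : R).
  apply: (@L2norm_bounded_cvg (M + M)).
  - move=> j x; apply: cvgB; first exact: cF.
    by apply: cvgM; [exact: continuous_cut | exact: cF].
  - move=> j x /andP[/ltW x0 /ltW x1]; apply: le_trans (ler_normB _ _) _.
    have hx : `|F x| <= M by apply: hM; rewrite x0.
    apply: lerD => //; rewrite normrM -[leRHS]mul1r; apply: ler_pM => //; exact: cut_norm_le1.
  - move=> x x01; apply: cvg_near_cst; near=> j.
    have [h _] : cutoff (rank j) x = 1 /\ dcutoff (rank j) x = 0 by near: j; exact: near_cut.
    by rewrite /psi h mul1r subrr.
have c2 : L2norm (fun x => dF x - (psi j)^`()%classic x) @[j --> \oo] --> (0 : R).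
  apply: (@L2norm_bounded_cvg (K + ((4 * K + 4 * K) + K))).
  - move=> j x; rewrite dpsi; apply: cvgB; first exact: cdF.
    apply: cvgD; apply: cvgM; [exact: continuous_dcut | exact: cF | exact: continuous_cut | exact: cdF].
  - move=> j x x01; have r4 := @rank_ge4 R j.
    have hx : `|dF x| <= K by case/andP: x01 => /ltW x0 /ltW x1; apply: hK; rewrite x0.
    apply: le_trans (ler_normB _ _) _; apply: lerD => //; rewrite dpsi.
    apply: le_trans (ler_normD _ _) _; apply: lerD; last first.
      by rewrite normrM -[leRHS]mul1r; apply: ler_pM => //; exact: cut_norm_le1.
    rewrite /dcutoff mulrBl.
    apply: le_trans (ler_normB _ _) _; apply: lerD; apply: mul_dstep_le => //; try exact: ltW.
    + by case/andP: x01 => /ltW.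
    + exact: Sx.
    + by case/andP: x01 => _ /ltW; rewrite subr_ge0.
    + exact: Sx1.
  - move=> x x01; apply: cvg_near_cst; near=> j.
    have [h h'] : cutoff (rank j) x = 1 /\ dcutoff (rank j) x = 0 by near: j; exact: near_cut.
    by rewrite dpsi h h' mul0r add0r mul1r subrr.
have : \forall j \near \oo, L2norm (fun x => F x - psi j x) < e /\ L2norm (fun x => dF x - (psi j)^`()%classic x) < e.
  near=> j; split.
    rewrite -[ltLHS]ger0_norm ?L2norm_ge0 // -normrN -[- _]add0r; near: j.
    by move/cvgrPdist_lt: c1 => /(_ _ e0).
  rewrite -[ltLHS]ger0_norm ?L2norm_ge0 // -normrN -[- _]add0r; near: j.
  by move/cvgrPdist_lt: c2 => /(_ _ e0).
by move=> [j _ hj]; exists (psi j) => //; exact: (hj j (leqnn _)).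
Unshelve. all: by end_near. Qed.

End WeakDerivatives.

(** * Function spaces in terms of Fourier coefficients *)
Section Coefficients.
Context {R : realType}.
Implicit Types (f g h u : R -> R) (a b c : nat -> R).

Definition sqsum c : Prop := exists K, forall N, \sum_(n < N) c n ^+ 2 <= K.

Lemma sqsum_le c d (W : nat -> R) K : (forall n, c n ^+ 2 <= W n * d n ^+ 2) ->
  (forall N, \sum_(n < N) W n * d n ^+ 2 <= K) -> sqsum c.
Proof. by move=> h hK; exists K => N; apply: le_trans (hK N); apply: ler_sum. Qed.

Let cosL := @cosb_L2 R.
Let cosO := @cosb_on R.
Let sinL := @sinb_L2 R.
Let sinO := @sinb_on R.

Lemma expands_wderiv_cosb f a : expands cosb f a -> sqsum (fun n => nu n * a n) ->
  weak_deriv 0 1 f (wderiv f) /\ expands sinb (wderiv f) (fun n => - (nu n * a n)).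
Proof.
move=> hf [K hK].
have [|g hg] := @expands_synthesis _ sinb sinL sinO (fun n => - (nu n * a n)) K.
  by move=> N; under eq_bigr do rewrite sqrrN.
have wd := weak_deriv_cosb hf hg.
have [h1 h2 e] := wderivP (expands_L2 hf) (expands_L2 hg) wd.
by split=> //; apply: (expands_eq01 sinL hg h1); exact: eq01_sym.
Qed.

Lemma expands_wderiv_sinb f b : expands sinb f b -> sqsum (fun n => nu n * b n) ->
  weak_deriv 0 1 f (wderiv f) /\ expands cosb (wderiv f) (fun n => nu n * b n).
Proof.
move=> hf [K hK].
have [g hg] := @expands_synthesis _ cosb cosL cosO (fun n => nu n * b n) K hK.
have wd := weak_deriv_sinb hf hg.
have [h1 h2 e] := wderivP (expands_L2 hf) (expands_L2 hg) wd.
by split=> //; apply: (expands_eq01 cosL hg h1); exact: eq01_sym.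
Qed.

Lemma expands_cosb_mean f a : expands cosb f a -> inner f (fun _ => 1) = 0.
Proof.
move=> hf; have c1 := expands_inner cosL hf (L2_cst 0 1 1).
have c2 : \sum_(n < N) a n * inner (cosb n) (fun _ => 1) @[N --> \oo] --> (0 : R).
  by under eq_fun do under eq_bigr do rewrite integral_cosb mulr0; under eq_fun do rewrite big1 //; exact: cvg_cst.
by exact: (cvg_unique (@Rhausdorff R) c1 c2).
Qed.

Lemma inner1 f : inner f (fun _ => 1) = \int[leb]_(x in `](0:R), 1[) f x.
Proof. by apply: eq_Rintegral => x _; rewrite mulr1. Qed.

Lemma nu_ge1 n : 1 <= nu n :> R.
Proof.
apply: le_trans (nu_ge_pi n); have := @pi_ge2 R; lra.
Qed.

(** Comparison with the telescoping series of [1/n - 1/(n+1)]. *)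
Lemma nu_inv_sum N : \sum_(n < N) (nu n)^-2 <= (1 : R).
Proof.
have h : forall N, \sum_(n < N) (nu n)^-2 <= 1 - (N.+1%:R)^-1 :> R.
  elim=> [|M IH]; first by rewrite big_ord0 invr1 subrr.
  rewrite big_ord_recr /=; apply: le_trans (lerD IH (lexx _)) _.
  have M0 : 0 < M.+1%:R :> R by rewrite ltr0n.
  have M1 : 0 < M.+2%:R :> R by rewrite ltr0n.
  have e : M.+2%:R = M.+1%:R + 1 :> R by rewrite -[in LHS]natr1.
  have p2 : 2 * M.+1%:R <= nu M :> R by rewrite /nu mulrC ler_pM2l // pi_ge2.
  have le2 : (nu M)^-2 <= (M.+1%:R * M.+2%:R)^-1 :> R.
    rewrite lef_pV2 ?posrE ?exprn_gt0 ?nu_gt0 ?mulr_gt0 //.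
    have M1' : 1 <= M.+1%:R :> R by rewrite ler1n.
    rewrite e; nra.
  apply: le_trans (lerD (lexx _) le2) _; rewrite e le_eqVlt; apply/orP; left; apply/eqP; field.
  by rewrite !gt_eqF // -e.
by apply: le_trans (h N) _; rewrite lerBlDr lerDl invr_ge0.
Qed.

(** The series is uniformly Cauchy by Cauchy-Schwarz, [nu_n b_n] and [1 / nu_n] being square
    summable; its terms vanish at both ends. *)
Lemma sine_series_continuous f b : expands sinb f b -> sqsum (fun n => nu n * b n) ->
  exists h, [/\ continuous h, eq01 h f, h 0 = 0 & h 1 = 0].
Proof.
move=> hf [K hK].
have [rho [rho0 rho_ge0 hrho]] : exists rho : nat -> R, [/\ rho @ \oo --> (0 : R), forall N, 0 <= rho N &
    forall N M, (N <= M)%N -> \sum_(N <= n < M) ((nu n)^-1) ^+ 2 <= rho N].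
  by apply: csum_tail => N; under eq_bigr do rewrite exprVn; exact: nu_inv_sum.
have K0 : 0 <= K by have := hK 0%N; rewrite big_ord0.
have sin2 n x : sinb n x ^+ 2 <= 2 :> R.
  by rewrite /sinb exprMn sqr_sqrtr // -[leRHS]mulr1 ler_pM2l // sin2cos2 lerBlDr lerDl sqr_ge0.
have tail N M (x : R) : (N <= M)%N -> (fsum sinb b M x - fsum sinb b N x) ^+ 2 <= 2 * K * rho N.
  move=> NM; have -> : fsum sinb b M x - fsum sinb b N x = \sum_(N <= n < M) (nu n * b n) * ((nu n)^-1 * sinb n x).
    rewrite /fsum -!(big_mkord xpredT (fun n => b n * sinb n x)) (big_cat_nat (n := N)) //= addrAC subrr add0r.
    by apply: eq_bigr => n _; rewrite mulrACA divff ?nu_neq0 // mul1r.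
  apply: le_trans (sum_cauchy_schwarz _ _ _) _.
  have h1 : \sum_(N <= n < M) (nu n * b n) ^+ 2 <= K.
    apply: le_trans (hK M); rewrite -(big_mkord xpredT (fun n => (nu n * b n) ^+ 2)) [leRHS](big_cat_nat (n := N)) //= lerDr.
    by apply: sumr_ge0 => n _; exact: sqr_ge0.
  have h2 : \sum_(N <= n < M) ((nu n)^-1 * sinb n x) ^+ 2 <= 2 * rho N.
    apply: (@le_trans _ _ (2 * \sum_(N <= n < M) ((nu n)^-1) ^+ 2)); last by rewrite ler_pM2l // hrho.
    by rewrite mulr_sumr; apply: ler_sum => n _; rewrite exprMn mulrC ler_wpM2r ?sqr_ge0.
  rewrite [2 * K]mulrC -mulrA; apply: ler_pM => //; apply: sumr_ge0 => n _; exact: sqr_ge0.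
have cfs N : continuous (fsum sinb b N).
  by apply: continuous_sum => n; move=> x; apply: cvgM; [exact: cvg_cst | exact: continuous_sinb].
have [h [ch hb hc]] := @uniform_limit R (fsum sinb b) (2 * K) rho 0 rho0 cfs (fun N M x _ NM _ => tail N M x NM).
have fs0 N : fsum sinb b N 0 = 0 by rewrite /fsum big1 // => n _; rewrite sinb0 mulr0.
have fs1 N : fsum sinb b N 1 = 0 by rewrite /fsum big1 // => n _; rewrite sinb1 mulr0.
have h0 : h 0 = 0.
  have := hc 0 (lexx _); under eq_fun do rewrite fs0; move=> c0.
  by exact: (cvg_unique (@Rhausdorff R) c0 (cvg_cst _)).
have h1 : h 1 = 0.
  have := hc 1 ler01; under eq_fun do rewrite fs1; move=> c0.
  by exact: (cvg_unique (@Rhausdorff R) c0 (cvg_cst _)).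
exists h; split=> //; apply: (@expands_unique _ sinb sinL sinO _ _ b) => //.
have Lh := continuous_L2 0 1 ch; split=> //.
have bd N : L2norm (fun x => h x - fsum sinb b N x) ^+ 2 <= 2 * K * rho N.
  have Ld := L2B Lh (fsum_L2 sinL b N); rewrite L2norm_sqr // /inner.
  apply: (@le_trans _ _ (\int[leb]_(x in `](0:R), 1[) (2 * K * rho N))); last first.
    have := L2norm1 (R := R); rewrite L2norm_sqr ?inner1; last exact: L2_cst.
    move=> i1; rewrite -[X in \int[leb]_(x in _) X]mulr1 RintegralZl ?i1 ?mulr1 //.
    exact: L2_integrable (L2_cst 0 1 1).
  apply: le_Rintegral => //; first exact: L2_mul_integrable.
    exact: L2_integrable (L2_cst 0 1 _).
  by move=> x; rewrite /= in_itv /= => /andP[/ltW x0 _]; rewrite -expr2; exact: hb.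
have c0 : 2 * K * rho N @[N --> \oo] --> (0 : R).
  by rewrite -[X in _ --> X](mulr0 (2 * K)); apply: cvgM => //; exact: cvg_cst.
apply/cvgrPdist_le => e e0; move/cvgrPdist_le: c0 => /(_ _ (exprn_gt0 2 e0)); apply: filterS => N.
rewrite sub0r normrN => hN; rewrite sub0r normrN ger0_norm ?L2norm_ge0 //.
rewrite -ler_sqr ?nnegrE ?L2norm_ge0 ?(ltW e0) //; apply: le_trans (bd N) _.
exact: le_trans (ler_norm _) hN.
Qed.

Lemma boundary_value_cts f h (y : R) : continuous h -> eq01 h f -> boundary_value f y (h y).
Proof. by move=> ch e; exists h; split=> //; exact: continuous_subspaceT. Qed.

(** The weights of the H^k norm on Fourier coefficients. *)
Definition wt (k n : nat) : R := \sum_(j < k.+1) nu n ^+ (2 * j).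

Lemma wt_ge k j n : (j <= k)%N -> nu n ^+ (2 * j) <= wt k n.
Proof.
move=> jk; rewrite /wt (bigD1 (Ordinal (jk : (j < k.+1)%N))) //= lerDl.
by apply: sumr_ge0 => i _; rewrite exprn_ge0 // ltW ?nu_gt0.
Qed.

Lemma wt_ge0 k n : 0 <= wt k n.
Proof. by apply: sumr_ge0 => i _; rewrite exprn_ge0 // ltW ?nu_gt0. Qed.

Lemma sqsum_wt k j a K : (j <= k)%N -> (forall N, \sum_(n < N) wt k n * a n ^+ 2 <= K) ->
  sqsum (fun n => nu n ^+ j * a n).
Proof.
move=> jk hK; apply: (sqsum_le _ hK) => n; rewrite exprMn -exprM mulnC.
by apply: ler_wpM2r; [exact: sqr_ge0 | exact: wt_ge].
Qed.

Lemma sqsumN a : sqsum a -> sqsum (fun n => - a n).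
Proof. by move=> [K h]; exists K => N; under eq_bigr do rewrite sqrrN. Qed.

Lemma Hnorm_sqr k f : Hnorm k f ^+ 2 = \sum_(j < k.+1) L2norm (wD j f) ^+ 2.
Proof. by rewrite /Hnorm sqr_sqrtr // sumr_ge0 // => i _; exact: sqr_ge0. Qed.

(** Parseval for each of the derivatives that enter the norm. *)
Lemma Hnorm_cvg k f a : (forall j, (j <= k)%N ->
    \sum_(n < N) (nu n ^+ j * a n) ^+ 2 @[N --> \oo] --> L2norm (wD j f) ^+ 2) ->
  \sum_(n < N) wt k n * a n ^+ 2 @[N --> \oo] --> Hnorm k f ^+ 2.
Proof.
move=> h; rewrite Hnorm_sqr.
have c : \sum_(j < k.+1) \sum_(n < N) (nu n ^+ j * a n) ^+ 2 @[N --> \oo] --> \sum_(j < k.+1) L2norm (wD j f) ^+ 2.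
  by apply: cvg_bigsum => j _; apply: (h (nat_of_ord j)); rewrite -ltnS ltn_ord.
apply: cvg_trans c; apply: near_eq_cvg; near=> N; rewrite exchange_big /=.
apply: eq_bigr => n _; rewrite /wt mulr_suml; apply: eq_bigr => j _.
by rewrite exprMn -exprM mulnC.
Unshelve. all: by end_near. Qed.

Lemma cvg_pow0 a (l : R) : \sum_(n < N) a n ^+ 2 @[N --> \oo] --> l ->
  \sum_(n < N) (nu n ^+ 0 * a n) ^+ 2 @[N --> \oo] --> l.
Proof.
by apply: cvg_trans; apply: near_eq_cvg; apply: nearW => N; apply: eq_bigr => n _; rewrite expr0 mul1r.
Qed.

Section CosineSeries.
Variables (f : R -> R) (a : nat -> R).
Hypothesis hf : expands cosb f a.

Lemma cos_series_wD1 : sqsum (fun n => nu n ^+ 1 * a n) ->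
  weak_deriv 0 1 f (wD 1 f) /\ expands sinb (wD 1 f) (fun n => - (nu n ^+ 1 * a n)).
Proof. by move=> s; have [] := expands_wderiv_cosb hf s. Qed.

Lemma cos_series_wD2 : sqsum (fun n => nu n ^+ 1 * a n) -> sqsum (fun n => nu n ^+ 2 * a n) ->
  weak_deriv 0 1 (wD 1 f) (wD 2 f) /\ expands cosb (wD 2 f) (fun n => - (nu n ^+ 2 * a n)).
Proof.
move=> s1 s2; have [_ e1] := cos_series_wD1 s1.
have e n : nu n * - (nu n ^+ 1 * a n) = - (nu n ^+ 2 * a n) by ring.
have [|w2 e2] := expands_wderiv_sinb e1.
  by rewrite (_ : (fun n => _) = (fun n => - (nu n ^+ 2 * a n))); [exact: sqsumN | apply/funext].
by split=> //; apply: expands_ext e2.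
Qed.

Lemma cos_series_wD3 : sqsum (fun n => nu n ^+ 1 * a n) -> sqsum (fun n => nu n ^+ 2 * a n) ->
  sqsum (fun n => nu n ^+ 3 * a n) ->
  weak_deriv 0 1 (wD 2 f) (wD 3 f) /\ expands sinb (wD 3 f) (fun n => nu n ^+ 3 * a n).
Proof.
move=> s1 s2 s3; have [_ e2] := cos_series_wD2 s1 s2.
have e n : nu n * - (nu n ^+ 2 * a n) = - (nu n ^+ 3 * a n) by ring.
have [|w3 e3] := expands_wderiv_cosb e2.
  by rewrite (_ : (fun n => _) = (fun n => - (nu n ^+ 3 * a n))); [exact: sqsumN | apply/funext].
by split=> //; apply: expands_ext e3 => n; rewrite e opprK.
Qed.

(** The derivative of the series is a sine series with square summable derivative, so it has
    zero boundary values. *)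
Lemma cos_series_Sbar K : (forall N, \sum_(n < N) wt 2 n * a n ^+ 2 <= K) ->
  inSbar f /\ Hnorm 2 f ^+ 2 <= K.
Proof.
move=> hK; have s1 := sqsum_wt (isT : (1 <= 2)%N) hK; have s2 := sqsum_wt (isT : (2 <= 2)%N) hK.
have [w1 e1] := cos_series_wD1 s1; have [w2 e2] := cos_series_wD2 s1 s2.
have L0 := expands_L2 hf; have L1 := expands_L2 e1; have L2' := expands_L2 e2.
split; last first.
  apply: (cvg_le_cst _ hK); apply: Hnorm_cvg; case=> [|[|[|//]]] _.
  - exact: cvg_pow0 (expands_norm cosL cosO hf).
  - by have := expands_norm sinL sinO e1; under eq_fun do under eq_bigr do rewrite sqrrN.
  - by have := expands_norm cosL cosO e2; under eq_fun do under eq_bigr do rewrite sqrrN.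
have [|h [ch hw h0 h1]] := sine_series_continuous e1.
  rewrite (_ : (fun n => _) = (fun n => - (nu n ^+ 2 * a n))); first exact: sqsumN.
  by apply/funext => n; ring.
split.
- by split=> //; exists (wD 1 f); split=> //; split=> //; exists (wD 2 f).
- by have := boundary_value_cts 0 ch hw; rewrite h0.
- by have := boundary_value_cts 1 ch hw; rewrite h1.
- by rewrite -inner1; exact: expands_cosb_mean hf.
Qed.

Lemma cos_series_H3 K : (forall N, \sum_(n < N) wt 3 n * a n ^+ 2 <= K) ->
  (Hk 3 f /\ inSbar f) /\ Hnorm 3 f ^+ 2 <= K.
Proof.
move=> hK; have s1 := sqsum_wt (isT : (1 <= 3)%N) hK; have s2 := sqsum_wt (isT : (2 <= 3)%N) hK.
have s3 := sqsum_wt (isT : (3 <= 3)%N) hK.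
have [w1 e1] := cos_series_wD1 s1; have [w2 e2] := cos_series_wD2 s1 s2.
have [w3 e3] := cos_series_wD3 s1 s2 s3.
have L0 := expands_L2 hf; have L1 := expands_L2 e1; have L2' := expands_L2 e2; have L3 := expands_L2 e3.
have hK2 N : \sum_(n < N) wt 2 n * a n ^+ 2 <= K.
  apply: le_trans (hK N); apply: ler_sum => n _; rewrite /wt [in leRHS]big_ord_recr /= mulrDl lerDl.
  by rewrite mulr_ge0 ?sqr_ge0 // exprn_ge0 // ltW ?nu_gt0.
split; last first.
  apply: (cvg_le_cst _ hK); apply: Hnorm_cvg; case=> [|[|[|[|//]]]] _.
  - exact: cvg_pow0 (expands_norm cosL cosO hf).
  - by have := expands_norm sinL sinO e1; under eq_fun do under eq_bigr do rewrite sqrrN.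
  - by have := expands_norm cosL cosO e2; under eq_fun do under eq_bigr do rewrite sqrrN.
  - exact: (expands_norm sinL sinO e3).
split; last by have [] := cos_series_Sbar hK2.
split=> //; exists (wD 1 f); split=> //; split=> //; exists (wD 2 f); split=> //; split=> //.
by exists (wD 3 f).
Qed.

End CosineSeries.

Section SineSeries.
Variables (u : R -> R) (b : nat -> R).
Hypothesis hu : expands sinb u b.

Lemma sin_series_wD1 : sqsum (fun n => nu n ^+ 1 * b n) ->
  weak_deriv 0 1 u (wD 1 u) /\ expands cosb (wD 1 u) (fun n => nu n ^+ 1 * b n).
Proof. by move=> s; have [] := expands_wderiv_sinb hu s. Qed.

Lemma sin_series_wD2 : sqsum (fun n => nu n ^+ 1 * b n) -> sqsum (fun n => nu n ^+ 2 * b n) ->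
  weak_deriv 0 1 (wD 1 u) (wD 2 u) /\ expands sinb (wD 2 u) (fun n => - (nu n ^+ 2 * b n)).
Proof.
move=> s1 s2; have [_ e1] := sin_series_wD1 s1.
have e n : nu n * (nu n ^+ 1 * b n) = nu n ^+ 2 * b n by ring.
have [|w2 e2] := expands_wderiv_cosb e1.
  by rewrite (_ : (fun n => _) = (fun n => nu n ^+ 2 * b n)) //; apply/funext.
by split=> //; apply: expands_ext e2 => n; rewrite e.
Qed.

Lemma sin_series_H2 K : (forall N, \sum_(n < N) wt 2 n * b n ^+ 2 <= K) ->
  Hk 2 u /\ Hnorm 2 u ^+ 2 <= K.
Proof.
move=> hK; have s1 := sqsum_wt (isT : (1 <= 2)%N) hK; have s2 := sqsum_wt (isT : (2 <= 2)%N) hK.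
have [w1 e1] := sin_series_wD1 s1; have [w2 e2] := sin_series_wD2 s1 s2.
have L0 := expands_L2 hu; have L1 := expands_L2 e1; have L2' := expands_L2 e2.
split; first by split=> //; exists (wD 1 u); split=> //; split=> //; exists (wD 2 u).
apply: (cvg_le_cst _ hK); apply: Hnorm_cvg; case=> [|[|[|//]]] _.
- exact: cvg_pow0 (expands_norm sinL sinO hu).
- exact: (expands_norm cosL cosO e1).
- by have := expands_norm sinL sinO e2; under eq_fun do under eq_bigr do rewrite sqrrN.
Qed.

Lemma sin_series_Hnorm1 K : (forall N, \sum_(n < N) wt 1 n * b n ^+ 2 <= K) -> Hnorm 1 u ^+ 2 <= K.
Proof.
move=> hK; have s1 := sqsum_wt (isT : (1 <= 1)%N) hK; have [w1 e1] := sin_series_wD1 s1.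
apply: (cvg_le_cst _ hK); apply: Hnorm_cvg; case=> [|[|//]] _.
- exact: cvg_pow0 (expands_norm sinL sinO hu).
- exact: (expands_norm cosL cosO e1).
Qed.

End SineSeries.

Lemma expands_fsum (e : nat -> R -> R) a N : (forall n, L2 0 1 (e n)) ->
  expands e (fsum e a N) (fun n => if (n < N)%N then a n else 0).
Proof.
move=> eL; split; first exact: fsum_L2.
apply: cvg_near_cst; exists N => // M /= NM.
have -> : (fun x => fsum e a N x - fsum e (fun n => if (n < N)%N then a n else 0) M x) = fun _ => 0.
  apply/funext => x; rewrite /fsum -!(big_mkord xpredT (fun n => _ n * e n x)).
  rewrite -(big_mkord xpredT (fun n => (if (n < N)%N then a n else 0) * e n x)).
  rewrite [X in _ - X](big_cat_nat (n := N)) //= [X in _ - (_ + X)]big_nat_cond [X in _ - (_ + X)]big1 ?addr0.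
    apply/eqP; rewrite subr_eq0; apply/eqP; rewrite big_nat_cond [RHS]big_nat_cond.
    by apply: eq_bigr => n /andP[/andP[_ ->]].
  by move=> n /andP[/andP[Nn _] _]; rewrite ltnNge Nn mul0r.
rewrite L2normE; last exact: L2_cst.
by rewrite inner0l sqrtr0.
Qed.

Lemma der_fsum_sinb b N (x : R) : is_derive x 1 (fsum sinb b N) (\sum_(n < N) b n * (nu n * cosb n x)).
Proof.
apply: (@is_derive_bigsum R _ (index_enum _) (fun (n : 'I_N) x => b n * sinb n x) (fun (n : 'I_N) x => b n * (nu n * cosb n x))) => n.
apply: derZ; exact: der_sinb.
Qed.

(** The partial sums converge in the H^1 norm; they vanish at both ends and so are limits of
    test functions. *)
Lemma sin_series_H10 u b K : expands sinb u b ->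
  (forall N, \sum_(n < N) wt 1 n * b n ^+ 2 <= K) -> H10 u.
Proof.
move=> hu hK; have s1 := sqsum_wt (isT : (1 <= 1)%N) hK; have [w1 e1] := sin_series_wD1 hu s1.
have L0 := expands_L2 hu; have L1 := expands_L2 e1.
have hk1 : Hk 1 u by split=> //; exists (wD 1 u).
split=> // e e0; have e4 : 0 < e / 4 by lra.
have [_ c0] := hu; have [_ c1] := e1.
have [N [n0 n1]] : exists N, L2norm (fun x => u x - fsum sinb b N x) < e / 4 /\
    L2norm (fun x => wD 1 u x - fsum cosb (fun n => nu n ^+ 1 * b n) N x) < e / 4.
  have : \forall N \near \oo, L2norm (fun x => u x - fsum sinb b N x) < e / 4 /\
    L2norm (fun x => wD 1 u x - fsum cosb (fun n => nu n ^+ 1 * b n) N x) < e / 4.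
    near=> N; split.
      rewrite -[ltLHS]ger0_norm ?L2norm_ge0 // -normrN -[- _]add0r; near: N.
      by move/cvgrPdist_lt: c0 => /(_ _ e4).
    rewrite -[ltLHS]ger0_norm ?L2norm_ge0 // -normrN -[- _]add0r; near: N.
    by move/cvgrPdist_lt: c1 => /(_ _ e4).
  by move=> [N _ hN]; exists N; exact: (hN N (leqnn _)).
pose dF x := \sum_(n < N) b n * (nu n * cosb n x).
have dFE : fsum cosb (fun n => nu n ^+ 1 * b n) N = dF.
  by apply/funext => x; apply: eq_bigr => n _; ring.
have cdF : continuous dF.
  apply: continuous_sum => n x; apply: cvgM; first exact: cvg_cst.
  by apply: cvgM; [exact: cvg_cst | exact: continuous_cosb].
have [|| psi hpsi [p0 p1]] := C1_H1_dense (der_fsum_sinb b N) cdF _ _ e4.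
- by rewrite /fsum big1 // => n _; rewrite sinb0 mulr0.
- by rewrite /fsum big1 // => n _; rewrite sinb1 mulr0.
exists psi => //; have [Lp Lp'] := C1c_L2 hpsi.
have cp : continuous psi^`()%classic by case: hpsi.
have LF := fsum_L2 sinL b N; have LdF := continuous_L2 0 1 cdF.
have wp := weak_deriv_classical (C1c_derive hpsi) cp.
have wd := weak_derivB L0 Lp L1 Lp' w1 wp.
have Ld := L2B L0 Lp; have Ldd := L2B L1 Lp'.
have [Lw _ ew] := wderivP Ld Ldd wd.
have q0 : L2norm (fun x => u x - psi x) < e / 2.
  have := L2norm_triangle (L2B L0 LF) (L2B LF Lp).
  rewrite (_ : (fun x => _ + _) = (fun x => u x - psi x)); last by apply/funext => x; rewrite addrA subrK.
  lra.
have q1 : L2norm (fun x => wD 1 u x - psi^`()%classic x) < e / 2.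
  rewrite dFE in n1; have := L2norm_triangle (L2B L1 LdF) (L2B LdF Lp').
  rewrite (_ : (fun x => _ + _) = (fun x => wD 1 u x - psi^`()%classic x)); last by apply/funext => x; rewrite addrA subrK.
  have : L2norm (fun x => dF x - psi^`()%classic x) < e / 4 by exact: p1.
  lra.
have hn := Hnorm1 (fun x => u x - psi x).
rewrite (L2norm_eq01 Lw Ldd ew) in hn.
rewrite -ltr_sqr ?nnegrE ?(ltW e0) ?sqrtr_ge0 // hn.
have := L2norm_ge0 (fun x => u x - psi x); have := L2norm_ge0 (fun x => wD 1 u x - psi^`()%classic x).
move=> r1 r0; rewrite /wD /= in q1 r1 *; nra.
Unshelve. all: by end_near. Qed.

(** Conversely, the boundary conditions make the coefficients of the derivatives of an element
    of the phase space those of the differentiated series. *)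
Lemma Sbar_coef f (a := fun n => inner f (cosb n)) : inSbar f ->
  [/\ expands cosb f a, expands sinb (wD 1 f) (fun n => - (nu n ^+ 1 * a n)),
      expands cosb (wD 2 f) (fun n => - (nu n ^+ 2 * a n)) &
      forall N, \sum_(n < N) wt 2 n * a n ^+ 2 <= Hnorm 2 f ^+ 2].
Proof.
move=> [hk b0 b1 m0]; have L0 := Hk_L2 hk; have [w1 hk1] := Hk_wderiv hk.
have L1 := Hk_L2 hk1; have [w2 L2'] := Hk_wderiv hk1.
have e0 : expands cosb f a by apply: expands_cosb; split.
have c1 n : inner (wD 1 f) (sinb n) = - (nu n ^+ 1 * a n) by rewrite (weak_deriv_sin n L0 L1 w1).
have e1 : expands sinb (wD 1 f) (fun n => - (nu n ^+ 1 * a n)).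
  by apply: expands_ext (expands_sinb L1) => n; exact: c1.
have c2 n : inner (wD 2 f) (cosb n) = - (nu n ^+ 2 * a n).
  rewrite (weak_deriv_test L1 L2' w2 b0 b1 (der_cosb n)); last first.
    by move=> x; apply: cvgM; [exact: cvg_cst | exact: continuous_sinb].
  by rewrite innerZr ?sinL // c1; ring.
have m2 : inner (wD 2 f) (fun _ => 1) = 0.
  rewrite (weak_deriv_test L1 L2' w2 b0 b1 (fun x : R => is_derive_cst (1 : R) x 1)) ?inner0r ?oppr0 //.
  exact: cst_continuous.
have e2 : expands cosb (wD 2 f) (fun n => - (nu n ^+ 2 * a n)).
  apply: expands_ext (expands_cosb _) => [n|]; first exact: c2.
  by split=> //; rewrite -inner1.
split=> // N.
have -> : \sum_(n < N) wt 2 n * a n ^+ 2 = \sum_(n < N) a n ^+ 2 + \sum_(n < N) (- (nu n ^+ 1 * a n)) ^+ 2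
    + \sum_(n < N) (- (nu n ^+ 2 * a n)) ^+ 2.
  rewrite -!big_split /=; apply: eq_bigr => n _; rewrite /wt !big_ord_recl big_ord0 /=.
  by rewrite /bump /=; ring.
rewrite Hnorm_sqr !big_ord_recl big_ord0 addr0 addrA.
have h0 := expands_norm_ge cosL cosO N e0; have h1 := expands_norm_ge sinL sinO N e1.
have h2 := expands_norm_ge cosL cosO N e2.
exact: lerD (lerD h0 h1) h2.
Qed.

(** The third derivative is paired with sines, whose vanishing at the ends takes care of the
    boundary terms. *)
Lemma Sbar_H3_coef f (a := fun n => inner f (cosb n)) : inSbar f -> Hk 3 f ->
  expands sinb (wD 3 f) (fun n => nu n ^+ 3 * a n).
Proof.
move=> hS hk; have [_ _ e2 _] := Sbar_coef hS.
have [_ hk1] := Hk_wderiv hk; have [_ hk2] := Hk_wderiv hk1; have [w3 L3] := Hk_wderiv hk2.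
apply: expands_ext (expands_sinb L3) => n; rewrite (weak_deriv_sin n (Hk_L2 hk2) L3 w3).
by rewrite (expands_coef cosL cosO n e2) /a; ring.
Qed.

(** The vanishing traces allow cosines as test functions; that the mean of the derivative is zero
    makes up for the missing constant cosine. *)
Lemma H10_coef u (b := fun n => inner u (sinb n)) : H10 u ->
  expands sinb u b /\ expands cosb (wD 1 u) (fun n => nu n ^+ 1 * b n).
Proof.
move=> hu; have L0 := Hk_L2 hu.1; have [w1 L1] := Hk_wderiv hu.1.
split; first exact: expands_sinb.
apply: expands_ext (expands_cosb _) => [n|]; first exact: (H10_cos n hu).
by split=> //; rewrite -inner1; exact: H10_mean.
Qed.

Lemma H10_H2_coef u (b := fun n => inner u (sinb n)) : H10 u -> Hk 2 u ->
  expands sinb (wD 2 u) (fun n => - (nu n ^+ 2 * b n)).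
Proof.
move=> hu hk; have [_ e1] := H10_coef hu.
have [_ hk1] := Hk_wderiv hk; have [w2 L2'] := Hk_wderiv hk1.
apply: expands_ext (expands_sinb L2') => n; rewrite (weak_deriv_sin n (Hk_L2 hk1) L2' w2).
by rewrite (expands_coef cosL cosO n e1) /b; ring.
Qed.

End Coefficients.

(** * Real variable *)
Section RealVariable.
Context {R : realType}.

(** The supremum of the initial segments on which [P] holds belongs to them and cannot be
    less than [T]. *)
Lemma real_induction (T : R) (P : R -> Prop) : 0 <= T -> P 0 ->
  (forall t, 0 <= t < T -> P t -> exists2 d, 0 < d & forall s, t <= s <= T -> s < t + d -> P s) ->
  (forall t, 0 < t <= T -> (forall s, 0 <= s < t -> P s) -> P t) -> forall t, 0 <= t <= T -> P t.
Proof.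
move=> T0 P0 hr hl.
pose S := [set t | 0 <= t <= T /\ forall s, 0 <= s <= t -> P s].
have S0 : S 0.
  by split=> [|s /andP[s0 s1]]; [rewrite lexx | have -> : s = 0 by apply/le_anti; rewrite s1].
have ub : ubound S T by move=> t [/andP[]].
have hs : has_sup S by split; [exists 0 | exists T].
set m := sup S.
have m0 : 0 <= m by apply: ub_le_sup; [exact: hs.2|].
have mT : m <= T by apply: ge_sup; [exact: hs.1|].
have below s : 0 <= s < m -> P s.
  move=> /andP[s0 sm]; have ms0 : 0 < m - s by rewrite subr_gt0.
  have [t [tT ht] st] := sup_adherent ms0 hs.
  by apply: ht; rewrite s0 ltW //; move: st; rewrite opprB addrC subrK.
have Pm : P m.
  have [m00|m00] := eqVneq m 0; first by rewrite m00.
  by apply: hl => //; rewrite lt_neqAle eq_sym m00 m0 mT.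
have Sm : S m.
  split; first by rewrite m0.
  move=> s /andP[s0]; rewrite le_eqVlt => /predU1P[->//|sm].
  by apply: below; rewrite s0.
have [mT'|Tm] := ltP m T; last first.
  by move=> t /andP[t0 tT]; apply: Sm.2; rewrite t0 (le_trans tT).
have [d d0 hd] := hr m ltac:(by rewrite m0) Pm.
pose s := Num.min (m + d / 2) T.
have ms : m < s by rewrite lt_min mT' andbT ltrDl; lra.
have sT : s <= T by rewrite ge_min lexx orbT.
have sd : s < m + d by rewrite gt_min; apply/orP; left; lra.
have Ss : S s.
  split; first by rewrite (le_trans m0 (ltW ms)).
  move=> x /andP[x0 xs]; have [xm|mx] := leP x m; first by apply: Sm.2; rewrite x0.
  apply: hd; first by rewrite (ltW mx) (le_trans xs).
  exact: le_lt_trans xs sd.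
have : s <= m by apply: ub_le_sup; [exact: hs.2|].
by rewrite leNgt ms.
Qed.

Lemma close_pair (x y t p : R) : x < t + p -> y < t + p -> `|x - y| < p / 2 -> t - p / 2 < x ->
  `|x - t| < p /\ `|y - t| < p.
Proof.
rewrite [`|x - y| < _]ltr_norml => xp yp /andP[h1 h2] tx.
by split; rewrite ltr_norml; apply/andP; split; lra.
Qed.

Lemma uniformly_continuous_segment (f : R -> R) (T e : R) : 0 <= T -> continuous f -> 0 < e ->
  exists2 d : R, 0 < d & forall x y : R, 0 <= x <= T -> 0 <= y <= T -> `|x - y| < d -> `|f x - f y| <= e.
Proof.
move=> T0 cf e0.
have loc (t : R) : exists2 d : R, 0 < d & forall x : R, `|x - t| < d -> `|f x - f t| <= e / 2.
  have /cvgrPdist_le /(_ (e / 2)) := cf t; rewrite divr_gt0 // => /(_ isT) /nbhs_ballP [d d0 hd].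
  by exists d => // x xt; rewrite distrC; apply: hd; rewrite /ball /= distrC.
have tri (t x y d : R) : (forall x : R, `|x - t| < d -> `|f x - f t| <= e / 2) ->
    `|x - t| < d /\ `|y - t| < d -> `|f x - f y| <= e.
  move=> h [xt yt]; rewrite -(subrKA (f t)); apply: le_trans (ler_normD _ _) _.
  by have := h x xt; have := h y yt; rewrite (distrC (f t)); lra.
pose P (t : R) := exists2 d : R, 0 < d &
  forall x y : R, 0 <= x <= t -> 0 <= y <= t -> `|x - y| < d -> `|f x - f y| <= e.
have ext (c t p s : R) : P c -> 0 < p -> (forall x : R, `|x - t| < p -> `|f x - f t| <= e / 2) ->
    t - p / 2 <= c -> s < t + p -> P s.
  move=> [d d0 hd] p0 hp pc sp; exists (Num.min d (p / 2)) => [|x y /andP[x0 xs] /andP[y0 ys]].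
    by rewrite lt_min d0 divr_gt0.
  rewrite lt_min => /andP[xyd xyp]; have xp := le_lt_trans xs sp; have yp := le_lt_trans ys sp.
  have [xc|cx] := leP x c; [have [yc|cy] := leP y c|].
  - by apply: hd; rewrite ?x0 ?y0.
  - by rewrite distrC; rewrite distrC in xyp; apply: (tri t y x p hp); apply: close_pair => //; exact: le_lt_trans cy.
  - by apply: (tri t x y p hp); apply: close_pair => //; exact: le_lt_trans cx.
have P0 : P 0.
  exists 1 => // x y x0 y0 _; rewrite -(le_anti x0) -(le_anti y0) subrr normr0; exact: ltW.
suff : P T by [].
apply: (@real_induction T P T0 P0) => [t /andP[t0 tT] Pt|t /andP[t0 tT] hs|]; last by rewrite T0 lexx.
  have [p p0 hp] := loc t; exists p => // s _ sp; apply: (ext t t p s Pt p0 hp) => //.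
  by rewrite gerBl divr_ge0 // ltW.
have [p p0 hp] := loc t; pose c := Num.max 0 (t - p / 2).
apply: (ext c t p t _ p0 hp); last by rewrite ltrDl.
  by apply: hs; rewrite le_max lexx gt_max t0 gtrBl divr_gt0.
by rewrite le_max lexx orbT.
Qed.

Lemma sum_tail_small (B : nat -> R) K e : (forall n, 0 <= B n) -> (forall N, \sum_(n < N) B n <= K) ->
  0 < e -> exists N0, forall M, \sum_(N0 <= n < M) B n <= e.
Proof.
move=> B0 hK e0.
have cs : cvgn (series B).
  apply: nondecreasing_is_cvgn; first by apply: nondecreasing_series.
  by exists K => _ [N _ <-]; rewrite /series /= big_mkord.
move/cauchy_cvgP/cauchy_seriesP: cs => /(_ _ e0) [[/= D1 D2] [[N1 _ h1] [N2 _ h2]] hN].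
exists (maxn N1 N2) => M; have [hM|hM] := leqP (maxn N1 N2) M; last by rewrite big_geq ?ltW // ltnW.
have := hN (maxn N1 N2, M) _ => /= h; apply: le_trans (ler_norm _) (ltW (h _)); split.
  by apply: h1; exact: leq_maxl.
by apply: h2; apply: leq_trans hM; exact: leq_maxr.
Qed.

(** Dominated convergence for series, uniformly in the number of terms: the tail is controlled
    by the tail of [B], and finitely many terms remain. *)
Lemma dominated_sum (T : Type) (F : set_system T) {FF : Filter F} (q : nat -> T -> R) (B : nat -> R) K e :
  (forall n, 0 <= B n) -> (forall N, \sum_(n < N) B n <= K) ->
  (\forall s \near F, forall n, 0 <= q n s <= B n) ->
  (forall n, q n s @[s --> F] --> (0 : R)) -> 0 < e ->
  \forall s \near F, forall N, \sum_(n < N) q n s <= e.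
Proof.
move=> B0 hK hq q0 e0; have e20 : 0 < e / 2 by lra.
have [N0 hN0] := sum_tail_small B0 hK e20.
have c : \sum_(n < N0) q n s @[s --> F] --> \sum_(n < N0) (0 : R) by apply: cvg_bigsum => n _; exact: q0.
rewrite big1 // in c.
have near1 : \forall s \near F, \sum_(n < N0) q n s <= e / 2.
  move/cvgrPdist_le: c => /(_ _ e20); apply: filterS => s; rewrite sub0r normrN.
  by apply: le_trans; exact: ler_norm.
apply: filterS2 hq near1 => s hqs h1 N.
have q_ge0 n : 0 <= q n s by case/andP: (hqs n).
apply: (@le_trans _ _ (\sum_(n < N0 + N) q n s)).
  rewrite -!(big_mkord xpredT (fun n => q n s)) [leRHS](big_cat_nat (n := N)) ?leq_addl //= lerDl.
  by apply: sumr_ge0.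
rewrite -(big_mkord xpredT (fun n => q n s)) (big_cat_nat (n := N0)) ?leq_addr //= big_mkord.
have h2 : \sum_(N0 <= n < N0 + N) q n s <= e / 2.
  by apply: le_trans (hN0 (N0 + N)%N); apply: ler_sum => n _; case/andP: (hqs n).
lra.
Qed.

Lemma cvg0_sqr (T : Type) (F : set_system T) {FF : Filter F} (x : T -> R) :
  (forall s, 0 <= x s) -> (forall e, 0 < e -> \forall s \near F, x s ^+ 2 <= e) ->
  x s @[s --> F] --> (0 : R).
Proof.
move=> x0 h; apply/cvgrPdist_le => e e0; have := h _ (exprn_gt0 2 e0); apply: filterS => s hs.
by rewrite sub0r normrN ger0_norm // -ler_sqr ?nnegrE // ltW.
Qed.

Lemma abs_cont_lipschitz (T L : R) (d : R -> R -> R) :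
  (forall s t : R, 0 <= s -> s <= t -> t <= T -> d s t <= L * (t - s)) -> abs_cont T d.
Proof.
move=> h e e0; pose M := `|L| + 1; have M0 : 0 < M by rewrite /M ltr_wpDl.
exists (e / M) => [|n a b hab _ hs]; first exact: divr_gt0.
apply: (@le_lt_trans _ _ (M * \sum_i (b i - a i))); last by rewrite -ltr_pdivlMl // mulrC.
rewrite mulr_sumr; apply: ler_sum => i _; have [a0 ab bT] := hab i.
apply: le_trans (h _ _ a0 ab bT) _; apply: ler_wpM2r; first by rewrite subr_ge0.
by rewrite /M; apply: le_trans (ler_norm _) _; rewrite lerDl.
Qed.

Import HBNNSimple.

(** The functions of time considered here are norms of representatives chosen pointwise, for
    which measurability is not at hand.  The integral of a nonnegative function is a supremum over
    simple functions, and one that lies below [F] lies below [G] once cut off on the null set. *)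
Lemma integral_le_ae (D N : set (measurableTypeR R)) (F G : R -> \bar R) : measurable D ->
  measurable N -> leb N = 0%E -> (forall x, D x -> (0 <= F x)%E) -> (forall x, D x -> (0 <= G x)%E) ->
  (forall x, D x -> ~ N x -> (F x <= G x)%E) ->
  (\int[leb]_(x in D) F x <= \int[leb]_(x in D) G x)%E.
Proof.
move=> mD mN N0 F0 G0 FG; rewrite !ge0_integralE //.
apply: ge_ereal_sup => _ [h hF <-].
have mNC : measurable (~` N) by exact: measurableC.
have mh : measurable_fun setT (EFin \o h) by apply/measurable_EFinP.
have -> : sintegral leb h = sintegral leb (proj_nnsfun h mNC).
  have E (g : {nnsfun (measurableTypeR R) >-> R}) : sintegral leb g = (\int[leb]_x (g x)%:E)%E.
    by rewrite integral_nnsfun // patch_setT.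
  rewrite !E.
  rewrite (ge0_negligible_integral mN measurableT) //; last by move=> x _; rewrite lee_fin.
  rewrite setTD integral_mkcond; apply: eq_integral => x _.
  by rewrite -mrestrict restrict_EFin.
apply: ereal_sup_ubound; exists (proj_nnsfun h mNC) => //= x.
rewrite -[X in (X%:E <= _)%E]/((proj_nnsfun h mNC) x) -mrestrict !patchE.
case: ifPn => [|_].
  rewrite inE => nNx; have := hF x; rewrite patchE.
  case: ifPn => // Dx hx; apply: le_trans hx _; apply: FG => //; by rewrite inE in Dx.
by case: ifPn => // Dx; apply: G0; rewrite inE in Dx.
Qed.

Lemma integral_eq_ae (D : set (measurableTypeR R)) (F G : R -> \bar R) : measurable D ->
  {ae leb, forall x, D x -> F x = G x} ->
  (\int[leb]_(x in D) F x = \int[leb]_(x in D) G x)%E.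
Proof.
move=> mD [N [mN N0 sN]]; have FG x : D x -> ~ N x -> F x = G x.
  by move=> Dx nN; apply: contrapT => h; apply: nN; apply: sN => /= h2; apply: h; exact: h2.
rewrite integralE [RHS]integralE; congr (_ - _)%E; apply/eqP; rewrite eq_le; apply/andP; split;
  by apply: (integral_le_ae mD mN N0) => // x Dx nN; rewrite ?funeposE ?funenegE FG.
Qed.

End RealVariable.

(** * Square-integrable functions of time given by coefficients *)
(** Monotone convergence: the sum is integrable, hence finite for almost every time, and at such
    a time it is an ordinary convergent series. *)
Lemma integrable_series {R : realType} (w : nat -> R -> R) (T K : R) (I : nat -> R) :
  (forall n t, 0 <= w n t) -> (forall n, continuous (w n)) ->
  (forall n, \int[leb]_(t in `]0, T[) w n t <= I n) -> (forall M, \sum_(n < M) I n <= K) ->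
  exists Ser : R -> \bar R, [/\ forall t, (0 <= Ser t)%E, leb.-integrable `]0, T[ Ser,
    {ae leb, forall t, t \in `]0, T[ -> (Ser t < +oo)%E} &
    forall t, (Ser t < +oo)%E -> exists Kt : R, [/\ Ser t = Kt%:E,
      forall M, \sum_(n < M) w n t <= Kt & \sum_(n < M) w n t @[M --> \oo] --> Kt]].
Proof.
move=> w0 cw hI hK; have mD := measurable_oo 0 T.
have mw n : measurable_fun `]0, T[ (fun t => (w n t)%:E).
  by apply/measurable_EFinP; exact: measurable_continuous.
have w0e (n : nat) (t : R) : (0 <= (w n t)%:E)%E by rewrite lee_fin.
pose Ser t : \bar R := (\sum_(n <oo) (w n t)%:E)%E.
have mSer : measurable_fun `]0, T[ Ser.
  exact: (ge0_emeasurable_sum (P := xpredT) (fun k x _ _ => w0e k x) (fun k _ => mw k)).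
have Ser0 t : (0 <= Ser t)%E by apply: nneseries_ge0.
have iSer : (\int[leb]_(t in `]0%R, T[) Ser t < +oo)%E.
  rewrite (@integral_nneseries _ _ _ leb _ mD _ mw (fun k x _ => w0e k x)).
  apply: (@le_lt_trans _ _ K%:E); last by rewrite ltry.
  apply: lime_le; first by apply: is_cvg_nneseries => n _ _; apply: integral_ge0.
  apply: nearW => M; apply: le_trans (_ : (K%:E <= K%:E)%E) => //.
  apply: (@le_trans _ _ (\sum_(n < M) I n)%:E); last by rewrite lee_fin.
  rewrite big_mkord -sumEFin; apply: lee_sum => n _.
  rewrite -[leLHS]fineK ?lee_fin; first exact: hI.
  apply: integrable_fin_num => //; exact: L2_integrable (continuous_L2 0 T (cw n)).
have good t : (Ser t < +oo)%E -> exists Kt : R, [/\ Ser t = Kt%:E, forall M, \sum_(n < M) w n t <= Kt &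
     \sum_(n < M) w n t @[M --> \oo] --> Kt].
  move=> fin; have ES : Ser t = (fine (Ser t))%:E by rewrite fineK // ge0_fin_numE.
  have le M : \sum_(n < M) w n t <= fine (Ser t).
    by rewrite -lee_fin -ES -sumEFin -(big_mkord xpredT (fun n => (w n t)%:E)); apply: nneseries_lim_ge.
  have cs : cvgn (series (w^~ t)).
    apply: nondecreasing_is_cvgn; first by apply: nondecreasing_series.
    by exists (fine (Ser t)) => _ [M _ <-]; rewrite /series /= big_mkord.
  have c2 : \sum_(n < M) w n t @[M --> \oo] --> limn (series (w^~ t)).
    by move: cs; rewrite /series /=; under eq_fun do rewrite big_mkord.
  exists (fine (Ser t)); split=> //.
  rewrite (_ : fine (Ser t) = limn (series (w^~ t))) //.
  rewrite /Ser (_ : (fun M => (\sum_(0 <= n < M) (w n t)%:E)%E) = EFin \o series (w^~ t)); last first.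
    by apply/funext => M; rewrite /series /= sumEFin.
  by rewrite EFin_lim.
have ig : leb.-integrable `]0%R, T[ Ser.
  apply/integrableP; split=> //.
  rewrite (_ : (\int[leb]_(x in _) _)%E = (\int[leb]_(x in `]0%R, T[) Ser x)%E) //.
  by apply: eq_integral => x _; rewrite gee0_abs.
exists Ser; split=> //.
have := integrable_ae mD ig; apply: aeS => t h tI.
by have /(_ tI) := h; rewrite fin_numElt => /andP[].
Qed.

Section Bochner.
Context {R : realType}.
Variables (e : nat -> R -> R) (W : nat -> R) (X : (R -> R) -> Prop) (N : (R -> R) -> R).
Hypotheses (eL : forall n, L2 0 1 (e n)) (W_ge0 : forall n, 0 <= W n).
Hypothesis N_ge0 : forall f, 0 <= N f.
Hypothesis XN : forall f a K, expands e f a -> (forall M, \sum_(n < M) W n * a n ^+ 2 <= K) ->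
  X f /\ N f ^+ 2 <= K.

Lemma weighted_uniformly_continuous (al : nat -> R -> R) (T eta : R) j : 0 <= T ->
  (forall n, continuous (al n)) -> 0 < eta ->
  exists2 d : R, 0 < d & forall x y : R, 0 <= x <= T -> 0 <= y <= T -> `|x - y| < d ->
    \sum_(n < j) W n * (al n x - al n y) ^+ 2 <= eta.
Proof.
move=> T0 ca; elim: j eta => [|j IH] eta eta0.
  by exists 1 => // x y _ _ _; rewrite big_ord0 ltW.
have eta2 : 0 < eta / 2 by rewrite divr_gt0.
have [d d0 hd] := IH _ eta2.
have W1 : 0 < W j + 1 by apply: ltr_wpDl.
pose q := Num.min 1 (eta / 2 / (W j + 1)).
have q0 : 0 < q by rewrite lt_min ltr01 divr_gt0.
have [d' d'0 hd'] := uniformly_continuous_segment T0 (ca j) q0.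
exists (Num.min d d') => [|x y xT yT]; first by rewrite lt_min d0.
rewrite lt_min => /andP[xd xd']; rewrite big_ord_recr /= (splitr eta); apply: lerD; first exact: hd.
have hq := hd' x y xT yT xd'.
have q1 : q <= 1 by rewrite ge_min lexx.
have q2 : q <= eta / 2 / (W j + 1) by rewrite ge_min lexx orbT.
have h2 : (al j x - al j y) ^+ 2 <= q.
  rewrite -real_normK ?num_real // expr2; apply: (@le_trans _ _ (q * 1)); last by rewrite mulr1.
  by apply: ler_pM => //; exact: le_trans hq q1.
apply: (@le_trans _ _ ((W j + 1) * q)).
  by apply: ler_pM => //; [exact: sqr_ge0 | rewrite lerDl].
by rewrite mulrC -ler_pdivlMr.
Qed.

(** Strong measurability: the [j]-th approximation takes [j] modes and is constant on a grid
    fine enough for uniform continuity of these modes.  At a time where the weighted series is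
    finite, the error consists of the oscillation of the first modes and of the tail of the
    series.  The expansion of [F t] is required only at such times. *)
Lemma L2_into_coef (al : nat -> R -> R) (F : R -> R -> R) (T K : R) (I : nat -> R) : 0 < T ->
  (forall n, continuous (al n)) ->
  (forall t, 0 < t < T -> (exists K', forall M, \sum_(n < M) W n * al n t ^+ 2 <= K') ->
    expands e (F t) (al^~ t)) ->
  (forall n, \int[leb]_(t in `]0, T[) (W n * al n t ^+ 2) <= I n) ->
  (forall M, \sum_(n < M) I n <= K) -> L2_into T X N F.
Proof.
move=> T0 ca hF hI hK; have mD := measurable_oo 0 T.
pose w (n : nat) (t : R) : R := W n * al n t ^+ 2.
have w0 n t : 0 <= w n t by rewrite mulr_ge0 ?sqr_ge0.
have cw n : continuous (w n).
  by move=> t; apply: cvgM; [exact: cvg_cst | exact: continuousX].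
have [Ser [Ser0 ig aefin good]] := integrable_series w0 cw hI hK.
split.
- apply: aeS aefin => t h tI; have [Kt [_ le _]] := good t (h tI).
  by have [] := XN (hF t ltac:(by move: tI; rewrite in_itv) (ex_intro _ Kt le)) le.
- have /choice [d hd] : forall j : nat, exists d : R, 0 < d /\
      forall x y : R, 0 <= x <= T -> 0 <= y <= T -> `|x - y| < d ->
      \sum_(n < j) W n * (al n x - al n y) ^+ 2 <= j.+1%:R^-1.
    move=> j; have j0 : (0 : R) < j.+1%:R^-1 by rewrite invr_gt0.
    by have [d d0 h] := weighted_uniformly_continuous j (ltW T0) ca j0; exists d.
  have /choice [m hm] : forall j : nat, exists m : nat, (0 < m)%N /\ T / m%:R < d j.
    move=> j; have d0 := (hd j).1; exists (Num.trunc `|T / d j|).+1; split=> //.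
    have := truncnS_gt (`|T / d j|); rewrite ger0_norm ?divr_ge0 ?ltW // => h.
    by rewrite ltr_pdivrMr // mulrC -ltr_pdivrMr.
  pose g j i : R := T * i%:R / (m j)%:R.
  exists (fun j t x => \sum_(i < m j) \1_(`[g j i, g j i.+1[) t * fsum e (al^~ (g j i)) j x).
  split.
    move=> j; exists (m j), (fun i => `[g j i, g j i.+1[%classic), (fun i => fsum e (al^~ (g j i)) j).
    split=> // i.
    have [] := XN (expands_fsum (al^~ (g j i)) j eL) (K := \sum_(n < j) W n * al n (g j i) ^+ 2) _ => // M.
    apply: (@le_trans _ _ (\sum_(n < M + j) W n * (if (n < j)%N then al n (g j i) else 0) ^+ 2)).
      rewrite -!(big_mkord xpredT (fun n => W n * (if (n < j)%N then al n (g j i) else 0) ^+ 2)).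
      rewrite [leRHS](big_cat_nat (n := M)) ?leq_addr //= lerDl; apply: sumr_ge0 => n _.
      by rewrite mulr_ge0 ?sqr_ge0.
    rewrite -(big_mkord xpredT (fun n => W n * (if (n < j)%N then al n (g j i) else 0) ^+ 2)).
    rewrite (big_cat_nat (n := j)) ?leq_addl //= [X in _ + X]big_nat_cond [X in _ + X]big1; last first.
      by move=> n /andP[/andP[jn _] _]; rewrite ltnNge jn expr0n mulr0.
    rewrite addr0 big_mkord le_eqVlt; apply/orP; left; apply/eqP; apply: eq_bigr => n _.
    by rewrite ltn_ord.
  apply: aeS aefin => t h tI; have [Kt [_ le cvKt]] := good t (h tI).
  have t0T : 0 < t < T by move: tI; rewrite in_itv.
  have hFt := hF t t0T (ex_intro _ Kt le).
  pose i0 j : nat := Num.trunc (t * (m j)%:R / T).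
  have tm j : 0 <= t * (m j)%:R / T by case/andP: t0T => ? ?; rewrite divr_ge0 ?mulr_ge0 // ltW.
  have m0 j : (0 : R) < (m j)%:R by rewrite ltr0n; exact: (hm j).1.
  have trn j := truncn_itv (tm j).
  have i0m j : (i0 j < m j)%N.
    rewrite -(ltr_nat R); have /andP[h1 _] := trn j; apply: le_lt_trans h1 _.
    by rewrite ltr_pdivrMr // [ltRHS]mulrC ltr_pM2r //; case/andP: t0T.
  have sE j x : \sum_(i < m j) \1_(`[g j i, g j i.+1[) t * fsum e (al^~ (g j i)) j x =
      fsum e (al^~ (g j (i0 j))) j x.
    have mem i : (t \in `[g j i, g j i.+1[) = (i == i0 j).
      rewrite in_itv /= /g ler_pdivrMr // ltr_pdivlMr // -ler_pdivlMl // -ltr_pdivrMl //.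
      rewrite [T^-1 * _]mulrC; apply/idP/eqP => [/andP[h1 h2]|->]; last exact: trn.
      by apply/esym; apply: truncn_def; rewrite h1.
    rewrite (bigD1 (Ordinal (i0m j))) //= indicE mem_setE mem eqxx mul1r big1 ?addr0 // => i ne.
    rewrite indicE mem_setE mem (_ : (val i == i0 j) = false) ?mul0r //.
    by apply: contraNF ne => /eqP h1; apply/eqP/val_inj.
  apply: cvg0_sqr => [j|eps eps0]; first exact: N_ge0.
  pose rem j : R := j.+1%:R^-1 + (Kt - \sum_(n < j) w n t).
  have crem : rem j @[j --> \oo] --> (0 + (Kt - Kt) : R).
    apply: cvgD; first exact: cvg_harmonic.
    by apply: cvgB => //; exact: cvg_cst.
  rewrite subrr addr0 in crem; move/cvgrPdist_le: crem => /(_ _ eps0); apply: filterS => j.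
  rewrite sub0r normrN => hj; apply: (@le_trans _ _ (rem j)); last exact: le_trans (ler_norm _) hj.
  rewrite (_ : F t \- _ = fun x => F t x - fsum e (al^~ (g j (i0 j))) j x); last first.
    by apply/funext => x /=; rewrite sE.
  have hd2 := expandsB eL hFt (expands_fsum (al^~ (g j (i0 j))) j eL).
  have gj : `|t - g j (i0 j)| < d j /\ 0 <= g j (i0 j) <= T.
    have /andP[h1 h2] : (i0 j)%:R <= t * (m j)%:R / T < (i0 j).+1%:R by exact: trn.
    have g1 : g j (i0 j) <= t by rewrite /g ler_pdivrMr // mulrC -ler_pdivlMr.
    have g2 : t < g j (i0 j) + T / (m j)%:R.
      rewrite /g -mulrDl -[X in _ + X](mulr1 T) -mulrDr ltr_pdivlMr // natr1.
      by rewrite [ltRHS]mulrC -ltr_pdivrMr //.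
    case/andP: t0T => ta tb; split.
      rewrite ger0_norm ?subr_ge0 //; apply: le_lt_trans (hm j).2.
      by rewrite lerBlDl ltW.
    by rewrite (le_trans g1 (ltW tb)) andbT /g divr_ge0 // mulr_ge0 // ltW.
  suff hM M : \sum_(n < M) W n * (al n t - (if (n < j)%N then al n (g j (i0 j)) else 0)) ^+ 2 <= rem j.
    by have [] := XN hd2 hM.
  apply: (@le_trans _ _ (\sum_(n < M + j) W n * (al n t - (if (n < j)%N then al n (g j (i0 j)) else 0)) ^+ 2)).
    rewrite -!(big_mkord xpredT (fun n => W n * (al n t - (if (n < j)%N then al n (g j (i0 j)) else 0)) ^+ 2)).
    rewrite [leRHS](big_cat_nat (n := M)) ?leq_addr //= lerDl; apply: sumr_ge0 => n _.
    by rewrite mulr_ge0 ?sqr_ge0.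
  rewrite -(big_mkord xpredT (fun n => W n * (al n t - (if (n < j)%N then al n (g j (i0 j)) else 0)) ^+ 2)).
  rewrite (big_cat_nat (n := j)) ?leq_addl //=; apply: lerD.
    case: gj => gj1 gj2; have := (hd j).2 t (g j (i0 j)) ltac:(by case/andP: t0T => /ltW -> /ltW ->) gj2 gj1.
    apply: le_trans; rewrite big_mkord le_eqVlt; apply/orP; left; apply/eqP; apply: eq_bigr => n _.
    by rewrite ltn_ord.
  rewrite lerBrDl; apply: le_trans (le (M + j)%N).
  rewrite -!(big_mkord xpredT (fun n => w n t)) [leRHS](big_cat_nat (n := j)) ?leq_addl //=.
  rewrite lerD2l big_nat_cond [leRHS]big_nat_cond; apply: ler_sum => n /andP[/andP[jn _] _].
  by rewrite ltnNge jn subr0.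
- have iSer : (\int[leb]_(t in `]0%R, T[) Ser t < +oo)%E.
    have /integrableP[_] := ig; apply: le_lt_trans; apply: (integral_le_ae mD measurable0 (measure0 _)) => // t _ _.
    exact: lee_abs.
  apply: le_lt_trans iSer.
  apply: (integral_le_ae mD measurable0 (measure0 _)) => [t _|t _|t tI _]; first by rewrite lee_fin sqr_ge0.
    exact: Ser0.
  have [fin|inf] := ltP (Ser t) +oo%E; last by apply: le_trans inf; rewrite leey.
  have [Kt [-> le _]] := good t fin; rewrite lee_fin.
  have t0T : 0 < t < T by move: tI; rewrite /= in_itv.
  by have [] := XN (hF t t0T (ex_intro _ Kt le)) le.
Qed.

End Bochner.

(** * Derivatives in time *)
Section TimeDerivatives.
Context {R : realType}.
Implicit Types (f g : R -> R).

Lemma mean_bound f df (a b K : R) : a <= b -> continuous f ->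
  (forall x : R, a < x < b -> is_derive x 1 f (df x)) ->
  (forall x : R, a < x < b -> `|df x| <= K) -> `|f b - f a| <= K * (b - a).
Proof.
rewrite le_eqVlt => /predU1P[->|ab] cf hd hK; first by rewrite !subrr normr0 mulr0.
have hd' (x : R) : x \in `]a, b[ -> is_derive x 1 f (df x) by rewrite in_itv /=; exact: hd.
have [c cab ->] := @MVT R f df a b ab hd' (continuous_subspaceT cf).
have ba : 0 <= b - a by rewrite subr_ge0 ltW.
rewrite in_itv /= in cab; rewrite normrM (ger0_norm ba).
by apply: ler_wpM2r => //; exact: hK.
Qed.

(** The mean value inequality for [f - d x].  Differentiability is asked at positive times only,
    so that the one-sided quotients at [t = 0] are covered. *)
Lemma quotient_bound f df (s t d K : R) : 0 <= s -> 0 <= t -> s != t -> continuous f ->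
  (forall x : R, 0 < x -> is_derive x 1 f (df x)) ->
  (forall x : R, 0 < x -> `|x - t| <= `|s - t| -> `|df x - d| <= K) ->
  `|(s - t)^-1 * (f s - f t) - d| <= K.
Proof.
move=> s0 t0 st cf hd hK; have st0 : s - t != 0 by rewrite subr_eq0.
pose g x := f x - d * x.
have cg : continuous g.
  by move=> x; apply: cvgB; [exact: cf | apply: cvgM; [exact: cvg_cst | exact: cvg_id]].
have dg (x : R) : 0 < x -> is_derive x 1 g (df x - d).
  move=> x0; apply: is_derive_conv (derB (hd x x0) (derZ d (derId x))) (fun _ => erefl) _.
  by rewrite mulr1.
have -> : (s - t)^-1 * (f s - f t) - d = (s - t)^-1 * (g s - g t).
  by rewrite /g; field.
rewrite normrM normfV mulrC ler_pdivrMr ?normr_gt0 //.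
have [lt|lt|e] := ltgtP s t; last by rewrite e eqxx in st.
  rewrite (distrC (g s)) (ltr0_norm (_ : s - t < 0)) ?subr_lt0 // (opprB s t).
  apply: (@mean_bound g (fun x => df x - d)) => //; first exact: ltW.
    by move=> x /andP[sx _]; apply: dg; apply: le_lt_trans sx.
  move=> x /andP[sx xt]; apply: hK; first exact: le_lt_trans sx.
  by rewrite !ltr0_norm ?subr_lt0 // !opprB lerD2l lerN2 ltW.
rewrite (gtr0_norm (_ : 0 < s - t)) ?subr_gt0 //.
apply: (@mean_bound g (fun x => df x - d)) => //; first exact: ltW.
  by move=> x /andP[tx _]; apply: dg; apply: le_lt_trans tx.
move=> x /andP[tx xs]; apply: hK; first exact: le_lt_trans tx.
by rewrite !gtr0_norm ?subr_gt0 // lerD2r ltW.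
Qed.

Lemma integral_derive_oo (F f : R -> R) (a b : R) : a < b ->
  (forall x : R, a < x < b -> is_derive x 1 F (f x)) -> continuous F -> continuous f ->
  \int[leb]_(x in `]a, b[) f x = F b - F a.
Proof.
move=> ab dF cF cf; rewrite Rintegral_oo_cc; last exact: measurable_continuous.
rewrite /Rintegral (@continuous_FTC2 _ f F) //.
- exact: continuous_subspaceT.
- split=> [x xab||].
  + by rewrite in_itv /= in xab; exact: (@ex_derive _ _ _ _ _ _ _ (dF x xab)).
  + by apply: cvg_at_right_filter; exact: cF.
  + by apply: cvg_at_left_filter; exact: cF.
- by move=> x; rewrite in_itv /= => xab; rewrite derive1E; exact: (@derive_val _ _ _ _ _ _ _ (dF x xab)).
Qed.

Lemma eq01_of_L2norm0 f g : L2 0 1 f -> L2 0 1 g -> L2norm (fun x => f x - g x) = 0 -> eq01 f g.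
Proof.
move=> hf hg h; apply: aeS (L2norm0_eq01 (L2B hf hg) h) => x hx /hx /eqP.
by rewrite subr_eq0 => /eqP.
Qed.

(** Some [s] is close to [t] for both limits; the properness of the filter is the assumption
    that [t] is an accumulation point of [I]. *)
Lemma is_tderiv_unique (I : set R) (F : R -> R -> R) (t : R) g h :
  ProperFilter (within I t^') -> I t -> (forall s, I s -> L2 0 1 (F s)) ->
  is_tderiv I F t g -> is_tderiv I F t h -> eq01 g h.
Proof.
move=> PF It LF [Lg cg] [Lh ch]; apply: eq01_of_L2norm0 => //; apply/le_anti.
rewrite L2norm_ge0 andbT; apply/ler_addgt0Pr => e e0; rewrite add0r.
have e2 : 0 < e / 2 by lra.
have inI : \forall s \near within I t^', I s by apply: withinT; exact: filter_filter.
move/cvgrPdist_le: cg => /(_ _ e2) hg; move/cvgrPdist_le: ch => /(_ _ e2) hh.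
have [s [[h1 h2] Is]] := filter_ex (filterI (filterI hg hh) inI).
move: h1 h2; rewrite !sub0r !normrN !ger0_norm ?L2norm_ge0 // => h1 h2.
have LQ : L2 0 1 (fun x => (F s x - F t x) / (s - t)).
  have := L2Z (s - t)^-1 (L2B (LF s Is) (LF t It)).
  by under eq_fun do rewrite mulrC.
have := L2norm_triangle (L2N (L2B LQ Lg)) (L2B LQ Lh).
rewrite L2normN (_ : (fun x => - _ + _) = (fun x => g x - h x)); last by apply/funext => x; ring.
lra.
Qed.

Lemma is_tderiv_eq01 (I : set R) (F F' : R -> R -> R) (t : R) g g' :
  I t -> (forall s, I s -> L2 0 1 (F s)) -> (forall s, I s -> L2 0 1 (F' s)) ->
  (forall s, I s -> eq01 (F s) (F' s)) -> L2 0 1 g' -> eq01 g g' ->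
  is_tderiv I F t g -> is_tderiv I F' t g'.
Proof.
move=> It LF LF' FF' Lg' gg' [Lg cg]; split=> //; apply: cvg_trans cg; apply: near_eq_cvg.
have inI : \forall s \near within I t^', I s by apply: withinT; exact: filter_filter.
apply: filterS inI => s Is.
have LQ G : (forall s, I s -> L2 0 1 (G s)) -> L2 0 1 (fun x => (G s x - G t x) / (s - t)).
  move=> LG; have := L2Z (s - t)^-1 (L2B (LG s Is) (LG t It)).
  by under eq_fun do rewrite mulrC.
apply: L2norm_eq01; [exact: L2B (LQ F LF) Lg | exact: L2B (LQ F' LF') Lg' |].
apply: (eq01_trans (g := fun x => (F' s x - F' t x) / (s - t) - g x)).
  by apply: aeS2 (FF' s Is) (FF' t It) => x h1 h2 xI; rewrite h1 // h2.
by apply: aeS gg' => x h xI; rewrite h.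
Qed.

Lemma within_dnbhs_proper (T : R) (t : R) : 0 < T -> 0 <= t <= T -> ProperFilter (within `[0, T] t^').
Proof.
move=> T0 /andP[t0 tT].
suff h P : within `[0, T] t^' P -> exists s, P s by split; [move=> /h [] | typeclasses eauto].
rewrite /within /= => /nbhs_ballP [d d0 hd].
pose m := Num.min (d / 2) (T / 2).
have m0 : 0 < m by rewrite lt_min !divr_gt0.
have md : m < d by rewrite gt_min; apply/orP; left; move: d0 => /= d0; lra.
have mT : m <= T / 2 by rewrite ge_min lexx orbT.
have [lt|le] := ltP t (T / 2).
  exists (t + m); apply: hd; last by rewrite /= in_itv /=; apply/andP; split; lra.
    by rewrite /ball /= opprD addrA subrr sub0r normrN gtr0_norm.
  by rewrite addrC -subr_eq0 addrK gt_eqF.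
exists (t - m); apply: hd; last by rewrite /= in_itv /=; apply/andP; split; lra.
  by rewrite /ball /= opprB addrC subrK gtr0_norm.
by rewrite -subr_eq0 addrC addKr oppr_eq0 gt_eqF.
Qed.

Lemma within_dnbhs_proper_ray (t : R) : 0 <= t -> ProperFilter (within `[0, +oo[ t^').
Proof.
move=> t0; have t1 : 0 < t + 1 by lra.
have tt : 0 <= t <= t + 1 by apply/andP; split; lra.
have PF := within_dnbhs_proper t1 tt.
suff h P : within `[0, +oo[ t^' P -> exists s, P s by split; [move=> /h [] | typeclasses eauto].
move=> hP; apply: (@filter_ex _ _ PF); move: hP; rewrite /within /=.
apply: (@filterS _ t^') => s h1; rewrite /= !in_itv /= => /andP[s0 _].
by apply: h1; rewrite /= in_itv /= s0.
Qed.

End TimeDerivatives.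

(** * From modes to weak solutions *)
Section Feedback.
Context {R : realType}.

(** The feedback in terms of three pairings.  The factor of the integral is distributed so that
    [k^2 Q] multiplies the limit of [qsum]. *)
Lemma feedbackE (mu kappa r k Q gamma : R) (ph u phit : R -> R) (xi w : R) :
  r != 0 -> k != 0 -> L2 0 1 ph -> L2 0 1 (wD 1 ph) -> L2 0 1 phit -> L2 0 1 (wD 1 u) -> eq01 phit (wD 1 u) ->
  feedback mu kappa r k Q gamma xi w ph phit = gamma * k * (w + k * xi + k ^+ 2 * Q *
    (- (r * kappa) * inner ph (fun x => x) + - (r + 1) * inner (wD 1 u) (fun x => x)
     + - (r * mu) * inner (wD 1 ph) (fun _ => 1))).
Proof.
move=> r0 k0 Lphi Lw Lp Lu ep.
have Lx : L2 0 1 (fun x : R => x) by apply: continuous_L2 => x; exact: cvg_id.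
have L1 : L2 0 1 (fun _ : R => 1) by exact: L2_cst.
have iI : \int[leb]_(x in `](0:R), 1[) (kappa * x * ph x + (r + 1) / r * x * phit x + mu * wD 1 ph x) =
    kappa * inner ph (fun x => x) + (r + 1) / r * inner (wD 1 u) (fun x => x) + mu * inner (wD 1 ph) (fun _ => 1).
  rewrite -(inner_eq01l Lp Lu Lx ep) /inner -!RintegralZl //; try exact: L2_mul_integrable.
  have i1 := integrable_EFinZ kappa (measurable_oo (0:R) 1) (L2_mul_integrable Lphi Lx).
  have i2 := integrable_EFinZ ((r + 1) / r) (measurable_oo (0:R) 1) (L2_mul_integrable Lp Lx).
  have i3 := integrable_EFinZ mu (measurable_oo (0:R) 1) (L2_mul_integrable Lw L1).
  rewrite -RintegralD // -RintegralD //; last exact: integrable_EFinD.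
  by apply: eq_Rintegral => x _; ring.
by rewrite /feedback iI; field; rewrite k0 r0.
Qed.

(** The moments against [x] become [qsum] through [inner_id_cosb], and the integral of [phi_x]
    does so because [one_coef] are the coefficients of 1. *)
Lemma Flaw_cvg_feedback (mu kappa r k Q gamma : R) (al be : nat -> R) (ph u phit : R -> R) (xi w : R) :
  r != 0 -> k != 0 -> expands cosb ph al -> expands sinb (wD 1 ph) (fun n => - (nu n ^+ 1 * al n)) ->
  expands cosb (wD 1 u) (fun n => nu n ^+ 1 * be n) -> L2 0 1 phit -> eq01 phit (wD 1 u) ->
  Flaw mu kappa r k Q gamma (@one_coef R) N al be xi w @[N --> \oo] -->
    feedback mu kappa r k Q gamma xi w ph phit.
Proof.
move=> r0 k0 e0 e1 e2 Lp ep.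
have Lx : L2 0 1 (fun x : R => x) by apply: continuous_L2 => x; exact: cvg_id.
have L1 : L2 0 1 (fun _ : R => 1) by exact: L2_cst.
have Lphi := expands_L2 e0; have Lw := expands_L2 e1; have Lu := expands_L2 e2.
have c1 := expands_inner (@cosb_L2 R) e0 Lx.
have c2 := expands_inner (@cosb_L2 R) e2 Lx.
have c3 := expands_inner (@sinb_L2 R) e1 L1.
have cq : qsum mu kappa r (@one_coef R) N al be @[N --> \oo] -->
    (- (r * kappa) * inner ph (fun x => x) + - (r + 1) * inner (wD 1 u) (fun x => x)
     + - (r * mu) * inner (wD 1 ph) (fun _ => 1) : R).
  have cs : - (r * kappa) * (\sum_(n < N) al n * inner (cosb n) (fun x => x)) +
     - (r + 1) * (\sum_(n < N) nu n ^+ 1 * be n * inner (cosb n) (fun x => x)) +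
     - (r * mu) * (\sum_(n < N) - (nu n ^+ 1 * al n) * inner (sinb n) (fun _ => 1)) @[N --> \oo] -->
    (- (r * kappa) * inner ph (fun x => x) + - (r + 1) * inner (wD 1 u) (fun x => x)
     + - (r * mu) * inner (wD 1 ph) (fun _ => 1) : R).
    apply: cvgD; [apply: cvgD |]; (apply: cvgM; first exact: cvg_cst).
    - exact: c1.
    - exact: c2.
    - exact: c3.
  apply: cvg_trans cs; apply: near_eq_cvg; apply: nearW => N.
  rewrite /qsum !mulr_sumr -!big_split /=; apply: eq_bigr => n _.
  rewrite (innerC (cosb n)) inner_id_cosb -[inner (sinb n) _]/(one_coef n) /zcoef.
  by field; exact: nu_neq0.
rewrite (feedbackE mu kappa Q gamma xi w r0 k0 Lphi Lw Lp Lu ep).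
apply: cvgM; first exact: cvg_cst.
by apply: cvgD; [exact: cvg_cst | apply: cvgM; [exact: cvg_cst | exact: cq]].
Qed.

End Feedback.

Section Synthesis.
Context {R : realType}.
Variables (sigma mu kappa : R).
Hypotheses (sigma_gt0 : 0 < sigma) (mu_gt0 : 0 < mu) (kappa_ge0 : 0 <= kappa).
Local Notation c := (@one_coef R).
Variables (a b : nat -> R -> R) (xi w f : R -> R) (B : nat -> R) (KB : R).
Hypotheses (ca : forall n, continuous (a n)) (cb : forall n, continuous (b n)).
Hypotheses (cw : continuous w) (cxi : continuous xi) (cf : continuous f).
Hypothesis modes : forall n t, 0 < t -> is_mode sigma mu kappa c n (a n) (b n) f t.
Hypothesis dxi : forall t : R, 0 < t -> is_derive t 1 xi (w t).
Hypothesis dw : forall t : R, 0 < t -> is_derive t 1 w (- f t).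
(* one summable majorant for the modes in the strong norm, the gained derivatives and the
   forcing *)
Hypothesis B_ge0 : forall n, 0 <= B n.
Hypothesis B_sum : forall N, \sum_(n < N) B n <= KB.
Hypothesis B_sup : forall n t, 0 <= t -> nu n ^+ 2 * b n t ^+ 2 + nu n ^+ 4 * a n t ^+ 2 <= B n.
Hypothesis B_int : forall n t, 0 <= t ->
  \int[leb]_(s in `[0, t]) (nu n ^+ 4 * b n s ^+ 2 + nu n ^+ 6 * a n s ^+ 2) <= (1 + t) * B n.
Hypothesis B_f : forall n t, 0 <= t -> c n ^+ 2 * f t ^+ 2 <= B n.

(** The coefficients of [u_t] prescribed by the modes. *)
Definition beta (n : nat) (t : R) : R :=
  - stiff sigma n * a n t - damp mu kappa n * b n t - c n * f t.

Variables (phi u ut : R -> R -> R).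
Hypothesis hphi : forall t, 0 <= t -> expands cosb (phi t) (a^~ t).
Hypothesis hu : forall t, 0 <= t -> expands sinb (u t) (b^~ t).
Hypothesis hut : forall t, 0 <= t -> sqsum (beta^~ t) -> expands sinb (ut t) (beta^~ t).

Let cosL := @cosb_L2 R.
Let cosO := @cosb_on R.
Let sinL := @sinb_L2 R.
Let sinO := @sinb_on R.

Lemma wt_le k n : wt k n <= k.+1%:R * nu n ^+ (2 * k) :> R.
Proof.
rewrite /wt mulr_natl -[X in _ *+ X]card_ord -sumr_const; apply: ler_sum => j _.
by apply: ler_weXn2l; [exact: nu_ge1 | rewrite leq_mul2l -ltnS ltn_ord orbT].
Qed.

Lemma nuX_ge1 n j : 1 <= nu n ^+ j :> R.
Proof. by apply: exprn_ege1; exact: nu_ge1. Qed.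

Lemma nuX_gt0 n j : 0 < nu n ^+ j :> R.
Proof. by rewrite exprn_gt0 // nu_gt0. Qed.

Lemma B_b n t : 0 <= t -> nu n ^+ 2 * b n t ^+ 2 <= B n.
Proof.
move=> t0; apply: le_trans (B_sup n t0); rewrite lerDl.
by rewrite mulr_ge0 ?sqr_ge0 // ltW ?nuX_gt0.
Qed.

Lemma B_a n t : 0 <= t -> nu n ^+ 4 * a n t ^+ 2 <= B n.
Proof.
move=> t0; apply: le_trans (B_sup n t0); rewrite lerDr.
by rewrite mulr_ge0 ?sqr_ge0 // ltW ?nuX_gt0.
Qed.

Lemma sum_scaled_le (x : nat -> R) C N : 0 <= C -> (forall n, x n <= C * B n) ->
  \sum_(n < N) x n <= C * KB.
Proof.
move=> C0 h; apply: (@le_trans _ _ (\sum_(n < N) C * B n)); first by apply: ler_sum.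
by rewrite -mulr_sumr ler_wpM2l.
Qed.

Lemma sum_wt_a t N : 0 <= t -> \sum_(n < N) wt 2 n * a n t ^+ 2 <= 3 * KB.
Proof.
move=> t0; apply: (@sum_scaled_le (fun n => wt 2 n * a n t ^+ 2)) => // n.
apply: le_trans (ler_wpM2l _ (B_a n t0)) => //; rewrite [leRHS]mulrA.
by apply: ler_wpM2r; [exact: sqr_ge0 | exact: wt_le].
Qed.

Lemma sum_wt_b t N : 0 <= t -> \sum_(n < N) wt 1 n * b n t ^+ 2 <= 2 * KB.
Proof.
move=> t0; apply: (@sum_scaled_le (fun n => wt 1 n * b n t ^+ 2)) => // n.
apply: le_trans (ler_wpM2l _ (B_b n t0)) => //; rewrite [leRHS]mulrA.
by apply: ler_wpM2r; [exact: sqr_ge0 | exact: wt_le].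
Qed.

Lemma phi_Sbar t : 0 <= t -> inSbar (phi t).
Proof. by move=> t0; have [] := cos_series_Sbar (hphi t0) (fun N => sum_wt_a N t0). Qed.

Lemma u_H10 t : 0 <= t -> H10 (u t).
Proof. by move=> t0; exact: sin_series_H10 (hu t0) (fun N => sum_wt_b N t0). Qed.

Lemma u_wD1 t : 0 <= t -> expands cosb (wD 1 (u t)) (fun n => nu n ^+ 1 * b n t).
Proof.
move=> t0; have [] // := sin_series_wD1 (hu t0) (sqsum_wt (isT : (1 <= 1)%N) (fun N => sum_wt_b N t0)).
Qed.

Lemma Rint_le (h1 h2 : R -> R) (T : R) : continuous h1 -> continuous h2 ->
  (forall t, 0 < t < T -> h1 t <= h2 t) ->
  \int[leb]_(t in `]0, T[) h1 t <= \int[leb]_(t in `]0, T[) h2 t.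
Proof.
move=> c1 c2 h; apply: le_Rintegral => //; try exact: L2_integrable (continuous_L2 0 T _).
Qed.

Let E n t := nu n ^+ 4 * b n t ^+ 2 + nu n ^+ 6 * a n t ^+ 2.

Lemma continuous_E n : continuous (E n).
Proof.
by move=> t; apply: cvgD; (apply: cvgM; [exact: cvg_cst | apply: continuousX; [exact: cb || exact: ca]]).
Qed.

(** The parabolic gain of one derivative, integrated in time. *)
Lemma Rint_E n T : 0 <= T -> \int[leb]_(t in `]0, T[) E n t <= (1 + T) * B n.
Proof.
move=> T0; rewrite Rintegral_oo_cc; first exact: B_int.
by apply: measurable_continuous; exact: continuous_E.
Qed.

Lemma Rint_scaled (h : R -> R) n C D T : 0 <= T -> 0 <= C -> continuous h ->
  (forall t, 0 < t < T -> h t <= C * E n t + D) -> 0 <= D ->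
  \int[leb]_(t in `]0, T[) h t <= C * ((1 + T) * B n) + D * T.
Proof.
move=> T0 C0 ch hh D0; have cE := @continuous_E n.
have cCE : continuous (fun t => C * E n t) by move=> t; apply: cvgM; [exact: cvg_cst | exact: cE].
apply: (@le_trans _ _ (\int[leb]_(t in `]0, T[) (C * E n t + D))).
  by apply: Rint_le => // t; apply: cvgD; [exact: cCE | exact: cvg_cst].
rewrite RintegralD //; try exact: L2_integrable (continuous_L2 0 T _); last first.
  by apply: L2_integrable; exact: L2_cst.
rewrite RintegralZl //; last exact: L2_integrable (continuous_L2 0 T cE).
apply: lerD; first by rewrite ler_wpM2l // Rint_E.
rewrite Rintegral_cst // -[X in _ * fine X]/(leb _) lebesgue_measure_itv /= lte_fin.
by case: ifP => _ /=; rewrite ?subr0 ?mulr0 ?mulr_ge0.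
Qed.

Lemma phi_L2H3 T : 0 < T -> L2_into T (fun g => Hk 3 g /\ inSbar g) (Hnorm 3) phi.
Proof.
move=> T0; apply: (@L2_into_coef R cosb (wt 3) _ _ cosL _ _ _ a phi T (4 * (1 + T) * KB) (fun n => 4 * (1 + T) * B n)) => //.
- by move=> n; exact: wt_ge0.
- by move=> g; exact: sqrtr_ge0.
- by move=> g al K h; exact: cos_series_H3.
- by move=> t /andP[t0 _] _; apply: hphi; exact: ltW.
- move=> n; have := @Rint_scaled (fun t => wt 3 n * a n t ^+ 2) n 4 0 T (ltW T0) _ _ _ (lexx _).
  rewrite mul0r addr0 mulrA; apply=> //.
    by move=> t; apply: cvgM; [exact: cvg_cst | apply: continuousX; exact: ca].
  move=> t _; rewrite addr0 /E; apply: (@le_trans _ _ (4 * (nu n ^+ 6 * a n t ^+ 2))).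
    by rewrite mulrA; apply: ler_wpM2r; [exact: sqr_ge0 | exact: wt_le].
  by rewrite ler_pM2l // lerDr mulr_ge0 ?sqr_ge0 // ltW ?nuX_gt0.
- move=> M; apply: (@sum_scaled_le (fun n => 4 * (1 + T) * B n)) => //.
  by have := T0 => ?; rewrite mulr_ge0 //; lra.
Qed.

Lemma u_L2H2 T : 0 < T -> L2_into T (Hk 2) (Hnorm 2) u.
Proof.
move=> T0; apply: (@L2_into_coef R sinb (wt 2) _ _ sinL _ _ _ b u T (3 * (1 + T) * KB) (fun n => 3 * (1 + T) * B n)) => //.
- by move=> n; exact: wt_ge0.
- by move=> g; exact: sqrtr_ge0.
- by move=> g al K h; exact: sin_series_H2.
- by move=> t /andP[t0 _] _; apply: hu; exact: ltW.
- move=> n; have := @Rint_scaled (fun t => wt 2 n * b n t ^+ 2) n 3 0 T (ltW T0) _ _ _ (lexx _).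
  rewrite mul0r addr0 mulrA; apply=> //.
    by move=> t; apply: cvgM; [exact: cvg_cst | apply: continuousX; exact: cb].
  move=> t _; rewrite addr0 /E; apply: (@le_trans _ _ (3 * (nu n ^+ 4 * b n t ^+ 2))).
    by rewrite mulrA; apply: ler_wpM2r; [exact: sqr_ge0 | exact: wt_le].
  by rewrite ler_pM2l // lerDl mulr_ge0 ?sqr_ge0 // ltW ?nuX_gt0.
- move=> M; apply: (@sum_scaled_le (fun n => 3 * (1 + T) * B n)) => //.
  by have := T0 => ?; rewrite mulr_ge0 //; lra.
Qed.

Lemma continuous_beta n : continuous (beta n).
Proof.
move=> t; apply: cvgB; [apply: cvgB |]; (apply: cvgM; first exact: cvg_cst).
- exact: ca.
- exact: cb.
- exact: cf.
Qed.

Lemma stiff_le n : 0 <= stiff sigma n <= (1 + sigma) * nu n ^+ 3.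
Proof.
have n0 := @nu_gt0 R n; have h1 := @nu_ge1 R n; rewrite /stiff; apply/andP; split; first by pos.
rewrite mulrDl mul1r lerD2r; apply: (@le_trans _ _ (nu n ^+ 1)); first by rewrite expr1.
exact: ler_weXn2l.
Qed.

Lemma damp_le' n : 0 <= damp mu kappa n <= (mu + kappa) * nu n ^+ 2.
Proof.
have n0 := @nu_gt0 R n; rewrite /damp; apply/andP; split; first by pos.
by rewrite mulrDl lerD2l ler_peMr // nuX_ge1.
Qed.

Definition Cbeta : R := 3 * ((1 + sigma) ^+ 2 + (mu + kappa) ^+ 2).

(** [u_t] costs as much as the gained derivatives: [stiff a] is of order [nu^3 a] and [damp b] of
    order [nu^2 b]. *)
Lemma beta_sqr_le n t : 0 <= t -> beta n t ^+ 2 <= Cbeta * E n t + 3 * B n.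
Proof.
move=> t0; rewrite /beta.
pose x := stiff sigma n * a n t; pose y := damp mu kappa n * b n t; pose z := c n * f t.
rewrite -/y -/z.
have h : (- stiff sigma n * a n t - y - z) ^+ 2 <= 3 * (x ^+ 2 + y ^+ 2 + z ^+ 2).
  rewrite mulNr -/x; have := sqr_ge0 (x - y); have := sqr_ge0 (y - z); have := sqr_ge0 (x - z); nra.
apply: le_trans h _.
have hx : x ^+ 2 <= (1 + sigma) ^+ 2 * (nu n ^+ 6 * a n t ^+ 2).
  rewrite /x exprMn mulrA; apply: ler_wpM2r; first exact: sqr_ge0.
  have /andP[s0 s1] := stiff_le n; rewrite (_ : nu n ^+ 6 = (nu n ^+ 3) ^+ 2); last by rewrite -exprM.
  by rewrite -exprMn; apply: lerXn2r => //; rewrite nnegrE // (le_trans s0).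
have hy : y ^+ 2 <= (mu + kappa) ^+ 2 * (nu n ^+ 4 * b n t ^+ 2).
  rewrite /y exprMn mulrA; apply: ler_wpM2r; first exact: sqr_ge0.
  have /andP[s0 s1] := damp_le' n; rewrite (_ : nu n ^+ 4 = (nu n ^+ 2) ^+ 2); last by rewrite -exprM.
  by rewrite -exprMn; apply: lerXn2r => //; rewrite nnegrE // (le_trans s0).
have hz : z ^+ 2 <= B n by rewrite /z exprMn; exact: B_f.
rewrite /Cbeta /E; set p := nu n ^+ 6 * _ in hx *; set q := nu n ^+ 4 * _ in hy *.
have p0 : 0 <= p by rewrite /p mulr_ge0 ?sqr_ge0 // ltW ?nuX_gt0.
have q0 : 0 <= q by rewrite /q mulr_ge0 ?sqr_ge0 // ltW ?nuX_gt0.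
have := mulr_ge0 (sqr_ge0 (1 + sigma)) q0; have := mulr_ge0 (sqr_ge0 (mu + kappa)) p0.
move: (_ ^+ 2) (_ ^+ 2) hx hy => S1 S2; lra.
Qed.

Lemma Cbeta_ge0 : 0 <= Cbeta.
Proof. by rewrite /Cbeta mulr_ge0 // addr_ge0 // sqr_ge0. Qed.

Lemma Rint_beta n T : 0 <= T -> \int[leb]_(t in `]0, T[) (beta n t ^+ 2) <= (Cbeta * (1 + T) + 3 * T) * B n.
Proof.
move=> T0; rewrite mulrDl -mulrA [3 * T * _]mulrAC.
apply: (@Rint_scaled (fun t => beta n t ^+ 2)) => //.
- exact: Cbeta_ge0.
- by apply: continuousX; exact: continuous_beta.
- by move=> t /andP[/ltW t0 _]; exact: beta_sqr_le.
- by rewrite mulr_ge0.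
Qed.

Lemma sum_Rint_beta T N : 0 <= T -> \sum_(n < N) (Cbeta * (1 + T) + 3 * T) * B n <= (Cbeta * (1 + T) + 3 * T) * KB.
Proof.
move=> T0; apply: (@sum_scaled_le (fun n => (Cbeta * (1 + T) + 3 * T) * B n)) => //.
have h := Cbeta_ge0; have T1 : 0 <= 1 + T by lra.
by rewrite addr_ge0 // mulr_ge0.
Qed.

Lemma ut_L2 T : 0 < T -> L2_into T (L2 0 1) L2norm ut.
Proof.
move=> T0; apply: (@L2_into_coef R sinb (fun=> 1) _ _ sinL _ _ _ beta ut T _ _ T0 continuous_beta _ _ (fun M => sum_Rint_beta M (ltW T0))) => //.
- by move=> g; exact: L2norm_ge0.
- move=> g al K h hK; split; first exact: expands_L2 h.
  by apply: (expands_norm_le sinL sinO h) => N; have := hK N; under eq_bigr do rewrite mul1r.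
- move=> t /andP[/ltW t0 _] [K' hK']; apply: hut => //; exists K' => M.
  by have := hK' M; under eq_bigr do rewrite mul1r.
- by move=> n; under eq_Rintegral do rewrite mul1r; apply: Rint_beta; exact: ltW.
Qed.

Lemma near_within (I : set R) (t d : R) (P : R -> Prop) : 0 < d ->
  (forall s, I s -> `|s - t| < d -> P s) -> \forall s \near within I (nbhs t), P s.
Proof.
move=> d0 h; rewrite near_withinE; apply/nbhs_ballP; exists d => // s; rewrite /ball /= distrC => st Is.
exact: h.
Qed.

Lemma cvg0_X2 (T : Type) (F : set_system T) {FF : Filter F} (x : T -> R) :
  x s @[s --> F] --> (0 : R) -> x s ^+ 2 @[s --> F] --> (0 : R).
Proof.
move=> h; have h2 : (fun s => x s * x s) @ F --> (0 * 0 : R) by apply: cvgM.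
by rewrite mulr0 in h2.
Qed.

Lemma sqrB_le (x y : R) : (x - y) ^+ 2 <= 2 * (x ^+ 2 + y ^+ 2).
Proof. have := sqr_ge0 (x + y); nra. Qed.

(** Each mode is continuous and the series is dominated by [B]. *)
Lemma u_C0 T : C0_into T H10 (Hnorm 1) u.
Proof.
move=> t; rewrite in_itv /= => /andP[t0 tT]; split; first exact: u_H10.
have FF : Filter (within `[0, T] (nbhs t)) by typeclasses eauto.
have inI : \forall s \near within `[0, T] (nbhs t), 0 <= s.
  by apply: (@near_within _ _ 1) => // s; rewrite /= in_itv /= => /andP[].
apply: cvg0_sqr => [s|e e0]; first exact: sqrtr_ge0.
have : \forall s \near within `[0, T] (nbhs t), forall N, \sum_(n < N) wt 1 n * (b n s - b n t) ^+ 2 <= e.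
  apply: (@dominated_sum _ _ _ _ (fun n s => wt 1 n * (b n s - b n t) ^+ 2) (fun n => 8 * B n) (8 * KB)) => //.
  - by move=> n; rewrite mulr_ge0.
  - by move=> N; rewrite -mulr_sumr ler_pM2l.
  - apply: filterS inI => s s0 n; rewrite mulr_ge0 ?sqr_ge0 ?wt_ge0 //=.
    apply: (@le_trans _ _ (2 * nu n ^+ 2 * (2 * (b n s ^+ 2 + b n t ^+ 2)))).
      by apply: ler_pM; [exact: wt_ge0 | exact: sqr_ge0 | exact: wt_le | exact: sqrB_le].
    have := B_b n s0; have := B_b n t0; lra.
  - move=> n; have c0 : b n s - b n t @[s --> within `[0, T] (nbhs t)] --> (b n t - b n t : R).
      by apply: cvgB; [apply: cvg_within_filter; exact: cb | exact: cvg_cst].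
    rewrite subrr in c0; rewrite -[X in _ --> X](mulr0 (wt 1 n)); apply: cvgM; first exact: cvg_cst.
    exact: cvg0_X2.
apply: filterS2 inI => s s0 hs.
by have := sin_series_Hnorm1 (expandsB sinL (hu s0) (hu t0)) hs.
Qed.

Lemma cvg_of_le (T : Type) (F : set_system T) {FF : Filter F} (x : T -> R) :
  (forall e : R, 0 < e -> \forall s \near F, `|x s| <= e) -> x s @[s --> F] --> (0 : R).
Proof.
move=> h; apply/cvgrPdist_le => e e0; have := h e e0; apply: filterS => s.
by rewrite sub0r normrN.
Qed.

Lemma a_bound n s : 0 <= s -> `|nu n * b n s| <= Num.sqrt (B n).
Proof.
move=> s0; rewrite -sqrtr_sqr; apply: ler_wsqrtr; rewrite exprMn; exact: B_b.
Qed.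

(** Each difference quotient is within [2 sqrt (B n)] of its limit, by the mean value
    inequality, so the limit may be taken term by term. *)
Lemma phi_tderiv (I : set R) t : (forall s, I s -> 0 <= s) -> 0 <= t ->
  is_tderiv I phi t (wD 1 (u t)).
Proof.
move=> I0 t0; split; first exact: expands_L2 (u_wD1 t0).
have FF : Filter (within I t^') by typeclasses eauto.
have inI : \forall s \near within I t^', 0 <= s /\ s != t.
  rewrite near_withinE; apply/nbhs_ballP; exists (1 : R) => [|s _ st Is]; [exact: ltr01 | split; [exact: I0 | exact: st]].
apply: cvg0_sqr => [s|e e0]; first exact: L2norm_ge0.
pose q n s := (s - t)^-1 * (a n s - a n t) - nu n * b n t.
have : \forall s \near within I t^', forall N, \sum_(n < N) q n s ^+ 2 <= e.
  apply: (@dominated_sum _ _ _ _ (fun n s => q n s ^+ 2) (fun n => 4 * B n) (4 * KB)) => //.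
  - by move=> n; rewrite mulr_ge0.
  - by move=> N; rewrite -mulr_sumr ler_pM2l.
  - apply: filterS inI => s [s0 st] n; rewrite sqr_ge0 /=.
    have h : `|q n s| <= Num.sqrt (B n) + Num.sqrt (B n).
      apply: (quotient_bound (df := fun x => nu n * b n x)) => //.
        by move=> x x0; case: (modes n x0).
      move=> x x0 _; apply: le_trans (ler_normB _ _) _; apply: lerD; apply: a_bound => //; exact: ltW.
    rewrite -real_normK ?num_real //; apply: (@le_trans _ _ ((Num.sqrt (B n) + Num.sqrt (B n)) ^+ 2)).
      by apply: lerXn2r => //; rewrite nnegrE // addr_ge0 // sqrtr_ge0.
    rewrite -[in leRHS](sqr_sqrtr (B_ge0 n)) le_eqVlt; apply/orP; left; apply/eqP; ring.
  - move=> n; suff c0 : q n s @[s --> within I t^'] --> (0 : R).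
      exact: cvg0_X2.
    apply: cvg_of_le => d d0.
    have cnb : continuous (fun s => nu n * b n s) by move=> x; apply: cvgM; [exact: cvg_cst | exact: cb].
    move/cvgrPdist_le: (cnb t) => /(_ _ d0) /nbhs_ballP [p p0 hp].
    have nearp : \forall s \near within I t^', `|s - t| < p.
      rewrite near_withinE; apply/nbhs_ballP; exists p => // s; rewrite /ball /= distrC => st _ _; exact: st.
    apply: filterS2 inI nearp => s [s0 st] sp.
    apply: (quotient_bound (df := fun x => nu n * b n x)) => //.
      by move=> x x0; case: (modes n x0).
    move=> x x0 xt; rewrite distrC; apply: hp; rewrite /ball /= distrC; exact: le_lt_trans xt sp.
apply: filterS2 inI => s [s0 st] hs.
have ex := expandsB cosL (expandsZ cosL (s - t)^-1 (expandsB cosL (hphi s0) (hphi t0))) (u_wD1 t0).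
rewrite (_ : (fun x => _) = (fun x => (s - t)^-1 * (phi s x - phi t x) - wD 1 (u t) x)); last first.
  by apply/funext => x; rewrite mulrC.
apply: (expands_norm_le cosL cosO ex) => N.
by have := hs N; under eq_bigr do rewrite /q -[X in _ - X * _]expr1.
Qed.

Lemma phi_ac T : abs_cont T (fun s t => L2norm (phi s \- phi t)).
Proof.
apply: (@abs_cont_lipschitz _ _ (Num.sqrt KB)) => s t s0 st tT.
have t0 : 0 <= t by exact: le_trans s0 st.
have KB0 : 0 <= KB by have := B_sum 0%N; rewrite big_ord0.
rewrite -ler_sqr ?nnegrE ?L2norm_ge0 ?mulr_ge0 ?sqrtr_ge0 ?subr_ge0 // exprMn sqr_sqrtr //.
apply: (expands_norm_le cosL cosO (expandsB cosL (hphi s0) (hphi t0))) => N.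
rewrite mulrC; apply: (@sum_scaled_le (fun n => (a n s - a n t) ^+ 2)) => [|n]; first exact: sqr_ge0.
have h : `|a n t - a n s| <= Num.sqrt (B n) * (t - s).
  apply: (@mean_bound _ _ (fun x => nu n * b n x)) => //.
    by move=> x /andP[sx _]; case: (modes n (le_lt_trans s0 sx)).
  by move=> x /andP[sx _]; apply: a_bound; exact: ltW (le_lt_trans s0 sx).
rewrite -sqrrN opprB -real_normK ?num_real // mulrC -[B n]sqr_sqrtr // -exprMn.
by apply: lerXn2r => //; rewrite nnegrE // mulr_ge0 ?sqrtr_ge0 // subr_ge0.
Qed.

Lemma scalar_ac (g dg : R -> R) T : continuous g -> continuous dg ->
  (forall t : R, 0 < t -> is_derive t 1 g (dg t)) -> abs_cont T (fun s t => `|g s - g t|).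
Proof.
move=> cg cdg hg; have [M M0 hM] := continuous_bounded 0 T cdg.
apply: (@abs_cont_lipschitz _ _ M) => s t s0 st tT; rewrite distrC.
apply: (@mean_bound _ _ dg) => //.
  by move=> x /andP[sx _]; apply: hg; exact: le_lt_trans sx.
by move=> x /andP[sx xt]; apply: hM; rewrite (le_trans s0 (ltW sx)) (le_trans (ltW xt)).
Qed.

Lemma sum_b_le t N : 0 <= t -> \sum_(n < N) b n t ^+ 2 <= KB.
Proof.
move=> t0; apply: le_trans (B_sum N); apply: ler_sum => n _; apply: le_trans (B_b n t0).
by rewrite ler_peMl ?sqr_ge0 // nuX_ge1.
Qed.

(** Integration by parts holds for the partial sums of the pairings with [eta].  Those of [u] are
    bounded; those of [ut] are dominated by the integrable series of [beta^2]. *)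
Lemma u_weak_tderiv T : 0 < T -> weak_tderiv T u ut.
Proof.
move=> T0 eta heta psi hpsi; have mD := measurable_oo 0 T.
have [p0 pT] := C1c_bd hpsi; have cp := C1c_continuous hpsi.
have cdp : continuous psi^`()%classic by case: hpsi.
pose en n := inner (sinb n) eta.
pose U N t := \sum_(n < N) en n * b n t; pose dU N t := \sum_(n < N) en n * beta n t.
have cU N : continuous (U N).
  by apply: continuous_sum => n t; apply: cvgM; [exact: cvg_cst | exact: cb].
have cdU N : continuous (dU N).
  by apply: continuous_sum => n t; apply: cvgM; [exact: cvg_cst | exact: continuous_beta].
have dUd N (t : R) : 0 < t -> is_derive t 1 (U N) (dU N t).
  move=> t0; apply: (@is_derive_bigsum R _ (index_enum _) (fun (n : 'I_N) t => en n * b n t) (fun (n : 'I_N) t => en n * beta n t)) => n.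
  by apply: derZ; case: (modes n t0).
have cpU N : continuous (fun t => psi^`()%classic t * U N t) by exact: continuous_mul.
have cpdU N : continuous (fun t => psi t * dU N t) by exact: continuous_mul.
have parts N : \int[leb]_(t in `]0, T[) (psi t * dU N t) = - \int[leb]_(t in `]0, T[) (psi^`()%classic t * U N t).
  apply/eqP; rewrite -addr_eq0 -RintegralD //; try exact: L2_integrable (continuous_L2 0 T _).
  apply/eqP; transitivity (psi T * U N T - psi 0 * U N 0); last by rewrite p0 pT !mul0r subrr.
  apply: (@integral_derive_oo _ (fun t => psi t * U N t) _ 0 T T0).
  - move=> t /andP[t0 _].
    by apply: is_derive_conv (derM (C1c_derive hpsi t) (dUd N t t0)) (fun _ => erefl) _; rewrite addrC.
  - exact: continuous_mul.
  - by move=> t; apply: cvgD; [exact: cpdU | exact: cpU].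
have eta2 N : \sum_(n < N) en n ^+ 2 <= L2norm eta ^+ 2.
  by have := bessel sinL sinO N heta; under eq_bigr do rewrite innerC.
have Ulim t : 0 < t < T -> U N t @[N --> \oo] --> inner (u t) eta.
  move=> /andP[/ltW t0 _]; have := expands_inner sinL (hu t0) heta.
  by apply: cvg_trans; apply: near_eq_cvg; apply: nearW => N; apply: eq_bigr => n _; rewrite mulrC.
have KB0 : 0 <= KB by have := B_sum 0%N; rewrite big_ord0.
have Ubd N t : 0 < t < T -> `|U N t| <= Num.sqrt (L2norm eta ^+ 2 * KB).
  move=> /andP[/ltW t0 _]; rewrite -sqrtr_sqr; apply: ler_wsqrtr.
  apply: le_trans (sum_cauchy_schwarz _ _ _) _.
  by apply: ler_pM => //; [apply: sumr_ge0 => n _; exact: sqr_ge0 | apply: sumr_ge0 => n _; exact: sqr_ge0 | exact: sum_b_le].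
have ml : measurable_fun `]0, T[ (fun t => inner (u t) eta).
  apply: (measurable_fun_cvg (h := fun N => U N)) => [N|t].
    exact: measurable_continuous.
  by rewrite /= in_itv /=; exact: Ulim.
have lhs := bounded_cvg_integral (L2_integrable (continuous_L2 0 T cdp))
  (fun N => measurable_continuous (cU N)) ml Ubd Ulim.
have [Ser [Ser0 iS aefin good]] := integrable_series (fun n t => sqr_ge0 (beta n t))
  (fun n => continuousX (n := 2) (@continuous_beta n)) (fun n => Rint_beta n (ltW T0)) (fun M => sum_Rint_beta M (ltW T0)).
have [P P0 hP] := continuous_bounded 0 T cp.
(* the pairing with [ut t] is not known to be measurable; the upper limit is, and agrees with
   it almost everywhere *)
pose F N t := (psi t * dU N t)%:E; pose Flim t := limn_esup (F^~ t).
have mF N : measurable_fun `]0, T[ (F N) by apply/measurable_EFinP; exact: measurable_continuous.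
have mFl : measurable_fun `]0, T[ Flim by apply: measurable_fun_limn_esup.
have Fcv t : t \in `]0, T[ -> (Ser t < +oo)%E -> F N t @[N --> \oo] --> (psi t * inner (ut t) eta)%:E.
  rewrite in_itv /= => /andP[/ltW t0 _] fin; have [Kt [_ hK _]] := good t fin.
  apply: cvg_EFin; first exact: nearW.
  apply: cvgM; first exact: cvg_cst.
  have := expands_inner sinL (hut t0 (ex_intro _ Kt hK)) heta.
  by apply: cvg_trans; apply: near_eq_cvg; apply: nearW => N; apply: eq_bigr => n _; rewrite mulrC.
have FlimE t : t \in `]0, T[ -> (Ser t < +oo)%E -> Flim t = (psi t * inner (ut t) eta)%:E.
  by move=> tI fin; have /cvg_limn_einf_sup [_ es] := Fcv t tI fin; rewrite /Flim es.
have dom : leb.-integrable `]0, T[ (fun t => (P%:E * (Ser t + (L2norm eta ^+ 2)%:E))%E).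
  apply: integrableZl => //; apply: integrableD => //.
  exact: L2_integrable (L2_cst 0 T _).
have [||_ _ rhs] := @dominated_convergence _ _ R leb `]0%R, T[%classic mD F Flim _ mF mFl _ dom _.
- apply: aeS aefin => t h tI; have fin := h tI; rewrite FlimE //; exact: Fcv.
- apply: aeS aefin => t h N tI; have fin := h tI; have [Kt [-> hK _]] := good t fin.
  move: tI; rewrite /= in_itv /= => /andP[/ltW t0 /ltW tT].
  rewrite lee_fin normrM; apply: ler_pM => //; first by apply: hP; rewrite t0.
  apply: (@le_trans _ _ (\sum_(n < N) (beta n t ^+ 2 + en n ^+ 2))); last first.
    by rewrite big_split /=; apply: lerD; [exact: hK | exact: eta2].
  apply: le_trans (ler_norm_sum _ _ _) _; apply: ler_sum => n _; rewrite normrM.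
  rewrite -(real_normK (num_real (beta n t))) -(real_normK (num_real (en n))).
  have := sqr_ge0 (`|beta n t| - `|en n|); have := sqr_ge0 (`|beta n t| + `|en n|); nra.
have rhsE : (\int[leb]_(t in `]0%R, T[) Flim t)%E = (\int[leb]_(t in `]0%R, T[) (psi t * inner (ut t) eta)%:E)%E.
  by apply: integral_eq_ae => //; apply: aeS aefin => t h tI; exact: FlimE tI (h tI).
have lhs' : (- \int[leb]_(t in `]0, T[) (psi^`()%classic t * U N t))%:E @[N --> \oo] -->
    (- \int[leb]_(t in `]0, T[) (psi^`()%classic t * inner (u t) eta))%:E.
  by apply: cvg_EFin; [exact: nearW | apply: cvgN; exact: lhs].
have rhs' : (- \int[leb]_(t in `]0, T[) (psi^`()%classic t * U N t))%:E @[N --> \oo] -->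
    (\int[leb]_(t in `]0%R, T[) (psi t * inner (ut t) eta)%:E)%E.
  rewrite -rhsE; move: rhs; rewrite /=; apply: cvg_trans; apply: near_eq_cvg; apply: nearW => N.
  rewrite /= -parts /Rintegral fineK //; apply: integrable_fin_num => //.
  exact: L2_integrable (continuous_L2 0 T (cpdU N)).
have e : (- \int[leb]_(t in `]0, T[) (psi^`()%classic t * inner (u t) eta))%:E =
    (\int[leb]_(t in `]0%R, T[) (psi t * inner (ut t) eta)%:E)%E.
  by exact: (cvg_unique (@ereal_hausdorff R) lhs' rhs').
have {e} := congr1 fine e; rewrite /= -[fine _]/(\int[leb]_(t in `]0, T[) (psi t * inner (ut t) eta)) => e.
rewrite (_ : \int[leb]_(x in `]0, T[) (inner (u x) eta * psi^`()%classic x) = \int[leb]_(x in `]0, T[) (psi^`()%classic x * inner (u x) eta)); last first.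
  by apply: eq_Rintegral => t _; rewrite mulrC.
rewrite -[LHS]opprK e; congr (- _); apply: eq_Rintegral => t _; rewrite mulrC //.
Qed.

(** At a time where the series of the gained derivatives converges, both sides have the same
    sine coefficients. *)
Lemma pde_ae T : 0 < T -> {ae leb, forall t, t \in `]0, T[ -> eq01 (ut t) (fun x =>
  wD 1 (phi t) x - sigma * wD 3 (phi t) x + mu * wD 2 (u t) x
  - kappa * u t x - f t * \1_(`[0, 1]%classic) x)}.
Proof.
move=> T0; have E0 n t : 0 <= E n t.
  by rewrite /E addr_ge0 // mulr_ge0 ?sqr_ge0 // ltW ?nuX_gt0.
have sI M : \sum_(n < M) (1 + T) * B n <= (1 + T) * KB.
  by apply: (@sum_scaled_le (fun n => (1 + T) * B n)) => //; lra.
have [Ser [Ser0 iS aefin good]] := integrable_series E0 continuous_E (fun n => Rint_E n (ltW T0)) sI.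
apply: aeS aefin => t h tI; have [Kt [_ hK _]] := good t (h tI).
move: (tI); rewrite in_itv /= => /andP[/ltW t0 _].
have sE (y : nat -> R) : (forall n, y n ^+ 2 <= E n t) -> sqsum y.
  by move=> hy; exists Kt => N; apply: le_trans (hK N); apply: ler_sum.
have sa3 : sqsum (fun n => nu n ^+ 3 * a n t).
  apply: sE => n; rewrite exprMn -exprM /E lerDr mulr_ge0 ?sqr_ge0 // ltW ?nuX_gt0 //.
have sb2 : sqsum (fun n => nu n ^+ 2 * b n t).
  apply: sE => n; rewrite exprMn -exprM /E lerDl mulr_ge0 ?sqr_ge0 // ltW ?nuX_gt0 //.
have wa := @sqsum_wt R 2 1 (a^~ t) _ isT (fun N => sum_wt_a N t0).
have wa2 := @sqsum_wt R 2 2 (a^~ t) _ isT (fun N => sum_wt_a N t0).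
have wb := @sqsum_wt R 1 1 (b^~ t) _ isT (fun N => sum_wt_b N t0).
have [_ e1] := cos_series_wD1 (hphi t0) wa.
have [_ e3] := cos_series_wD3 (hphi t0) wa wa2 sa3.
have [_ e2] := sin_series_wD2 (hu t0) wb sb2.
have e0 : expands sinb (fun _ => 1) (fun n => c n).
  by apply: expands_ext (expands_sinb (L2_cst 0 1 1)) => n; rewrite innerC.
have sbeta : sqsum (beta^~ t).
  exists (Cbeta * Kt + 3 * KB) => N.
  apply: (@le_trans _ _ (\sum_(n < N) (Cbeta * E n t + 3 * B n))).
    by apply: ler_sum => n _; exact: beta_sqr_le.
  rewrite big_split /= -!mulr_sumr; apply: lerD; apply: ler_wpM2l.
  - exact: Cbeta_ge0.
  - exact: hK.
  - by [].
  - exact: B_sum.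
have ex := expandsB sinL (expandsB sinL (expandsD sinL (expandsB sinL e1 (expandsZ sinL sigma e3)) (expandsZ sinL mu e2))
   (expandsZ sinL kappa (hu t0))) (expandsZ sinL (f t) e0).
have eu : eq01 (ut t) (fun x => wD 1 (phi t) x - sigma * wD 3 (phi t) x + mu * wD 2 (u t) x
    - kappa * u t x - f t * 1).
  apply: (expands_unique sinL sinO (hut t0 sbeta)); apply: expands_ext ex => n.
  by rewrite /beta /stiff /damp; ring.
apply: aeS eu => x hx xI; rewrite hx // indicE mem_set //=.
by move: xI; rewrite !in_itv /= => /andP[/ltW -> /ltW ->].
Qed.

(** The canonical time derivative exists by [phi_tderiv] and is unique. *)
Lemma phi_t_eq01 t : 0 <= t -> L2 0 1 (phi_t phi t) /\ eq01 (phi_t phi t) (wD 1 (u t)).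
Proof.
move=> t0; have I0 (s : R) : `[0, +oo[%classic s -> 0 <= s by rewrite /= in_itv /= andbT.
have h := @phi_tderiv `[0, +oo[%classic t I0 t0.
have h2 : is_tderiv `[0, +oo[ phi t (phi_t phi t).
  have : [set g | is_tderiv `[0, +oo[ phi t g] (phi_t phi t) by apply: xgetPex; exists (wD 1 (u t)).
  by [].
split; first by case: h2.
apply: (is_tderiv_unique (within_dnbhs_proper_ray t0) _ _ h2 h); first by rewrite /= in_itv /= t0.
by move=> s /I0 s0; exact: expands_L2 (hphi s0).
Qed.

(** The majorant [B] gives all the regularity required of a weak solution. *)
Lemma synthesis_weak_solution (phi0 phib0 : R -> R) (xi0 w0 : R) :
  inSbar phi0 -> inS phib0 -> (forall n, a n 0 = inner phi0 (cosb n)) ->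
  (forall n, b n 0 = inner phib0 (cosb n) / nu n) -> xi 0 = xi0 -> w 0 = w0 ->
  weak_solution sigma mu kappa f phi0 phib0 xi0 w0 xi w phi.
Proof.
move=> h0 hb0 a0 b0 xi00 w00 T T0; split.
- exact: continuous_L2.
- exact: (@scalar_ac xi w).
- by apply: (@scalar_ac w (fun t => - f t)) => // t; apply: cvgN; exact: cf.
- by move=> t; rewrite in_itv /= => /andP[t0 _]; exact: phi_Sbar.
- exact: phi_ac.
- by apply: aeW => t; rewrite in_itv /= => /andP[t0 _]; exact: dxi.
- by apply: aeW => t; rewrite in_itv /= => /andP[t0 _]; exact: dw.
- exact: phi_L2H3.
- have [e0 _ _ _] := Sbar_coef h0.
  by apply: (expands_unique cosL cosO (hphi (lexx 0))); apply: expands_ext e0 => n; rewrite a0.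
- have I0 (s : R) : `[0, T]%classic s -> 0 <= s by rewrite /= in_itv /= => /andP[].
  have ht := @phi_tderiv `[0, T]%classic 0 I0 (lexx 0).
  have Ls s : `[0, T]%classic s -> L2 0 1 (phi s) by move=> /I0 s0; exact: expands_L2 (hphi s0).
  apply: (is_tderiv_eq01 _ Ls Ls _ hb0.1 _ ht) => //.
  + by rewrite /= in_itv /= lexx ltW.
  + by move=> s _; exact: eq01_refl.
  + apply: (expands_unique cosL cosO (u_wD1 (lexx 0))); apply: expands_ext (expands_cosb hb0) => n.
    by rewrite b0 expr1 mulrC divfK // nu_neq0.
- by [].
- exists u, ut; split.
  + by split; [exact: u_C0 | exact: u_L2H2].
  + by split; [exact: ut_L2 | exact: u_weak_tderiv].
  + move=> t; rewrite in_itv /= => /andP[t0 _]; apply: phi_tderiv => // s.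
    by rewrite /= in_itv /= => /andP[].
  + exact: pde_ae.
Qed.

End Synthesis.

(** * Absolute continuity and weak derivatives in time *)
Section AbsolutelyContinuous.
Context {R : realType}.
Implicit Types F g : R -> R.

Lemma derive0_small F (t e : R) : is_derive t 1 F 0 -> 0 < e ->
  exists2 p : R, 0 < p & forall s : R, `|s - t| < p -> `|F s - F t| <= e * `|s - t|.
Proof.
move=> [dF F0] e0.
have c : h^-1 *: (F (h *: 1 + t) - F t) @[h --> (0 : R)^'] --> 'D_1 F t by exact: dF.
move: c; rewrite F0 => /cvgrPdist_le /(_ e e0).
rewrite /dnbhs /within /= => /nbhs_ballP [p /= p0 hp]; exists p => // s st.
have [->|ts] := eqVneq s t; first by rewrite !subrr normr0 mulr0.
have ts0 : s - t != 0 by rewrite subr_eq0.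
have := hp (s - t); rewrite /ball /= sub0r normrN => /(_ st ts0).
rewrite sub0r normrN /GRing.scale /= mulr1 subrK normrM normfV.
by rewrite mulrC ler_pdivrMr // normr_gt0.
Qed.

Lemma lebU0 (A B : set (measurableTypeR R)) : measurable A -> measurable B -> leb A = 0%E -> leb B = 0%E ->
  leb (A `|` B) = 0%E.
Proof.
move=> mA mB A0 B0; apply/le_anti; rewrite measure_ge0 andbT.
apply: (@le_trans _ _ (leb A + leb B)%E); first exact: measureU2.
by rewrite A0 B0 add0e.
Qed.

(** Consecutive disjoint intervals inside [U]: the shape of the families that the definition
    of absolute continuity quantifies over. *)
Definition chain (U : set R) (t : R) (m : nat) (A B : nat -> R) :=
  [/\ forall i, (i < m)%N -> [/\ 0 <= A i, A i <= B i & B i <= t],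
      forall i, (i < m)%N -> forall x, A i < x < B i -> U x &
      forall i j, (i < j < m)%N -> B i <= A j].

(** Disjoint intervals inside an open set have total length at most its measure. *)
Lemma chain_length (U : set R) (t : R) (m : nat) A B (d : R) : open U -> (leb U < d%:E)%E -> chain U t m A B ->
  trivIset setT (fun i : 'I_m => [set` `]A i, B i[]) /\ \sum_(i < m) (B i - A i) < d.
Proof.
move=> oU Ud [hAB hU hs]; move: Ud => /[hide] Ud.
have tI : trivIset setT (fun i : 'I_m => [set` `]A i, B i[]).
  move=> i j _ _ [x [/=]]; rewrite !in_itv /= => /andP[ai bi] /andP[aj bj].
  apply: val_inj; apply/eqP; rewrite eqn_leq; apply/andP; split; rewrite leqNgt; apply/negP => ij.
    by have := hs j i; rewrite ij ltn_ord => /(_ isT) h; clear Ud; lra.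
  by have := hs i j; rewrite ij ltn_ord => /(_ isT) h; clear Ud; lra.
split=> //; rewrite -lte_fin; apply: le_lt_trans Ud; rewrite -sumEFin.
rewrite (eq_bigr (fun i : 'I_m => leb ([set` `]A i, B i[] : set R))) => [|i _]; last first.
  rewrite lebesgue_measure_itv /= lte_fin; have [_ ab _] := hAB i (ltn_ord i).
  case: ltP => // ba; rewrite (_ : B i - A i = 0) //; lra.
rewrite -(@measure_bigsetU_ord _ _ _ leb m xpredT) //.
apply: le_measure; rewrite ?inE.
- by apply: bigsetU_measurable => i _; exact: measurable_itv.
- exact: open_measurable.
- rewrite -(bigcup_mkord m (fun i => [set` `]A i, B i[])) => x [i /= im]; rewrite /= in_itv /=; exact: hU.
Qed.

(** Cover the exceptional null set by an open set [U] of small measure.  Moving from 0 to [T] by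
    real induction, [F] changes at a slope at most [e] near a point outside [U], and a step inside
    [U] is recorded in a chain, on which absolute continuity bounds the total change by [e]. *)
Lemma abs_cont_zero_deriv F (T : R) : 0 < T -> abs_cont T (fun s t => `|F s - F t|) ->
  {ae leb, forall t, t \in `]0, T[ -> is_derive t 1 F 0} -> F T = F 0.
Proof.
move=> T0 ac [N [mN N0 sN]]; apply/eqP; rewrite -subr_eq0 -normr_le0; apply/ler_addgt0Pr => e' e'0; rewrite add0r.
pose e := e' / (T + 1); have e0 : 0 < e by rewrite divr_gt0 //; lra.
have -> : e' = e * T + e by rewrite /e; field; lra.
have [d d0 hd] := ac e e0.
(* the end points are exceptional too: the derivative is given inside only *)
pose N' := N `|` ([set 0] `|` [set T]).
have mN' : measurable N' by apply: measurableU => //; apply: measurableU.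
have N'0 : leb N' = 0%E.
  by rewrite /N'; apply: lebU0 => //; [exact: measurableU | apply: lebU0; rewrite ?lebesgue_measure_set1].
have N'fin : (leb N' < +oo)%E by apply: (@le_lt_trans _ _ 0%E); rewrite ?ltry // [leLHS]N'0.
have [U [oU NU Ud]] := @lebesgue_regularity_outer R N' d mN' N'fin d0.
have {}Ud : (leb U < d%:E)%E.
  rewrite -(setDUK NU); apply: (@le_lt_trans _ _ (leb N' + leb (U `\` N'))%E).
    by apply: measureU2 => //; apply: measurableD => //; exact: open_measurable.
  by rewrite N'0 add0e.
have loc (t : R) : 0 <= t <= T -> exists2 p : R, 0 < p &
    (forall s : R, `|s - t| < p -> `|F s - F t| <= e * `|s - t|) \/ (forall s : R, `|s - t| < p -> U s).
  move=> /andP[t0 tT]; have [Ut|nUt] := pselect (U t).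
    have /nbhs_ballP [p /= p0 hp] : nbhs t U by exact: (open_nbhs_nbhs (conj oU Ut)).
    by exists p => //; right => s st; apply: hp; rewrite /ball /= distrC.
  have nN : ~ N' t by move=> /NU.
  have t0' : 0 < t by rewrite lt_neqAle t0 andbT; apply/eqP => h; apply: nN; right; left.
  have tT' : t < T by rewrite lt_neqAle tT andbT; apply/eqP => h; apply: nN; right; right.
  have dF : is_derive t 1 F 0.
    apply: contrapT => h; apply: nN; left; apply: sN => /= h2; apply: h; apply: h2.
    by rewrite in_itv /= t0'.
  have [p p0 hp] := derive0_small dF e0.
  by exists p => //; left => s st; exact: hp.
pose P (t : R) := exists m A B, chain U t m A B /\
  `|F t - F 0| <= e * t + \sum_(i < m) `|F (A i) - F (B i)|.
have ext (s t : R) : 0 <= s -> s <= t -> P s ->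
    `|F t - F s| <= e * (t - s) \/ (forall x, s < x < t -> U x) -> P t.
  move=> s0 st [m [A [B [[h1 h2 h3] hF]]]] [h|h].
    exists m, A, B; split; first split => // i im.
      by have [? ? ?] := h1 i im; split=> //; lra.
    have := ler_distD (F s) (F t) (F 0); lra.
  exists m.+1, (fun i => if (i < m)%N then A i else s), (fun i => if (i < m)%N then B i else t).
  split; first split => [i im|i im x|i j /andP[ij jm]].
  - by case: ifP => hi; [have [? ? ?] := h1 i hi; split=> //; lra | split].
  - by case: ifP => hi; [exact: h2 | exact: h].
  - rewrite ltnS in jm; rewrite (leq_trans ij jm); case: ifP => hj; first by apply: h3; rewrite ij.
    by have [] := h1 i (leq_trans ij jm).
  rewrite big_ord_recr /= ltnn (eq_bigr (fun i : 'I_m => `|F (A i) - F (B i)|)) => [|i _]; last by rewrite ltn_ord.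
  have := ler_distD (F s) (F t) (F 0); rewrite [`|F t - F s|]distrC.
  have : 0 <= e * (t - s) by rewrite mulr_ge0 ?subr_ge0 // ltW.
  lra.
have [m [A [B [hc hF]]]] : P T.
  apply: (@real_induction _ T P (ltW T0)) => [||t /andP[t0 tT] hs|]; last by rewrite (ltW T0) lexx.
  - by exists 0%N, (fun=> 0), (fun=> 0); split; [split | rewrite subrr normr0 big_ord0 mulr0 addr0].
  - move=> t /andP[t0 tT] Pt; have [p p0 hp] := loc t ltac:(by rewrite t0 ltW).
    exists p => // s /andP[ts sT] sp; apply: (ext t s) => //; case: hp => hp; [left|right].
      by have := hp s; rewrite ger0_norm ?subr_ge0 //; apply; lra.
    by move=> x /andP[tx xs]; apply: hp; rewrite ger0_norm; lra.
  - have [p p0 hp] := loc t ltac:(by rewrite (ltW t0) tT).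
    pose s := Num.max 0 (t - p / 2).
    have s0 : 0 <= s by rewrite le_max lexx.
    have st : s < t by rewrite gt_max t0; lra.
    have ps : t - p / 2 <= s by rewrite le_max lexx orbT.
    apply: (ext s t) => //; [exact: ltW | by apply: hs; rewrite s0 | case: hp => hp; [left|right]].
      by have := hp s; rewrite [`|s - t|]distrC [`|F s - F t|]distrC (ger0_norm (_ : 0 <= t - s)); [apply; lra | rewrite subr_ge0 ltW].
    by move=> x /andP[tx xs]; apply: hp; rewrite distrC ger0_norm; lra.
have [tI hl] := chain_length oU Ud hc.
have := hd m A B _ tI hl; case: hc => h1 _ _ /(_ (fun i => h1 i (ltn_ord i))); lra.
Qed.

Lemma primitive_within (P g : R -> R) (T : R) : (forall t : R, -1 < t -> is_derive t 1 P (g t)) ->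
  {within `[0, T], continuous P}.
Proof.
move=> dP; apply: derivable_within_continuous => x; rewrite in_itv /= => /andP[x0 _].
by apply: (@ex_derive _ _ _ _ _ _ _ (dP x _)); lra.
Qed.

Lemma primitive_lipschitz (P g : R -> R) (T : R) : continuous g -> (forall t : R, -1 < t -> is_derive t 1 P (g t)) ->
  exists2 L, 0 <= L & forall s t : R, 0 <= s -> s <= t -> t <= T -> `|P t - P s| <= L * (t - s).
Proof.
move=> cg dP; have [M M0 hM] := continuous_bounded 0 T cg; exists M; first exact: ltW.
move=> s t s0 st tT; apply: (@derive_bound _ P g) => // x /andP[sx xt]; first by apply: dP; lra.
by apply: hM; rewrite (le_trans s0 sx) (le_trans xt tT).
Qed.

(** [F - P] is absolutely continuous with zero derivative almost everywhere. *)
Lemma abs_cont_primitive F g P (T : R) : 0 < T -> continuous g -> abs_cont T (fun s t => `|F s - F t|) ->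
  (forall t : R, -1 < t -> is_derive t 1 P (g t)) ->
  {ae leb, forall t, t \in `]0, T[ -> is_derive t 1 F (g t)} ->
  forall t, 0 <= t <= T -> F t - F 0 = P t - P 0.
Proof.
move=> T0 cg ac dP dF t /andP[]; rewrite le_eqVlt => /predU1P[<- _|t0 tT]; first by rewrite !subrr.
have [L L0 hL] := primitive_lipschitz T cg dP.
apply/eqP; rewrite -subr_eq0 (_ : _ - _ - _ = (F t - P t) - (F 0 - P 0)); last by ring.
rewrite subr_eq0; apply/eqP; apply: (@abs_cont_zero_deriv (fun x => F x - P x)) => //.
  move=> e e0; have e2 : 0 < e / 2 by lra.
  have [d1 d10 h1] := ac _ e2.
  have lip : abs_cont T (fun s t => `|P s - P t|).
    by apply: (@abs_cont_lipschitz _ _ L) => x y x0 xy yT; rewrite distrC; exact: hL.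
  have [d2 d20 h2] := lip _ e2.
  exists (Num.min d1 d2) => [|n a b hab tI]; first by rewrite lt_min d10.
  rewrite lt_min => /andP[s1 s2].
  have habT i : [/\ 0 <= a i, a i <= b i & b i <= T] by have [? ? bt] := hab i; split=> //; exact: le_trans tT.
  have := h1 n a b habT tI s1; have := h2 n a b habT tI s2.
  have : \sum_i `|F (a i) - P (a i) - (F (b i) - P (b i))| <= \sum_i `|F (a i) - F (b i)| + \sum_i `|P (a i) - P (b i)|.
    rewrite -big_split /=; apply: ler_sum => i _; rewrite (_ : _ + _ = (F (a i) - F (b i)) - (P (a i) - P (b i))); last by ring.
    exact: ler_normB.
  lra.
apply: aeS dF => x dFx; rewrite in_itv /= => /andP[x0 xt].
apply: (is_derive_conv (derB (dFx _) (dP x _)) (fun _ => erefl) (subrr _)); last by lra.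
by rewrite in_itv /= x0 (lt_le_trans xt).
Qed.

(** The lemma of du Bois-Reymond.  With [P] a primitive of [h], the test function [S s - S t],
    a plateau between two steep smooth steps, shows that [B - P] takes almost the same value at
    [s] and at [t]. *)
Lemma weak_deriv_derive (T : R) (B h : R -> R) : continuous B -> continuous h -> weak_deriv 0 T B h ->
  forall t : R, 0 < t < T -> is_derive t 1 B (h t).
Proof.
move=> cB ch wd; have [P [P0 dP _]] := primitive_exists ch.
pose D t := B t - P t.
have cP (t : R) : -1 < t -> {for t, continuous P}.
  by move=> t1; apply: differentiable_continuous; apply/derivable1_diffP; apply: (@ex_derive _ _ _ _ _ _ _ (dP t _)).
suff key (s t e : R) : 0 < s < T -> 0 < t < T -> 0 < e -> D t - D s <= 2 * e.
  have DE (s t : R) : 0 < s < T -> 0 < t < T -> D t = D s.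
    have le1 (x y : R) : 0 < x < T -> 0 < y < T -> D y <= D x.
      move=> hx hy; apply/ler_addgt0Pr => e e0; have e2 : 0 < e / 2 by lra.
      by have := key x y (e / 2) hx hy e2; lra.
    by move=> hs ht; apply/le_anti/andP; split; exact: le1.
  move=> t ht; have /andP[t0 tT] := ht.
  have dPt : is_derive t 1 (fun x => P x + D t) (h t).
    apply: is_derive_conv (derD (dP t _) (is_derive_cst (D t) t 1)) (fun _ => erefl) _; first by lra.
    by rewrite addr0.
  apply/is_derive_nearP => e e0; move/is_derive_nearP: dPt => /(_ e e0) n1.
  have n2 : \forall s \near t, 0 < s < T.
    by near=> s; apply/andP; split; near: s; [exact: lt_nbhsr | exact: lt_nbhsl].
  apply: filterS2 n1 n2 => s h1 hs; move: h1; rewrite -{1}(DE t s ht hs) /D.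
  by rewrite (_ : P s + _ = B s) ?[P t + _]addrC ?subrK // addrC subrK.
move=> /andP[s0 sT] /andP[t0 tT] e0.
have loc (y : R) : 0 < y -> exists2 p : R, 0 < p & forall x : R, `|x - y| < p -> `|D x - D y| <= e.
  move=> y0; have cD : D x @[x --> y] --> D y by apply: cvgB; [exact: cB | apply: cP; lra].
  move/cvgrPdist_le: cD => /(_ e e0) /nbhs_ballP [p p0 hp].
  by exists p => // x xs; rewrite distrC; apply: hp; rewrite /ball /= distrC.
have [p p0 hp] := loc s s0; have [p' p'0 hp'] := loc t t0.
pose q := Num.min (Num.min p p') (Num.min (T - s) (T - t)) / 2.
have q0 : 0 < q by rewrite /q divr_gt0 // !lt_min p0 p'0 !subr_gt0 sT tT.
have qle x : Num.min (Num.min p p') (Num.min (T - s) (T - t)) <= x -> q < x by rewrite /q in q0 *; lra.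
have qp : q < p by apply: qle; rewrite !ge_min lexx.
have qp' : q < p' by apply: qle; rewrite !ge_min lexx orbT.
have qs : q < T - s by apply: qle; rewrite !ge_min lexx !orbT.
have qt : q < T - t by apply: qle; rewrite !ge_min lexx !orbT.
have [m m0 mq] : exists2 m : R, 0 < m & m * q = 2.
  by exists (2 / q); [rewrite divr_gt0 | field; rewrite gt_eqF].
clearbody q.
pose S (s x : R) := step (m * x + - (m * s)); pose dS (s x : R) := m * dstep (m * x + - (m * s)).
have derS s' (x : R) : is_derive x 1 (S s') (dS s' x) by apply: der_shift; exact: der_step.
have cdS s' : continuous (dS s').
  move=> x; apply: cvgM; first exact: cvg_cst.
  apply: (@continuous_comp _ _ _ (fun x => m * x + - (m * s')) dstep); last exact: continuous_dstep.
  by apply: cvgD; [apply: cvgM; [exact: cvg_cst | exact: cvg_id] | exact: cvg_cst].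
have Slo s' x : x <= s' -> S s' x = 0.
  by move=> xs; apply: step_le1; rewrite -mulrN -mulrDr; apply: (@le_trans _ _ 0); [by rewrite pmulr_rle0 ?subr_le0 | exact: ler01].
have Shi s' x : s' + q <= x -> S s' x = 1.
  by move=> xs; apply: step_ge2; rewrite -mulrN -mulrDr -[leLHS]mq; apply: ler_wpM2l; [exact: ltW | rewrite lerBrDl].
have dSe s' p'' x : q < p'' -> (forall x : R, `|x - s'| < p'' -> `|D x - D s'| <= e) -> `|(D x - D s') * dS s' x| <= e * dS s' x.
  move=> qp'' hp''; have dS0 : 0 <= dS s' x.
    by have /andP[h0 _] := dstep_bound (m * x + - (m * s')); apply: mulr_ge0 => //; exact: ltW.
  rewrite normrM (ger0_norm dS0); have [xs|xs] := ltP `|x - s'| p''; first by apply: ler_wpM2r => //; exact: hp''.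
  suff -> : dS s' x = 0 by rewrite !mulr0.
  rewrite /dS; have [xs'|xs'] := leP x s'.
    rewrite dstep_le1 ?mulr0 // -mulrN -mulrDr; apply: (@le_trans _ _ 0); [by rewrite pmulr_rle0 ?subr_le0 | exact: ler01].
  rewrite dstep_ge2 ?mulr0 // -mulrN -mulrDr -[leLHS]mq; apply: ler_wpM2l; first exact: ltW.
  by move: xs; rewrite (ger0_norm (_ : 0 <= x - s')) ?subr_ge0 ?(ltW xs') // => xs; exact: ltW (lt_le_trans qp'' xs).
pose psi x := S s x - S t x; pose dpsi x := dS s x - dS t x.
have dpsiE (x : R) : is_derive x 1 psi (dpsi x) by exact: derB.
have cdpsi : continuous dpsi by move=> x; apply: cvgB; exact: cdS.
have hpsi : C1c 0 T psi.
  apply: (C1c_of_derive dpsiE cdpsi); exists (Num.min s t), (Num.max s t + q); split.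
  - by rewrite lt_min s0 t0.
  - by rewrite maxEle; case: ifP => _; lra.
  - move=> x; rewrite in_itv /= negb_and -!ltNge => /orP[|h2].
      by rewrite lt_min => /andP[xs xt]; rewrite /psi !Slo ?subrr // ltW.
    rewrite /psi !Shi ?subrr //.
    + by apply: le_trans (ltW h2); rewrite lerD2r le_max lexx orbT.
    + by apply: le_trans (ltW h2); rewrite lerD2r le_max lexx.
have dpsi' : psi^`()%classic = dpsi.
  by apply/funext => x; rewrite derive1E; exact: (@derive_val _ _ _ _ _ _ _ (dpsiE x)).
have cpsi := is_derive_continuous dpsiE.
have cI : continuous (fun x => B x * dpsi x + h x * psi x).
  by move=> x; apply: cvgD; apply: cvgM; [exact: cB | exact: cdpsi | exact: ch | exact: cpsi].
have [W [W0 dW iW]] := primitive_exists cI.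
have T0 : 0 < T by lra.
have WT : W T = W 0.
  have T00 := ltW T0; apply/eqP; rewrite -subr_eq0 -iW ?lexx //.
  rewrite -Rintegral_oo_cc; last exact: measurable_continuous.
  have := wd psi hpsi; rewrite dpsi' => hw.
  rewrite RintegralD //; first by rewrite hw addNr.
    by apply: L2_integrable; apply: continuous_L2 => x; apply: cvgM; [exact: cB | exact: cdpsi].
  by apply: L2_integrable; apply: continuous_L2 => x; apply: cvgM; [exact: ch | exact: cpsi].
(* a function that decreases because [D] is within [e] of [D s], resp. [D t], on the steps *)
pose Z x := W x - P x * psi x - D s * S s x + D t * S t x - e * (S s x + S t x).
have dZ (x : R) : -1 < x -> is_derive x 1 Z ((D x - D s) * dS s x - (D x - D t) * dS t x - e * (dS s x + dS t x)).
  move=> x1; apply: is_derive_conv (derB (derD (derB (derB (dW x x1) (derM (dP x x1) (dpsiE x)))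
    (derZ (D s) (derS s x))) (derZ (D t) (derS t x))) (derZ e (derD (derS s x) (derS t x)))) (fun _ => erefl) _.
  by rewrite /D /dpsi; ring.

have hle (x : R) : (D x - D s) * dS s x - (D x - D t) * dS t x - e * (dS s x + dS t x) <= 0.
  have := dSe s p x qp hp; have := dSe t p' x qp' hp'; rewrite !ler_norml => /andP[? ?] /andP[? ?]; lra.
have dZ0 (x : R) : 0 < x < T -> is_derive x 1 Z ((D x - D s) * dS s x - (D x - D t) * dS t x - e * (dS s x + dS t x)).
  by move=> /andP[x0 _]; apply: dZ; exact: lt_trans (ltrN10 _) x0.
have := derive_le0_le (ltW T0) (@primitive_within _ _ T dZ) dZ0 (fun x _ => hle x).
have Ss0 := Slo s 0 (ltW s0); have St0 := Slo t 0 (ltW t0).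
have SsT : S s T = 1 by apply: Shi; rewrite -lerBrDl ltW.
have StT : S t T = 1 by apply: Shi; rewrite -lerBrDl ltW.
rewrite /Z /psi Ss0 St0 SsT StT WT subrr !mulr0 !mulr1; move: (W 0) => W1 h1; clear -h1; lra.
Unshelve. all: by end_near. Qed.

End AbsolutelyContinuous.

(** * From weak solutions to modes *)
Section Clamp.
Context {R : realType}.
Implicit Types g : R -> R.

(** A solution is known on [0,T] only; composing with [clamp] gives continuous functions on the
    line that agree with it there. *)
Definition clamp (T t : R) : R := Num.max 0 (Num.min t T).

Lemma clamp_in (T t : R) : 0 <= T -> 0 <= clamp T t <= T.
Proof. by move=> T0; rewrite /clamp le_max lexx ge_max T0 ge_min lexx orbT. Qed.

Lemma clamp_id (T t : R) : 0 <= t <= T -> clamp T t = t.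
Proof. by move=> /andP[t0 tT]; rewrite /clamp min_l // max_r. Qed.

Lemma clamp_dist (T s t : R) : 0 <= T -> `|clamp T s - clamp T t| <= `|s - t|.
Proof.
move=> T0; rewrite /clamp; wlog st : s t / s <= t.
  by move=> h; have [st|/ltW ts] := leP s t; [exact: h | rewrite distrC [leRHS]distrC; exact: h].
rewrite distrC [leRHS]distrC [leRHS]ger0_norm ?subr_ge0 //.
by rewrite /Num.max /Num.min; do 4 case: ifP => /=; rewrite ?ltNge => *;
  rewrite ler_norml; apply/andP; split; lra.
Qed.

Lemma continuous_clamp g (T : R) : 0 <= T ->
  (forall t : R, 0 <= t <= T -> forall e : R, 0 < e -> exists2 d : R, 0 < d &
     forall s : R, 0 <= s <= T -> `|s - t| < d -> `|g s - g t| <= e) ->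
  continuous (fun t => g (clamp T t)).
Proof.
move=> T0 h t; apply/cvgrPdist_le => e e0; have [d d0 hd] := h _ (clamp_in t T0) e e0.
apply/nbhs_ballP; exists d => // s; rewrite /ball /= => st; rewrite distrC; apply: hd.
  exact: clamp_in.
by apply: le_lt_trans (clamp_dist _ _ T0) _; rewrite distrC.
Qed.

Lemma clamp_near (T t : R) : 0 < t < T -> \near t, clamp T t = t.
Proof.
move=> /andP[t0 tT]; near=> s; apply: clamp_id; apply/andP; split; apply: ltW; near: s.
  exact: lt_nbhsr.
exact: lt_nbhsl.
Unshelve. all: by end_near. Qed.

Lemma clamp_derive g (T t d : R) : 0 < t < T -> is_derive t 1 g d -> is_derive t 1 (fun t => g (clamp T t)) d.
Proof.
move=> tT; apply: near_eq_is_derive; have := clamp_near tT; apply: filterS => s ->.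
by [].
Qed.

Lemma abs_cont_modulus (T : R) (d : R -> R -> R) : abs_cont T d -> forall e : R, 0 < e ->
  exists2 p : R, 0 < p & forall a b : R, 0 <= a -> a <= b -> b <= T -> b - a < p -> d a b < e.
Proof.
move=> ac e e0; have [p p0 h] := ac e e0; exists p => // a b a0 ab bT bp.
have := h 1%N (fun=> a) (fun=> b); rewrite !big_ord1; apply=> //.
by move=> i j _ _ _; rewrite (ord1 i) (ord1 j).
Qed.

Lemma abs_cont_continuous g (T : R) : 0 <= T -> abs_cont T (fun s t => `|g s - g t|) ->
  continuous (fun t => g (clamp T t)).
Proof.
move=> T0 ac; apply: continuous_clamp => // t /andP[t0 tT] e e0.
have [p p0 hp] := abs_cont_modulus ac e0; exists p => // s /andP[s0 sT] st; apply: ltW.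
have [ts|/ltW ts] := leP t s.
  by rewrite distrC; apply: hp => //; move: st; rewrite ger0_norm // subr_ge0.
by apply: hp => //; move: st; rewrite distrC ger0_norm // subr_ge0.
Qed.

(** An absolutely continuous function whose derivative is almost everywhere a continuous
    function is a primitive of it. *)
Lemma abs_cont_derive F g (T : R) : 0 < T -> abs_cont T (fun s t => `|F s - F t|) -> continuous g ->
  {ae leb, forall t, t \in `]0, T[ -> is_derive t 1 F (g t)} ->
  forall t : R, 0 < t < T -> is_derive t 1 F (g t).
Proof.
move=> T0 ac cg dF t tT; have [P [P0 dP _]] := primitive_exists cg.
have e := abs_cont_primitive T0 cg ac dP dF.
have d : is_derive t 1 (fun t => P t - P 0 + F 0) (g t).
  have /andP[t0 _] := tT.
  apply: is_derive_conv (derD (derB (dP t _) (is_derive_cst (P 0) t 1)) (is_derive_cst (F 0) t 1)) (fun _ => erefl) _.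
    by lra.
  by rewrite subr0 addr0.
apply: near_eq_is_derive d; have := clamp_near tT; apply: filterS => s hs.
by rewrite -e ?subrK // -hs clamp_in // ltW.
Qed.

End Clamp.

Section ModalData.
Context {R : realType}.
Variables (sigma mu kappa r k Q gamma : R).
Hypotheses (sigma_gt0 : 0 < sigma) (mu_gt0 : 0 < mu) (kappa_ge0 : 0 <= kappa).
Hypotheses (r_gt0 : 0 < r) (k_neq0 : k != 0).
Local Notation c := (@one_coef R).
Variables (f phi0 phib0 : R -> R) (xi0 w0 T : R) (xi w : R -> R) (phi u ut : R -> R -> R).
Hypotheses (T0 : 0 < T) (phi0S : inSbar phi0) (phib0S : inS phib0).
Hypothesis ws : weak_solution_on sigma mu kappa f phi0 phib0 xi0 w0 T xi w phi.
Hypothesis hC0 : C0_into T H10 (Hnorm 1) u.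
Hypothesis hL2 : L2_into T (Hk 2) (Hnorm 2) u.
Hypothesis hut : L2_into T (L2 0 1) L2norm ut.
Hypothesis hwt : weak_tderiv T u ut.
Hypothesis htd : forall t, t \in `[0, T] -> is_tderiv `[0, T] phi t (wD 1 (u t)).
Hypothesis hpde : {ae leb, forall t, t \in `]0, T[ ->
  eq01 (ut t) (fun x => wD 1 (phi t) x - sigma * wD 3 (phi t) x + mu * wD 2 (u t) x
    - kappa * u t x - f t * \1_(`[0, 1]%classic) x)}.
Hypothesis hf : forall t, 0 <= t < T -> f t = feedback mu kappa r k Q gamma (xi t) (w t) (phi t) (wD 1 (u t)).

Let cosL := @cosb_L2 R.
Let cosO := @cosb_on R.
Let sinL := @sinb_L2 R.
Let sinO := @sinb_on R.
Let T00 : 0 <= T := ltW T0.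
Local Notation cl := (clamp T).

(** [cosc] and [sinc] are the Fourier coefficients of [phi] and [u] along a weak solution, and
    [fcl] its feedback, extended to all times by [clamp]. *)
Definition cosc (n : nat) (t : R) : R := inner (phi (cl t)) (cosb n).
Definition sinc (n : nat) (t : R) : R := inner (u (cl t)) (sinb n).
Definition fcl (t : R) : R := feedback mu kappa r k Q gamma (xi (cl t)) (w (cl t)) (phi (cl t)) (wD 1 (u (cl t))).

Lemma phi_S t : 0 <= t <= T -> inSbar (phi t).
Proof. by move=> tT; apply: (ws_phi_Sbar ws); rewrite in_itv. Qed.

Lemma u_H t : 0 <= t <= T -> H10 (u t).
Proof. by move=> tT; have [] := hC0 (_ : t \in `[0, T]). Qed.

Lemma L2phi t : 0 <= t <= T -> L2 0 1 (phi t).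
Proof. by move=> /phi_S [/Hk_L2]. Qed.

Lemma L2u t : 0 <= t <= T -> L2 0 1 (u t).
Proof. by move=> /u_H [/Hk_L2]. Qed.

Lemma cl_in t : 0 <= cl t <= T. Proof. exact: clamp_in. Qed.

Lemma continuous_phi_inner eta : L2 0 1 eta -> continuous (fun t => inner (phi (cl t)) eta).
Proof.
move=> Le; apply: (@abs_cont_continuous _ (fun t => inner (phi t) eta)) => // e e0.
have N0 := L2norm_ge0 eta; have e1 : 0 < e / (L2norm eta + 1) by rewrite divr_gt0 // ltr_wpDl.
have [p p0 h] := ws_phi_ac ws e1; exists p => // n a b hab tI s.
have := h n a b hab tI s; rewrite ltr_pdivlMr ?ltr_wpDl // => lt1.
apply: le_lt_trans lt1; rewrite mulrDr mulr1 mulr_suml -big_split /=; apply: ler_sum => i _.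
have [a0 ab bT] := hab i; have La : L2 0 1 (phi (a i)) by apply: L2phi; rewrite a0 (le_trans ab).
have Lb : L2 0 1 (phi (b i)) by apply: L2phi; rewrite (le_trans a0 ab).
rewrite -innerBl //; apply: le_trans (inner_le (L2B La Lb) Le) _; rewrite lerDl; exact: L2norm_ge0.
Qed.

Lemma continuous_u_inner eta : L2 0 1 eta -> continuous (fun t => inner (u (cl t)) eta).
Proof.
move=> Le; apply: (@continuous_clamp _ (fun t => inner (u t) eta)) => // t tT e e0.
have N0 := L2norm_ge0 eta; have e1 : 0 < e / (L2norm eta + 1) by rewrite divr_gt0 // ltr_wpDl.
have tI : t \in `[0, T] by rewrite in_itv.
have [_ /cvgrPdist_le /(_ _ e1)] := hC0 tI; rewrite near_withinE => /nbhs_ballP [d /= d0 hd].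
exists d => // s sT st; have := hd s; rewrite /ball /= distrC in_itv => /(_ st sT).
rewrite sub0r normrN ger0_norm ?sqrtr_ge0 // ler_pdivlMr ?ltr_wpDl // => h1.
have Lu := L2u sT; have Lu' := L2u tT.
rewrite -innerBl //; apply: le_trans (inner_le (L2B Lu Lu') Le) _; apply: le_trans h1.
apply: ler_pM; rewrite ?L2norm_ge0 ?lerDl //; exact: (Hnorm_ge (u s \- u t) (isT : (0 <= 1)%N)).
Qed.

Lemma continuous_cosc n : continuous (cosc n).
Proof. exact: continuous_phi_inner. Qed.

Lemma continuous_sinc n : continuous (sinc n).
Proof. exact: continuous_u_inner. Qed.

Lemma coefs t :
  [/\ expands cosb (phi (cl t)) (cosc^~ t),
      expands sinb (wD 1 (phi (cl t))) (fun n => - (nu n ^+ 1 * cosc n t)),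
      expands sinb (u (cl t)) (sinc^~ t) &
      expands cosb (wD 1 (u (cl t))) (fun n => nu n ^+ 1 * sinc n t)].
Proof.
have [e0 e1 _ _] := Sbar_coef (phi_S (cl_in t)); have [e2 e3] := H10_coef (u_H (cl_in t)); split=> //.
Qed.

(** [phi_t = u_x] holds at every time, in the strong sense. *)
Lemma der_cosc n t : 0 < t < T -> is_derive t 1 (cosc n) (nu n * sinc n t).
Proof.
move=> tT; have tT' : 0 <= t <= T by case/andP: tT => /ltW -> /ltW ->.
apply: (clamp_derive tT (g := fun t => inner (phi t) (cosb n))).
have [_ _ _ e3] := coefs t; rewrite clamp_id // in e3.
have Lw := expands_L2 e3.
have -> : nu n * sinc n t = inner (wD 1 (u t)) (cosb n) by rewrite (expands_coef cosL cosO n e3) expr1.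
apply/is_derive_nearP => e e0; pose C := L2norm (@cosb R n) + 1.
have C0 : 0 < C by rewrite ltr_wpDl // L2norm_ge0.
have tI : t \in `[0, T] by rewrite in_itv.
have eC : 0 < e / C by rewrite divr_gt0.
have [_ /cvgrPdist_le /(_ _ eC)] := htd tI; rewrite near_withinE /dnbhs near_withinE => h.
have := clamp_near tT; apply: filterS2 h => s h hs.
have sT : 0 <= s <= T by rewrite -hs cl_in.
have [->|st] := eqVneq s t; first by rewrite !subrr mulr0 subrr normr0 mulr0.
have st0 : s - t != 0 by rewrite subr_eq0.
have sI : `[0, T]%classic s by rewrite /= in_itv.
have := h st sI; rewrite sub0r normrN ger0_norm ?L2norm_ge0 // => hle.
have Ls := L2phi sT; have Lt := L2phi tT'; have Ld := L2Z (s - t)^-1 (L2B Ls Lt).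
have Ld' : L2 0 1 (fun x => (phi s x - phi t x) / (s - t)) by under eq_fun do rewrite mulrC.
have := inner_le (L2B Ld' Lw) (cosL n); rewrite innerBl //.
under [in inner (fun x => _ / _) _]eq_fun do rewrite mulrC.
rewrite innerZl ?innerBl //; last exact: L2B.
move=> hin; have -> : inner (phi s) (cosb n) - inner (phi t) (cosb n) - inner (wD 1 (u t)) (cosb n) * (s - t) =
   ((s - t)^-1 * (inner (phi s) (cosb n) - inner (phi t) (cosb n)) - inner (wD 1 (u t)) (cosb n)) * (s - t) by field.
rewrite normrM; apply: ler_wpM2r; first exact: normr_ge0.
apply: le_trans hin _; move: hle; rewrite ler_pdivlMr // => hle; apply: le_trans hle.
by apply: ler_wpM2l; [exact: L2norm_ge0 | rewrite /C lerDl].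
Qed.

Lemma Flaw_fcl t : Flaw mu kappa r k Q gamma c N (cosc^~ t) (sinc^~ t) (xi (cl t)) (w (cl t)) @[N --> \oo] --> fcl t.
Proof.
have [e0 e1 e2 e3] := coefs t; have r0 : r != 0 by rewrite gt_eqF.
exact: (Flaw_cvg_feedback r0 k_neq0 e0 e1 e3 (expands_L2 e3) (eq01_refl _)).
Qed.

(** The [L^2(0,T;H^2)] norm of [u] on coefficients; this is the only bound with two derivatives
    of [u] that a weak solution provides. *)
Lemma H2_energy : exists2 K : R, 0 <= K & forall N,
  \int[leb]_(t in `[0, T]) (\sum_(n < N) nu n ^+ 4 * sinc n t ^+ 2) <= K.
Proof.
have [hH _ hfin] := hL2; exists (fine (\int[leb]_(t in `]0%R, T[) ((Hnorm 2 (u t) ^+ 2)%R)%:E)%E).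
  by apply: fine_ge0; apply: integral_ge0 => t _; rewrite lee_fin sqr_ge0.
move=> N; pose E t := \sum_(n < N) nu n ^+ 4 * sinc n t ^+ 2.
change (\int[leb]_(t in `[0, T]) E t <= fine (\int[leb]_(t in `]0%R, T[) ((Hnorm 2 (u t) ^+ 2)%R)%:E)%E).
have E0 t : 0 <= E t by apply: sumr_ge0 => n _; rewrite mulr_ge0 ?sqr_ge0 // exprn_ge0 // ltW // nu_gt0.
have cE : continuous E.
  apply: (@continuous_sum R 'I_N (index_enum 'I_N) (fun n t => nu n ^+ 4 * sinc n t ^+ 2)) => n t.
  by apply: cvgM; [exact: cvg_cst | apply: continuousX; exact: continuous_sinc].
rewrite -Rintegral_oo_cc; last exact: measurable_continuous.
have iE : leb.-integrable `]0, T[ (EFin \o E) by apply: L2_integrable; exact: continuous_L2.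
rewrite /Rintegral; apply: fine_le.
- exact: integrable_fin_num.
- rewrite ge0_fin_numE //; apply: integral_ge0 => t _; rewrite lee_fin; exact: sqr_ge0.
case: hH => Z [mZ Z0 sZ].
apply: (integral_le_ae (measurable_oo 0 T) mZ Z0) => t /=; rewrite ?lee_fin ?sqr_ge0 //.
rewrite in_itv /= => /andP[t0 tT] nZ; have tI : 0 <= t <= T by rewrite (ltW t0) (ltW tT).
have hk : Hk 2 (u t).
  apply: contrapT => h; apply: nZ; apply: sZ => /= h2; apply: h; apply: h2.
  by rewrite in_itv /= t0.
have e2 := H10_H2_coef (u_H tI) hk.
have l1 := Hnorm_ge (u t) (isT : (2 <= 2)%N).
apply: (@le_trans _ _ (L2norm (wD 2 (u t)) ^+ 2)); last by rewrite ler_sqr ?nnegrE ?L2norm_ge0 ?sqrtr_ge0.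
apply: le_trans (expands_norm_ge sinL sinO N e2); apply: ler_sum => n _.
by rewrite /sinc clamp_id // le_eqVlt; apply/orP; left; apply/eqP; ring.
Qed.

Let S N t := \sum_(n < N) - (nu n ^+ 1 * cosc n t) * c n.

(** The term of the feedback that is not continuous in time by assumption is the integral of
    [phi_x], of which [S N] is the partial sum.  Its derivative is [- sum_n nu^2 b_n c_n], of
    modulus at most [lam / 2 + (sum_n nu^4 b_n^2) / (2 lam)] as [sum_n c_n^2 <= 1]; integrating and
    using [H2_energy] gives a modulus of continuity independent of [N], of Hoelder type once
    [lam] is optimised. *)
Lemma S_modulus : exists2 K : R, 0 <= K & forall N (lam s t : R), 0 < lam -> 0 <= s -> s <= t -> t <= T ->
  `|S N t - S N s| <= lam / 2 * (t - s) + K / (2 * lam).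
Proof.
have [K K0 hK] := H2_energy; exists K => // N lam s t lam0 s0 st tT.
pose E t := \sum_(n < N) nu n ^+ 4 * sinc n t ^+ 2.
have E0 x : 0 <= E x by apply: sumr_ge0 => n _; rewrite mulr_ge0 ?sqr_ge0 // exprn_ge0 // ltW // nu_gt0.
have cE : continuous E.
  apply: (@continuous_sum R 'I_N (index_enum 'I_N) (fun n t => nu n ^+ 4 * sinc n t ^+ 2)) => n x.
  by apply: cvgM; [exact: cvg_cst | apply: continuousX; exact: continuous_sinc].
have [P [P0 dP iP]] := primitive_exists cE.
have PK : P t - P s <= K.
  have mono (x y : R) : 0 <= x -> x <= y -> P x <= P y.
    by move=> x0 xy; rewrite -subr_ge0 -iP ?x0 ?xy //; apply: Rintegral_ge0 => z _; exact: E0.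
  have := hK N; rewrite iP ?lexx //.
  by have := mono 0 s (lexx _) s0; have := mono t T (le_trans s0 st) tT; lra.
pose dS x := \sum_(n < N) - (nu n ^+ 1 * (nu n * sinc n x)) * c n.
have cS : continuous (S N).
  apply: (@continuous_sum R 'I_N (index_enum 'I_N) (fun n t => - (nu n ^+ 1 * cosc n t) * c n)) => n x.
  apply: cvgM; last exact: cvg_cst.
  by apply: cvgN; apply: cvgM; [exact: cvg_cst | exact: continuous_cosc].
have derS (x : R) : 0 < x < T -> is_derive x 1 (S N) (dS x).
  move=> xT; apply: (@is_derive_bigsum R 'I_N (index_enum 'I_N) (fun n t => - (nu n ^+ 1 * cosc n t) * c n)
    (fun n x => - (nu n ^+ 1 * (nu n * sinc n x)) * c n)) => n.
  apply: is_derive_conv (derZ (- (nu n ^+ 1 * c n)) (der_cosc n xT)) _ _ => [z|]; ring.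
have dSle x : `|dS x| <= lam / 2 + E x / (2 * lam).
  apply: le_trans (ler_norm_sum _ _ _) _.
  apply: (@le_trans _ _ (\sum_(n < N) (lam / 2 * c n ^+ 2 + nu n ^+ 4 * sinc n x ^+ 2 / (2 * lam)))).
    apply: ler_sum => n _; set q := nu n ^+ 2 * sinc n x.
    have -> : nu n ^+ 4 * sinc n x ^+ 2 = q ^+ 2 by rewrite /q; ring.
    have -> : - (nu n ^+ 1 * (nu n * sinc n x)) * c n = - (q * c n) by rewrite /q; ring.
    rewrite normrN normrM -(real_normK (num_real (c n))) -(real_normK (num_real q)).
    move: (`|c n|) (`|q|) => y z.
    have -> : lam / 2 * y ^+ 2 + z ^+ 2 / (2 * lam) = z * y + (lam * y - z) ^+ 2 / (2 * lam) by field; rewrite gt_eqF.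
    by rewrite lerDl divr_ge0 ?sqr_ge0 // mulr_ge0 // ltW.
  rewrite big_split /= -mulr_sumr -mulr_suml lerD2r -[leRHS]mulr1; apply: ler_wpM2l; first by rewrite divr_ge0 // ltW.
  exact: one_coef_sum.
have wP (g dg : R -> R) : continuous g -> (forall x : R, 0 < x < T -> is_derive x 1 g (dg x)) ->
    (forall x, dg x <= lam / 2 + E x / (2 * lam)) -> g t - g s <= lam / 2 * (t - s) + K / (2 * lam).
  move=> cg hg hle; pose F x := g x - lam / 2 * x - (2 * lam)^-1 * P x.
  have dF (x : R) : s < x < t -> is_derive x 1 F (dg x - lam / 2 * 1 - (2 * lam)^-1 * E x).
    move=> /andP[sx xt]; apply: derB; last by apply: derZ; apply: dP; lra.
    by apply: (derB (hg x _) (derZ _ (derId x))); apply/andP; split; lra.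
  have cF : {within `[s, t], continuous F}.
    have cP : {within `[s, t], continuous P}.
      apply: derivable_within_continuous => x; rewrite in_itv /= => /andP[sx _].
      by apply: (@ex_derive _ _ _ _ _ _ _ (dP x _)); lra.
    move=> x; apply: cvgB; last by apply: cvgM; [exact: cvg_cst | exact: cP].
    apply: cvgB; first by apply: continuous_subspaceT cg x.
    by apply: cvgM; [exact: cvg_cst | apply: (@continuous_subspaceT _ _ _ (fun x : R => x)) => z; exact: cvg_id].
  have i0 : 0 < (2 * lam)^-1 by rewrite invr_gt0 mulr_gt0.
  have h1 : (2 * lam)^-1 * (P t - P s) <= K / (2 * lam) by rewrite mulrC ler_wpM2r // ltW.
  have : g t - lam / 2 * t - (2 * lam)^-1 * P t <= g s - lam / 2 * s - (2 * lam)^-1 * P s.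
    by apply: (derive_le0_le st cF dF) => x _; have := hle x; rewrite mulr1 (mulrC (E x)); lra.
  by move: h1; rewrite mulrBr; lra.
rewrite ler_norml; apply/andP; split.
  have := wP (fun x => - S N x) (fun x => - dS x); rewrite opprK => h.
  rewrite lerNl opprB addrC; apply: h.
  - by move=> x; apply: cvgN; exact: cS.
  - by move=> x xT; apply: derN; exact: derS.
  - by move=> x; apply: le_trans (dSle x); rewrite -normrN; exact: ler_norm.
apply: (wP _ dS cS derS) => x; apply: le_trans (dSle x); exact: ler_norm.
Qed.

Lemma S_cvg t : S N t @[N --> \oo] --> inner (wD 1 (phi (cl t))) (fun _ => 1).
Proof.
have [_ e1 _ _] := coefs t; apply: cvg_trans (expands_inner sinL e1 (L2_cst 0 1 1)).
by apply: near_eq_cvg; apply: nearW => N.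
Qed.

Lemma continuous_phi_x1 : continuous (fun t => inner (wD 1 (phi (cl t))) (fun _ => 1)).
Proof.
have [K K0 hK] := S_modulus; pose g t := inner (wD 1 (phi t)) (fun _ => 1).
have gmod (lam s t : R) : 0 < lam -> 0 <= s -> s <= t -> t <= T ->
    `|g t - g s| <= lam / 2 * (t - s) + K / (2 * lam).
  move=> lam0 s0 st tT; have ct := @S_cvg t; have cs := @S_cvg s.
  rewrite !clamp_id ?s0 ?tT ?(le_trans s0 st) ?(le_trans st tT) // in ct cs.
  have cd : `|S N t - S N s| @[N --> \oo] --> `|g t - g s| by apply: cvg_norm; apply: cvgB; [exact: ct | exact: cs].
  by apply: (cvg_le_cst cd) => N; exact: hK.
apply: (@continuous_clamp _ g) => // t /andP[t0 tT] e e0.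
(* the choice of [lam] that makes the constant term of the modulus at most [e / 2] *)
pose lam := (K + 1) / e; have lam0 : 0 < lam by rewrite divr_gt0 // ltr_wpDl.
have Kl : K / (2 * lam) <= e / 2.
  have K1 : 0 < K + 1 by rewrite ltr_wpDl.
  have -> : K / (2 * lam) = e / 2 * (K / (K + 1)) by rewrite /lam; field; rewrite !gt_eqF.
  by apply: ler_piMr; [lra | rewrite ler_pdivrMr // mul1r lerDl].
exists (e / lam) => [|s /andP[s0 sT] st]; first exact: divr_gt0.
have fin (y : R) : y < e / lam -> lam / 2 * y + K / (2 * lam) <= e.
  rewrite ltr_pdivlMr // => hy; have : lam / 2 * y <= e / 2 by rewrite mulrAC ler_pM2r // mulrC ltW.
  lra.
have [ts|/ltW ts] := leP t s.
  apply: le_trans (gmod lam t s lam0 t0 ts sT) _; apply: fin; move: st; rewrite ger0_norm ?subr_ge0 //.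
rewrite distrC; apply: le_trans (gmod lam s t lam0 s0 ts tT) _; apply: fin; move: st.
by rewrite distrC ger0_norm ?subr_ge0.
Qed.

(** Integration by parts; it removes the derivative of [u], which is only controlled in L^2,
    from the feedback. *)
Lemma H10_inner_id (v : R -> R) : H10 v -> inner (wD 1 v) (fun x => x) = - inner v (fun _ => 1).
Proof.
move=> hv; have [e2 e3] := H10_coef hv.
have Lx : L2 0 1 (fun x : R => x) by apply: continuous_L2 => x; exact: cvg_id.
have c1 := expands_inner cosL e3 Lx; have c2 := expands_inner sinL e2 (L2_cst 0 1 1).
have c3 : \sum_(n < N) nu n ^+ 1 * inner v (sinb n) * inner (cosb n) (fun x => x) @[N --> \oo] --> - inner v (fun _ => 1).
  have c4 : - (\sum_(n < N) inner v (sinb n) * inner (sinb n) (fun _ => 1)) @[N --> \oo] --> - inner v (fun _ => 1).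
    exact: cvgN c2.
  apply: cvg_trans c4; apply: near_eq_cvg; apply: nearW => N; rewrite -sumrN.
  by apply: eq_bigr => n _; rewrite (innerC (cosb n)) inner_id_cosb -[inner (sinb n) _]/(c n); field; exact: nu_neq0.
by exact: (cvg_unique (@Rhausdorff R) c1 c3).
Qed.

Lemma continuous_xi : continuous (fun t => xi (cl t)).
Proof. exact: abs_cont_continuous T00 (ws_xi_ac ws). Qed.

Lemma continuous_w : continuous (fun t => w (cl t)).
Proof. exact: abs_cont_continuous T00 (ws_w_ac ws). Qed.

(** After [H10_inner_id] the only delicate term is the integral of [phi_x], settled by
    [continuous_phi_x1]. *)
Lemma continuous_fcl : continuous fcl.
Proof.
have Lx : L2 0 1 (fun x : R => x) by apply: continuous_L2 => x; exact: cvg_id.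
have -> : fcl = fun t => gamma * k * (w (cl t) + k * xi (cl t) + k ^+ 2 * Q *
    (- (r * kappa) * inner (phi (cl t)) (fun x => x) + - (r + 1) * - inner (u (cl t)) (fun _ => 1)
     + - (r * mu) * inner (wD 1 (phi (cl t))) (fun _ => 1))).
  apply/funext => t; have [e0 e1 e2 e3] := coefs t; have r0 : r != 0 by rewrite gt_eqF.
  rewrite /fcl (@feedbackE R mu kappa r k Q gamma _ (u (cl t))) // -?H10_inner_id //.
  - exact: u_H (cl_in t).
  - exact: expands_L2 e0.
  - exact: expands_L2 e1.
  - exact: expands_L2 e3.
  - exact: expands_L2 e3.
  - exact: eq01_refl.
have cM (C : R) (g : R -> R) : continuous g -> continuous (fun t => C * g t).
  by move=> cg t; apply: cvgM; [exact: cvg_cst | exact: cg].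
have cD (g h : R -> R) : continuous g -> continuous h -> continuous (fun t => g t + h t).
  by move=> cg ch t; apply: cvgD; [exact: cg | exact: ch].
apply: (cM (gamma * k)); apply: (cD).
  by apply: (cD); [exact: continuous_w | apply: (cM); exact: continuous_xi].
apply: (cM); apply: (cD); last by apply: (cM); exact: continuous_phi_x1.
apply: (cD); first by apply: (cM); exact: continuous_phi_inner.
by apply: (cM) => t; apply: cvgN; apply: continuous_u_inner; exact: L2_cst.
Qed.

Lemma der_xi (t : R) : 0 < t < T -> is_derive t 1 (fun t => xi (cl t)) (w (cl t)).
Proof.
move=> tT; apply: (clamp_derive tT).
apply: (abs_cont_derive T0 (ws_xi_ac ws) continuous_w _ tT).
apply: aeS (ws_ode_xi ws) => x hx xI; rewrite clamp_id; first exact: hx.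
by move: xI; rewrite in_itv /= => /andP[/ltW -> /ltW ->].
Qed.

Lemma f_fcl t : 0 <= t < T -> f t = fcl t.
Proof.
move=> tT; have tT' : 0 <= t <= T by case/andP: tT => -> /ltW ->.
by rewrite (hf tT) /fcl (clamp_id tT').
Qed.

Lemma der_w (t : R) : 0 < t < T -> is_derive t 1 (fun t => w (cl t)) (- fcl t).
Proof.
move=> tT; apply: (clamp_derive tT).
have cf : continuous (fun t => - fcl t) by move=> x; apply: cvgN; exact: continuous_fcl.
apply: (abs_cont_derive T0 (ws_w_ac ws) cf _ tT).
apply: aeS (ws_ode_w ws) => x hx xI; have e : f x = fcl x.
  by apply: f_fcl; move: xI; rewrite in_itv /= => /andP[/ltW -> ->].
by rewrite -e; exact: hx.
Qed.

Let h n t : R := - stiff sigma n * cosc n t - damp mu kappa n * sinc n t - c n * fcl t.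

Lemma continuous_h n : continuous (h n).
Proof.
move=> t; apply: cvgB; [apply: cvgB |]; (apply: cvgM; first exact: cvg_cst).
- exact: continuous_cosc.
- exact: continuous_sinc.
- exact: continuous_fcl.
Qed.

(** The coefficients of the partial differential equation, valid at almost every time. *)
Lemma ut_coef n : {ae leb, forall t, t \in `]0, T[ -> inner (ut t) (sinb n) = h n t}.
Proof.
have [a1 _ _] := ws_phi_L2H3 ws; have [a2 _ _] := hL2; have [a3 _ _] := hut.
have a4 : {ae leb, forall t, t \in `]0, T[ -> Hk 2 (u t) /\ L2 0 1 (ut t)}.
  by apply: aeS2 a2 a3 => t h1 h2 tI; split; [exact: h1 | exact: h2].
have a5 : {ae leb, forall t, t \in `]0, T[ -> Hk 3 (phi t) /\ Hk 2 (u t) /\ L2 0 1 (ut t)}.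
  by apply: aeS2 a1 a4 => t h1 h2 tI; split; [exact: (h1 tI).1 | exact: h2].
apply: aeS2 a5 hpde => t h1 h2 tI; have [hk3 [hk2 Lut]] := h1 tI; have {h2} ep := h2 tI.
have /andP[t0 tT] : 0 < t < T by move: tI; rewrite in_itv.
have tI' : 0 <= t <= T by rewrite (ltW t0) (ltW tT).
have [_ e1 e2 _] := coefs t; rewrite clamp_id // in e1 e2.
have e3 := Sbar_H3_coef (phi_S tI') hk3; have e4 := H10_H2_coef (u_H tI') hk2.
have e5 := expandsB sinL (expandsB sinL (expandsD sinL (expandsB sinL e1 (expandsZ sinL sigma e3)) (expandsZ sinL mu e4))
  (expandsZ sinL kappa e2)) (expandsZ sinL (f t) (expands_sinb (L2_cst 0 1 1))).
have eu : eq01 (fun x => wD 1 (phi t) x - sigma * wD 3 (phi t) x + mu * wD 2 (u t) x - kappa * u t x - f t * 1) (ut t).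
  apply: aeS ep => x hx xI; rewrite hx // indicE mem_set //=.
  by move: xI; rewrite !in_itv /= => /andP[/ltW -> /ltW ->].
rewrite (expands_coef sinL sinO n (expands_eq01 sinL e5 Lut eu)).
have ea : inner (phi t) (cosb n) = cosc n t by rewrite /cosc clamp_id.
have eb : inner (u t) (sinb n) = sinc n t by rewrite /sinc clamp_id.
have ef : fcl t = f t by rewrite f_fcl // (ltW t0).
rewrite ea eb /h ef (innerC _ (sinb n)) -[inner (sinb n) _]/(c n) /stiff /damp; ring.
Qed.

(** The right-hand side of the weak identity is continuous in time, so the derivative is
    classical. *)
Lemma der_sinc n (t : R) : 0 < t < T -> is_derive t 1 (sinc n) (h n t).
Proof.
apply: weak_deriv_derive; [exact: continuous_sinc | exact: continuous_h |].
move=> psi hpsi; have := hwt (sinL n) hpsi.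
have -> : \int[leb]_(x in `]0, T[) (inner (u x) (sinb n) * psi^`()%classic x) =
    \int[leb]_(x in `]0, T[) (sinc n x * psi^`()%classic x).
  apply: eq_Rintegral => x; rewrite inE /= in_itv /= => /andP[x0 xT].
  by rewrite /sinc clamp_id // (ltW x0) (ltW xT).
move=> ->; congr (- _); congr fine; apply: integral_eq_ae; first exact: measurable_oo.
by apply: aeS (ut_coef n) => x hx xI; rewrite hx.
Qed.

Lemma coef_init : (forall n, cosc n 0 = inner phi0 (cosb n)) /\ forall n, sinc n 0 = inner phib0 (cosb n) / nu n.
Proof.
have t00 : 0 <= (0 : R) <= T by rewrite lexx T00.
have t0I : (0 : R) \in `[0, T] by rewrite in_itv.
split=> n.
  by rewrite /cosc clamp_id //; apply: inner_eq01l (ws_init_phi ws) => //; [exact: L2phi | case: phi0S => /Hk_L2].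
have [_ _ _ e3] := coefs 0; rewrite clamp_id // in e3.
have e : eq01 (wD 1 (u 0)) phib0.
  apply: (is_tderiv_unique (within_dnbhs_proper T0 t00) _ _ (htd t0I) (ws_init_phit ws)) => //.
  by move=> s /=; rewrite in_itv /=; exact: L2phi.
rewrite -(inner_eq01l (expands_L2 e3) phib0S.1 (cosL n) e) (expands_coef cosL cosO n e3) expr1 [nu n * _]mulrC mulfK //.
exact: nu_neq0.
Qed.

(** Estimates mode by mode suffice, since the input is already known to be bounded: [f^2] is
    multiplied by [c_n^2], which is summable. *)
Lemma modal_energy : exists M, forall N t, 0 <= t <= T -> Lsum sigma mu kappa r N (cosc^~ t) (sinc^~ t) <= M.
Proof.
have r0 : 0 <= r by exact: ltW.
have [F F0 hF] := continuous_bounded 0 T continuous_fcl.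
have [d [C [d0 C0 hC]]] := mode_level1 c sigma_gt0 mu_gt0 kappa_ge0.
have [Mr Mr0 hMr] := Lmode_le sigma_gt0 mu_gt0 kappa_ge0 r0.
have [M1 M10 hM1] := Lmode_le sigma_gt0 mu_gt0 kappa_ge0 (ler01 : (0 : R) <= 1).
pose m := Num.min (1 / 2) (sigma / 2) : R; have m0 : 0 < m by rewrite lt_min !divr_gt0.
pose D := C * F ^+ 2; have D0 : 0 <= D by rewrite mulr_ge0 ?sqr_ge0 // ltW.
have grow n t : 0 <= t <= T -> Lmode sigma mu kappa 1 n (cosc n t) (sinc n t) <=
    Lmode sigma mu kappa 1 n (cosc n 0) (sinc n 0) + D * c n ^+ 2 * T.
  move=> /andP[t0 tT]; pose g x := Lmode sigma mu kappa 1 n (cosc n x) (sinc n x) - D * c n ^+ 2 * x.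
  have dg (x : R) : 0 < x < t -> is_derive x 1 g (- Dmode sigma mu kappa 1 n (cosc n x) (sinc n x) -
      c n * fcl x * (1 * zcoef mu kappa n (cosc n x) (sinc n x) + sinc n x) - D * c n ^+ 2 * 1).
    move=> /andP[x0 xt]; have xT : 0 < x < T by rewrite x0 (lt_le_trans xt).
    have hm : is_mode sigma mu kappa c n (cosc n) (sinc n) fcl x by split; [exact: der_cosc | exact: der_sinc].
    exact: (derB (is_derive_Lmode 1 hm) (derZ _ (derId x))).
  have cg : {within `[0, t], continuous g}.
    apply: continuous_subspaceT => x; apply: cvgB; last by apply: cvgM; [exact: cvg_cst | exact: cvg_id].
    by apply: continuous_Lmode; [exact: continuous_cosc | exact: continuous_sinc].
  have : g t <= g 0.
    apply: (derive_le0_le t0 cg dg) => x /andP[x0 xt]; rewrite mulr1 subr_le0.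
    have n2 : 1 <= nu n ^+ 2 :> R by apply: exprn_ege1; exact: nu_ge1.
    have hx := hC n (cosc n x) (sinc n x) (fcl x).
    have hc : c n ^+ 2 * fcl x ^+ 2 <= c n ^+ 2 * F ^+ 2.
      apply: ler_wpM2l; first exact: sqr_ge0.
      rewrite -(real_normK (num_real (fcl x))) ler_sqr ?nnegrE ?(ltW F0) //.
      by apply: hF; rewrite (ltW x0) (le_trans (ltW xt)).
    move: hx; set X := - Dmode _ _ _ _ _ _ _ - _ => hx.
    (* the bound is known for [nu^2 X]; for [X > 0] it is a bound for [X] since [nu >= 1] *)
    have [X0|X0] := leP X 0; first by apply: le_trans X0 _; rewrite mulr_ge0 ?sqr_ge0.
    have hX : X <= nu n ^+ 2 * X by rewrite ler_peMl // ltW.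
    have hd : 0 <= d * (nu n ^+ 4 * sinc n x ^+ 2 + nu n ^+ 6 * cosc n x ^+ 2).
      by rewrite mulr_ge0 ?(ltW d0) // addr_ge0 // mulr_ge0 ?sqr_ge0 // exprn_ge0 // ltW // nu_gt0.
    have := ler_wpM2l (ltW C0) hc; rewrite /D; rewrite mulNr in hx; lra.
  rewrite /g mulr0 subr0 lerBlDr => /le_trans; apply; rewrite lerD2l.
  by apply: ler_wpM2l => //; rewrite mulr_ge0 ?sqr_ge0.
have [_ e1 e2 _] := coefs 0.
pose A := L2norm (wD 1 (phi (cl 0))) ^+ 2; pose B := L2norm (u (cl 0)) ^+ 2.
exists (Mr / m * (M1 * (A + B) + D * T)) => N t tT.
have key n : Lmode sigma mu kappa r n (cosc n t) (sinc n t) <=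
    Mr / m * (M1 * ((nu n ^+ 1 * cosc n 0) ^+ 2 + sinc n 0 ^+ 2) + D * T * c n ^+ 2).
  apply: le_trans (hMr _ _ _) _; rewrite -mulrA ler_pM2l // ler_pdivlMl // .
  apply: le_trans (Lmode_ge mu kappa sigma_gt0 n _ _ (ler01 : (0 : R) <= 1)) _.
  apply: le_trans (grow n t tT) _; rewrite [D * T * _]mulrAC lerD2r.
  by rewrite expr1 [(nu n * _) ^+ 2]exprMn; exact: hM1.
apply: (@le_trans _ _ (\sum_(n < N) Mr / m * (M1 * ((nu n ^+ 1 * cosc n 0) ^+ 2 + sinc n 0 ^+ 2) + D * T * c n ^+ 2))).
  by apply: ler_sum => n _; exact: key.
rewrite -mulr_sumr; apply: ler_wpM2l; first by rewrite ltW // divr_gt0.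
rewrite big_split /= -!mulr_sumr; apply: lerD.
  apply: ler_wpM2l; first exact: ltW.
  rewrite big_split /=; apply: lerD; last exact: (expands_norm_ge sinL sinO N e2).
  apply: le_trans (expands_norm_ge sinL sinO N e1); apply: ler_sum => n _.
  by rewrite sqrrN.
rewrite -[leRHS]mulr1; apply: ler_wpM2l; last exact: one_coef_sum.
by rewrite mulr_ge0.
Qed.

End ModalData.

(** * Uniqueness *)
Section Uniqueness.
Context {R : realType}.
Variables (sigma mu kappa r k Q gamma : R).
Hypotheses (sigma_gt0 : 0 < sigma) (mu_gt0 : 0 < mu) (kappa_ge0 : 0 <= kappa).
Hypotheses (r_gt0 : 0 < r) (k_gt0 : 0 < k) (Q_gt0 : 0 < Q).
Hypothesis small : k ^+ 3 * Q * C0 sigma mu kappa r < 1.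
Hypothesis gain : 1 < gamma * (1 - k ^+ 3 * Q * C0 sigma mu kappa r).
Local Notation c := (@one_coef R).

(** The infinite system satisfied by the coefficients of a solution; the input is the limit of
    the truncated feedbacks, and the energy is finite. *)
Definition modal_solution (T : R) (a b : nat -> R -> R) (xi w f : R -> R) : Prop :=
  [/\ [/\ forall n, continuous (a n), forall n, continuous (b n), continuous xi & continuous w],
      forall N, is_sys sigma mu kappa c N T a b xi w f,
      forall t, 0 < t < T -> Flaw mu kappa r k Q gamma c N (a^~ t) (b^~ t) (xi t) (w t) @[N --> \oo] --> f t &
      exists M, forall N t, 0 < t < T -> Lsum sigma mu kappa r N (a^~ t) (b^~ t) <= M].

Lemma one_coef_nu_sum3 N : \sum_(n < N) (c n / nu n) ^+ 2 <= 1 / 3.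
Proof. by rewrite mul1r; exact: one_coef_nu_sum. Qed.

(** Finite energy bounds the effect of the modes above [N] on the feedback. *)
Lemma Flaw_tail (tau : nat -> R) (A B : nat -> R) (xi w l M : R) N :
  (forall N M, (N <= M)%N -> \sum_(N <= n < M) c n ^+ 2 <= tau N) ->
  Flaw mu kappa r k Q gamma c N A B xi w @[N --> \oo] --> l ->
  (forall N, Lsum sigma mu kappa r N A B <= M) ->
  (l - Flaw mu kappa r k Q gamma c N A B xi w) ^+ 2 <=
  (gamma * k ^+ 3 * Q) ^+ 2 * (4 * (r + 1) * tau N * M).
Proof.
move=> htau cl hM; set F := fun N => Flaw mu kappa r k Q gamma c N A B xi w.
have cd : (F (N' + N)%N - F N) ^+ 2 @[N' --> \oo] --> (l - F N) ^+ 2.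
  have d : F (N' + N)%N - F N @[N' --> \oo] --> l - F N.
    by apply: cvgB; [rewrite (cvg_shiftn N F); exact: cl | exact: cvg_cst].
  exact: (cvgM d d).
apply: (cvg_le_cst cd) => N'; have NM := leq_addl N' N.
have -> : F (N' + N)%N - F N = gamma * k ^+ 3 * Q * (qsum mu kappa r c (N' + N) A B - qsum mu kappa r c N A B).
  by rewrite /F /Flaw; ring.
rewrite exprMn; apply: ler_wpM2l; first exact: sqr_ge0.
apply: le_trans (qtail_sqr_le mu kappa c sigma_gt0 r_gt0 A B NM) _.
have M0 : 0 <= Lsum sigma mu kappa r (N' + N) A B by apply: Lsum_ge0.
have r1 : 0 <= 4 * (r + 1) by rewrite mulr_ge0 // addr_ge0 // ltW.
have t0 : 0 <= \sum_(N <= n < N' + N) c n ^+ 2 by apply: sumr_ge0 => n _; exact: sqr_ge0.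
apply: ler_pM => //; first exact: mulr_ge0.
by apply: ler_wpM2l => //; exact: htau.
Qed.

Lemma le0_of_tail (y D : R) (tau : nat -> R) n : tau @ \oo --> (0 : R) ->
  (forall N, (n < N)%N -> y <= D * tau N) -> y <= 0.
Proof.
move=> t0 h; have cD : D * tau (N + n.+1)%N @[N --> \oo] --> D * 0.
  by apply: cvgM; [exact: cvg_cst | rewrite (cvg_shiftn n.+1 tau)].
rewrite mulr0 in cD.
have cy : - (D * tau (N + n.+1)%N) @[N --> \oo] --> (0 : R) by rewrite -oppr0; exact: cvgN cD.
have := cvg_le_cst (K := - y) cy; rewrite oppr_ge0; apply => N.
by rewrite lerN2; apply: h; exact: leq_addl.
Qed.

(** For each [N], the first [N] modes of both solutions obey the [N]-mode loop up to disturbances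
    of order [tau N].  The difference starts from zero, hence [V] of it is at most of that order
    by [Vtot_compare]; then [N -> oo]. *)
Lemma modal_unique (T : R) a b xi w f a' b' xi' w' f' : 0 < T ->
  modal_solution T a b xi w f -> modal_solution T a' b' xi' w' f' ->
  (forall n, a n 0 = a' n 0) -> (forall n, b n 0 = b' n 0) -> xi 0 = xi' 0 -> w 0 = w' 0 ->
  [/\ forall n, a n T = a' n T, xi T = xi' T & w T = w' T].
Proof.
move=> T0 [[ca cb cx cw] hs hF [M hM]] [[ca' cb' cx' cw'] hs' hF' [M' hM']] a0 b0 x0 w0.
have [om [C [om0 C0' iss]]] := Vtot_iss sigma_gt0 mu_gt0 kappa_ge0 r_gt0 k_gt0 Q_gt0
  (@one_coef_sum R) one_coef_nu_sum3 small gain.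
have [tau [tau0 tau_ge0 htau]] := csum_tail (@one_coef_sum R).
have [K K0 hK] := ab_Vtot mu kappa sigma_gt0 r_gt0 k_gt0 Q_gt0.
pose G := 2 * ((gamma * k ^+ 3 * Q) ^+ 2 * (4 * (r + 1))) * (`|M| + `|M'|).
have G0 : 0 <= G.
  have r1 : 0 <= r + 1 by rewrite addr_ge0 // ltW.
  rewrite /G; apply: mulr_ge0; last by rewrite addr_ge0.
  by apply: mulr_ge0 => //; apply: mulr_ge0; [exact: sqr_ge0 | exact: mulr_ge0].
have V N : Vtot sigma mu kappa r k Q N (fun n => a n T - a' n T) (fun n => b n T - b' n T)
    (xi T - xi' T) (w T - w' T) <= C * (G * tau N).
  pose h t := f t - Flaw mu kappa r k Q gamma c N (a^~ t) (b^~ t) (xi t) (w t).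
  pose h' t := f' t - Flaw mu kappa r k Q gamma c N (a'^~ t) (b'^~ t) (xi' t) (w' t).
  have H0 : 0 <= G * tau N by rewrite mulr_ge0.
  apply: le_trans (Vtot_compare iss (h := h) (h' := h') (ltW T0) H0 ca cb cx cw ca' cb' cx' cw' (hs N) (hs' N) _ _ _) _.
  - by move=> t tT; rewrite /h addrC subrK.
  - by move=> t tT; rewrite /h' addrC subrK.
  - move=> t tT; apply: le_trans (sqrB_le _ _) _.
    have b1 := Flaw_tail N htau (hF t tT) (fun N => hM N t tT).
    have b2 := Flaw_tail N htau (hF' t tT) (fun N => hM' N t tT).
    have X0 : 0 <= (gamma * k ^+ 3 * Q) ^+ 2 * (4 * (r + 1)) * tau N.
      have r1 : 0 <= r + 1 by rewrite addr_ge0 // ltW.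
      by apply: mulr_ge0 => //; apply: mulr_ge0; [exact: sqr_ge0 | exact: mulr_ge0].
    have m1 := ler_wpM2l X0 (ler_norm M); have m2 := ler_wpM2l X0 (ler_norm M').
    by rewrite /h /h' /G; lra.
  rewrite (_ : Vtot _ _ _ _ _ _ _ _ _ _ _ = 0) ?mulr0 ?add0r //.
  rewrite /Vtot /Lsum x0 w0 !subrr big1 => [|n _]; first by ring.
  by rewrite a0 b0 !subrr /Lmode /zcoef; ring.
have z (y : R) n : (forall N, (n < N)%N -> y ^+ 2 <= K * Vtot sigma mu kappa r k Q N (fun n => a n T - a' n T)
    (fun n => b n T - b' n T) (xi T - xi' T) (w T - w' T)) -> y = 0.
  move=> hy; apply/eqP; rewrite -(@sqrf_eq0 R) eq_le sqr_ge0 andbT.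
  apply: (@le0_of_tail _ (K * C * G) tau n tau0) => N nN; apply: le_trans (hy N nN) _.
  apply: (@le_trans _ _ (K * (C * (G * tau N)))); last by rewrite !mulrA.
  by apply: ler_wpM2l; [exact: ltW | exact: V].
split=> [n||]; apply/eqP; rewrite -subr_eq0; apply/eqP.
- by apply: (z _ n) => N nN; have [h _] := hK N (fun n => a n T - a' n T) (fun n => b n T - b' n T) (xi T - xi' T) (w T - w' T); case: (h n nN).
- by apply: (z _ 0%N) => N nN; have [_ []] := hK N (fun n => a n T - a' n T) (fun n => b n T - b' n T) (xi T - xi' T) (w T - w' T).
- by apply: (z _ 0%N) => N nN; have [_ []] := hK N (fun n => a n T - a' n T) (fun n => b n T - b' n T) (xi T - xi' T) (w T - w' T).
Qed.

(** The time derivative on the half-line is local: before [T] it is the one on [0,T]. *)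
Lemma phi_t_local (T : R) (phi : R -> R -> R) (t : R) g : 0 <= t < T ->
  (forall s, 0 <= s -> L2 0 1 (phi s)) -> is_tderiv `[0, T] phi t g ->
  L2 0 1 (phi_t phi t) /\ eq01 (phi_t phi t) g.
Proof.
move=> /andP[t0 tT] Lp [Lg cg].
have h : is_tderiv `[0, +oo[ phi t g.
  split=> //; apply/cvgrPdist_le => e e0; move/cvgrPdist_le: cg => /(_ e e0).
  rewrite !near_withinE => h.
  have n1 : \forall s \near t, s < T by exact: lt_nbhsl.
  apply: filterS2 h n1 => s h sT st; rewrite /= in_itv /= andbT => s0; apply: h => //.
  by rewrite /= in_itv /= s0 ltW.
have h2 : is_tderiv `[0, +oo[ phi t (phi_t phi t).
  have : [set g | is_tderiv `[0, +oo[ phi t g] (phi_t phi t) by apply: xgetPex; exists g.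
  by [].
split; first by case: h2.
apply: (is_tderiv_unique (within_dnbhs_proper_ray t0) _ _ h2 h); first by rewrite /= in_itv /= t0.
by move=> s /=; rewrite in_itv /= andbT; exact: Lp.
Qed.

(** The time derivative on the half-line that enters the feedback is first replaced by [u_x],
    with the help of [phi_t_local]; before [T] the input then agrees with the continuous function
    [fcl]. *)
Lemma closed_loop_modal (T : R) (phi0 phib0 : R -> R) (xi0 w0 : R) (xi w : R -> R) (phi : R -> R -> R) :
  0 < T -> inSbar phi0 -> inS phib0 ->
  closed_loop_solution sigma mu kappa r k Q gamma phi0 phib0 xi0 w0 xi w phi ->
  exists (a b : nat -> R -> R) (xi' w' f : R -> R), [/\ modal_solution T a b xi' w' f,
    [/\ forall n, a n 0 = inner phi0 (cosb n), forall n, b n 0 = inner phib0 (cosb n) / nu n,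
        xi' 0 = xi0 & w' 0 = w0],
    expands cosb (phi T) (a^~ T) & xi' T = xi T /\ w' T = w T].
Proof.
move=> T0 h0 hb0 [f [wsol hf]]; have ws := wsol T T0.
have [u [ut [[hC0 hL2] [hut hwt] htd hpde]]] := ws_pde ws.
have Lp s : 0 <= s -> L2 0 1 (phi s).
  move=> s0; have s1 : 0 < s + 1 by rewrite ltr_wpDl.
  have sI : s \in `[0, s + 1] by rewrite in_itv /= s0 lerDl ler01.
  by have [/Hk_L2] := ws_phi_Sbar (wsol _ s1) sI.
have k0 : k != 0 by rewrite gt_eqF.
have hf' t : 0 <= t < T -> f t = feedback mu kappa r k Q gamma (xi t) (w t) (phi t) (wD 1 (u t)).
  move=> tT; have /andP[t0 tT'] := tT; have tI : t \in `[0, T] by rewrite in_itv /= t0 ltW.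
  have [Lt et] := phi_t_local tT Lp (htd t tI); have r0 : r != 0 by rewrite gt_eqF.
  have [_ e1 _ _] := Sbar_coef (ws_phi_Sbar ws tI).
  have [_ e3] := H10_coef (hC0 t tI).1.
  have L1 := expands_L2 e1; have L3 := expands_L2 e3; have L0 := Lp t t0.
  by rewrite hf // (@feedbackE _ _ _ _ _ _ _ _ (u t)) // (@feedbackE _ _ _ _ _ _ _ _ (u t) (wD 1 (u t))) //; exact: eq01_refl.
have T00 : 0 <= T by exact: ltW.
have cl0 : clamp T 0 = 0 by apply: clamp_id; rewrite lexx T00.
have clT : clamp T T = T by apply: clamp_id; rewrite lexx T00.
pose a := cosc T phi; pose b := sinc T u.
exists a, b, (fun t => xi (clamp T t)), (fun t => w (clamp T t)), (fcl mu kappa r k Q gamma T xi w phi u).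
split; [split | split | |].
- split.
  + by move=> n; exact: (continuous_cosc T0 ws).
  + by move=> n; exact: (continuous_sinc T0 hC0).
  + exact: (continuous_xi T0 ws).
  + exact: (continuous_w T0 ws).
- move=> N t tT; split.
  + by move=> n _; split; [exact: (der_cosc T0 ws hC0 htd) | exact: (der_sinc r_gt0 k0 T0 ws hC0 hL2 hut hwt htd hpde hf')].
  + exact: (der_xi T0 ws).
  + exact: (der_w r_gt0 k0 T0 ws hC0 hL2 htd hf').
- move=> t tT; exact: (Flaw_fcl r_gt0 k0 T0 ws hC0).
- have [M hM] := modal_energy sigma_gt0 mu_gt0 kappa_ge0 r_gt0 k0 T0 ws hC0 hL2 hut hwt htd hpde hf'.
  by exists M => N t /andP[t0 tT]; apply: hM; rewrite !ltW.
- by have [] := coef_init T0 h0 hb0 ws hC0 htd.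
- by have [] := coef_init T0 h0 hb0 ws hC0 htd.
- by rewrite cl0; have [] := ws_init_ode ws.
- by rewrite cl0; have [] := ws_init_ode ws.
- by have [] := coefs T0 ws hC0 T; rewrite clT.
- by rewrite clT.
Qed.

(** At a positive time both solutions reduce to modes with the same initial coefficients; at time
    0 they share their data. *)
Lemma closed_loop_unique (phi0 phib0 : R -> R) (xi0 w0 : R) (xi w xi' w' : R -> R) (phi phi' : R -> R -> R) :
  inSbar phi0 -> inS phib0 ->
  closed_loop_solution sigma mu kappa r k Q gamma phi0 phib0 xi0 w0 xi w phi ->
  closed_loop_solution sigma mu kappa r k Q gamma phi0 phib0 xi0 w0 xi' w' phi' ->
  forall t, 0 <= t -> [/\ xi' t = xi t, w' t = w t & eq01 (phi' t) (phi t)].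
Proof.
move=> h0 hb0 s1 s2 t; rewrite le_eqVlt => /predU1P[<-|t0].
  have [f [/(_ 1 ltr01) ws _]] := s1; have [f' [/(_ 1 ltr01) ws' _]] := s2.
  have [-> ->] := ws_init_ode ws; have [-> ->] := ws_init_ode ws'; split=> //.
  exact: eq01_trans (ws_init_phi ws') (eq01_sym (ws_init_phi ws)).
have [a [b [x [y [f [m1 [ia ib ix iy] e1 [xT yT]]]]]]] := closed_loop_modal t0 h0 hb0 s1.
have [a' [b' [x' [y' [f' [m2 [ia' ib' ix' iy'] e2 [xT' yT']]]]]]] := closed_loop_modal t0 h0 hb0 s2.
have ea n : a n 0 = a' n 0 by rewrite ia ia'.
have eb n : b n 0 = b' n 0 by rewrite ib ib'.
have ex : x 0 = x' 0 by rewrite ix ix'.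
have ey : y 0 = y' 0 by rewrite iy iy'.
have [ha hx hy] := modal_unique t0 m1 m2 ea eb ex ey.
split; [by rewrite -xT' -hx xT | by rewrite -yT' -hy yT |].
apply: (expands_unique (@cosb_L2 R) (@cosb_on R) e2); apply: expands_ext e1 => n; exact: ha.
Qed.

End Uniqueness.

(** * Existence and exponential decay *)
Section Stability.
Context {R : realType}.
Variables (sigma mu kappa r k Q gamma : R).
Hypotheses (sigma_gt0 : 0 < sigma) (mu_gt0 : 0 < mu) (kappa_ge0 : 0 <= kappa).
Hypotheses (r_gt0 : 0 < r) (k_gt0 : 0 < k) (Q_gt0 : 0 < Q).
Local Notation c := (@one_coef R).

(** The initial coefficient of [u] is that of the initial velocity divided by [nu]. *)
Lemma Vtot_data : exists2 C : R, 0 < C & forall (phi0 phib0 : R -> R) (xi0 w0 : R) N,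
  inSbar phi0 -> inS phib0 ->
  Vtot sigma mu kappa r k Q N (fun n => inner phi0 (cosb n)) (fun n => inner phib0 (cosb n) / nu n) xi0 w0 <=
  C * (xi0 ^+ 2 + w0 ^+ 2 + L2norm phib0 ^+ 2 + Hnorm 2 phi0 ^+ 2).
Proof.
have [Mr Mr0 hMr] := Lmode_le sigma_gt0 mu_gt0 kappa_ge0 (ltW r_gt0).
pose C1 := (3 * k ^+ 2 + 2) / (2 * k ^+ 2 * Q).
have D0 : 0 < 2 * k ^+ 2 * Q by rewrite !mulr_gt0 // exprn_gt0.
have C10 : 0 < C1 by rewrite divr_gt0 // addr_gt0 // mulr_gt0 // exprn_gt0.
exists (Mr + C1) => [|phi0 phib0 xi0 w0 N h0 hb0]; first exact: addr_gt0.
have [_ _ _ h2] := Sbar_coef h0; have eb := expands_norm_ge (@cosb_L2 R) (@cosb_on R) N (expands_cosb hb0).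
rewrite mulrDl; apply: lerD.
  apply: (@le_trans _ _ (Mr * (Hnorm 2 phi0 ^+ 2 + L2norm phib0 ^+ 2))); last first.
    apply: ler_wpM2l; first exact: ltW.
    by have := sqr_ge0 xi0; have := sqr_ge0 w0; lra.
  apply: (@le_trans _ _ (Mr * \sum_(n < N) (wt 2 n * inner phi0 (cosb n) ^+ 2 + inner phib0 (cosb n) ^+ 2))).
    rewrite mulr_sumr; apply: ler_sum => n _; apply: le_trans (hMr _ _ _) _.
    apply: ler_wpM2l; first exact: ltW.
    apply: lerD; first by apply: ler_wpM2r; [exact: sqr_ge0 | exact: (@wt_ge R 2 1)].
    rewrite exprMn exprVn ler_piMr ?sqr_ge0 // invf_le1 ?exprn_gt0 ?nu_gt0 //.
    by apply: exprn_ege1; exact: nu_ge1.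
  by apply: ler_wpM2l; [exact: ltW | rewrite big_split /=; apply: lerD; [exact: h2 | exact: eb]].
apply: (@le_trans _ _ (C1 * (xi0 ^+ 2 + w0 ^+ 2))); last first.
  apply: ler_wpM2l; first exact: ltW.
  by have := sqr_ge0 (L2norm phib0); have := sqr_ge0 (Hnorm 2 phi0); lra.
rewrite /C1 [leRHS]mulrAC; apply: ler_wpM2r; first by rewrite invr_ge0 ltW.
have hh : (w0 + k * xi0) ^+ 2 <= 2 * (w0 ^+ 2 + k ^+ 2 * xi0 ^+ 2).
  by rewrite -[k ^+ 2 * _]exprMn; have := sqrB_le w0 (- (k * xi0)); rewrite opprK sqrrN.
have h3 := sqr_ge0 xi0; have h4 := mulr_ge0 (sqr_ge0 k) (sqr_ge0 w0).
by move: hh h3 h4; rewrite !mulrDl !mulrDr; lra.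
Qed.

Hypothesis small : k ^+ 3 * Q * C0 sigma mu kappa r < 1.
Hypothesis gain : 1 < gamma * (1 - k ^+ 3 * Q * C0 sigma mu kappa r).

(** The modes of [modal_exists] have an input with [f^2] of order [exp(- om1 t)]; [mode_decay]
    then bounds the [n]-th mode in the strong norm by [E n], which is summable.  These bounds serve
    twice: as majorant [B] for the synthesis, and as the decay estimate. *)
Lemma closed_loop_stable : exists G omega : R, [/\ 0 < G, 0 < omega &
  forall (phi0 phib0 : R -> R) (xi0 w0 : R), inSbar phi0 -> inS phib0 ->
  exists (xi w : R -> R) (phi : R -> R -> R),
    closed_loop_solution sigma mu kappa r k Q gamma phi0 phib0 xi0 w0 xi w phi /\
    forall t, 0 <= t ->
      xi t ^+ 2 + w t ^+ 2 + L2norm (phi_t phi t) ^+ 2 + Hnorm 2 (phi t) ^+ 2 <=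
      G * expR (- omega * t) * (xi0 ^+ 2 + w0 ^+ 2 + L2norm phib0 ^+ 2 + Hnorm 2 phi0 ^+ 2)].
Proof.
have [om1 [C1 [om10 C10 hexists]]] := modal_exists sigma_gt0 mu_gt0 kappa_ge0 r_gt0 k_gt0 Q_gt0
  (@one_coef_sum R) (@one_coef_nu_sum3 R) small gain.
have [om2 [C2 [om20 C20 hdecay]]] := mode_decay c sigma_gt0 mu_gt0 kappa_ge0 om10.
have [CE CE0 hCE] := Vtot_data.
have [K K0 hK] := ab_Vtot mu kappa sigma_gt0 r_gt0 k_gt0 Q_gt0.
pose om := Num.min om1 om2; have om0 : 0 < om by rewrite lt_min om10.
pose G := 2 * K * CE + 4 * C2 * (1 + C1 * CE).
have C1CE : 0 < C1 * CE by exact: mulr_gt0.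
have G0 : 0 < G by rewrite addr_gt0 // !mulr_gt0 // addr_gt0.
exists G, om; split=> // phi0 phib0 xi0 w0 h0 hb0.
pose D := xi0 ^+ 2 + w0 ^+ 2 + L2norm phib0 ^+ 2 + Hnorm 2 phi0 ^+ 2.
have D0 : 0 <= D by rewrite !addr_ge0 ?sqr_ge0.
have [a [b [xi [w [f [[ca cb cx cw cf] [a0 b0 x0 w0'] hs hF hV]]]]]] :=
  hexists (fun n => inner phi0 (cosb n)) (fun n => inner phib0 (cosb n) / nu n) xi0 w0 (CE * D)
   (fun N => hCE phi0 phib0 xi0 w0 N h0 hb0).
have modes n (t : R) : 0 < t -> is_mode sigma mu kappa c n (a n) (b n) f t.
  move=> t0; have tt1 : 0 < t < t + 1 by rewrite t0 ltrDl ltr01.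
  by have [h _ _] := hs n.+1 (t + 1) t tt1; exact: h.
have dxi (t : R) : 0 < t -> is_derive t 1 xi (w t).
  move=> t0; have tt1 : 0 < t < t + 1 by rewrite t0 ltrDl ltr01.
  by have [_ h _] := hs 0%N (t + 1) t tt1.
have dw (t : R) : 0 < t -> is_derive t 1 w (- f t).
  move=> t0; have tt1 : 0 < t < t + 1 by rewrite t0 ltrDl ltr01.
  by have [_ _ h] := hs 0%N (t + 1) t tt1.
pose F := C1 * (CE * D).
have F0 : 0 <= F by rewrite /F mulr_ge0 ?(ltW C10) // mulr_ge0 // ltW.
have hf (t : R) : 0 <= t -> f t ^+ 2 <= expR (- om1 * t) * F.
  by move=> t0; have [_ h] := hV t t0; rewrite /F mulrCA.
pose E n := nu n ^+ 2 * b n 0 ^+ 2 + nu n ^+ 4 * a n 0 ^+ 2 + c n ^+ 2 * F.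
have E0 n : 0 <= E n.
  by rewrite /E !addr_ge0 // mulr_ge0 ?sqr_ge0 // exprn_ge0 // ltW // nu_gt0.
have hE n (t : R) : 0 <= t -> nu n ^+ 2 * b n t ^+ 2 + nu n ^+ 4 * a n t ^+ 2 <= C2 * expR (- om2 * t) * E n /\
    \int[leb]_(s in `[0, t]) (nu n ^+ 4 * b n s ^+ 2 + nu n ^+ 6 * a n s ^+ 2) <= C2 * (1 + t) * E n.
  by move=> t0; exact: (hdecay n _ _ _ F (ca n) (cb n) cf F0 (modes n) hf t t0).
have exp1 (o t : R) : 0 < o -> 0 <= t -> expR (- o * t) <= 1.
  by move=> o0 t0; rewrite mulNr -expR0 ler_expR oppr_le0 mulr_ge0 // ltW.
have sumE N : \sum_(n < N) E n <= (1 + C1 * CE) * D.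
  have [_ _ _ h2] := Sbar_coef h0.
  have eb := expands_norm_ge (@cosb_L2 R) (@cosb_on R) N (expands_cosb hb0).
  rewrite /E big_split /= -mulr_suml mulrDl mul1r; apply: lerD; last first.
    by rewrite -mulrA -/F -[leRHS]mul1r; apply: ler_wpM2r => //; exact: one_coef_sum.
  apply: (@le_trans _ _ (L2norm phib0 ^+ 2 + Hnorm 2 phi0 ^+ 2)); last first.
    by rewrite /D -addrA lerDr addr_ge0 ?sqr_ge0.
  rewrite big_split /=; apply: lerD.
    apply: le_trans eb; apply: ler_sum => n _; rewrite b0 -exprMn mulrC divfK // nu_neq0 //.
  apply: le_trans (h2 N); apply: ler_sum => n _; rewrite a0.
  by apply: ler_wpM2r; [exact: sqr_ge0 | exact: (@wt_ge R 2 2)].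
pose B n := (C2 + 1) * E n; pose KB := (C2 + 1) * ((1 + C1 * CE) * D).
have C21 : 0 <= C2 + 1 by rewrite addr_ge0 // ltW.
have B_ge0 n : 0 <= B n by exact: mulr_ge0.
have B_sum N : \sum_(n < N) B n <= KB by rewrite -mulr_sumr; apply: ler_wpM2l.
have B_sup n (t : R) : 0 <= t -> nu n ^+ 2 * b n t ^+ 2 + nu n ^+ 4 * a n t ^+ 2 <= B n.
  move=> t0; apply: le_trans (hE n t t0).1 _; apply: ler_wpM2r => //.
  have := ler_wpM2l (ltW C20) (exp1 om2 t om20 t0); lra.
have B_int n (t : R) : 0 <= t ->
    \int[leb]_(s in `[0, t]) (nu n ^+ 4 * b n s ^+ 2 + nu n ^+ 6 * a n s ^+ 2) <= (1 + t) * B n.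
  move=> t0; apply: le_trans (hE n t t0).2 _; rewrite /B mulrA [(1 + t) * _]mulrC.
  apply: ler_wpM2r => //; apply: ler_wpM2r; first by rewrite addr_ge0.
  by rewrite lerDl.
have B_f n (t : R) : 0 <= t -> c n ^+ 2 * f t ^+ 2 <= B n.
  move=> t0; apply: (@le_trans _ _ (c n ^+ 2 * F)).
    apply: ler_wpM2l; first exact: sqr_ge0.
    by apply: le_trans (hf t t0) _; rewrite ler_piMl // exp1.
  apply: (@le_trans _ _ (E n)).
    by rewrite /E lerDr addr_ge0 // mulr_ge0 ?sqr_ge0 // exprn_ge0 // ltW // nu_gt0.
  by rewrite /B ler_peMl // lerDr ltW.
have sa (t : R) : 0 <= t -> forall N, \sum_(n < N) a n t ^+ 2 <= KB.
  move=> t0 N; apply: le_trans (B_sum N); apply: ler_sum => n _.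
  by apply: le_trans (B_a B_sup n t0); rewrite ler_peMl ?sqr_ge0 // nuX_ge1.
have [phi hphi] : {phi : R -> R -> R & forall t : R, 0 <= t -> expands cosb (phi t) (a^~ t)}.
  apply: (@choice _ _ (fun (t : R) (g : R -> R) => 0 <= t -> expands cosb g (a^~ t))) => t.
  have [t0|t0] := leP 0 t; last by exists (fun=> 0).
  have [g hg] := @expands_synthesis R cosb (@cosb_L2 R) (@cosb_on R) (a^~ t) KB (sa t t0).
  by exists g.
have [u hu] : {u : R -> R -> R & forall t : R, 0 <= t -> expands sinb (u t) (b^~ t)}.
  apply: (@choice _ _ (fun (t : R) (g : R -> R) => 0 <= t -> expands sinb g (b^~ t))) => t.
  have [t0|t0] := leP 0 t; last by exists (fun=> 0).
  have [g hg] := @expands_synthesis R sinb (@sinb_L2 R) (@sinb_on R) (b^~ t) KB (fun N => sum_b_le B_sum B_sup N t0).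
  by exists g.
pose be := beta sigma mu kappa a b f.
have [ut hut] : {ut : R -> R -> R & forall t : R, 0 <= t -> sqsum (be^~ t) -> expands sinb (ut t) (be^~ t)}.
  apply: (@choice _ _ (fun (t : R) (g : R -> R) => 0 <= t -> sqsum (be^~ t) -> expands sinb g (be^~ t))) => t.
  have [[M hM]|ns] := pselect (sqsum (be^~ t)); last by exists (fun=> 0).
  by have [g hg] := @expands_synthesis R sinb (@sinb_L2 R) (@sinb_on R) (be^~ t) M hM; exists g.
have pt (t : R) (t0 : 0 <= t) := phi_t_eq01 ca cb modes B_ge0 B_sum B_sup hphi hu t0.
exists xi, w, phi; split.
  exists f; split.
    exact: (synthesis_weak_solution sigma_gt0 mu_gt0 kappa_ge0 ca cb cw cx cf modes dxi dw B_ge0 B_sum B_sup B_int B_f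
      hphi hu hut h0 hb0 a0 b0 x0 w0').
  move=> t t0; have [Lt et] := pt t t0.
  have r0 : r != 0 by rewrite gt_eqF.
  have k0 : k != 0 by rewrite gt_eqF.
  have wa := @sqsum_wt R 2 1 (a^~ t) _ isT (fun N => sum_wt_a B_sum B_sup N t0).
  have [_ e1] := cos_series_wD1 (hphi t t0) wa.
  have cl := Flaw_cvg_feedback (mu := mu) (kappa := kappa) (Q := Q) (gamma := gamma) (xi := xi t) (w := w t)
    r0 k0 (hphi t t0) e1 (u_wD1 B_sum B_sup hu t0) Lt et.
  by exact: (cvg_unique (@Rhausdorff R) (hF t t0) cl).
move=> t t0; have [Lt et] := pt t t0; rewrite -/D; pose X := expR (- om * t).
have X1 : expR (- om1 * t) <= X by rewrite ler_expR; apply: ler_wpM2r => //; rewrite lerN2 ge_min lexx.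
have X2 : expR (- om2 * t) <= X by rewrite ler_expR; apply: ler_wpM2r => //; rewrite lerN2 ge_min lexx orbT.
have [hV0 _] := hV t t0.
have V0 := hV0 0%N; have [_ [hx hw]] := hK 0%N (a^~ t) (b^~ t) (xi t) (w t).
have CED : 0 <= CE * D by rewrite mulr_ge0 // ltW.
have VX : K * Vtot sigma mu kappa r k Q 0 (a^~ t) (b^~ t) (xi t) (w t) <= K * CE * X * D.
  rewrite (_ : K * CE * X * D = K * (X * (CE * D))); last by ring.
  apply: ler_wpM2l; first exact: ltW.
  by apply: le_trans V0 _; apply: ler_wpM2r.
pose S := (1 + C1 * CE) * D.
have sumB N : \sum_(n < N) (nu n ^+ 2 * b n t ^+ 2 + nu n ^+ 4 * a n t ^+ 2) <= C2 * X * S.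
  apply: (@le_trans _ _ (\sum_(n < N) C2 * X * E n)).
    apply: ler_sum => n _; apply: le_trans (hE n t t0).1 _; apply: ler_wpM2r => //.
    by apply: ler_wpM2l => //; exact: ltW.
  rewrite -mulr_sumr; apply: ler_wpM2l; last exact: sumE.
  by rewrite mulr_ge0 ?expR_ge0 // ltW.
have bphit : L2norm (phi_t phi t) ^+ 2 <= C2 * X * S.
  have eu := u_wD1 B_sum B_sup hu t0; rewrite (L2norm_eq01 Lt (expands_L2 eu) et).
  apply: (expands_norm_le (@cosb_L2 R) (@cosb_on R) eu) => N; apply: le_trans (sumB N).
  apply: ler_sum => n _; rewrite expr1 [(nu n * _) ^+ 2]exprMn lerDl.
  by rewrite mulr_ge0 ?sqr_ge0 // exprn_ge0 // ltW // nu_gt0.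
have bphi : Hnorm 2 (phi t) ^+ 2 <= 3 * (C2 * X * S).
  apply: (cos_series_Sbar (hphi t t0) _).2 => N; apply: (@le_trans _ _ (3 * \sum_(n < N) (nu n ^+ 2 * b n t ^+ 2 + nu n ^+ 4 * a n t ^+ 2))).
    rewrite mulr_sumr; apply: ler_sum => n _.
    apply: (@le_trans _ _ (3 * (nu n ^+ 4 * a n t ^+ 2))).
      by rewrite mulrA; apply: ler_wpM2r; [exact: sqr_ge0 | exact: wt_le].
    by apply: ler_wpM2l => //; rewrite lerDr mulr_ge0 ?sqr_ge0 // exprn_ge0 // ltW // nu_gt0.
  by apply: ler_wpM2l.
have -> : G * expR (- om * t) * D = 2 * (K * CE * X * D) + 4 * (C2 * X * S) by rewrite /G /S /X; ring.
lra.
Qed.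

End Stability.

Theorem theorem2p4 (R : realType) (sigma mu kappa r k Q gamma : R)
    (sigma_gt0 : 0 < sigma) (mu_gt0 : 0 < mu) (kappa_ge0 : 0 <= kappa)
    (r_gt0 : 0 < r) (k_gt0 : 0 < k) (Q_gt0 : 0 < Q)
    (condA : k ^+ 3 * Q <
      (1 + sigma * pi ^+ 2) /
      (mu * r * ((1 + kappa / (pi * mu * Num.sqrt 3)) ^+ 2 +
                 (r + 1) ^+ 2 * (1 + sigma * pi ^+ 2) /
                 (r * mu * (kappa + mu * pi ^+ 2)))))
    (gamma_star : R)
    (gamma_starE : gamma_star =
      2 / (1 - mu * r * k ^+ 3 * Q / (1 + sigma * pi ^+ 2) *
               ((1 + kappa / (pi * mu * Num.sqrt 3)) ^+ 2 +
                (r + 1) ^+ 2 * (1 + sigma * pi ^+ 2) /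
                (r * mu * (kappa + mu * pi ^+ 2)))))
    (gamma_gt : gamma_star / 2 < gamma) :
  exists G omega : R, [/\ 0 < G, 0 < omega &
    forall (phi0 phib0 : R -> R) (xi0 w0 : R), inSbar phi0 -> inS phib0 ->
    exists (xi w : R -> R) (phi : R -> R -> R),
    [/\ closed_loop_solution sigma mu kappa r k Q gamma
          phi0 phib0 xi0 w0 xi w phi,
        forall (xi' w' : R -> R) (phi' : R -> R -> R),
          closed_loop_solution sigma mu kappa r k Q gamma
            phi0 phib0 xi0 w0 xi' w' phi' ->
          forall t, 0 <= t ->
            [/\ xi' t = xi t, w' t = w t & eq01 (phi' t) (phi t)] &
        forall t, 0 <= t ->
          `|xi t| ^+ 2 + `|w t| ^+ 2 + L2norm (phi_t phi t) ^+ 2 +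
            Hnorm 2 (phi t) ^+ 2 <=
          G * expR (- omega * t) *
          (`|xi0| ^+ 2 + `|w0| ^+ 2 + L2norm phib0 ^+ 2 +
            Hnorm 2 phi0 ^+ 2)]].
Proof.
pose X := (1 + kappa / (pi * mu * Num.sqrt 3)) ^+ 2 +
  (r + 1) ^+ 2 * (1 + sigma * pi ^+ 2) / (r * mu * (kappa + mu * pi ^+ 2)).
have pi2 : 0 < pi ^+ 2 :> R by rewrite exprn_gt0 // pi_gt0.
have e1 : 0 < 1 + sigma * pi ^+ 2 by rewrite addr_gt0 // mulr_gt0.
have e2 : 0 < kappa + mu * pi ^+ 2 by rewrite ltr_wpDl // mulr_gt0.
have X0 : 0 < X.
  have h1 : 0 < (r + 1) ^+ 2 * (1 + sigma * pi ^+ 2) / (r * mu * (kappa + mu * pi ^+ 2)).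
    have r1 : 0 < r + 1 by exact: addr_gt0.
    by apply: divr_gt0; apply: mulr_gt0 => //; [exact: exprn_gt0 | exact: mulr_gt0].
  by rewrite /X ltr_wpDl // sqr_ge0.
have C0E : C0 sigma mu kappa r = mu * r * X / (1 + sigma * pi ^+ 2).
  rewrite /C0 /A0 /X; set A := 1 + kappa / _; move: e1 e2; set s := 1 + _; set d := kappa + _ => e1 e2.
  by field; rewrite !gt_eqF.
have small : k ^+ 3 * Q * C0 sigma mu kappa r < 1.
  move: condA; rewrite -/X ltr_pdivlMr ?mulr_gt0 // => h.
  by rewrite C0E mulrA ltr_pdivrMr // mul1r.
have gE : gamma_star = 2 / (1 - k ^+ 3 * Q * C0 sigma mu kappa r).
  rewrite gamma_starE -/X C0E; congr (2 / (1 - _)).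
  by move: (1 + sigma * pi ^+ 2) e1 => s s0; field; rewrite gt_eqF.
have gain : 1 < gamma * (1 - k ^+ 3 * Q * C0 sigma mu kappa r).
  have d0 : 0 < 1 - k ^+ 3 * Q * C0 sigma mu kappa r by rewrite subr_gt0.
  by rewrite -ltr_pdivrMr //; move: gamma_gt; rewrite gE mulrAC divff ?pnatr_eq0.
have [G [omega [G0 om0 h]]] := closed_loop_stable sigma_gt0 mu_gt0 kappa_ge0 r_gt0 k_gt0 Q_gt0 small gain.
exists G, omega; split=> // phi0 phib0 xi0 w0 h0 hb0.
have [xi [w [phi [sol decay]]]] := h phi0 phib0 xi0 w0 h0 hb0.
exists xi, w, phi; split=> //.
  move=> xi' w' phi' sol' t t0.
  exact: (closed_loop_unique sigma_gt0 mu_gt0 kappa_ge0 r_gt0 k_gt0 Q_gt0 small gain h0 hb0 sol sol' t0).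
by move=> t t0; rewrite !real_normK ?num_real //; exact: decay.
Qed.
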